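(* Let $n\ge 1$, $d\ge 1$ be integers, let $r>0$, and let $M\subset\mathbb{R}^d$ be a closed connected smooth $n$-dimensional submanifold contained in a closed ball of radius $r$ in $\mathbb{R}^d$. Suppose that all normal curvatures of $M$ are strictly less than $\tfrac{2}{\sqrt{3}}\cdot\tfrac{1}{r}$. Then $M$ is homeomorphic to the $n$-sphere $\mathbb{S}^n$.
   Context: A closed submanifold means a compact embedded submanifold without boundary, with the Riemannian metric induced from $\mathbb{R}^d$. The normal curvatures of $M$ are the numbers $|\mathrm{II}_p(u,u)|$, where $p\in M$, $u\in T_pM$ is a unit vector, and $\mathrm{II}$ is the second fundamental form of $M\subset\mathbb{R}^d$ (with values in the normal space). Equivalently, they are the curvatures, as curves in $\mathbb{R}^d$, of unit-speed geodesics of $M$. *)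

(* Defs.v *)
From HB Require Import structures.
From mathcomp Require Import all_boot all_order all_algebra.
From mathcomp Require Import all_classical all_reals all_analysis.

Set Implicit Arguments.
Unset Strict Implicit.
Unset Printing Implicit Defensive.

Import Order.TTheory GRing.Theory Num.Theory.
Import numFieldNormedType.Exports.

Local Open Scope classical_set_scope.
Local Open Scope ring_scope.

(* The library norm on 'rV[R]_d is the sup norm. It induces the usual topology
   and differentiability, but lengths, balls and orthogonality must be
   Euclidean, hence the next two definitions. *)
Definition dotp (R : realType) (d : nat) (u v : 'rV[R]_d) : R :=
  \sum_(i < d) u 0 i * v 0 i.

Definition enorm (R : realType) (d : nat) (u : 'rV[R]_d) : R :=
  Num.sqrt (dotp u u).

Definition eball (R : realType) (d : nat) (c : 'rV[R]_d) (r : R) :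
    set 'rV[R]_d :=
  [set x | enorm (x - c) <= r].

Definition esphere (R : realType) (n : nat) : set 'rV[R]_n.+1 :=
  [set x | enorm x = 1].

Definition homeomorphism_on (T S : topologicalType) (A : set T) (B : set S)
    (f : T -> S) : Prop :=
  exists g : S -> T,
    [/\ (forall x, A x -> B (f x) /\ g (f x) = x),
        (forall y, B y -> A (g y) /\ f (g y) = y),
        {within A, continuous f} &
        {within B, continuous g}].

Definition homeomorphic (T S : topologicalType) (A : set T) (B : set S) : Prop :=
  exists f : T -> S, homeomorphism_on A B f.

(* Meant for open U: then f is C^k on U iff (k = 0) it is continuous on U, or
   (k > 0) it is differentiable on U with all directional derivatives of class
   C^(k-1) on U. Values of f outside U are irrelevant. *)
Fixpoint Ck_on (R : realType) (n d : nat) (k : nat) (U : set 'rV[R]_n)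
    (f : 'rV[R]_n -> 'rV[R]_d) {struct k} : Prop :=
  match k with
  | 0%N => forall x, U x -> {for x, continuous f}
  | k'.+1 => (forall x, U x -> differentiable f x) /\
             (forall v : 'rV[R]_n, Ck_on k' U ('D_v f))
  end.

Definition smooth_on (R : realType) (n d : nat) (U : set 'rV[R]_n)
    (f : 'rV[R]_n -> 'rV[R]_d) : Prop :=
  forall k : nat, Ck_on k U f.

Definition local_parametrization (R : realType) (n d : nat) (M : set 'rV[R]_d)
    (U : set 'rV[R]_n) (phi : 'rV[R]_n -> 'rV[R]_d) : Prop :=
  [/\ open U,
      smooth_on U phi,
      (forall x, U x -> injective (fun a : 'rV[R]_n => 'D_a phi x)) &
      exists2 V : set 'rV[R]_d, open V & homeomorphism_on U (M `&` V) phi].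

(* Smooth n-dimensional embedded submanifold of R^d, without boundary. *)
Definition submanifold (R : realType) (n d : nat) (M : set 'rV[R]_d) : Prop :=
  forall p, M p -> exists (U : set 'rV[R]_n) (phi : 'rV[R]_n -> 'rV[R]_d),
    local_parametrization M U phi /\ (phi @` U) p.

Definition closed_submanifold (R : realType) (n d : nat) (M : set 'rV[R]_d) :
    Prop :=
  submanifold n M /\ compact M.

Definition tangent_space (R : realType) (n d : nat) (M : set 'rV[R]_d)
    (p : 'rV[R]_d) : set 'rV[R]_d :=
  [set u | exists (U : set 'rV[R]_n) (phi : 'rV[R]_n -> 'rV[R]_d)
             (x a : 'rV[R]_n),
     [/\ local_parametrization M U phi, U x, phi x = p & 'D_a phi x = u]].

Definition normal_component (R : realType) (n d : nat) (M : set 'rV[R]_d)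
    (p z w : 'rV[R]_d) : Prop :=
  tangent_space n M p (z - w) /\
  (forall t, tangent_space n M p t -> dotp t w = 0).

(* II_p(u, v) = w, i.e. w = (D_u Y)^perp, where Y is a smooth tangent vector
   field of M near p with Y(p) = v and D_u is the derivative in R^d. The field
   is given in a local parametrization phi as Y(phi(y)), so that D_u Y at
   p = phi(x) is the derivative at x in the direction a with dphi_x(a) = u.
   The value w depends neither on phi nor on the field. *)
Definition second_fundamental_form (R : realType) (n d : nat)
    (M : set 'rV[R]_d) (p u v w : 'rV[R]_d) : Prop :=
  exists (U : set 'rV[R]_n) (phi Y : 'rV[R]_n -> 'rV[R]_d) (x a : 'rV[R]_n),
    [/\ local_parametrization M U phi,
        U x /\ phi x = p,
        'D_a phi x = u,
        [/\ smooth_on U Y,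
            (forall y, U y -> tangent_space n M (phi y) (Y y)) &
            Y x = v] &
        normal_component n M p ('D_a Y x) w].

Definition normal_curvatures (R : realType) (n d : nat) (M : set 'rV[R]_d) :
    set R :=
  [set k | exists p u w : 'rV[R]_d,
     [/\ M p, tangent_space n M p u, enorm u = 1,
         second_fundamental_form n M p u u w & k = enorm w]].

(* Main.v *)
(* Shrink the ball so that [M] touches its boundary at [p]; normalise the centre to [0] and
   the radius to [1]. Let [rho] be slightly smaller than the least radius of curvature, so that
   [sqrt 3 / 2 < rho < 1]. For every [w], the quantity [|x - w|^2 - 2 rho |N_x (x - w)|]
   ([N_x] the projection onto the normal space), which is nonnegative exactly when no open ball of
   radius [rho] tangent to [M] at [x] contains [w], is nondecreasing along the gradient
   flow of [|x - w|^2] on [M].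
   For [w = 0] and [w = p] this bounds the tangential parts of [x] from above and of [x - p]
   from below on the region swept out from [p]. It follows that for
   [z = - p / 2] the descending gradient flow of [|x - z|^2] strictly
   increases [|x - p|] as long as [|x - z|^2 >= 3 / 4], and that every orbit leaving [p]
   reaches [|x - z|^2 < 3 / 4 < rho^2], where all critical points are strict local
   minima. If [n >= 2], punctured neighbourhoods in [M] are connected, so all orbits leaving [p]
   converge to the same minimum [q]; [p], [q] and the orbits from a small sphere around [p]
   form a suspension of the sphere of dimension [n - 1], and a clopen argument shows that it
   is all of [M]. If [n = 1], the arc length flow on unit tangent vectors is periodic and its
   orbit covers [M]. The flows are limits of Euler polygons. *)
Require Import Defs.
From HB Require Import structures.
From mathcomp Require Import all_boot all_order all_algebra.
From mathcomp Require Import all_classical all_reals all_analysis.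
From mathcomp Require Import ring lra.

Set Implicit Arguments.
Unset Strict Implicit.
Unset Printing Implicit Defensive.

Import Order.TTheory GRing.Theory Num.Theory.
Import numFieldNormedType.Exports.

Local Open Scope classical_set_scope.
Local Open Scope ring_scope.

(** * Euclidean geometry and compactness in ['rV[R]_d] *)

Section Euclid.
Context {R : realType} {d : nat}.
Implicit Types (u v w : 'rV[R]_d) (k : R).

(** The constant of the theorem enters as [3 < 4 * rho ^+ 2]. Write [m = 1 - |x|^2] and
    [f = |x - p|^2]. Half the gradient of [|x - z|^2] is half the tangential part of
    [3 x - (x - p)], so moving against it increases [|x - p|] once the tangential part of [x - p] is
    more than three times that of [x]. The bounds on tangential parts reduce this to
    [9 m (1 - m) < f (4 rho^2 - f)]. The condition [|x - z|^2 >= 3 / 4] says exactly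
    [f / 3 <= 1 - m]; with [m <= f / 3] it gives [9 m (1 - m) <= f (3 - f)]. The inequality
    [m <= f / 3] holds because [x] stays outside a ball of radius [rho] touching the unit sphere
    from inside at [p]. This is propagated from [p] along orbits, so the estimates live on a swept
    region and reach all of [M] only at the end. The length of a normal part need not be
    differentiable where it vanishes, and projections are only controlled up to Lipschitz estimates;
    monotonicity is therefore derived from single time steps with quadratic error. *)

Lemma dotpC u v : dotp u v = dotp v u.
Proof. by apply: eq_bigr => i _; rewrite mulrC. Qed.

Lemma dotpDl u v w : dotp (u + v) w = dotp u w + dotp v w.
Proof. by rewrite -big_split; apply: eq_bigr => i _; rewrite mxE mulrDl. Qed.

Lemma dotpZl k u v : dotp (k *: u) v = k * dotp u v.
Proof. by rewrite mulr_sumr; apply: eq_bigr => i _; rewrite mxE mulrA. Qed.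

Lemma dotpNl u v : dotp (- u) v = - dotp u v.
Proof. by rewrite -scaleN1r dotpZl mulN1r. Qed.

Lemma dotpBl u v w : dotp (u - v) w = dotp u w - dotp v w.
Proof. by rewrite dotpDl dotpNl. Qed.

Lemma dotpDr u v w : dotp w (u + v) = dotp w u + dotp w v.
Proof. by rewrite !(dotpC w) dotpDl. Qed.

Lemma dotpZr k u v : dotp v (k *: u) = k * dotp v u.
Proof. by rewrite !(dotpC v) dotpZl. Qed.

Lemma dotpNr u v : dotp v (- u) = - dotp v u.
Proof. by rewrite !(dotpC v) dotpNl. Qed.

Lemma dotpBr u v w : dotp w (u - v) = dotp w u - dotp w v.
Proof. by rewrite !(dotpC w) dotpBl. Qed.

Lemma dot0p u : dotp 0 u = 0.
Proof. by rewrite -(scale0r 0) dotpZl mul0r. Qed.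

Lemma dotp0 u : dotp u 0 = 0.
Proof. by rewrite dotpC dot0p. Qed.

Definition dotpE := (dotpDl, dotpDr, dotpBl, dotpBr, dotpNl, dotpNr,
  dotpZl, dotpZr, dot0p, dotp0).

Lemma dotp_ge0 u : 0 <= dotp u u.
Proof. by apply: sumr_ge0 => i _; rewrite -expr2 sqr_ge0. Qed.

Lemma dotp_eq0 u : dotp u u = 0 -> u = 0.
Proof.
move/eqP; rewrite psumr_eq0 => [/allP h|i _]; last by rewrite -expr2 sqr_ge0.
apply/rowP => i; rewrite mxE; apply/eqP.
by have := h i (mem_index_enum i); rewrite implyTb mulf_eq0 orbb.
Qed.

Lemma enorm_ge0 u : 0 <= enorm u. Proof. exact: sqrtr_ge0. Qed.
Hint Resolve enorm_ge0 : core.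

Lemma enorm_sqr u : enorm u ^+ 2 = dotp u u.
Proof. by rewrite sqr_sqrtr ?dotp_ge0. Qed.

Lemma enorm_eq0 u : enorm u = 0 -> u = 0.
Proof. by move=> u0; apply: dotp_eq0; rewrite -enorm_sqr u0 expr0n. Qed.

Lemma enorm0 : enorm (0 : 'rV[R]_d) = 0.
Proof. by rewrite /enorm dot0p sqrtr0. Qed.

Lemma enorm_gt0 u : u != 0 -> 0 < enorm u.
Proof.
move=> u0; rewrite lt_neqAle enorm_ge0 andbT eq_sym.
by apply: contra_neq u0 => /enorm_eq0.
Qed.

Lemma enormZ k u : enorm (k *: u) = `|k| * enorm u.
Proof.
by rewrite /enorm !dotpE mulrA -expr2 sqrtrM ?sqr_ge0 // sqrtr_sqr.
Qed.

Lemma enormN u : enorm (- u) = enorm u.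
Proof. by rewrite -scaleN1r enormZ normrN1 mul1r. Qed.

Lemma enormB u v : enorm (u - v) = enorm (v - u).
Proof. by rewrite -enormN opprB. Qed.

Lemma cauchy_schwarz_sqr u v : dotp u v ^+ 2 <= dotp u u * dotp v v.
Proof.
have [->|v0] := eqVneq v 0; first by rewrite !dotp0 expr0n mulr0.
have vv : 0 < dotp v v by rewrite -enorm_sqr exprn_gt0 // enorm_gt0.
have := dotp_ge0 (dotp v v *: u - dotp u v *: v).
rewrite !dotpE (dotpC v u) => h.
have : 0 <= dotp v v * (dotp u u * dotp v v - dotp u v ^+ 2) by nra.
by rewrite pmulr_rge0 // subr_ge0.
Qed.

Lemma ler_abs_dotp u v : `|dotp u v| <= enorm u * enorm v.
Proof.
rewrite -(@ler_pXn2r _ 2) ?nnegrE ?mulr_ge0 //.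
by rewrite -normrX ger0_norm ?sqr_ge0 // exprMn !enorm_sqr cauchy_schwarz_sqr.
Qed.

Lemma ler_dotp u v : dotp u v <= enorm u * enorm v.
Proof. exact: le_trans (ler_norm _) (ler_abs_dotp _ _). Qed.

Lemma ler_enormD u v : enorm (u + v) <= enorm u + enorm v.
Proof.
rewrite -(@ler_pXn2r _ 2) ?nnegrE ?addr_ge0 //.
rewrite enorm_sqr !dotpE (dotpC v u) sqrrD !enorm_sqr.
by have := ler_dotp u v; lra.
Qed.

Lemma ler_enormB u v : enorm (u - v) <= enorm u + enorm v.
Proof. by rewrite -(enormN v) ler_enormD. Qed.

Lemma ler_enorm_dist w u v : enorm (u - v) <= enorm (u - w) + enorm (w - v).
Proof. by apply: le_trans (ler_enormD _ _); rewrite addrA subrK. Qed.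

Lemma ler_enorm_sub u v : `|enorm u - enorm v| <= enorm (u - v).
Proof.
rewrite ler_norml; have := ler_enormD (u - v) v; have := ler_enormD (v - u) u.
by rewrite !subrK (enormB v u); lra.
Qed.

Lemma ler_enorm_dot u k : 0 <= k ->
  (forall v, enorm v = 1 -> dotp u v <= k) -> enorm u <= k.
Proof.
move=> k0 h; have [->|u0] := eqVneq u 0; first by rewrite enorm0.
have u1 := enorm_gt0 u0.
have := h ((enorm u)^-1 *: u); rewrite enormZ ger0_norm ?invr_ge0 //.
rewrite mulVf ?gt_eqF // => /(_ erefl); rewrite dotpZr -enorm_sqr expr2 mulKf //.
by rewrite gt_eqF.
Qed.

Lemma unit_vector v : v != 0 -> enorm ((enorm v)^-1 *: v) = 1.
Proof.
move=> v0; rewrite enormZ ger0_norm ?invr_ge0 //.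
by rewrite mulVf // gt_eqF // enorm_gt0.
Qed.

End Euclid.
#[global] Hint Extern 0 (is_true (0 <= enorm _)) => exact: enorm_ge0 : core.

Section EuclidTopology.
Context {R : realType}.

Lemma ler_mx_enorm d (u : 'rV[R]_d) : `|u| <= enorm u.
Proof.
rewrite [leLHS]mx_normrE; apply: bigmax_le; first exact: enorm_ge0.
move=> -[i j] _ /=.
rewrite (ord1 i) -(@ler_pXn2r _ 2) ?nnegrE ?enorm_ge0 // enorm_sqr /dotp (bigD1 j) //=.
rewrite -normrX ger0_norm ?sqr_ge0 // expr2 lerDl sumr_ge0 // => k _.
by rewrite -expr2 sqr_ge0.
Qed.

Lemma ler_coord d (u : 'rV[R]_d) j : `|u 0 j| <= `|u|.
Proof. by rewrite [leRHS]mx_normrE; apply/bigmax_geP; right => /=; exists (0, j). Qed.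

Lemma ler_enorm_mx d (u : 'rV[R]_d) : enorm u <= d.+1%:R * `|u|.
Proof.
rewrite -(@ler_pXn2r _ 2) ?nnegrE ?mulr_ge0 // enorm_sqr.
have : dotp u u <= \sum_(i < d) `|u| ^+ 2.
  apply: ler_sum => i _; rewrite -expr2 -real_normK ?num_real //.
  by rewrite lerXn2r ?nnegrE // ler_coord.
rewrite sumr_const card_ord => /le_trans -> //.
rewrite -[leLHS]mulr_natl exprMn; apply: ler_wpM2r; first exact: sqr_ge0.
by rewrite -natrX ler_nat expnS expn1 mulSn; apply: leq_trans (leq_addr _ _); rewrite leqW.
Qed.

Lemma nbhs_enormP d (x : 'rV[R]_d) (A : set 'rV[R]_d) :
  nbhs x A <-> exists2 e : R, 0 < e & forall y, enorm (y - x) < e -> A y.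
Proof.
split=> [/nbhs_ballP[e /= e0 eA]|[e e0 eA]].
  exists e => // y ye; apply: eA; rewrite -ball_normE /=; apply: le_lt_trans ye.
  by rewrite enormB ler_mx_enorm.
apply/nbhs_ballP; exists (e / d.+1%:R) => /=; first by rewrite divr_gt0.
move=> y; rewrite -ball_normE /=; rewrite ltr_pdivlMr ?ltr0n // => ye; apply: eA.
by rewrite enormB; apply: le_lt_trans (ler_enorm_mx _) _; rewrite mulrC.
Qed.

(** Continuity within [A] in terms of the Euclidean norm. By [within_econtP] it agrees with the
    topological notion, since the Euclidean and the sup norm are equivalent. *)
Definition econt m d (A : set 'rV[R]_m) (f : 'rV[R]_m -> 'rV[R]_d) :=
  forall x, A x -> forall e, 0 < e -> exists2 dl, 0 < dl &
    forall y, A y -> enorm (y - x) < dl -> enorm (f y - f x) < e.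

Lemma within_econtP m d (A : set 'rV[R]_m) (f : 'rV[R]_m -> 'rV[R]_d) :
  {within A, continuous f} <-> econt A f.
Proof.
split=> [/subspace_continuousP fc x Ax e e0|fc].
  have /(fc x Ax)/nbhs_enormP[dl dl0 h] : nbhs (f x) [set y | enorm (y - f x) < e].
    by apply/nbhs_enormP; exists e.
  by exists dl => // y Ay /h; apply.
apply/subspace_continuousP => x Ax B /nbhs_enormP[e e0 eB].
have [dl dl0 h] := fc x Ax e e0.
by apply/nbhs_enormP; exists dl => // y /h yd Ay; apply: eB; apply: yd.
Qed.

(** Compactness in the form used throughout: local constants give a uniform one. The number [e] is
    both the constant in the property and the radius of the neighbourhood on which it is claimed, so
    a single quantity has to shrink. *)
Lemma compact_uniform d (K : set 'rV[R]_d) (P : 'rV[R]_d -> R -> Prop) :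
  compact K ->
  (forall x e e', 0 < e' -> e' <= e -> P x e -> P x e') ->
  (forall x, K x -> exists2 e, 0 < e & forall y, K y -> enorm (y - x) < e -> P y e) ->
  exists2 e, 0 < e & forall x, K x -> P x e.
Proof.
move=> /compact_near_coveringP/near_covering_withinP cK mono loc.
have : \forall e \near 0^'+, K `<=` (fun x => P x e).
  apply: cK => x Kx; have [e e0 h] := loc x Kx.
  exists ([set y | enorm (y - x) < e], [set e' | e' < e /\ 0 < e']) => /=.
    split; first by apply/nbhs_enormP; exists e.
    near=> e'; split; last by near: e'; exact: nbhs_right_gt.
    by near: e'; exact: nbhs_right_lt.
  move=> [y e'] /= [ye [e'e e'0]] Ky; apply: (mono _ e) => //; first exact: ltW.
  exact: h.
move=> [e /= e0 he]; exists (e / 2); first lra.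
move=> x; apply: (he (e / 2)) => /=; last lra.
by rewrite sub0r normrN ger0_norm; lra.
Unshelve. all: end_near. Qed.

Lemma compact_seq_cluster d (K : set 'rV[R]_d) (u : nat -> 'rV[R]_d) :
  compact K -> (forall m, K (u m)) ->
  exists2 x, K x & forall e N, 0 < e -> exists2 m, (N <= m)%N & enorm (u m - x) < e.
Proof.
move=> cK Ku.
have [x [Kx clx]] : K `&` cluster (u @ \oo) !=set0.
  by apply: cK; exists 0%N => // m _; exact: Ku.
exists x => // e N e0.
have [||y [[m Nm <-] ym]] := clx (u @` [set m | (N <= m)%N]) [set y | enorm (y - x) < e].
- by exists N => // m /= Nm; exists m.
- by apply/nbhs_enormP; exists e.
- by exists m.
Qed.

Lemma connected_clopen d (A B : set 'rV[R]_d) :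
  connected A -> B `<=` A -> B !=set0 ->
  (forall x, B x -> exists2 e, 0 < e & forall y, A y -> enorm (y - x) < e -> B y) ->
  (forall x, A x -> ~ B x ->
    exists2 e, 0 < e & forall y, A y -> enorm (y - x) < e -> ~ B y) ->
  A `<=` B.
Proof.
move=> cA BA B0 opB clB.
suff -> : A = B by [].
apply/esym; apply: cA => //.
  exists (fun y => exists x e, [/\ B x, enorm (y - x) < e &
     forall z, A z -> enorm (z - x) < e -> B z]).
    rewrite openE => y [x [e [Bx yx h]]].
    apply/nbhs_enormP; exists (e - enorm (y - x)); first lra.
    move=> z zy; exists x, e; split => //.
    by have := ler_enorm_dist y z x; lra.
  apply/seteqP; split=> [x Bx|y [Ay [x [e [_ yx]]]]]; last exact.
  split; first exact: BA.
  have [e e0 h] := opB x Bx; exists x, e; split => //.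
  by rewrite subrr enorm0.
exists (~` [set y | exists x e, [/\ A x, ~ B x, enorm (y - x) < e &
     forall z, A z -> enorm (z - x) < e -> ~ B z]]).
  apply: open_closedC; rewrite openE => y [x [e [Ax Bx yx h]]].
  apply/nbhs_enormP; exists (e - enorm (y - x)); first lra.
  move=> z zy; exists x, e; split => //.
  by have := ler_enorm_dist y z x; lra.
apply/seteqP; split=> [x Bx|y [Ay /= h]].
  split; first exact: BA.
  by move=> [y [e [Ay _ yx /(_ _ (BA _ Bx) yx)]]].
apply: contrapT => By; apply: h; have [e e0 h] := clB y Ay By.
by exists y, e; split => //; rewrite subrr enorm0.
Qed.

Lemma compact_closed_seq d (K : set 'rV[R]_d) x : compact K ->
  (forall e, 0 < e -> exists2 y, K y & enorm (y - x) < e) -> K x.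
Proof.
move=> cK h; have : closed K by apply: compact_closed => //; exact: norm_hausdorff.
apply=> B /nbhs_enormP[e e0 eB]; have [y Ky yx] := h e e0.
by exists y; split => //; apply: eB.
Qed.

Lemma compact_enorm_bounded d (K : set 'rV[R]_d) : compact K ->
  exists2 C, 0 < C & forall x, K x -> enorm x <= C.
Proof.
(* The bound is written [e^-1] so that it weakens as [e] shrinks, which is what [compact_uniform]
   asks for. *)
move=> cK; have [] := @compact_uniform d K (fun x e => enorm x <= e^-1) cK.
- move=> x e e' e'0 e'e h; apply: le_trans h _.
  by rewrite lef_pV2 ?posrE //; lra.
- move=> x Kx; have x0 := enorm_ge0 x; exists (enorm x + 1)^-1.
    by rewrite invr_gt0; lra.
  move=> y _ yx; rewrite invrK.
  have : (enorm x + 1)^-1 <= 1 by rewrite invf_le1; lra.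
  by have := ler_enormD (y - x) x; rewrite subrK; lra.
by move=> e e0 h; exists e^-1; rewrite ?invr_gt0.
Qed.

End EuclidTopology.

(** * Curves *)

Section Curves.
Context {R : realType}.

Lemma is_derive_line n (V : normedModType R) (f : 'rV[R]_n -> V) (y a : 'rV[R]_n) (s : R) :
  derivable f (y + s *: a) a ->
  is_derive s 1 (fun t : R => f (y + t *: a)) ('D_a f (y + s *: a)).
Proof.
move=> df; have E : (fun h : R => h^-1 *: (((fun t : R => f (y + t *: a)) \o shift s) (h *: 1) -
   (fun t : R => f (y + t *: a)) s)) =
   (fun h : R => h^-1 *: ((f \o shift (y + s *: a)) (h *: a) - f (y + s *: a))).
  apply/funext => h /=; congr (_ *: (f _ - _)).
  by rewrite [h *: 1]mulr1 scalerDl addrCA.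
by split; [rewrite /derivable E|rewrite /derive E].
Qed.

Lemma is_derive_coord d (f : R -> 'rV[R]_d) (s : R) (df : 'rV[R]_d) i :
  is_derive s 1 f df -> is_derive s 1 (fun t => f t 0 i) (df 0 i).
Proof.
move=> [fd fD]; have /derivable_mxP h := fd.
by split; [exact: h|rewrite -fD derive_mx // mxE].
Qed.

Lemma is_derive_dotp d (f g : R -> 'rV[R]_d) (s : R) (df dg : 'rV[R]_d) :
  is_derive s 1 f df -> is_derive s 1 g dg ->
  is_derive s 1 (fun t => dotp (f t) (g t)) (dotp df (g s) + dotp (f s) dg).
Proof.
move=> fd gd; have H i : is_derive s 1 (fun t => f t 0 i * g t 0 i)
    (f s 0 i *: dg 0 i + g s 0 i *: df 0 i).
  have fi := is_derive_coord i fd.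
  have gi := is_derive_coord i gd.
  by have H := is_deriveM fi gi.
have := is_derive_sum H.
rewrite (_ : \sum_(i < d) _ = (fun t => dotp (f t) (g t))).
  move=> [D E]; apply: (DeriveDef D); rewrite E /dotp -big_split /=.
  by apply: eq_bigr => i _; rewrite /GRing.scale /=; ring.
by apply/funext => t; rewrite fct_sumE.
Qed.

Lemma is_derive_dotpl d (f : R -> 'rV[R]_d) (s : R) (df v : 'rV[R]_d) :
  is_derive s 1 f df -> is_derive s 1 (fun t => dotp (f t) v) (dotp df v).
Proof.
move=> fd; have := is_derive_dotp fd (is_derive_cst v s 1).
by rewrite dotp0 addr0.
Qed.

Lemma is_derive_continuous (f df : R -> R) : (forall s : R, is_derive s 1 f (df s)) ->
  continuous f.
Proof.
by move=> h s; apply: differentiable_continuous; apply/derivable1_diffP; case: (h s).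
Qed.

Lemma mean_value (f df : R -> R) (a b : R) : a < b ->
  (forall s : R, a <= s <= b -> is_derive s 1 f (df s)) ->
  exists2 c, a < c < b & f b - f a = df c * (b - a).
Proof.
move=> ab h; have [||c cab E] := @MVT R f df a b ab.
- by move=> s /itvP sab; apply: h; rewrite !sab.
- apply: derivable_within_continuous => s; rewrite in_itv /= => sab.
  by have [] := h s sab.
- by exists c => //; move: cab; rewrite in_itv.
Qed.

(** No integral is involved: the mean value theorem bounds [dg], and applied once more it bounds the
    difference [q] of [g] and its quadratic majorant. *)
Lemma taylor2_le (g dg ddg : R -> R) (K : R) :
  (forall s : R, 0 <= s <= 1 -> is_derive s 1 g (dg s)) ->
  (forall s : R, 0 <= s <= 1 -> is_derive s 1 dg (ddg s)) ->
  (forall s : R, 0 <= s <= 1 -> ddg s <= K) ->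
  g 1 <= g 0 + dg 0 + K / 2.
Proof.
move=> hg hdg hK.
have dgle (s : R) : 0 <= s <= 1 -> dg s <= dg 0 + K * s.
  move=> /andP[s0 s1]; have [->|sn0] := eqVneq s 0; first by rewrite mulr0 addr0.
  have sp : 0 < s by lra.
  have [|c /andP[c0 cs]] := @mean_value dg ddg 0 s sp.
    by move=> u us; apply: hdg; lra.
  have cK : ddg c <= K by apply: hK; lra.
  have : ddg c * s <= K * s by rewrite ler_wpM2r // ltW.
  by rewrite subr0; lra.
pose q t := g t - (dg 0 *: t + (K / 2) *: (t ^+ 2)).
have hq (s : R) : 0 <= s <= 1 -> is_derive s 1 q (dg s - (dg 0 + K * s)).
  move=> s01; have gs := hg s s01.
  have := is_deriveB gs (is_deriveD (is_deriveZ (dg 0) (is_derive_id s 1))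
    (is_deriveZ (K/2) (is_deriveX 2 (is_derive_id s 1)))).
  move=> H; have E : q = (g - (dg 0 \*: id + (K / 2) \*: (id ^+ 2))) :> (R -> R) by apply/funext.
  by rewrite E; apply: (is_derive_eq H); rewrite /GRing.scale /= expr1; field.
have [c /andP[c0 c1]] := mean_value ltr01 hq.
have : dg c <= dg 0 + K * c by apply: dgle; lra.
by rewrite /q /GRing.scale /= expr1n expr0n /= subr0 mulr1; lra.
Qed.

End Curves.

(** * Derivatives of parametrizations *)

Section DerivativeContinuity.
Context {R : realType}.

Lemma cvg_sum_ord (V : normedModType R) (T : Type) (F : set_system T) {FF : Filter F} m
    (f : 'I_m -> T -> V) (a : 'I_m -> V) :
  (forall i, f i @ F --> a i) -> (fun t => \sum_i f i t) @ F --> \sum_i a i.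
Proof. by move=> fa; apply: cvg_big => //; exact: add_continuous. Qed.

Lemma derive_sumE n (V : normedModType R) (f : 'rV[R]_n -> V) x a : differentiable f x ->
  'D_a f x = \sum_i a 0 i *: 'D_(delta_mx 0 i) f x.
Proof.
move=> df; rewrite deriveE // [in LHS](row_sum_delta a) linear_sum.
by apply: eq_bigr => i _; rewrite linearZ deriveE.
Qed.

Lemma cvg_fstP (T1 T2 T3 : topologicalType) (f : T1 -> T3) (a : T1) (b : T2) :
  {for a, continuous f} -> (fun p : T1 * T2 => f p.1) @ (a, b) --> f a.
Proof.
move=> fa; apply: (@cvg_comp _ _ _ fst f _ (nbhs a)) => //.
exact: (@cvg_fst _ _ (nbhs a) (nbhs b)).
Qed.

Lemma cvg_sndP (T1 T2 T3 : topologicalType) (f : T2 -> T3) (a : T1) (b : T2) :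
  {for b, continuous f} -> (fun p : T1 * T2 => f p.2) @ (a, b) --> f b.
Proof.
move=> fb; apply: (@cvg_comp _ _ _ snd f _ (nbhs b)) => //.
exact: (@cvg_snd _ _ (nbhs a) (nbhs b)).
Qed.

Lemma cvg_fst_of (T1 T2 : topologicalType) (T : Type) (F : set_system T) {FF : Filter F}
    (f : T -> T1 * T2) (a : T1) (b : T2) : f @ F --> (a, b) -> (fun t => (f t).1) @ F --> a.
Proof. by move=> fab; apply: cvg_comp fab _; exact: (@cvg_fst _ _ (nbhs a) (nbhs b)). Qed.

Lemma cvg_snd_of (T1 T2 : topologicalType) (T : Type) (F : set_system T) {FF : Filter F}
    (f : T -> T1 * T2) (a : T1) (b : T2) : f @ F --> (a, b) -> (fun t => (f t).2) @ F --> b.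
Proof. by move=> fab; apply: cvg_comp fab _; exact: (@cvg_snd _ _ (nbhs a) (nbhs b)). Qed.

Lemma continuous_dotp d : continuous (fun p : 'rV[R]_d * 'rV[R]_d => dotp p.1 p.2).
Proof.
move=> [a b]; rewrite /dotp /=; apply: cvg_sum_ord => i.
apply: cvgM.
  by apply: (@cvg_fstP _ _ _ (fun v : 'rV[R]_d => v 0 i)) => //; exact: coord_continuous.
by apply: (@cvg_sndP _ _ _ (fun v : 'rV[R]_d => v 0 i)) => //; exact: coord_continuous.
Qed.

Lemma cvg_dotp (T : Type) (F : set_system T) {FF : Filter F} d (f g : T -> 'rV[R]_d) a b :
  f @ F --> a -> g @ F --> b -> (fun t => dotp (f t) (g t)) @ F --> dotp a b.
Proof.
move=> fa gb.
apply: (@cvg_comp _ _ _ (fun t => (f t, g t)) (fun p => dotp p.1 p.2) F (nbhs (a, b))).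
  exact: cvg_pair fa gb.
exact: (@continuous_dotp d (a, b)).
Qed.

End DerivativeContinuity.

Section Chart.
Context {R : realType} {n d : nat}.
Variables (U : set 'rV[R]_n) (phi : 'rV[R]_n -> 'rV[R]_d).
Hypotheses (oU : open U) (sm : smooth_on U phi).

Lemma chart_diff x : U x -> differentiable phi x.
Proof. by move=> Ux; have [+ _] := sm 1; apply. Qed.

Lemma chart_diff2 a x : U x -> differentiable ('D_a phi) x.
Proof. by move=> Ux; have [_ /(_ a) [+ _]] := sm 2; apply. Qed.

Lemma chart_cont2 a b x : U x -> {for x, continuous ('D_b ('D_a phi))}.
Proof. by move=> Ux; have [_ /(_ a) [_ /(_ b)]] := sm 2; apply. Qed.

(** Smoothness gives continuity of second derivatives in the point for fixed directions. Expanding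
    along the basis separates point and direction, which yields the joint continuity of
    [cvg_derive2]. *)
Lemma derive2_sumE x a : U x ->
  'D_a ('D_a phi) x = \sum_i a 0 i *: \sum_j a 0 j *:
     'D_(delta_mx 0 j) ('D_(delta_mx 0 i) phi) x.
Proof.
move=> Ux; have Un : \forall y \near x, U y by apply: open_nbhs_nbhs; split.
have dab i : derivable ('D_(delta_mx 0 i) phi) x a.
  by apply: diff_derivable; exact: chart_diff2.
have H : is_derive x a (\sum_i a 0 i \*: 'D_(delta_mx 0 i) phi)
    (\sum_i a 0 i *: 'D_a ('D_(delta_mx 0 i) phi) x).
  by apply: is_derive_sum => i; apply: is_deriveZ; exact: derivableP.
(* [near_eq_derive] concerns a nonzero direction, so [a = 0] is treated apart. *)
have [->|a0] := eqVneq a 0.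
  by rewrite [LHS]derive0; apply/esym/big1 => i _; rewrite mxE scale0r.
have -> : 'D_a ('D_a phi) x = 'D_a (\sum_i a 0 i \*: 'D_(delta_mx 0 i) phi) x.
  apply: near_eq_derive => //; near=> y; rewrite derive_sumE; last first.
    by apply: chart_diff; near: y.
  by rewrite fct_sumE.
rewrite (@derive_val _ _ _ _ _ _ _ H); apply: eq_bigr => i _; congr (_ *: _).
by apply: derive_sumE; exact: chart_diff2.
Unshelve. all: by end_near. Qed.

Lemma cvg_derive1 y0 a0 : U y0 ->
  (fun p : 'rV[R]_n * 'rV[R]_n => 'D_(p.2) phi p.1) @ (y0, a0) --> 'D_a0 phi y0.
Proof.
move=> Uy; have Un : \forall y \near y0, U y by apply: open_nbhs_nbhs; split.
rewrite (derive_sumE a0 (chart_diff Uy)).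
apply: (@cvg_trans _ ((fun p : 'rV[R]_n * 'rV[R]_n =>
    \sum_i p.2 0 i *: 'D_(delta_mx 0 i) phi p.1) @ (y0, a0))).
  apply: near_eq_cvg; near=> p; rewrite -derive_sumE //.
  apply: chart_diff; near: p.
  by apply: (@cvg_fst _ _ (nbhs y0) (nbhs a0)).
apply: (@cvg_sum_ord R 'rV[R]_d _ (nbhs (y0, a0))) => i; apply: cvgZ.
  by apply: (@cvg_sndP _ _ _ (fun v : 'rV[R]_n => v 0 i)); exact: coord_continuous.
apply: (@cvg_fstP _ _ _ ('D_(delta_mx 0 i) phi)).
by apply: differentiable_continuous; exact: chart_diff2.
Unshelve. all: by end_near. Qed.

Lemma cvg_derive2 y0 a0 : U y0 ->
  (fun p : 'rV[R]_n * 'rV[R]_n => 'D_(p.2) ('D_(p.2) phi) p.1) @ (y0, a0) -->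
  'D_a0 ('D_a0 phi) y0.
Proof.
move=> Uy; have Un : \forall y \near y0, U y by apply: open_nbhs_nbhs; split.
rewrite (derive2_sumE a0 Uy).
apply: (@cvg_trans _ ((fun p : 'rV[R]_n * 'rV[R]_n =>
    \sum_i p.2 0 i *: \sum_j p.2 0 j *:
     'D_(delta_mx 0 j) ('D_(delta_mx 0 i) phi) p.1) @ (y0, a0))).
  apply: near_eq_cvg; near=> p; rewrite -derive2_sumE //; near: p.
  by apply: (@cvg_fst _ _ (nbhs y0) (nbhs a0)).
have c2 i : (fun p : 'rV[R]_n * 'rV[R]_n => p.2 0 i) @ (y0, a0) --> a0 0 i.
  by apply: (@cvg_sndP _ _ _ (fun v : 'rV[R]_n => v 0 i)); exact: coord_continuous.
apply: (@cvg_sum_ord R 'rV[R]_d _ (nbhs (y0, a0))) => i; apply: cvgZ; first exact: c2.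
apply: (@cvg_sum_ord R 'rV[R]_d _ (nbhs (y0, a0))) => j; apply: cvgZ; first exact: c2.
by apply: (@cvg_fstP _ _ _ ('D_(delta_mx 0 j) ('D_(delta_mx 0 i) phi))); exact: chart_cont2.
Unshelve. all: by end_near. Qed.

End Chart.

Local Opaque derive enorm dotp.

Section UnitSphere.
Context {R : realType}.

Definition usphere d : set 'rV[R]_d := [set x | enorm x = 1].

Lemma compact_closed_bounded d (K : set 'rV[R]_d) (C : R) :
  (forall x, K x -> enorm x <= C) ->
  (forall x, (forall e, 0 < e -> exists2 y, K y & enorm (y - x) < e) -> K x) ->
  compact K.
Proof.
move=> bK clK; apply: bounded_closed_compact.
  exists C; split; first exact: num_real.
  move=> M CM x Kx; apply: le_trans (ler_mx_enorm _) _.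
  exact: le_trans (bK x Kx) (ltW CM).
move=> x clx; apply: clK => e e0.
have [|y [Ky yx]] := clx [set y | enorm (y - x) < e]; first by apply/nbhs_enormP; exists e.
by exists y.
Qed.

Lemma compact_usphere d : compact (@usphere d).
Proof.
apply: (@compact_closed_bounded _ _ 1) => x; first by move=> ->.
move=> h; apply: contrapT => /eqP; rewrite -subr_eq0 => x1.
have [|y y1] := h `|enorm x - 1|; first by rewrite normr_gt0.
by have := ler_enorm_sub y x; rewrite y1 distrC; lra.
Qed.

End UnitSphere.

(** * Curvature bounds in a chart, uniform in points, directions and normals *)

Section ChartCurvature.
Context {R : realType} {n d : nat}.
Variables (U : set 'rV[R]_n) (phi : 'rV[R]_n -> 'rV[R]_d) (y0 : 'rV[R]_n).
Hypotheses (oU : open U) (sm : smooth_on U phi) (Uy0 : U y0).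
Hypothesis inj : injective (fun a : 'rV[R]_n => 'D_a phi y0).

Local Notation D a y := ('D_a phi y).
Local Notation DD a y := ('D_a ('D_a phi) y).

Lemma chart_deriveZ a k y : U y -> D (k *: a) y = k *: D a y.
Proof. by move=> Uy; rewrite !deriveE ?linearZ //; exact: (chart_diff sm). Qed.

Lemma chart_derive2Z a k y : U y -> DD (k *: a) y = (k ^+ 2) *: DD a y.
Proof.
move=> Uy; rewrite [LHS](derive2_sumE oU sm _ Uy) [in RHS](derive2_sumE oU sm _ Uy).
rewrite scaler_sumr; apply: eq_bigr => i _.
have -> : \sum_j (k *: a) 0 j *: 'D_(delta_mx 0 j) ('D_(delta_mx 0 i) phi) y = k *: \sum_j a 0 j *: 'D_(delta_mx 0 j) ('D_(delta_mx 0 i) phi) y.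
  by rewrite scaler_sumr; apply: eq_bigr => j _; rewrite mxE scalerA.
rewrite mxE !scalerA; congr (_ *: _); ring.
Qed.

Lemma chart_derive_neq0 a : a != 0 -> D a y0 != 0.
Proof.
by apply: contra_neq => a0; apply: inj; rewrite a0 derive0.
Qed.

Let W := ('rV[R]_n * 'rV[R]_n * 'rV[R]_n * 'rV[R]_n * 'rV[R]_d * R)%type.

(** The three points have separate roles: [nu] is normal at [y1], while [y2] and [y3] will be
    intermediate points of a Taylor expansion and of the mean value theorem. At [y1 = y2 = y3 = y0]
    the claim is the strict curvature bound, and strict inequalities between continuous expressions
    persist nearby. *)
Lemma curvature_near_point (k0 : R) (a0 : 'rV[R]_n) (nu0 : 'rV[R]_d) : a0 != 0 ->
  ((forall b : 'rV[R]_n, dotp (D b y0) nu0 = 0) ->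
     dotp (DD a0 y0) nu0 < k0 * dotp (D a0 y0) (D a0 y0)) ->
  exists2 e, 0 < e & forall (y1 y2 y3 a : 'rV[R]_n) (nu : 'rV[R]_d) (k : R),
    enorm (y1 - y0) < e -> enorm (y2 - y0) < e -> enorm (y3 - y0) < e ->
    enorm (a - a0) < e -> enorm (nu - nu0) < e -> `|k - k0| < e ->
    (forall b : 'rV[R]_n, dotp (D b y1) nu = 0) ->
    dotp (DD a y2) nu * dotp (D a y1) (D a y1) < k * dotp (D a y3) (D a y1) ^+ 2 /\
    0 < dotp (D a y3) (D a y1).
Proof.
move=> a00 hk.
pose p0 : W := (y0, y0, y0, a0, nu0, k0).
suff : \forall p \near p0, let: (y1, y2, y3, a, nu, k) := p in
    (forall b : 'rV[R]_n, dotp (D b y1) nu = 0) ->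
    dotp (DD a y2) nu * dotp (D a y1) (D a y1) < k * dotp (D a y3) (D a y1) ^+ 2 /\
    0 < dotp (D a y3) (D a y1).
  move=> /nbhs_ballP[e /= e0 he]; exists e => // y1 y2 y3 a nu k h1 h2 h3 h4 h5 h6.
  apply: (he (y1, y2, y3, a, nu, k)).
  have B m (u v : 'rV[R]_m) : enorm (u - v) < e -> ball v e u.
    by move=> uv; rewrite -ball_normE /= enormB in uv *;
      apply: le_lt_trans uv; exact: ler_mx_enorm.
  split; last by rewrite /= -ball_normE /= distrC.
  split; last exact: B.
  split; last exact: B.
  split; last exact: B.
  by split; exact: B.
have FF : Filter (nbhs p0) by exact: nbhs_filter.
have c : (fun p : W => p) @ p0 --> p0 by exact: cvg_id.
have c6 := @cvg_snd_of _ _ _ _ FF _ _ _ c; have {}c := @cvg_fst_of _ _ _ _ FF _ _ _ c.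
have c5 := @cvg_snd_of _ _ _ _ FF _ _ _ c; have {}c := @cvg_fst_of _ _ _ _ FF _ _ _ c.
have c4 := @cvg_snd_of _ _ _ _ FF _ _ _ c; have {}c := @cvg_fst_of _ _ _ _ FF _ _ _ c.
have c3 := @cvg_snd_of _ _ _ _ FF _ _ _ c; have {}c := @cvg_fst_of _ _ _ _ FF _ _ _ c.
have c2 := @cvg_snd_of _ _ _ _ FF _ _ _ c; have c1 := @cvg_fst_of _ _ _ _ FF _ _ _ c.
have cD1 (f : W -> 'rV[R]_n) : f @ p0 --> y0 ->
    (fun p : W => D p.1.1.2 (f p)) @ p0 --> D a0 y0.
  move=> fc; apply: (@cvg_comp _ _ _ (fun p => (f p, p.1.1.2))
    (fun q => D q.2 q.1) _ (nbhs (y0, a0))); last exact: (cvg_derive1 oU sm).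
  exact: cvg_pair fc c4.
have cD2 : (fun p : W => DD p.1.1.2 p.1.1.1.1.2) @ p0 --> DD a0 y0.
  apply: (@cvg_comp _ _ _ (fun p : W => (p.1.1.1.1.2, p.1.1.2))
    (fun q => DD q.2 q.1) _ (nbhs (y0, a0))); last exact: (cvg_derive2 oU sm).
  exact: cvg_pair c2 c4.
have cG1 : (fun p : W => dotp (D p.1.1.2 p.1.1.1.2) (D p.1.1.2 p.1.1.1.1.1)) @ p0 -->
    dotp (D a0 y0) (D a0 y0) by apply: cvg_dotp; apply: cD1.
have pos : 0 < dotp (D a0 y0) (D a0 y0).
  by rewrite -enorm_sqr exprn_gt0 // enorm_gt0 // chart_derive_neq0.
have [orth|/existsNP[b hb]] := pselect (forall b : 'rV[R]_n, dotp (D b y0) nu0 = 0).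
  have cG2 : (fun p : W => p.2 * (dotp (D p.1.1.2 p.1.1.1.2) (D p.1.1.2 p.1.1.1.1.1) *
        dotp (D p.1.1.2 p.1.1.1.2) (D p.1.1.2 p.1.1.1.1.1)) -
      dotp (DD p.1.1.2 p.1.1.1.1.2) p.1.2 *
      dotp (D p.1.1.2 p.1.1.1.1.1) (D p.1.1.2 p.1.1.1.1.1)) @ p0 -->
    k0 * (dotp (D a0 y0) (D a0 y0) * dotp (D a0 y0) (D a0 y0)) -
    dotp (DD a0 y0) nu0 * dotp (D a0 y0) (D a0 y0).
    apply: cvgB; first by apply: cvgM => //; exact: cvgM.
    apply: cvgM; first exact: cvg_dotp.
    by apply: cvg_dotp; apply: cD1.
  have := hk orth => hk'.
  have pos2 : 0 < k0 * (dotp (D a0 y0) (D a0 y0) * dotp (D a0 y0) (D a0 y0)) -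
    dotp (DD a0 y0) nu0 * dotp (D a0 y0) (D a0 y0).
    by rewrite mulrA -mulrBl mulr_gt0 // subr_gt0.
  have N1 := cvgr_gt _ cG1 _ pos.
  have N2 := cvgr_gt _ cG2 _ pos2.
  apply: (@filterS _ _ FF _ _ _ (filterI (N1 FF) (N2 FF))) => -[[[[[y1 y2] y3] a] nu] k] /= [n1 n2] _.
  by split => //; rewrite expr2 -subr_gt0.
(* If [nu0] is not normal at [y0], then no [nu] near it is normal at a point [y1] near [y0], and the
   claim is void. *)
have cG3 : (fun p : W => dotp (D b p.1.1.1.1.1) p.1.2) @ p0 --> dotp (D b y0) nu0.
  have c7 : (fun p : W => D b p.1.1.1.1.1) @ p0 --> D b y0.
    exact: (@cvg_comp _ _ _ (fun p : W => p.1.1.1.1.1) (fun y => D b y) _ (nbhs y0) _ c1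
      (differentiable_continuous (chart_diff2 sm b Uy0))).
  exact: (@cvg_dotp R _ _ FF _ _ _ _ _ c7 c5).
have N3 := cvgr_neq0 _ cG3 (introN eqP hb).
by apply: (@filterS _ _ FF _ _ _ (N3 FF)) => -[[[[[y1 y2] y3] a] nu] k] /= /eqP n3 /(_ b).
Qed.

(** Compactness of the spheres of directions and of normals makes [e] uniform. Letting [k] range
    below [k0] is what later gives a curvature bound strictly below [k0]. *)
Lemma curvature_near (k0 : R) :
  (forall (a : 'rV[R]_n) (nu : 'rV[R]_d), a != 0 -> enorm nu = 1 -> (forall b : 'rV[R]_n, dotp (D b y0) nu = 0) ->
     dotp (DD a y0) nu < k0 * dotp (D a y0) (D a y0)) ->
  exists2 e, 0 < e & forall (y1 y2 y3 a : 'rV[R]_n) (nu : 'rV[R]_d) (k : R),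
    enorm (y1 - y0) < e -> enorm (y2 - y0) < e -> enorm (y3 - y0) < e ->
    enorm a = 1 -> enorm nu = 1 -> k0 - e < k -> k <= k0 ->
    (forall b : 'rV[R]_n, dotp (D b y1) nu = 0) ->
    dotp (DD a y2) nu * dotp (D a y1) (D a y1) < k * dotp (D a y3) (D a y1) ^+ 2 /\
    0 < dotp (D a y3) (D a y1).
Proof.
move=> hk.
pose Q (a : 'rV[R]_n) (nu : 'rV[R]_d) (e : R) := forall (y1 y2 y3 : 'rV[R]_n) (k : R),
    enorm (y1 - y0) < e -> enorm (y2 - y0) < e -> enorm (y3 - y0) < e ->
    k0 - e < k -> k <= k0 ->
    (forall b : 'rV[R]_n, dotp (D b y1) nu = 0) ->
    dotp (DD a y2) nu * dotp (D a y1) (D a y1) < k * dotp (D a y3) (D a y1) ^+ 2 /\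
    0 < dotp (D a y3) (D a y1).
have Qm a nu (e e' : R) : e' <= e -> Q a nu e -> Q a nu e'.
  by move=> e'e q y1 y2 y3 k h1 h2 h3 h4 h5 h6; apply: q => //; lra.
have [] := @compact_uniform R n (@usphere R n) (fun (a : 'rV[R]_n) (e : R) => forall nu : 'rV[R]_d, enorm nu = 1 -> Q a nu e).
- exact: compact_usphere.
- by move=> a e e' _ e'e q nu nu1; apply: Qm e'e (q nu nu1).
- move=> a0 a01; have a00 : a0 != 0.
    by apply/eqP => a0E; move: a01; rewrite a0E /usphere /= enorm0; lra.
  have [] := @compact_uniform R d (@usphere R d) (fun (nu : 'rV[R]_d) (e : R) => forall a : 'rV[R]_n, enorm a = 1 ->
      enorm (a - a0) < e -> Q a nu e).
  + exact: compact_usphere.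
  + move=> nu e e' _ e'e q a a1 aa0; exact: (Qm _ _ _ _ e'e (q a a1 (lt_le_trans aa0 e'e))).
  + move=> nu0 nu01.
    have [e e0 he] := @curvature_near_point k0 a0 nu0 a00 (hk a0 nu0 a00 nu01).
    exists e => // nu nu1 nunu0 a a1 aa0 y1 y2 y3 k h1 h2 h3 h4 h5 h6.
    by apply: he => //; rewrite ltr_norml; lra.
  by move=> e e0 he; exists e => // a a1 aa0 nu nu1; apply: he.
by move=> e e0 he; exists e => // y1 y2 y3 a nu k h1 h2 h3 a1 nu1 h4 h5 h6;
  apply: (he a a1 nu nu1).
Qed.

End ChartCurvature.

(** In use [N] is the length of a parameter vector, [Q] that of its image and [S] that of a
    derivative; bounding [S] by [N] cancels one factor [N]. *)
Lemma quadratic_lower_bound (R : realType) (c e N Q S : R) : 0 < e -> 0 <= N -> 0 <= Q ->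
  c <= e * e -> e * N ^+ 2 <= Q * S -> S <= e^-1 * N -> c * N <= Q.
Proof.
move=> e0 N0 Q0 ce h1 h2; have [->|Nn0] := eqVneq N 0; first by rewrite mulr0.
have Np : 0 < N by rewrite lt_neqAle eq_sym Nn0.
have h3 : e * N ^+ 2 <= Q * (e^-1 * N) by apply: le_trans h1 _; rewrite ler_wpM2l.
have h4 : e * e * N <= Q.
  rewrite -(ler_pM2r Np); have := ler_wpM2l (ltW e0) h3.
  have -> : e * (Q * (e^-1 * N)) = Q * N by field; rewrite gt_eqF.
  by rewrite expr2 !mulrA.
by apply: le_trans h4; rewrite ler_wpM2r.
Qed.

(* [D a y] and [DD a y] stand for the first and second derivatives of [phi] at [y] in the
   direction [a]. *)
Section ChartEstimates.
Context {R : realType} {n d : nat}.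
Variables (U : set 'rV[R]_n) (phi : 'rV[R]_n -> 'rV[R]_d) (y0 : 'rV[R]_n).
Variables D DD : 'rV[R]_n -> 'rV[R]_n -> 'rV[R]_d.
Hypotheses (oU : open U) (Uy0 : U y0).
Hypothesis chart_is_derive : forall (y a : 'rV[R]_n) (nu : 'rV[R]_d) (s : R),
  U (y + s *: a) ->
  is_derive s 1 (fun t : R => dotp (phi (y + t *: a)) nu) (dotp (D a (y + s *: a)) nu).
Hypothesis chart_is_derive2 : forall (y a : 'rV[R]_n) (nu : 'rV[R]_d) (s : R),
  U (y + s *: a) ->
  is_derive s 1 (fun t : R => dotp (D a (y + t *: a)) nu) (dotp (DD a (y + s *: a)) nu).
Hypothesis cvgD1 : forall a0 : 'rV[R]_n,
  (fun p : 'rV[R]_n * 'rV[R]_n => D p.2 p.1) @ (y0, a0) --> D a0 y0.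
Hypothesis cvgD2 : forall a0 : 'rV[R]_n,
  (fun p : 'rV[R]_n * 'rV[R]_n => DD p.2 p.1) @ (y0, a0) --> DD a0 y0.
Hypothesis DZ : forall (a y : 'rV[R]_n) (k : R), U y -> D (k *: a) y = k *: D a y.
Hypothesis DDZ : forall (a y : 'rV[R]_n) (k : R), U y ->
  DD (k *: a) y = k ^+ 2 *: DD a y.
Hypothesis D_neq0 : forall a : 'rV[R]_n, a != 0 -> D a y0 != 0.

Lemma D0 y : U y -> D 0 y = 0.
Proof. by move=> Uy; rewrite -[0 in LHS](scale0r 0) DZ // scale0r. Qed.

Lemma DD0 y : U y -> DD 0 y = 0.
Proof. by move=> Uy; rewrite -[0 in LHS](scale0r 0) DDZ // expr0n scale0r. Qed.

Lemma open_enorm_ball : exists2 e : R, 0 < e &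
  forall y : 'rV[R]_n, enorm (y - y0) < e -> U y.
Proof. by apply/nbhs_enormP; apply: open_nbhs_nbhs; split. Qed.

Lemma segment_in_ball (e s : R) (y1 a : 'rV[R]_n) : 0 <= s <= 1 ->
  enorm (y1 - y0) < e -> enorm (y1 + a - y0) < e -> enorm (y1 + s *: a - y0) < e.
Proof.
move=> /andP[s0 s1] h1 h2.
have -> : y1 + s *: a - y0 = (1 - s) *: (y1 - y0) + s *: (y1 + a - y0).
  by apply/rowP => i; rewrite !mxE; ring.
apply: le_lt_trans (ler_enormD _ _) _; rewrite !enormZ !ger0_norm ?subr_ge0 //.
set A := enorm _ in h1 *; set B := enorm _ in h2 *.
have q1 : 0 <= (1 - s) * (e - A) by rewrite mulr_ge0 // subr_ge0 // ltW.
have q2 : 0 <= s * (e - B) by rewrite mulr_ge0 // subr_ge0 // ltW.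
have [sh|sh] := lerP s (1 / 2).
  have : (1 / 2) * (e - A) <= (1 - s) * (e - A) by apply: ler_wpM2r; lra.
  lra.
have : (1 / 2) * (e - B) <= s * (e - B) by apply: ler_wpM2r; lra.
lra.
Qed.

Lemma chart_taylor (y a : 'rV[R]_n) (nu : 'rV[R]_d) (K : R) :
  (forall s : R, 0 <= s <= 1 -> U (y + s *: a)) ->
  (forall s : R, 0 <= s <= 1 -> dotp (DD a (y + s *: a)) nu <= K) ->
  dotp (phi (y + a) - phi y) nu <= dotp (D a y) nu + K / 2.
Proof.
move=> Uy hK.
have := @taylor2_le R (fun s => dotp (phi (y + s *: a)) nu)
  (fun s => dotp (D a (y + s *: a)) nu) (fun s => dotp (DD a (y + s *: a)) nu) K.
rewrite scale1r scale0r addr0 dotpBl => h.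
suff : dotp (phi (y + a)) nu <= dotp (phi y) nu + dotp (D a y) nu + K / 2 by lra.
apply: h => // s s01; first by apply: chart_is_derive; exact: Uy.
by apply: chart_is_derive2; exact: Uy.
Qed.

Lemma chart_mean_value (y a : 'rV[R]_n) (v : 'rV[R]_d) :
  (forall s : R, 0 <= s <= 1 -> U (y + s *: a)) ->
  exists2 s, 0 < s < 1 & dotp (phi (y + a) - phi y) v = dotp (D a (y + s *: a)) v.
Proof.
move=> Uy; have [|s s01] := @mean_value R (fun s => dotp (phi (y + s *: a)) v)
  (fun s => dotp (D a (y + s *: a)) v) 0 1 ltr01.
  by move=> s s01; apply: chart_is_derive; exact: Uy.
by rewrite scale1r scale0r addr0 subr0 mulr1 -dotpBl => E; exists s.
Qed.

(** Taylor's formula bounds the normal component of the chord by half of a bound for the normal part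
    of [DD a], which is quadratic in the parameter length [N]; the mean value theorem bounds [N] by
    the chord. Both use intermediate points, and the hypothesis compares them so that [N] cancels
    and exactly [k / 2] times the squared chord remains. *)
Lemma chart_normal_estimate (k0 : R) :
  (exists2 e, 0 < e & forall (y1 y2 y3 a : 'rV[R]_n) (nu : 'rV[R]_d) (k : R),
    enorm (y1 - y0) < e -> enorm (y2 - y0) < e -> enorm (y3 - y0) < e ->
    enorm a = 1 -> enorm nu = 1 -> k0 - e < k -> k <= k0 ->
    (forall b : 'rV[R]_n, dotp (D b y1) nu = 0) ->
    dotp (DD a y2) nu * dotp (D a y1) (D a y1) < k * dotp (D a y3) (D a y1) ^+ 2 /\
    0 < dotp (D a y3) (D a y1)) ->
  exists2 e, 0 < e & forall (y1 y2 : 'rV[R]_n) (nu : 'rV[R]_d) (k : R),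
    enorm (y1 - y0) < e -> enorm (y2 - y0) < e -> 0 < k -> k0 - e < k -> k <= k0 ->
    (forall b : 'rV[R]_n, dotp (D b y1) nu = 0) ->
    dotp (phi y2 - phi y1) nu <= k / 2 * enorm (phi y2 - phi y1) ^+ 2 * enorm nu.
Proof.
move=> [e1 e10 h1].
have [e2 e20 h2] := open_enorm_ball.
exists (Num.min e1 e2); first by rewrite lt_min e10.
move=> y1 y2 nu k; rewrite !lt_min => /andP[y1e1 y1e2] /andP[y2e1 y2e2] kp.
move=> kk kk0 orth.
have {}kk : k0 - e1 < k by apply: le_lt_trans kk; rewrite lerD2l lerN2 ge_min lexx.
have [->|nu0] := eqVneq nu 0; first by rewrite dotp0 enorm0 mulr0.
have [a0|a0] := eqVneq (y2 - y1) 0.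
  by move/eqP: a0; rewrite subr_eq0 => /eqP ->; rewrite subrr dot0p enorm0 expr0n mulr0 mul0r.
set a := y2 - y1 in a0; set N := enorm a; set a1 := N^-1 *: a.
set nu1 := (enorm nu)^-1 *: nu.
have nup := enorm_gt0 nu0; have Np : 0 < N := enorm_gt0 a0.
have y2E : y2 = y1 + a by rewrite /a addrC subrK.
have aE : a = N *: a1 by rewrite scalerA mulfV ?scale1r // gt_eqF.
have DE y : U y -> D a y = N *: D a1 y by move=> Uy; rewrite [in LHS]aE DZ.
have DDE y : U y -> DD a y = N ^+ 2 *: DD a1 y.
  by move=> Uy; rewrite [in LHS]aE DDZ.
have inb (s : R) : 0 <= s <= 1 -> enorm (y1 + s *: a - y0) < e1 /\ U (y1 + s *: a).
  move=> s01; split; first by apply: segment_in_ball => //; rewrite -y2E.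
  by apply: h2; apply: segment_in_ball => //; rewrite -y2E.
have orth1 b : dotp (D b y1) nu1 = 0 by rewrite dotpZr orth mulr0.
have a11 : enorm a1 = 1 := unit_vector a0.
have nu11 : enorm nu1 = 1 := unit_vector nu0.
have [_ m2] := h1 y1 y1 y1 a1 nu1 k y1e1 y1e1 y1e1 a11 nu11 kk kk0 orth1.
have [|s s01 E] := @chart_mean_value y1 a (D a1 y1); first by move=> s /inb[].
have /inb[ins Us] : 0 <= s <= 1 by lra.
have Uy1 : U y1 by apply: h2.
have {}E : dotp (phi y2 - phi y1) (D a1 y1) = N * dotp (D a1 (y1 + s *: a)) (D a1 y1).
  by rewrite [in LHS]y2E E DE // dotpZl.
set Dl := phi y2 - phi y1 in E *.
set t := dotp (D a1 (y1 + s *: a)) (D a1 y1) in E.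
(* [N * t] is the product of the chord with [D a1 y1], so [(N * t) ^+ 2] is at most the squared
   chord times [|D a1 y1|^2]. *)
have CS := cauchy_schwarz_sqr Dl (D a1 y1); rewrite E -enorm_sqr in CS.
have H (u : R) : 0 <= u <= 1 -> dotp (DD a (y1 + u *: a)) nu1 <= k * enorm Dl ^+ 2.
  move=> u01; have [inu Uu] := inb u u01.
  have [lt1 _] := h1 y1 (y1 + u *: a) (y1 + s *: a) a1 nu1 k y1e1 inu ins a11 nu11 kk kk0 orth1.
  rewrite DDE // dotpZl -(ler_pM2r m2) -/t.
  rewrite -/t in lt1; apply: (@le_trans _ _ (k * (N * t) ^+ 2)).
    rewrite exprMn mulrCA -mulrA ler_wpM2l ?sqr_ge0 //; exact: ltW.
  by rewrite -mulrA ler_wpM2l // ltW.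
have := @chart_taylor y1 a nu1 (k * enorm Dl ^+ 2) (fun u u01 => (inb u u01).2) H.
rewrite -y2E -/Dl orth1 add0r => T.
have -> : nu = enorm nu *: nu1 by rewrite scalerA mulfV ?scale1r // gt_eqF.
rewrite dotpZr enormZ nu11 mulr1 ger0_norm //.
by rewrite [leRHS]mulrC ler_wpM2l //; lra.
Qed.

Lemma chart_bounds_near : exists2 e, 0 < e &
  forall y1 y3 a : 'rV[R]_n, enorm (y1 - y0) < e -> enorm (y3 - y0) < e -> enorm a = 1 ->
  [/\ e < dotp (D a y3) (D a y1), enorm (D a y1) < e^-1 & enorm (DD a y1) < e^-1].
Proof.
have [] := @compact_uniform R n (@usphere R n) (fun a e => forall y1 y3 : 'rV[R]_n,
   enorm (y1 - y0) < e -> enorm (y3 - y0) < e ->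
   [/\ e < dotp (D a y3) (D a y1), enorm (D a y1) < e^-1 & enorm (DD a y1) < e^-1]).
- exact: compact_usphere.
- move=> a e e' e'0 e'e h y1 y3 h1 h3.
  have ee : e^-1 <= e'^-1 by rewrite lef_pV2 ?posrE //; lra.
  by have [||h4 h5 h6] := h y1 y3; try lra; split; lra.
- move=> a0 a01; have a00 : a0 != 0.
    by apply/eqP => a0E; move: a01; rewrite a0E /usphere /= enorm0; lra.
  set v := dotp (D a0 y0) (D a0 y0).
  have vp : 0 < v by rewrite /v -enorm_sqr exprn_gt0 // enorm_gt0 // D_neq0.
  pose p0 := (y0, y0, a0); pose W := ('rV[R]_n * 'rV[R]_n * 'rV[R]_n)%type.
  have FF : Filter (nbhs p0) by exact: nbhs_filter.
  have c : (fun p : W => p) @ p0 --> p0 by exact: cvg_id.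
  have c3 := @cvg_snd_of _ _ _ _ FF _ _ _ c; have {}c := @cvg_fst_of _ _ _ _ FF _ _ _ c.
  have c2 := @cvg_snd_of _ _ _ _ FF _ _ _ c; have c1 := @cvg_fst_of _ _ _ _ FF _ _ _ c.
  have cD1 (f : W -> 'rV[R]_n) : f @ p0 --> y0 ->
      (fun p : W => D p.2 (f p)) @ p0 --> D a0 y0.
    move=> fc; apply: (@cvg_comp _ _ _ (fun p => (f p, p.2))
      (fun q => D q.2 q.1) _ (nbhs (y0, a0))); last exact: cvgD1.
    exact: cvg_pair fc c3.
  have cD2 : (fun p : W => DD p.2 p.1.1) @ p0 --> DD a0 y0.
    apply: (@cvg_comp _ _ _ (fun p : W => (p.1.1, p.2))
      (fun q => DD q.2 q.1) _ (nbhs (y0, a0))); last exact: cvgD2.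
    exact: cvg_pair c1 c3.
  have G1 : (fun p : W => dotp (D p.2 p.1.2) (D p.2 p.1.1)) @ p0 --> v.
    by apply: cvg_dotp; apply: cD1.
  have G2 : (fun p : W => dotp (D p.2 p.1.1) (D p.2 p.1.1)) @ p0 --> v.
    by apply: cvg_dotp; apply: cD1.
  have G3 : (fun p : W => dotp (DD p.2 p.1.1) (DD p.2 p.1.1)) @ p0 -->
     dotp (DD a0 y0) (DD a0 y0) by apply: cvg_dotp.
  set w := dotp (DD a0 y0) (DD a0 y0) in G3.
  have w0 : 0 <= w := dotp_ge0 _.
  have N1 := cvgr_gt _ G1 (v / 2); have N2 := cvgr_lt _ G2 (v + 1).
  have N3 := cvgr_lt _ G3 (w + 1).
  have N12 : \forall p \near p0, [/\ v / 2 < dotp (D p.2 p.1.2) (D p.2 p.1.1),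
     dotp (D p.2 p.1.1) (D p.2 p.1.1) < v + 1 & dotp (DD p.2 p.1.1) (DD p.2 p.1.1) < w + 1].
    near=> p; split; near: p; [apply: N1|apply: N2|apply: N3]; lra.
  have /nbhs_ballP[e1 /= e10 he] := N12.
  (* One number has to serve as radius, as lower bound for the inner product and, through its
     inverse, as upper bound for both derivatives. *)
  pose e := Num.min e1 (Num.min (v / 2) (Num.min (v + 1)^-1 (w + 1)^-1)).
  have ee1 : e <= e1 by rewrite ge_min lexx.
  have ev : e <= v / 2 by rewrite !ge_min lexx orbT.
  have ev1 : e <= (v + 1)^-1 by rewrite !ge_min lexx !orbT.
  have ew1 : e <= (w + 1)^-1 by rewrite !ge_min lexx !orbT.
  have v1 : 0 < v + 1 by apply: ltr_pwDr => //; exact: ltW.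
  have w1 : 0 < w + 1 by apply: ltr_pwDr.
  have e0 : 0 < e by rewrite !lt_min e10 !invr_gt0 v1 w1 divr_gt0.
  have lev : v + 1 <= e^-1 by rewrite -[leLHS]invrK lef_pV2 ?posrE ?invr_gt0 //; lra.
  have lew : w + 1 <= e^-1 by rewrite -[leLHS]invrK lef_pV2 ?posrE ?invr_gt0 //; lra.
  have sqrt_bound (u : 'rV[R]_d) (x : R) : 0 <= x -> dotp u u < x + 1 -> enorm u < x + 1.
    rewrite -enorm_sqr => x0 ux; have u0 := enorm_ge0 u.
    by rewrite ltNge; apply/negP => xu; nra.
  exists e => // a a1 aa0 y1 y3 h1 h3.
  have B m (u u' : 'rV[R]_m) : enorm (u - u') < e -> ball u' e1 u.
    move=> uv; rewrite -ball_normE /= enormB in uv *.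
    by apply: lt_le_trans ee1; apply: le_lt_trans uv; exact: ler_mx_enorm.
  have [|h4 h5 h6] := he (y1, y3, a); first by split; [split|]; exact: B.
  split; first by apply: le_lt_trans h4.
    by apply: lt_le_trans lev; apply: sqrt_bound h5; exact: ltW.
  by apply: lt_le_trans lew; apply: sqrt_bound h6.
by move=> e e0 h; exists e => // y1 y3 a h1 h3 a1; exact: h.
Unshelve. all: by end_near. Qed.

Lemma chart_bounds : exists2 e, 0 < e & exists2 c, 0 < c & exists2 C, 0 < C &
  (forall y : 'rV[R]_n, enorm (y - y0) < e -> U y) /\
  forall y1 : 'rV[R]_n, enorm (y1 - y0) < e -> [/\
    forall y2 : 'rV[R]_n, enorm (y2 - y0) < e ->
      c * enorm (y2 - y1) ^+ 2 <= dotp (phi y2 - phi y1) (D (y2 - y1) y1),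
    forall y2 : 'rV[R]_n, enorm (y2 - y0) < e ->
      c * enorm (y2 - y1) <= enorm (phi y2 - phi y1),
    forall a : 'rV[R]_n, c * enorm a <= enorm (D a y1),
    forall a : 'rV[R]_n, enorm (D a y1) <= C * enorm a &
    forall a : 'rV[R]_n, enorm (y1 + a - y0) < e ->
      enorm (phi (y1 + a) - phi y1 - D a y1) <= C * enorm a ^+ 2].
Proof.
have [e1 e10 h1] := chart_bounds_near.
have [e2 e20 h2] := open_enorm_ball.
pose e := Num.min e1 e2; have ee1 : e <= e1 by rewrite ge_min lexx.
have ee2 : e <= e2 by rewrite ge_min lexx orbT.
exists e; first by rewrite lt_min e10.
(* [e1] is the constant of the quadratic bound; [e1 * e1] is that of the linear ones, which lose a
   factor [e1] in [quadratic_lower_bound]. *)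
exists (Num.min e1 (e1 * e1)); first by rewrite lt_min e10 mulr_gt0.
exists e1^-1; first by rewrite invr_gt0.
set c := Num.min _ _; have ce1 : c <= e1 by rewrite ge_min lexx.
have cee : c <= e1 * e1 by rewrite ge_min lexx orbT.
have c0 : 0 < c by rewrite lt_min e10 mulr_gt0.
have UE y : enorm (y - y0) < e -> U y by move=> ye; apply: h2; apply: lt_le_trans ye ee2.
split => // y1 y1e.
have y1e1 : enorm (y1 - y0) < e1 by lra.
have Uy1 := UE _ y1e.
have K1 a y3 : enorm (y3 - y0) < e -> e1 * enorm a ^+ 2 <= dotp (D a y3) (D a y1).
  move=> y3e; have [->|a0] := eqVneq a 0; first by rewrite enorm0 expr0n mulr0 !D0 ?dotp0 //; exact: UE.
  have ap := enorm_gt0 a0.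
  have y3e1 : enorm (y3 - y0) < e1 by apply: lt_le_trans y3e ee1.
  have [H _ _] := h1 y1 y3 _ y1e1 y3e1 (unit_vector a0).
  have aE : a = enorm a *: ((enorm a)^-1 *: a) by rewrite scalerA mulfV ?scale1r // gt_eqF.
  have Uy3 := UE _ y3e.
  have -> : D a y3 = enorm a *: D ((enorm a)^-1 *: a) y3 by rewrite -DZ // -aE.
  have -> : D a y1 = enorm a *: D ((enorm a)^-1 *: a) y1 by rewrite -DZ // -aE.
  by rewrite dotpZl dotpZr mulrA -expr2 mulrC ler_wpM2l ?sqr_ge0 // ltW.
have K2 a : enorm (D a y1) <= e1^-1 * enorm a.
  have [->|a0] := eqVneq a 0; first by rewrite enorm0 mulr0 D0 ?enorm0.
  have ap := enorm_gt0 a0.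
  have [_ H _] := h1 y1 y1 _ y1e1 y1e1 (unit_vector a0).
  move: H; rewrite !DZ // enormZ ger0_norm ?invr_ge0 //.
  by rewrite ltr_pdivrMl // mulrC => /ltW.
have K3 a y3 : enorm (y3 - y0) < e -> enorm (DD a y3) <= e1^-1 * enorm a ^+ 2.
  move=> y3e; have [->|a0] := eqVneq a 0.
    by rewrite enorm0 expr0n mulr0 DD0 ?enorm0 //; exact: UE.
  have ap := enorm_gt0 a0.
  have y3e1 : enorm (y3 - y0) < e1 by lra.
  have [_ _ H] := h1 y3 y3 _ y3e1 y3e1 (unit_vector a0).
  have Uy3 := UE _ y3e.
  move: H; rewrite DDZ // enormZ ger0_norm ?sqr_ge0 // exprVn.
  by rewrite ltr_pdivrMl ?exprn_gt0 // mulrC => /ltW.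
have seg a : enorm (y1 + a - y0) < e -> forall s : R, 0 <= s <= 1 -> enorm (y1 + s *: a - y0) < e.
  by move=> ae s s01; exact: segment_in_ball.
have P1 y2 : enorm (y2 - y0) < e ->
   e1 * enorm (y2 - y1) ^+ 2 <= dotp (phi y2 - phi y1) (D (y2 - y1) y1).
  move=> y2e; have y2E : y2 = y1 + (y2 - y1) by rewrite addrC subrK.
  have s2 := seg (y2 - y1); rewrite -y2E in s2; have {}s2 := s2 y2e.
  have [|s s01] := @chart_mean_value y1 (y2 - y1) (D (y2 - y1) y1).
    by move=> s s01; apply: UE; exact: s2.
  by rewrite -y2E => ->; apply: K1; apply: s2; lra.
split.
- move=> y2 y2e; apply: le_trans (P1 y2 y2e).
  by rewrite ler_wpM2r ?sqr_ge0.
- move=> y2 y2e; apply: (quadratic_lower_bound e10 _ _ cee _ (K2 (y2 - y1))) => //.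
  by apply: le_trans (P1 y2 y2e) _; exact: ler_dotp.
- move=> a; apply: (quadratic_lower_bound e10 _ _ cee _ (K2 a)) => //.
  by apply: le_trans (K1 a y1 y1e) _; exact: ler_dotp.
- exact: K2.
move=> a ae; apply: ler_enorm_dot; first by rewrite mulr_ge0 ?sqr_ge0 // invr_ge0 ltW.
move=> v v1; have T := @chart_taylor y1 a v (e1^-1 * enorm a ^+ 2).
rewrite dotpBl lerBlDl; apply: (@le_trans _ _ (dotp (D a y1) v + e1^-1 * enorm a ^+ 2 / 2)).
  apply: T => s s01; first by apply: UE; exact: seg.
  apply: le_trans (ler_dotp _ _) _; rewrite v1 mulr1; apply: K3; exact: seg.
rewrite lerD2l ler_pdivrMr // ler_peMr ?ler1n //.
by rewrite mulr_ge0 ?sqr_ge0 // invr_ge0 ltW.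
Qed.

End ChartEstimates.

(** * Projections onto tangent spaces *)

Section ChartInstances.
Context {R : realType} {n d : nat}.
Variables (U : set 'rV[R]_n) (phi : 'rV[R]_n -> 'rV[R]_d) (y0 : 'rV[R]_n).
Hypotheses (oU : open U) (sm : smooth_on U phi) (Uy0 : U y0).
Hypothesis inj : injective (fun a : 'rV[R]_n => 'D_a phi y0).

Lemma derivative_is_derive (y a : 'rV[R]_n) (nu : 'rV[R]_d) (s : R) : U (y + s *: a) ->
  is_derive s 1 (fun t : R => dotp (phi (y + t *: a)) nu) (dotp ('D_a phi (y + s *: a)) nu).
Proof.
move=> Uy; apply: is_derive_dotpl; apply: is_derive_line.
by apply: diff_derivable; exact: (chart_diff sm).
Qed.

Lemma derivative2_is_derive (y a : 'rV[R]_n) (nu : 'rV[R]_d) (s : R) : U (y + s *: a) ->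
  is_derive s 1 (fun t : R => dotp ('D_a phi (y + t *: a)) nu)
    (dotp ('D_a ('D_a phi) (y + s *: a)) nu).
Proof.
move=> Uy; apply: is_derive_dotpl; apply: is_derive_line.
by apply: diff_derivable; exact: (chart_diff2 sm).
Qed.

Lemma derivative_bounds : exists2 e, 0 < e & exists2 c, 0 < c & exists2 C, 0 < C &
  (forall y : 'rV[R]_n, enorm (y - y0) < e -> U y) /\
  forall y1 : 'rV[R]_n, enorm (y1 - y0) < e -> [/\
    forall y2 : 'rV[R]_n, enorm (y2 - y0) < e ->
      c * enorm (y2 - y1) ^+ 2 <= dotp (phi y2 - phi y1) ('D_(y2 - y1) phi y1),
    forall y2 : 'rV[R]_n, enorm (y2 - y0) < e ->
      c * enorm (y2 - y1) <= enorm (phi y2 - phi y1),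
    forall a : 'rV[R]_n, c * enorm a <= enorm ('D_a phi y1),
    forall a : 'rV[R]_n, enorm ('D_a phi y1) <= C * enorm a &
    forall a : 'rV[R]_n, enorm (y1 + a - y0) < e ->
      enorm (phi (y1 + a) - phi y1 - 'D_a phi y1) <= C * enorm a ^+ 2].
Proof.
apply: (@chart_bounds R n d U phi y0 (fun a y => 'D_a phi y) (fun a y => 'D_a ('D_a phi) y)).
- exact: oU.
- exact: Uy0.
- exact: derivative_is_derive.
- exact: derivative2_is_derive.
- by move=> a0; exact: (cvg_derive1 oU sm).
- by move=> a0; exact: (cvg_derive2 oU sm).
- by move=> a y k Uy; exact: (chart_deriveZ sm).
- by move=> a y k Uy; exact: (chart_derive2Z oU sm).
- exact: chart_derive_neq0.
Qed.

Lemma normal_estimate (k0 : R) :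
  (forall (a : 'rV[R]_n) (nu : 'rV[R]_d), a != 0 -> enorm nu = 1 ->
     (forall b : 'rV[R]_n, dotp ('D_b phi y0) nu = 0) ->
     dotp ('D_a ('D_a phi) y0) nu < k0 * dotp ('D_a phi y0) ('D_a phi y0)) ->
  exists2 e, 0 < e & forall (y1 y2 : 'rV[R]_n) (nu : 'rV[R]_d) (k : R),
    enorm (y1 - y0) < e -> enorm (y2 - y0) < e -> 0 < k -> k0 - e < k -> k <= k0 ->
    (forall b : 'rV[R]_n, dotp ('D_b phi y1) nu = 0) ->
    dotp (phi y2 - phi y1) nu <= k / 2 * enorm (phi y2 - phi y1) ^+ 2 * enorm nu.
Proof.
move=> hk.
apply: (@chart_normal_estimate R n d U phi y0 (fun a y => 'D_a phi y)
  (fun a y => 'D_a ('D_a phi) y)).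
- exact: oU.
- exact: Uy0.
- exact: derivative_is_derive.
- exact: derivative2_is_derive.
- by move=> a y k Uy; exact: (chart_deriveZ sm).
- by move=> a y k Uy; exact: (chart_derive2Z oU sm).
- exact: (curvature_near oU sm Uy0 inj hk).
Qed.

End ChartInstances.

Section OrthogonalProjection.
Context {R : realType}.

Lemma dotp_mulmx d (u v : 'rV[R]_d) : dotp u v = (u *m v^T) 0 0.
Proof. by rewrite mxE; apply: eq_bigr => i _; rewrite mxE. Qed.

Lemma dotp_mulmxl m d (a : 'rV[R]_m) (A : 'M[R]_(m, d)) (v : 'rV[R]_d) :
  dotp (a *m A) v = dotp a (v *m A^T).
Proof. by rewrite !dotp_mulmx trmx_mul trmxK mulmxA. Qed.

(** The solution of the normal equations: for a row-free [A] the Gram matrix [A *m A^T] is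
    invertible, and this is the orthogonal projection onto the row space, acting on row vectors from
    the right. *)
Definition rowspace_proj m d (A : 'M[R]_(m, d)) : 'M[R]_d :=
  A^T *m invmx (A *m A^T) *m A.

Variables (m d : nat) (A : 'M[R]_(m, d)).
Hypothesis freeA : row_free A.

Lemma gram_unitmx : A *m A^T \in unitmx.
Proof.
rewrite -row_free_unit -kermx_eq0; apply/rowV0P => v /sub_kermxP vAA.
have /dotp_eq0 vA0 : dotp (v *m A) (v *m A) = 0.
  by rewrite dotp_mulmxl -mulmxA vAA dotp0.
by apply: (row_free_inj freeA); rewrite vA0 mul0mx.
Qed.

Lemma rowspace_proj_sym : (rowspace_proj A)^T = rowspace_proj A.
Proof.
by rewrite /rowspace_proj !trmx_mul trmxK trmx_inv trmx_mul trmxK mulmxA.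
Qed.

Lemma rowspace_proj_id : A *m rowspace_proj A = A.
Proof. by rewrite /rowspace_proj !mulmxA mulmxV ?mul1mx // gram_unitmx. Qed.

Lemma rowspace_proj_idem : rowspace_proj A *m rowspace_proj A = rowspace_proj A.
Proof. by rewrite {1}/rowspace_proj -mulmxA rowspace_proj_id. Qed.

Lemma rank_rowspace_proj : \rank (rowspace_proj A) = m.
Proof.
apply/eqP; rewrite eqn_leq; apply/andP; split.
  by rewrite (leq_trans (mulmx_max_rank _ _)).
rewrite -{1}(eqP freeA) -{1}rowspace_proj_id; exact: mxrankM_maxr.
Qed.

Lemma rowspace_projP (v : 'rV[R]_d) : reflect (exists a, v = a *m A) (v *m rowspace_proj A == v).
Proof.
apply: (iffP eqP) => [vE|[a ->]]; last by rewrite -mulmxA rowspace_proj_id.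
by exists (v *m (A^T *m invmx (A *m A^T))); rewrite -[RHS]mulmxA; exact: esym.
Qed.

Lemma rowspace_proj_orth (v : 'rV[R]_d) (a : 'rV[R]_m) : dotp (a *m A) (v - v *m rowspace_proj A) = 0.
Proof.
have PA : rowspace_proj A *m A^T = A^T.
  by rewrite -{1}rowspace_proj_sym -trmx_mul rowspace_proj_id.
by rewrite dotp_mulmxl mulmxBl -mulmxA PA subrr dotp0.
Qed.

End OrthogonalProjection.

Section TangentSpace.
Context {R : realType} {n d : nat}.
Implicit Types (M : set 'rV[R]_d) (U : set 'rV[R]_n) (phi : 'rV[R]_n -> 'rV[R]_d).

Definition jac phi (y : 'rV[R]_n) : 'M[R]_(n, d) :=
  \matrix_(i, j) ('D_(delta_mx 0 i) phi y) 0 j.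

Lemma derive_jac phi y a : differentiable phi y -> 'D_a phi y = a *m jac phi y.
Proof.
move=> dphi; rewrite derive_sumE //; apply/rowP => j; rewrite summxE mxE.
by apply: eq_bigr => i _; rewrite !mxE.
Qed.

Definition chart_at M p U phi y := [/\ local_parametrization M U phi, U y & phi y = p].

Lemma chart_at_move M p U phi y z : chart_at M p U phi y -> U z ->
  chart_at M (phi z) U phi z.
Proof. by move=> [lp _ _] Uz. Qed.

Lemma chart_at_jac M p U phi y a : chart_at M p U phi y -> 'D_a phi y = a *m jac phi y.
Proof. by move=> [[_ sm _ _] Uy _]; apply: derive_jac; exact: (chart_diff sm). Qed.

Lemma chart_at_free M p U phi y : chart_at M p U phi y -> row_free (jac phi y).
Proof.
move=> ch; have [[_ _ inj _] Uy _] := ch.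
rewrite -kermx_eq0; apply/rowV0P => v /sub_kermxP vJ.
by apply: (inj _ Uy); rewrite !(chart_at_jac _ ch) vJ mul0mx.
Qed.

Lemma chart_at_inverse M p U phi y : chart_at M p U phi y ->
  (forall z, U z -> M (phi z)) /\
  forall e, 0 < e -> exists2 dl, 0 < dl & forall q, M q -> enorm (q - p) < dl ->
    exists z, [/\ U z, enorm (z - y) < e & phi z = q].
Proof.
move=> [[_ _ _ [V oV [g [h1 h2 _ gc]]]] Uy py].
split=> [z /h1[[]] //|e e0].
have [[Mp Vp] gp] := h1 y Uy; rewrite py in Mp Vp gp.
have /nbhs_enormP[e1 e10 he1] : nbhs p V by apply: open_nbhs_nbhs; split.
have [dl dl0 hdl] := (within_econtP _ _).1 gc p (conj Mp Vp) e e0.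
exists (Num.min e1 dl); first by rewrite lt_min e10.
move=> q Mq; rewrite lt_min => /andP[q1 q2].
have MVq : (M `&` V) q by split => //; exact: he1.
by have [Ug gq] := h2 q MVq; exists (g q); split => //; rewrite -gp; exact: hdl.
Qed.

(** Two charts at [p] have the same tangent space; the argument avoids differentiating the change of
    charts. The point [phi (y + s *: a)] is also a value of [psi]. Its first order expansions in
    both charts have errors of order [s ^+ 2], and the linear term of the one in [psi] is orthogonal
    to [nu]. Hence [s * dotp u nu] is of order [s ^+ 2]. *)
Lemma chart_tangent_orth M p U phi y V psi z a nu :
  chart_at M p U phi y -> chart_at M p V psi z ->
  (forall b, dotp ('D_b psi z) nu = 0) -> dotp ('D_a phi y) nu = 0.
Proof.
move=> ch1 ch2 orth; have [[oU sm1 inj1 _] Uy py] := ch1.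
have [[oV sm2 inj2 _] Vz pz] := ch2.
have [MU _] := chart_at_inverse ch1; have [_ inv2] := chart_at_inverse ch2.
have [e1 e10 [c1 c10 [C1 C10 [_ h1]]]] := derivative_bounds oU sm1 Uy (inj1 _ Uy).
have [e2 e20 [c2 c20 [C2 C20 [_ h2]]]] := derivative_bounds oV sm2 Vz (inj2 _ Vz).
have [dl dl0 hdl] := inv2 e2 e20.
have y0 : enorm (y - y) < e1 by rewrite subrr enorm0.
have z0 : enorm (z - z) < e2 by rewrite subrr enorm0.
have {h1}[_ _ _ _ h1] := h1 y y0.
have {h2}[_ h2 _ _ h2'] := h2 z z0.
have [e3 e30 he3] := open_enorm_ball oU Uy.
set u := 'D_a phi y in h1 *.
have [aE|a0] := eqVneq a 0; first by rewrite /u aE derive0 dot0p.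
have ap := enorm_gt0 a0; set N := enorm a in ap.
have upper := enorm_ge0 u.
pose K := enorm u + C1 * N ^+ 2; have K0 : 0 <= K by rewrite addr_ge0 // mulr_ge0 ?sqr_ge0 // ltW.
pose s0 := Num.min 1 (Num.min (e1 / N) (Num.min (e3 / N) (dl / (K + 1)))).
have s00 : 0 < s0 by rewrite !lt_min ltr01 !divr_gt0 //; lra.
pose L := (C2 * (K / c2) ^+ 2 + C1 * N ^+ 2) * enorm nu.
have L0 : 0 <= L by rewrite mulr_ge0 // addr_ge0 // mulr_ge0 ?sqr_ge0 // ltW.
have key s : 0 < s -> s < s0 -> `|dotp u nu| <= L * s.
  move=> sp; rewrite !lt_min => /and4P[s1]; rewrite !ltr_pdivlMr //; last lra.
  move=> se1 se3 sdl.
  have nsa : enorm (s *: a) = s * N by rewrite enormZ ger0_norm // ltW.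
  have Us : U (y + s *: a) by apply: he3; rewrite addrC addrA addNr add0r nsa.
  have Q1 : enorm (phi (y + s *: a) - p - s *: u) <= C1 * N ^+ 2 * s ^+ 2.
    have := h1 (s *: a); rewrite addrC addrA addNr add0r nsa => /(_ se1).
    by rewrite py (chart_deriveZ sm1) // exprMn mulrA mulrAC.
  set q := phi (y + s *: a) in Q1.
  have Q2 : enorm (q - p) <= s * K.
    have := ler_enormD (q - p - s *: u) (s *: u); rewrite subrK enormZ (ger0_norm (ltW sp)).
    have : C1 * N ^+ 2 * s ^+ 2 <= C1 * N ^+ 2 * s.
      by rewrite ler_wpM2l ?mulr_ge0 ?sqr_ge0 // ltW //; nra.
    have -> : s * K = s * enorm u + C1 * N ^+ 2 * s by rewrite /K; ring.
    by lra.
  have [|z' [Vz' z'e qz']] := hdl q (MU _ Us).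
    by apply: le_lt_trans Q2 _; apply: le_lt_trans sdl; rewrite ler_wpM2l ?ltW //; lra.
  have {}h2 := h2 z' z'e; rewrite qz' pz in h2.
  have zE : z + (z' - z) = z' by rewrite addrC subrK.
  have {}h2' := h2' (z' - z); rewrite zE qz' pz in h2'; have {}h2' := h2' z'e.
  (* The lower bound on chords of [psi] turns the distance of the images into a bound for the
     parameters that is linear in [s]. *)
  have zn : enorm (z' - z) <= K / c2 * s.
    rewrite -(ler_pM2l c20); apply: le_trans h2 _; apply: le_trans Q2 _.
    by rewrite mulrA mulrCA mulfV ?gt_eqF // mulr1 mulrC.
  have Q3 : enorm (q - p - 'D_(z' - z) psi z) <= C2 * (K / c2) ^+ 2 * s ^+ 2.
    apply: le_trans h2' _; rewrite -mulrA -exprMn ler_pM2l //.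
    by rewrite lerXn2r ?nnegrE // mulr_ge0 // ?divr_ge0 // ltW.
  have E : s * dotp u nu = dotp (q - p - 'D_(z' - z) psi z) nu - dotp (q - p - s *: u) nu.
    by rewrite !dotpE orth; ring.
  rewrite -(ler_pM2l sp).
  have -> : s * `|dotp u nu| = `|s * dotp u nu| by rewrite normrM ger0_norm // ltW.
  rewrite E; apply: le_trans (ler_normB _ _) _.
  have B1 := ler_abs_dotp (q - p - 'D_(z' - z) psi z) nu.
  have B2 := ler_abs_dotp (q - p - s *: u) nu.
  have B3 := ler_wpM2r (enorm_ge0 nu) Q3; have B4 := ler_wpM2r (enorm_ge0 nu) Q1.
  by rewrite /L; lra.
apply/eqP; rewrite -normr_le0 leNgt; apply/negP => dp.
set D := `|dotp u nu| in dp key.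
pose s := Num.min (s0 / 2) (D / (2 * (L + 1))).
have sp : 0 < s by rewrite lt_min !divr_gt0 //; lra.
have ss0 : s < s0 by apply: le_lt_trans (_ : s0 / 2 < s0); [rewrite ge_min lexx|lra].
have := key s sp ss0.
have : s * (2 * (L + 1)) <= D.
  by rewrite -ler_pdivlMr; [rewrite ge_min lexx orbT|lra].
by nra.
Qed.

(** [tangent_space] collects the vectors of all charts at [p]. The part [w] of such a vector that is
    normal to the row space of one Jacobian is orthogonal to the vector, by [chart_tangent_orth],
    and to its projection, hence to itself. So the tangent space is the row space of any one
    Jacobian. *)
Lemma tangent_spaceP M p U phi y v : chart_at M p U phi y ->
  tangent_space n M p v <-> v *m rowspace_proj (jac phi y) = v.
Proof.
move=> ch; have fr := chart_at_free ch; split=> [|/eqP/(rowspace_projP fr)[a ->]]; last first.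
  have [lp Uy py] := ch.
  by exists U, phi, y, a; split => //; rewrite (chart_at_jac _ ch).
move=> [V [psi [z [a [lp Vz pz <-]]]]].
have ch2 : chart_at M p V psi z by [].
set u := 'D_a psi z; set w := u - u *m rowspace_proj (jac phi y).
suff w0 : w = 0 by apply/eqP; rewrite eq_sym -subr_eq0 -/w w0.
apply: dotp_eq0; rewrite {1}/w dotpBl (chart_tangent_orth _ ch2 ch); last first.
  by move=> b; rewrite (chart_at_jac _ ch) rowspace_proj_orth.
by rewrite {1}/rowspace_proj !mulmxA rowspace_proj_orth ?subr0.
Qed.

End TangentSpace.

Section TangentData.
Context {R : realType} {d : nat}.

(* All that the global argument uses of the charts. Vectors are rows, so the orthogonal
   projection [P x] onto the tangent space at [x] acts on the right. *)
Record tangent_data (n : nat) (M : set 'rV[R]_d) (P : 'rV[R]_d -> 'M[R]_d)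
    (kap del C : R) : Prop := TangentData {
  td_compact : compact M;
  td_kap : 0 < kap;
  td_del : 0 < del;
  td_C : 0 < C;
  td_sym : forall x, M x -> (P x)^T = P x;
  td_idem : forall x, M x -> P x *m P x = P x;
  td_rank : forall x, M x -> \rank (P x) = n;
  td_normal : forall x y nu, M x -> M y -> enorm (y - x) < del -> nu *m P x = 0 ->
    dotp (y - x) nu <= kap / 2 * enorm (y - x) ^+ 2 * enorm nu;
  td_exp : forall x u, M x -> u *m P x = u -> enorm u <= del ->
    exists2 y, M y & enorm (y - x - u) <= C * enorm u ^+ 2 }.

Lemma tangent_data_le n M P kap kap' del C : kap <= kap' ->
  tangent_data n M P kap del C -> tangent_data n M P kap' del C.
Proof.
move=> le [h1 h2 h3 h4 h5 h6 h7 h8 h9]; split => //; first exact: lt_le_trans le.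
move=> x y nu Mx My yx nuP; apply: le_trans (h8 x y nu Mx My yx nuP) _.
by rewrite ler_wpM2r // ler_wpM2r ?sqr_ge0 // ler_wpM2r // invr_ge0.
Qed.

End TangentData.

(** * From the curvature hypothesis to uniform tangent data *)

Section ChartTangentData.
Context {R : realType} {n d : nat}.
Variables (M : set 'rV[R]_d) (k0 : R).
Hypotheses (k00 : 0 < k0) (hcurv : forall k, normal_curvatures n M k -> k < k0).

(** The field ['D_a1 phi], with constant coefficient [a1] in the chart, is tangent, and at [y] it is
    a unit vector. The normal part of its derivative along [a1] is the second fundamental form of
    that vector; homogeneity in [a] undoes the normalisation. *)
Lemma chart_normal_curvature p U phi y (a : 'rV[R]_n) (nu : 'rV[R]_d) :
  chart_at M p U phi y -> a != 0 -> enorm nu = 1 ->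
  (forall b : 'rV[R]_n, dotp ('D_b phi y) nu = 0) ->
  dotp ('D_a ('D_a phi) y) nu < k0 * dotp ('D_a phi y) ('D_a phi y).
Proof.
move=> ch a0 nu1 orth; have [lp Uy py] := ch; have [oU sm inj _] := lp.
have fr := chart_at_free ch.
have u0 : 'D_a phi y != 0 := chart_derive_neq0 (inj _ Uy) a0.
set N := enorm ('D_a phi y); have Np : 0 < N := enorm_gt0 u0.
pose a1 := N^-1 *: a.
have Da1 : 'D_a1 phi y = N^-1 *: 'D_a phi y := chart_deriveZ sm _ _ Uy.
have DDa1 : 'D_a1 ('D_a1 phi) y = (N^-1) ^+ 2 *: 'D_a ('D_a phi) y.
  exact: (chart_derive2Z oU sm _ _ Uy).
set z := 'D_a1 ('D_a1 phi) y in DDa1.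
pose w := z - z *m rowspace_proj (jac phi y).
have tang v : tangent_space n M p (v *m rowspace_proj (jac phi y)).
  by apply/(tangent_spaceP _ ch); rewrite -mulmxA rowspace_proj_idem.
have wk : enorm w < k0.
  apply: hcurv; exists p, ('D_a1 phi y), w; split => //.
  - by rewrite -py; have [+ _] := chart_at_inverse ch; apply.
  - by exists U, phi, y, a1; split.
  - by rewrite Da1; exact: unit_vector.
  exists U, phi, ('D_a1 phi), y, a1; split => //.
    split => //; first by move=> k; have [_ +] := sm k.+1; apply.
    by move=> y' Uy'; exists U, phi, y', a1; split.
  split; first by rewrite /w opprB addrC subrK; exact: tang.
  move=> t /(tangent_spaceP _ ch)/eqP/(rowspace_projP fr)[b ->].
  exact: rowspace_proj_orth.
have zw : dotp z nu = dotp w nu.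
  rewrite /w dotpBl [dotp (z *m _) _](_ : _ = 0) ?subr0 //.
  by rewrite /rowspace_proj !mulmxA -(chart_at_jac _ ch) orth.
have : dotp z nu < k0.
  rewrite zw; apply: le_lt_trans wk; apply: le_trans (ler_dotp _ _) _.
  by rewrite nu1 mulr1.
rewrite DDa1 dotpZl -enorm_sqr -/N exprVn mulrC ltr_pdivrMr ?exprn_gt0 //.
Qed.

Lemma exists_tangent_data : closed_submanifold n M ->
  exists P del C, exists2 kap, kap < k0 & tangent_data n M P kap del C.
Proof.
move=> [subM cM].
(* One chart is fixed at each point of [M], and an arbitrary triple elsewhere; by [tangent_spaceP]
   the projections [P] do not depend on the charts chosen. *)
have /choice[c hc] : forall p : 'rV[R]_d,
    exists t : set 'rV[R]_n * ('rV[R]_n -> 'rV[R]_d) * 'rV[R]_n,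
      M p -> chart_at M p t.1.1 t.1.2 t.2.
  move=> p.
  have [Mp|nMp] := pselect (M p); last by exists (setT, fun=> 0, 0).
  have [U [phi [lp [y Uy py]]]] := subM p Mp.
  by exists (U, phi, y).
pose P p := rowspace_proj (jac (c p).1.2 (c p).2).
have PE p U phi y v : chart_at M p U phi y -> M p -> v *m P p = v ->
    exists a : 'rV[R]_n, 'D_a phi y = v.
  move=> ch Mp; move/(tangent_spaceP _ (hc p Mp))/(tangent_spaceP _ ch)/eqP.
  by move/(rowspace_projP (chart_at_free ch)) => [a ->]; exists a; rewrite (chart_at_jac _ ch).
have P0 p U phi y nu : chart_at M p U phi y -> M p -> nu *m P p = 0 ->
    forall a : 'rV[R]_n, dotp ('D_a phi y) nu = 0.
  move=> ch Mp nuP a.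
  have : 'D_a phi y *m P p = 'D_a phi y.
    apply/(tangent_spaceP _ (hc p Mp)); have [lp Uy py] := ch.
    by exists U, phi, y, a; split.
  by move=> <-; rewrite dotp_mulmxl rowspace_proj_sym nuP dotp0.
have [e1 e10 h1] : exists2 e, 0 < e & forall x, M x -> forall y, M y -> enorm (y - x) < e ->
   forall k, 0 < k -> k0 - e < k -> k <= k0 -> forall nu, nu *m P x = 0 ->
   dotp (y - x) nu <= k / 2 * enorm (y - x) ^+ 2 * enorm nu.
  apply: (@compact_uniform R d M (fun x e => forall y, M y -> enorm (y - x) < e ->
     forall k, 0 < k -> k0 - e < k -> k <= k0 -> forall nu, nu *m P x = 0 ->
     dotp (y - x) nu <= k / 2 * enorm (y - x) ^+ 2 * enorm nu)) => //.
    move=> x e e' e'0 e'e h y My yx k kp ke kk0; apply: h => //.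
      exact: lt_le_trans e'e.
    by apply: le_lt_trans ke; rewrite lerD2l lerN2.
  move=> x0 Mx0; have ch := hc x0 Mx0; have [[oU sm inj _] Uy0 py0] := ch.
  have [e e0 he] := normal_estimate oU sm Uy0 (inj _ Uy0)
    (fun a nu => chart_normal_curvature ch).
  have [MU inv] := chart_at_inverse ch.
  have [dl dl0 hdl] := inv e e0.
  exists (Num.min e (dl / 2)); first by rewrite lt_min e0 divr_gt0.
  move=> x Mx; rewrite lt_min => /andP[_ xx0] y My; rewrite lt_min => /andP[_ yx].
  move=> k kp ke kk0 nu nuP.
  have [|z1 [Uz1 z1e xE]] := hdl x Mx; first by lra.
  have [|z2 [Uz2 z2e yE]] := hdl y My.
    by have := ler_enorm_dist x y x0; lra.
  have := he z1 z2 nu k z1e z2e kp; rewrite xE yE; apply => //.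
    by apply: le_lt_trans ke; rewrite lerD2l lerN2 ge_min lexx.
  have chz : chart_at M x (c x0).1.1 (c x0).1.2 z1 by rewrite -xE; exact: chart_at_move ch Uz1.
  exact: (P0 _ _ _ _ _ chz Mx nuP).
have [e2 e20 h2] : exists2 e, 0 < e & forall x, M x -> forall u, u *m P x = u ->
   enorm u <= e -> exists2 y, M y & enorm (y - x - u) <= e^-1 * enorm u ^+ 2.
  apply: (@compact_uniform R d M (fun x e => forall u, u *m P x = u ->
   enorm u <= e -> exists2 y, M y & enorm (y - x - u) <= e^-1 * enorm u ^+ 2)) => //.
    move=> x e e' e'0 e'e h u uP ue; have [|y My hy] := h u uP; first exact: le_trans e'e.
    exists y => //; apply: le_trans hy _; rewrite ler_wpM2r ?sqr_ge0 // lef_pV2 ?posrE //.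
    exact: lt_le_trans e'e.
  move=> x0 Mx0; have ch := hc x0 Mx0; have [[oU sm inj _] Uy0 py0] := ch.
  have [e e0 [c1 c10 [C1 C10 [_ hb]]]] := derivative_bounds oU sm Uy0 (inj _ Uy0).
  have [MU inv] := chart_at_inverse ch.
  have e20 : 0 < e / 2 by rewrite divr_gt0.
  have [dl dl0 hdl] := inv (e / 2) e20.
  have [e3 e30 he3] := open_enorm_ball oU Uy0.
  pose E := Num.min (e / 2) (e3 / 2).
  have E0 : 0 < E by rewrite lt_min e20 divr_gt0.
  have [dl' dl'0 hdl'] := inv E E0.
  (* [dl'] keeps [x] inside the chart, [c1 * E / 2] makes the parameter [a] of [u] at most [E / 2],
     and [c1 ^+ 2 / C1] lets [f^-1] absorb the constant [C1] of the chart. *)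
  pose f := Num.min dl' (Num.min (c1 * E / 2) (c1 ^+ 2 / C1)).
  exists f; first by rewrite !lt_min dl'0 !divr_gt0 ?mulr_gt0 ?exprn_gt0.
  move=> x Mx; rewrite lt_min => /andP[xx0 _] u uP uf.
  have [z [Uz ze xE]] := hdl' x Mx xx0.
  move: ze; rewrite lt_min => /andP[ze ze3].
  have ze' : enorm (z - (c x0).2) < e by apply: lt_trans ze _; rewrite ltr_pdivrMr // ltr_pMr // ltr1n.
  have chz : chart_at M x (c x0).1.1 (c x0).1.2 z by rewrite -xE; exact: chart_at_move ch Uz.
  have [a aE] := PE _ _ _ _ u chz Mx uP.
  have [_ _ hb1 _ hb2] := hb z ze'.
  have ua : c1 * enorm a <= enorm u by rewrite -aE.
  have aE2 : enorm a <= E / 2.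
    rewrite -(ler_pM2l c10); apply: le_trans ua _; apply: le_trans uf _.
    by rewrite mulrA !ge_min lexx !orbT.
  have aE3 : enorm a < E by apply: le_lt_trans aE2 _; rewrite ltr_pdivrMr // ltr_pMr // ltr1n.
  have zb b : E <= b / 2 -> enorm (z - (c x0).2) < b / 2 -> enorm (z + a - (c x0).2) < b.
    move=> Eb zb; rewrite addrAC; apply: le_lt_trans (ler_enormD _ _) _.
    by rewrite [b]splitr ltrD //; exact: lt_le_trans Eb.
  exists ((c x0).1.2 (z + a)).
    by apply: MU; apply: he3; apply: zb => //; rewrite ge_min lexx orbT.
  have := hb2 a; rewrite xE aE => /(_ _)/le_trans -> //.
    by apply: zb => //; rewrite ge_min lexx.
  have fC : C1 <= f^-1 * c1 ^+ 2.
    rewrite ler_pdivlMl; last by rewrite !lt_min dl'0 !divr_gt0 ?mulr_gt0 ?exprn_gt0.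
    by rewrite -ler_pdivlMr // !ge_min lexx !orbT.
  apply: (@le_trans _ _ (f^-1 * c1 ^+ 2 * enorm a ^+ 2)).
    by rewrite ler_wpM2r ?sqr_ge0.
  rewrite -mulrA -exprMn ler_wpM2l //.
    by rewrite invr_ge0 ltW // !lt_min dl'0 !divr_gt0 ?mulr_gt0 ?exprn_gt0.
  by rewrite lerXn2r ?nnegrE // mulr_ge0 // ltW.
(* Chosen inside the window allowed by [h1]: positive, above [k0 - e1] and strictly below [k0]. *)
pose kap := k0 - Num.min e1 k0 / 2.
have m0 : 0 < Num.min e1 k0 by rewrite lt_min e10.
have m1 : Num.min e1 k0 <= e1 by rewrite ge_min lexx.
have m2 : Num.min e1 k0 <= k0 by rewrite ge_min lexx orbT.
have kapp : 0 < kap by rewrite /kap; lra.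
have kape : k0 - e1 < kap by rewrite /kap; lra.
have kapk : kap < k0 by rewrite /kap; lra.
exists P, (Num.min e1 e2), e2^-1, kap => //; split => //.
- by rewrite lt_min e10.
- by rewrite invr_gt0.
- by move=> x Mx; exact: rowspace_proj_sym.
- by move=> x Mx; apply: rowspace_proj_idem; exact: chart_at_free (hc x Mx).
- by move=> x Mx; apply: rank_rowspace_proj; exact: chart_at_free (hc x Mx).
- move=> x y nu Mx My; rewrite lt_min => /andP[yx _] nuP.
  exact: (h1 x Mx y My yx kap kapp kape (ltW kapk)).
- move=> x u Mx uP; rewrite le_min => /andP[_ ue]; exact: h2.
Qed.

End ChartTangentData.

(** * Flows from approximate time steps *)

Section ApproximateFlow.
Context {R : realType} {T : Type}.
Variables (dist : T -> T -> R) (K : T -> Prop).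
Hypothesis dist_ge0 : forall x y, 0 <= dist x y.
Hypothesis dist_refl : forall x, dist x x = 0.
Hypothesis dist_sym : forall x y, dist x y = dist y x.
Hypothesis dist_tri : forall y x z, dist x z <= dist x y + dist y z.
Hypothesis dist_sep : forall x y, dist x y <= 0 -> x = y.
Hypothesis dist_complete : forall u : nat -> T, (forall k, K (u k)) ->
  (forall e : R, 0 < e -> exists N, forall i j, (N <= i)%N -> (N <= j)%N -> dist (u i) (u j) < e) ->
  exists2 l, K l & forall e : R, 0 < e -> exists N, forall i, (N <= i)%N -> dist (u i) l < e.

Lemma pow2_eps (e : R) : 0 < e -> exists N, forall k, (N <= k)%N -> 2 ^- k < e.
Proof.
move=> e0; exists (Num.truncn e^-1) => k Nk.
rewrite -[ltRHS]invrK ltf_pV2 ?posrE ?invr_gt0 ?exprn_gt0 //.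
apply: lt_le_trans (truncnS_gt _) _.
by rewrite -natrX ler_nat; apply: leq_ltn_trans Nk _; exact: ltn_expl.
Qed.

Lemma le0_pow2 (z B : R) N : (forall k, (N <= k)%N -> z <= B * 2 ^- k) -> z <= 0.
Proof.
move=> h; rewrite leNgt; apply/negP => z0.
have B0 : 0 < B.
  have := h N (leqnn _); have p : (0 : R) < 2 ^- N by rewrite invr_gt0 exprn_gt0.
  by move=> zB; rewrite -(pmulr_lgt0 _ p); exact: lt_le_trans zB.
have [N' h'] := pow2_eps (divr_gt0 z0 B0).
have := h' (maxn N N') (leq_maxr _ _); rewrite ltr_pdivlMr // mulrC.
by have := h (maxn N N') (leq_maxl _ _); lra.
Qed.

Lemma geometric_limit (A : R) N (u : nat -> T) : 0 <= A -> (forall k, K (u k)) ->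
  (forall k, (N <= k)%N -> dist (u k) (u k.+1) <= A * 2 ^- k) ->
  exists2 l, K l & forall k, (N <= k)%N -> dist (u k) l <= 2 * A * 2 ^- k.
Proof.
move=> A0 Ku h.
have p k : (0 : R) < 2 ^- k by rewrite invr_gt0 exprn_gt0.
have h2 k j : (N <= k)%N -> dist (u k) (u (k + j)%N) <= 2 * A * 2 ^- k - 2 * A * 2 ^- (k + j).
  move=> Nk; elim: j => [|j IH]; first by rewrite addn0 dist_refl subrr.
  apply: le_trans (dist_tri (u (k + j)%N) _ _) _; rewrite addnS.
  have := h (k + j)%N (leq_trans Nk (leq_addr _ _)).
  have -> : (2 : R) ^- (k + j).+1 = 2 ^- (k + j) / 2.
    by rewrite exprS invfM mulrC.
  by lra.
have h3 k i : (N <= k)%N -> (k <= i)%N -> dist (u k) (u i) <= 2 * A * 2 ^- k.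
  move=> Nk ki; have := h2 k (i - k)%N Nk; rewrite subnKC //.
  by have := mulr_ge0 (mulr_ge0 (ler0n R 2) A0) (ltW (p i)); lra.
have [|l Kl hl] := dist_complete Ku.
  move=> e e0; have A1 : 0 < 4 * A + 1 by rewrite ltr_wpDl // mulr_ge0.
  have [N' h'] := pow2_eps (divr_gt0 e0 A1).
  exists (maxn N N') => i j Ni Nj.
  have hi := h3 _ i (leq_maxl N N') Ni; have hj := h3 _ j (leq_maxl N N') Nj.
  apply: le_lt_trans (dist_tri (u (maxn N N')) _ _) _; rewrite dist_sym.
  have := h' _ (leq_maxr N N'); rewrite ltr_pdivlMr //.
  by have := p (maxn N N'); lra.
exists l => // k Nk; rewrite -subr_le0; apply: (@le0_pow2 _ 1 0) => m _.
have [N' h'] := hl _ (p m); rewrite mul1r lerBlDr addrC.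
have := h' _ (leq_maxr k N'); have := h3 k _ Nk (leq_maxl k N').
by have := dist_tri (u (maxn k N')) (u k) l; lra.
Qed.

Section Semiflow.
Variables (sig : R -> T -> T) (L C e0 : R).
Hypotheses (L_ge0 : 0 <= L) (C_ge0 : 0 <= C) (e0_gt0 : 0 < e0).
Hypothesis sigK : forall (e : R) x, 0 <= e -> e <= e0 -> K x -> K (sig e x).
Hypothesis sigL : forall (e : R) x y, 0 <= e -> e <= e0 -> K x -> K y ->
  dist (sig e x) (sig e y) <= (1 + L * e) * dist x y + C * e ^+ 2.
Hypothesis sigD : forall (e f : R) x, 0 <= e -> 0 <= f -> e + f <= e0 -> K x ->
  dist (sig e (sig f x)) (sig (e + f) x) <= C * (e + f) ^+ 2.
Hypothesis sig1 : forall (e : R) x, 0 <= e -> e <= e0 -> K x -> dist (sig e x) x <= C * e.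

Lemma compare_orbits (e D : R) (a b : nat -> T) N : 0 <= e -> e <= e0 -> 0 <= D ->
  (forall m, K (a m)) -> (forall m, K (b m)) ->
  (forall m, (m < N)%N -> dist (a m.+1) (sig e (a m)) <= D * e ^+ 2) ->
  (forall m, (m < N)%N -> dist (b m.+1) (sig e (b m)) <= D * e ^+ 2) ->
  forall m, (m <= N)%N ->
    dist (a m) (b m) <= expR (L * (m%:R * e)) *
      (dist (a 0%N) (b 0%N) + (m%:R * e) * ((C + 2 * D) * e)).
Proof.
move=> ep ee0 D0 Ka Kb ha hb m mN.
have Le : 0 <= L * e by rewrite mulr_ge0.
have E m' : (1 + L * e) ^+ m' <= expR (L * (m'%:R * e)).
  rewrite mulrCA expRM_natl lerXn2r ?nnegrE ?expR_ge0 //; last exact: expR_ge1Dx.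
  by rewrite addr_ge0.
suff H : dist (a m) (b m) <= (1 + L * e) ^+ m *
    (dist (a 0%N) (b 0%N) + (m%:R * e) * ((C + 2 * D) * e)).
  apply: le_trans H _; rewrite ler_wpM2r // addr_ge0 //.
  by rewrite !mulr_ge0 // addr_ge0 // mulr_ge0.
elim: m mN => [_|m IH mN]; first by rewrite expr0 !mul0r mul1r addr0.
have {}IH := IH (ltnW mN).
apply: le_trans (dist_tri (sig e (a m)) _ _) _.
have h1 := dist_tri (sig e (b m)) (sig e (a m)) (b m.+1).
have h2 := ha m mN; have := hb m mN; rewrite dist_sym => h3.
have h4 := sigL ep ee0 (Ka m) (Kb m).
set X := dist (a 0%N) (b 0%N) in IH *; set Y := (1 + L * e) ^+ m in IH.
have Y1 : 1 <= Y by rewrite exprn_ege1 // lerDl.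
have h5 : (1 + L * e) * dist (a m) (b m) <=
   (1 + L * e) * (Y * (X + m%:R * e * ((C + 2 * D) * e))).
  by rewrite ler_wpM2l // addr_ge0.
rewrite exprS -/Y -natr1.
have Z0 : 0 <= (C + 2 * D) * e ^+ 2 by rewrite mulr_ge0 ?sqr_ge0 // addr_ge0 // mulr_ge0.
have YZ : (C + 2 * D) * e ^+ 2 <= (1 + L * e) * Y * ((C + 2 * D) * e ^+ 2).
  by rewrite ler_peMl // mulr_ege1 // lerDl.
have -> : (1 + L * e) * Y * (X + (m%:R + 1) * e * ((C + 2 * D) * e)) =
  (1 + L * e) * (Y * (X + m%:R * e * ((C + 2 * D) * e))) +
  (1 + L * e) * Y * ((C + 2 * D) * e ^+ 2) by ring.
by lra.
Qed.

Lemma iter_sigK (e : R) m x : 0 <= e -> e <= e0 -> K x -> K (iter m (sig e) x).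
Proof. by move=> ep ee Kx; elim: m => //= m IH; exact: sigK. Qed.

(** The polygon with dyadic step [2 ^- k], stopped at its last node not after [t]; up to one step of
    time is lost. *)
Definition euler (k : nat) (t : R) (x : T) : T :=
  iter (Num.truncn (t * 2 ^+ k)) (sig (2 ^- k)) x.

Lemma pow2_gt0 k : (0 : R) < 2 ^- k. Proof. by rewrite invr_gt0 exprn_gt0. Qed.
Hint Resolve pow2_gt0 : core.

Lemma euler_time k (t : R) : 0 <= t -> 0 <= t - (Num.truncn (t * 2 ^+ k))%:R * 2 ^- k <= 2 ^- k.
Proof.
move=> t0; have tp : 0 <= t * 2 ^+ k by rewrite mulr_ge0 // exprn_ge0.
have /andP[h1 h2] := truncn_itv tp; rewrite subr_ge0 lerBlDr.
rewrite ler_pdivrMr ?exprn_gt0 // h1 /= -[X in X + _]mul1r -mulrDl.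
by rewrite ler_pdivlMr ?exprn_gt0 // nat1r ltW.
Qed.

Variable k0 : nat.
Hypothesis k0P : forall k, (k0 <= k)%N -> 2 ^- k <= e0.

Lemma dist_iter (e : R) m x : 0 <= e -> e <= e0 -> K x ->
  dist (iter m (sig e) x) x <= m%:R * e * C.
Proof.
move=> ep ee Kx; elim: m => [|m IH]; first by rewrite dist_refl !mul0r.
apply: le_trans (dist_tri (iter m (sig e) x) _ _) _ => /=.
by have := sig1 ep ee (iter_sigK m ep ee Kx); rewrite -natr1; lra.
Qed.

Lemma iter_lipschitz (e : R) m x y : 0 <= e -> e <= e0 -> K x -> K y ->
  dist (iter m (sig e) x) (iter m (sig e) y) <=
    expR (L * (m%:R * e)) * (dist x y + (m%:R * e) * (C * e)).
Proof.
move=> ep ee Kx Ky.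
have := @compare_orbits e 0 (fun m => iter m (sig e) x) (fun m => iter m (sig e) y) m ep ee.
rewrite mulr0 addr0; apply => //; try by move=> m'; exact: iter_sigK.
  by move=> m' _; rewrite dist_refl mul0r.
by move=> m' _; rewrite dist_refl mul0r.
Qed.

Lemma expR_mono_time k (t : R) : 0 <= t ->
  expR (L * ((Num.truncn (t * 2 ^+ k))%:R * 2 ^- k)) <= expR (L * t).
Proof.
by move=> t0; rewrite ler_expR ler_wpM2l //; have /andP[] := euler_time k t0; lra.
Qed.

Lemma euler_lipschitz k (t : R) x y : (k0 <= k)%N -> 0 <= t -> K x -> K y ->
  dist (euler k t x) (euler k t y) <= expR (L * t) * (dist x y + t * C * 2 ^- k).
Proof.
move=> kk t0 Kx Ky; have ep := ltW (pow2_gt0 k); have ee := k0P kk.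
apply: le_trans (iter_lipschitz _ ep ee Kx Ky) _.
have /andP[h1 h2] := euler_time k t0.
set m := (Num.truncn _)%:R in h1 h2 *; have m0 : 0 <= m * 2 ^- k by rewrite mulr_ge0.
apply: ler_pM; rewrite ?expR_ge0 ?addr_ge0 ?mulr_ge0 //; first exact: expR_mono_time.
by rewrite lerD2l -[leRHS]mulrA ler_wpM2r ?mulr_ge0 //; lra.
Qed.

Lemma euler_step_refine k (t : R) x : (k0 <= k)%N -> 0 <= t -> K x ->
  dist (euler k t x) (euler k.+1 t x) <= (expR (L * t) * (t * (3 * C)) + C) * 2 ^- k.
Proof.
move=> kk t0 Kx; rewrite /euler.
have ep := ltW (pow2_gt0 k); have ee := k0P kk.
set e := 2 ^- k in ep ee *.
have e2 : 2 ^- k.+1 = e / 2 :> R by rewrite exprS invfM mulrC.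
have ep2 : 0 <= e / 2 by rewrite divr_ge0.
have ee2 : e / 2 <= e0 by lra.
rewrite e2; set m := Num.truncn (t * 2 ^+ k).
have tp : 0 <= t * 2 ^+ k by rewrite mulr_ge0 // exprn_ge0.
have /andP[m1 m2] := truncn_itv tp; rewrite -/m in m1 m2.
set m' := Num.truncn (t * 2 ^+ k.+1).
(* Halving the step doubles the number of steps, with one more if a further node fits before [t];
   that extra half step costs at most [C * 2 ^- k]. *)
have m'E : m' = m.*2 \/ m' = m.*2.+1.
  have [tl|tl] := lerP (m.*2.+1)%:R (t * 2 ^+ k.+1).
    right; apply: truncn_def; rewrite tl /= exprS mulrCA.
    by rewrite -doubleS -mul2n natrM ltr_pM2l.
  left; apply: truncn_def; rewrite tl andbT exprS mulrCA -mul2n natrM.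
  by rewrite ler_pM2l.
have main : dist (iter m (sig e) x) (iter m.*2 (sig (e / 2)) x) <=
    expR (L * t) * (t * (3 * C)) * e.
  have := @compare_orbits e C (fun m => iter m (sig e) x)
    (fun m => iter m.*2 (sig (e / 2)) x) m ep ee C_ge0.
  move=> /(_ _ _ _ _ m (leqnn _)) h; apply: le_trans (h _ _ _ _) _.
  - by move=> j; exact: iter_sigK.
  - by move=> j; exact: iter_sigK.
  - by move=> j _; rewrite dist_refl mulr_ge0 // sqr_ge0.
  - move=> j _; rewrite doubleS /=.
    have := sigD ep2 ep2 _ (iter_sigK j.*2 ep2 ee2 Kx).
    by rewrite -splitr; apply.
  rewrite dist_refl add0r -[leRHS]mulrA; apply: ler_pM; rewrite ?expR_ge0 //.
  - by rewrite !mulr_ge0 // addr_ge0 // mulr_ge0.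
  - exact: expR_mono_time.
  have -> : C + 2 * C = 3 * C by ring.
  rewrite mulrA ler_wpM2r // ler_wpM2r ?mulr_ge0 //.
  by have /andP[] := euler_time k t0; rewrite -/m -/e; lra.
have Ce : 0 <= C * e by rewrite mulr_ge0.
case: m'E => ->; first by rewrite mulrDl; lra.
apply: le_trans (dist_tri (iter m.*2 (sig (e / 2)) x) _ _) _ => /=.
have := sig1 ep2 ee2 (iter_sigK m.*2 ep2 ee2 Kx); rewrite dist_sym.
by rewrite mulrDl; lra.
Qed.

Lemma eulerK k (t : R) x : (k0 <= k)%N -> K x -> K (euler k t x).
Proof. by move=> kk Kx; apply: iter_sigK => //; exact: k0P. Qed.

Lemma exists_semiflow : exists F : R -> T -> T, exists B : R -> R,
  forall (t : R) x, 0 <= t -> K x -> K (F t x) /\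
   forall k, (k0 <= k)%N -> dist (euler k t x) (F t x) <= B t * 2 ^- k.
Proof.
pose B t := 2 * (expR (L * t) * (t * (3 * C)) + C).
have /choice[F hF] : forall tx : R * T, exists l : T, 0 <= tx.1 -> K tx.2 -> K l /\
   forall k, (k0 <= k)%N -> dist (euler k tx.1 tx.2) l <= B tx.1 * 2 ^- k.
  move=> [t x] /=; have [t0|] := pselect (0 <= t); last by exists x.
  have [Kx|] := pselect (K x); last by exists x.
  have A0 : 0 <= expR (L * t) * (t * (3 * C)) + C.
    by rewrite addr_ge0 // mulr_ge0 ?expR_ge0 // !mulr_ge0.
  have [||l Kl hl] := @geometric_limit _ k0 (fun k => euler (maxn k k0) t x) A0.
  - by move=> k; apply: eulerK => //; exact: leq_maxr.
  - move=> k kk; rewrite (maxn_idPl kk) (maxn_idPl (leqW kk)).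
    exact: euler_step_refine.
  by exists l => _ _; split => // k kk; have := hl k kk; rewrite (maxn_idPl kk).
by exists (fun t x => F (t, x)), B => t x t0 Kx; exact: (hF (t, x)).
Qed.

Section SemiflowProperties.
Variables (F : R -> T -> T) (B : R -> R).
Hypothesis hF : forall (t : R) x, 0 <= t -> K x -> K (F t x) /\
   forall k, (k0 <= k)%N -> dist (euler k t x) (F t x) <= B t * 2 ^- k.

Lemma semiflow_unique (t : R) x y (B' : R) : 0 <= t -> K x ->
  (forall k, (k0 <= k)%N -> dist (euler k t x) y <= B' * 2 ^- k) -> F t x = y.
Proof.
move=> tp Kx h; apply: dist_sep; apply: (@le0_pow2 _ (B t + B') k0) => k kk.
have [_ /(_ k kk)] := hF tp Kx; rewrite dist_sym => h1.
by have := dist_tri (euler k t x) (F t x) y; have := h k kk; lra.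
Qed.

Lemma semiflow0 x : K x -> F 0 x = x.
Proof.
move=> Kx; apply: (@semiflow_unique _ _ _ 0) => // k kk.
by rewrite /euler mul0r truncn0 dist_refl mul0r.
Qed.

Lemma semiflow_lipschitz (t : R) x y : 0 <= t -> K x -> K y ->
  dist (F t x) (F t y) <= expR (L * t) * dist x y.
Proof.
move=> tp Kx Ky; rewrite -subr_le0.
apply: (@le0_pow2 _ (B t + B t + expR (L * t) * (t * C)) k0) => k kk.
have [_ /(_ k kk)] := hF tp Kx; rewrite dist_sym => h1.
have [_ /(_ k kk) h2] := hF tp Ky.
have := euler_lipschitz kk tp Kx Ky.
have := dist_tri (euler k t x) (F t x) (F t y).
by have := dist_tri (euler k t y) (euler k t x) (F t y); lra.
Qed.

Lemma semiflow_dist (t : R) x : 0 <= t -> K x -> dist (F t x) x <= C * t.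
Proof.
move=> tp Kx; rewrite -subr_le0; apply: (@le0_pow2 _ (B t) k0) => k kk.
have [_ /(_ k kk)] := hF tp Kx; rewrite dist_sym => h1.
have := dist_tri (euler k t x) (F t x) x.
have h2 : dist (euler k t x) x <= C * t.
  apply: le_trans (dist_iter _ (ltW (pow2_gt0 k)) (k0P kk) Kx) _.
  rewrite mulrC ler_wpM2l //.
  by have /andP[] := euler_time k tp; lra.
by lra.
Qed.

Lemma semiflowD (s t : R) x : 0 <= s -> 0 <= t -> K x -> F (s + t) x = F s (F t x).
Proof.
move=> sp tp Kx; have [Kt ht] := hF tp Kx; have [_ hs] := hF sp Kt.
apply: (@semiflow_unique _ _ _ (C + expR (L * s) * (B t + s * C) + B s)) => //.
  by rewrite addr_ge0.
move=> k kk.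
have h1 : dist (euler k (s + t) x) (euler k s (euler k t x)) <= C * 2 ^- k.
  rewrite /euler -iterD.
  set a := Num.truncn (s * 2 ^+ k); set b := Num.truncn (t * 2 ^+ k).
  have p2 : (0 : R) <= 2 ^+ k by rewrite exprn_ge0.
  have /andP[a1 a2] := truncn_itv (mulr_ge0 sp p2).
  have /andP[b1 b2] := truncn_itv (mulr_ge0 tp p2).
  rewrite -/a -/b in a1 a2 b1 b2; rewrite -nat1r in a2; rewrite -nat1r in b2.
  (* Rounding the two times separately can lose one step, which moves the point by order
     [2 ^- k]. *)
  have [E|E] : Num.truncn ((s + t) * 2 ^+ k) = (a + b)%N \/
      Num.truncn ((s + t) * 2 ^+ k) = (a + b).+1.
    rewrite mulrDl; have [tl|tl] := lerP (a + b).+1%:R (s * 2 ^+ k + t * 2 ^+ k).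
      right; apply: truncn_def; rewrite tl /=.
      by rewrite -[(a + b).+2%:R]nat1r -[(a + b).+1%:R]nat1r natrD; lra.
    by left; apply: truncn_def; rewrite tl andbT natrD; lra.
    by rewrite E dist_refl mulr_ge0.
  rewrite E /=; apply: sig1 => //; first exact: k0P.
  by apply: iter_sigK => //; exact: k0P.
have h2 := euler_lipschitz kk sp (eulerK t kk Kx) Kt.
have h3 : expR (L * s) * (dist (euler k t x) (F t x) + s * C * 2 ^- k) <=
    expR (L * s) * (B t * 2 ^- k + s * C * 2 ^- k).
  by rewrite ler_wpM2l ?expR_ge0 // lerD2r; exact: ht.
have h4 := hs k kk.
have := dist_tri (euler k s (euler k t x)) (euler k (s + t) x) (F s (F t x)).
by have := dist_tri (euler k s (F t x)) (euler k s (euler k t x)) (F s (F t x)); lra.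
Qed.

(** [pos] reads a point of Euclidean space off the state, and [X] its velocity. The errors
    [CX * e ^+ 2] of the single steps add up to order [e] and vanish in the limit; what stays is the
    variation of [X] along the orbit. *)
Lemma semiflow_velocity d (pos X : T -> 'rV[R]_d) (LX CX : R) : 0 <= LX -> 0 <= CX ->
  (forall x y, K x -> K y -> enorm (pos x - pos y) <= dist x y) ->
  (forall x y, K x -> K y -> enorm (X x - X y) <= LX * dist x y) ->
  (forall (e : R) x, 0 <= e -> e <= e0 -> K x ->
     enorm (pos (sig e x) - pos x - e *: X x) <= CX * e ^+ 2) ->
  forall (t : R) x, 0 <= t -> K x ->
    enorm (pos (F t x) - pos x - t *: X x) <= LX * C * t ^+ 2.
Proof.
move=> LX0 CX0 hpos hX hsig t x tp Kx; rewrite -subr_le0.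
apply: (@le0_pow2 _ (B t + CX * t + enorm (X x)) k0) => k kk.
have [Kt /(_ k kk) h1] := hF tp Kx; have ep := ltW (pow2_gt0 k); have ee := k0P kk.
set e := 2 ^- k in ep ee h1 *; set m := Num.truncn (t * 2 ^+ k).
have /andP[m1 m2] : 0 <= t - m%:R * e <= e := euler_time k tp.
have iK j : K (iter j (sig e) x) := iter_sigK j ep ee Kx.
have h2 j : enorm (pos (iter j (sig e) x) - pos x - (j%:R * e) *: X x) <=
    j%:R * e * (CX * e) + LX * C * (j%:R * e) ^+ 2.
  elim: j => [|j IH]; first by rewrite /= !mul0r scale0r subrr subr0 enorm0 expr0n mulr0 addr0.
  set z := iter j (sig e) x in IH *.
  have -> : pos (iter j.+1 (sig e) x) - pos x - (j.+1%:R * e) *: X x =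
     (pos (sig e z) - pos z - e *: X z) + (pos z - pos x - (j%:R * e) *: X x) +
     e *: (X z - X x).
    by rewrite iterS -/z -natr1; apply/rowP => i; rewrite !mxE; ring.
  apply: le_trans (ler_enormD _ _) _; rewrite enormZ (ger0_norm ep).
  have q1 := ler_enormD (pos (sig e z) - pos z - e *: X z) (pos z - pos x - (j%:R * e) *: X x).
  have q2 := hsig e z ep ee (iK j).
  have q3 : enorm (X z - X x) <= LX * (j%:R * e * C).
    apply: le_trans (hX _ _ (iK j) Kx) _; rewrite ler_wpM2l //; exact: dist_iter.
  have q4 : e * enorm (X z - X x) <= e * (LX * (j%:R * e * C)) by rewrite ler_wpM2l.
  have q5 : 0 <= LX * C * (j%:R * e) * e by rewrite !mulr_ge0.
  have q6 : 0 <= LX * C * (e * e) by rewrite !mulr_ge0.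
  rewrite -natr1; apply: le_trans (_ : _ <= CX * e ^+ 2 + (j%:R * e * (CX * e) +
     LX * C * (j%:R * e) ^+ 2) + e * (LX * (j%:R * e * C))) _; first lra.
  rewrite -subr_ge0 [X in 0 <= X](_ : _ = LX * C * (j%:R * e) * e + LX * C * (e * e)).
    by rewrite addr_ge0.
  by ring.
have h3 := h2 m.
have -> : pos (F t x) - pos x - t *: X x = (pos (F t x) - pos (iter m (sig e) x)) +
   (pos (iter m (sig e) x) - pos x - (m%:R * e) *: X x) - (t - m%:R * e) *: X x.
  by apply/rowP => i; rewrite !mxE; ring.
have h4 := hpos _ _ Kt (iK m); rewrite dist_sym in h4.
have h5 : enorm ((t - m%:R * e) *: X x) <= e * enorm (X x).
  by rewrite enormZ (ger0_norm m1) ler_wpM2r.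
have me0 : 0 <= m%:R * e by rewrite mulr_ge0.
have h6 : m%:R * e * (CX * e) <= CX * t * e.
  by rewrite mulrA ler_wpM2r // mulrC ler_wpM2l //; lra.
have h7 : LX * C * (m%:R * e) ^+ 2 <= LX * C * t ^+ 2.
  by rewrite ler_wpM2l ?mulr_ge0 // lerXn2r ?nnegrE //; lra.
set a := pos (F t x) - _ in h4 *; set b := _ - _ - _ in h3 *; set c := _ *: _ in h5 *.
have := ler_enormB (a + b) c; have := ler_enormD a b.
have h1' : dist (iter m (sig e) x) (F t x) <= B t * e by [].
by lra.
Qed.

End SemiflowProperties.
End Semiflow.

Section Flow.
Variables (sig : R -> T -> T) (L C e0 : R).
Hypotheses (L_ge0 : 0 <= L) (C_ge0 : 0 <= C) (e0_gt0 : 0 < e0).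
Hypothesis sigK : forall (e : R) x, `|e| <= e0 -> K x -> K (sig e x).
Hypothesis sigL : forall (e : R) x y, `|e| <= e0 -> K x -> K y ->
  dist (sig e x) (sig e y) <= (1 + L * `|e|) * dist x y + C * e ^+ 2.
Hypothesis sigD : forall (e f : R) x, `|e| + `|f| <= e0 -> K x ->
  dist (sig e (sig f x)) (sig (e + f) x) <= C * (`|e| + `|f|) ^+ 2.
Hypothesis sig1 : forall (e : R) x, `|e| <= e0 -> K x -> dist (sig e x) x <= C * `|e|.

Let sigN (e : R) := sig (- e).

Let k0_exists : exists k0, forall k, (k0 <= k)%N -> 2 ^- k <= e0 / 2.
Proof.
have [k0 hk] := pow2_eps (divr_gt0 e0_gt0 (ltr0n R 2)).
by exists k0 => k kk; apply: ltW; exact: hk.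
Qed.

(** Meant for a map [j] that turns forward into backward steps up to order [e ^+ 2]: the image of a
    forward polygon is then an approximate orbit of the backward steps. *)
Lemma polygon_conjugate (sg sg' : R -> T -> T) (j : T -> T) (e D : R) N x : 0 <= e -> e <= e0 ->
  0 <= D ->
  (forall (e : R) x, 0 <= e -> e <= e0 -> K x -> K (sg e x)) ->
  (forall (e : R) x, 0 <= e -> e <= e0 -> K x -> K (sg' e x)) ->
  (forall (e : R) x y, 0 <= e -> e <= e0 -> K x -> K y ->
     dist (sg' e x) (sg' e y) <= (1 + L * e) * dist x y + C * e ^+ 2) ->
  (forall x, K x -> K (j x)) ->
  (forall x, K x -> dist (j (sg e x)) (sg' e (j x)) <= D * e ^+ 2) ->
  K x -> dist (iter N (sg' e) (j x)) (j (iter N (sg e) x)) <=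
    expR (L * (N%:R * e)) * ((N%:R * e) * ((C + 2 * D) * e)).
Proof.
move=> ep ee D0 K1 K2 L2 Kj hj Kx.
have := @compare_orbits sg' L C e0 L_ge0 C_ge0 L2 e D
  (fun m => iter m (sg' e) (j x)) (fun m => j (iter m (sg e) x)) N ep ee D0.
move=> /(_ _ _ _ _ N (leqnn _)) h; apply: le_trans (h _ _ _ _) _.
- by move=> m; exact: (iter_sigK K2 m ep ee (Kj _ Kx)).
- by move=> m; apply: Kj; exact: (iter_sigK K1 m ep ee Kx).
- by move=> m _; rewrite dist_refl mulr_ge0 ?sqr_ge0.
- by move=> m _ /=; apply: hj; exact: (iter_sigK K1 m ep ee Kx).
by rewrite dist_refl add0r.
Qed.

Lemma polygon_inverse (sg sg' : R -> T -> T) (e D : R) N x : 0 <= e -> e <= e0 -> 0 <= D ->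
  (forall (e : R) x, 0 <= e -> e <= e0 -> K x -> K (sg e x)) ->
  (forall (e : R) x, 0 <= e -> e <= e0 -> K x -> K (sg' e x)) ->
  (forall (e : R) x y, 0 <= e -> e <= e0 -> K x -> K y ->
     dist (sg' e x) (sg' e y) <= (1 + L * e) * dist x y + C * e ^+ 2) ->
  (forall x, K x -> dist (sg' e (sg e x)) x <= D * e ^+ 2) ->
  K x -> dist (iter N (sg' e) (iter N (sg e) x)) x <=
    expR (L * (N%:R * e)) * ((N%:R * e) * ((C + 2 * D) * e)).
Proof.
move=> ep ee D0 K1 K2 L2 hj Kx.
(* The forward polygon read backwards, [iter (N - m)], is an approximate orbit of the reversed
   steps. *)
have := @compare_orbits sg' L C e0 L_ge0 C_ge0 L2 e D
  (fun m => iter m (sg' e) (iter N (sg e) x)) (fun m => iter (N - m) (sg e) x) N ep ee D0.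
move=> /(_ _ _ _ _ N (leqnn _)) h; rewrite subnn subn0 dist_refl add0r in h.
apply: h.
- by move=> m; exact: (iter_sigK K2 m ep ee (iter_sigK K1 N ep ee Kx)).
- by move=> m; exact: (iter_sigK K1 (N - m) ep ee Kx).
- by move=> m _; rewrite dist_refl mulr_ge0 ?sqr_ge0.
move=> m mN; rewrite dist_sym.
have -> : (N - m = (N - m.+1).+1)%N by rewrite -subSn.
by apply: hj; exact: (iter_sigK K1 (N - m.+1) ep ee Kx).
Qed.

(** Two semiflows, from the steps [sig e] and [sig (- e)], are glued at time [0]; they are inverse
    to each other because a step followed by its reverse is the identity up to order [e ^+ 2]. State
    space and distance are abstract since the result is applied both to points and to unit tangent
    vectors. *)
Theorem exists_flow : exists F : R -> T -> T,
  [/\ forall t x, K x -> K (F t x),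
      forall x, K x -> F 0 x = x,
      forall s t x, K x -> F (s + t) x = F s (F t x),
      forall t x y, K x -> K y -> dist (F t x) (F t y) <= expR (L * `|t|) * dist x y &
   [/\ forall t x, K x -> dist (F t x) x <= C * `|t|,
      forall d (pos X : T -> 'rV[R]_d) (LX CX : R), 0 <= LX -> 0 <= CX ->
        (forall x y, K x -> K y -> enorm (pos x - pos y) <= dist x y) ->
        (forall x y, K x -> K y -> enorm (X x - X y) <= LX * dist x y) ->
        (forall (e : R) x, `|e| <= e0 -> K x ->
          enorm (pos (sig e x) - pos x - e *: X x) <= CX * e ^+ 2) ->
        forall (t : R) x, K x -> enorm (pos (F t x) - pos x - t *: X x) <= LX * C * t ^+ 2 &
      forall (j : T -> T) (D : R), 0 <= D -> (forall x, K x -> K (j x)) ->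
        (forall x y, K x -> K y -> dist (j x) (j y) <= dist x y) ->
        (forall (e : R) x, `|e| <= e0 -> K x -> dist (j (sig e x)) (sig (- e) (j x)) <= D * e ^+ 2) ->
        forall (t : R) x, K x -> F (- t) (j x) = j (F t x)]].
Proof.
have [k0 hk] := k0_exists; have hk' k : (k0 <= k)%N -> 2 ^- k <= e0.
  move=> kk; apply: le_trans (hk k kk) _.
  by rewrite ler_pdivrMr ?ltr0n // ler_peMr ?ler1n // ltW.
have nn (e : R) : 0 <= e -> `|e| = e by move=> ep; rewrite ger0_norm.
have nN (e : R) : 0 <= e -> `|- e| = e by move=> ep; rewrite normrN ger0_norm.
have K1 (e : R) x : 0 <= e -> e <= e0 -> K x -> K (sig e x).
  by move=> ep ee; apply: sigK; rewrite nn.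
have K2 (e : R) x : 0 <= e -> e <= e0 -> K x -> K (sigN e x).
  by move=> ep ee; apply: sigK; rewrite nN.
have L1 (e : R) x y : 0 <= e -> e <= e0 -> K x -> K y ->
  dist (sig e x) (sig e y) <= (1 + L * e) * dist x y + C * e ^+ 2.
  by move=> ep ee Kx Ky; rewrite -{3}(nn e ep); apply: sigL => //; rewrite nn.
have L2 (e : R) x y : 0 <= e -> e <= e0 -> K x -> K y ->
  dist (sigN e x) (sigN e y) <= (1 + L * e) * dist x y + C * e ^+ 2.
  by move=> ep ee Kx Ky; rewrite -{3}(nN e ep) -sqrrN; apply: sigL => //; rewrite nN.
have D1 (e f : R) x : 0 <= e -> 0 <= f -> e + f <= e0 -> K x ->
  dist (sig e (sig f x)) (sig (e + f) x) <= C * (e + f) ^+ 2.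
  by move=> ep fp ef Kx; have := @sigD e f x; rewrite !nn //; apply.
have D2 (e f : R) x : 0 <= e -> 0 <= f -> e + f <= e0 -> K x ->
  dist (sigN e (sigN f x)) (sigN (e + f) x) <= C * (e + f) ^+ 2.
  by move=> ep fp ef Kx; have := @sigD (- e) (- f) x; rewrite !nN // -opprD; apply.
have S1 (e : R) x : 0 <= e -> e <= e0 -> K x -> dist (sig e x) x <= C * e.
  by move=> ep ee Kx; rewrite -{2}(nn e ep); apply: sig1; rewrite ?nn.
have S2 (e : R) x : 0 <= e -> e <= e0 -> K x -> dist (sigN e x) x <= C * e.
  by move=> ep ee Kx; rewrite -{2}(nN e ep); apply: sig1; rewrite ?nN.
have sig0 x : K x -> sig 0 x = x.
  move=> Kx; apply: dist_sep; have := @sig1 0 x; rewrite normr0 mulr0; apply => //.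
  exact: ltW.
have [F1 [B1 hF1]] := exists_semiflow L_ge0 C_ge0 K1 L1 D1 S1 hk'.
have [F2 [B2 hF2]] := exists_semiflow L_ge0 C_ge0 K2 L2 D2 S2 hk'.
have inv (sg sg' : R -> T -> T) F F' (B B' : R -> R) :
    (forall (e : R) x, 0 <= e -> e <= e0 -> K x -> K (sg e x)) ->
    (forall (e : R) x, 0 <= e -> e <= e0 -> K x -> K (sg' e x)) ->
    (forall (e : R) x y, 0 <= e -> e <= e0 -> K x -> K y ->
       dist (sg' e x) (sg' e y) <= (1 + L * e) * dist x y + C * e ^+ 2) ->
    (forall (e : R) x, 0 <= e -> e <= e0 / 2 -> K x -> dist (sg' e (sg e x)) x <= 4 * C * e ^+ 2) ->
    (forall (t : R) x, 0 <= t -> K x -> K (F t x) /\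
      forall k, (k0 <= k)%N -> dist (euler sg k t x) (F t x) <= B t * 2 ^- k) ->
    (forall (t : R) x, 0 <= t -> K x -> K (F' t x) /\
      forall k, (k0 <= k)%N -> dist (euler sg' k t x) (F' t x) <= B' t * 2 ^- k) ->
    forall (t : R) x, 0 <= t -> K x -> F' t (F t x) = x.
  move=> Ks Ks' Ls' hss hF hF' t x tp Kx; have [Kt ht] := hF t x tp Kx.
  apply: (@semiflow_unique sg' k0 F' B' hF' _ _ _
    (expR (L * t) * (B t + t * C) + expR (L * t) * (t * (C + 2 * (4 * C))))) => // k kk.
  have ep : (0 : R) <= 2 ^- k := ltW (pow2_gt0 k).
  have Ke : K (euler sg k t x) := eulerK Ks hk' t kk Kx.
  have q1 := euler_lipschitz L_ge0 C_ge0 Ks' Ls' hk' kk tp Kt Ke.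
  have q2 := polygon_inverse (Num.truncn (t * 2 ^+ k)) ep (hk' k kk)
    (mulr_ge0 (ler0n R 4) C_ge0) Ks Ks' Ls' (fun x => hss _ x ep (hk k kk)) Kx.
  have q3 := ht k kk; rewrite dist_sym in q3.
  have q4 : expR (L * t) * (dist (F t x) (euler sg k t x) + t * C * 2 ^- k) <=
     expR (L * t) * (B t * 2 ^- k + t * C * 2 ^- k).
    by rewrite ler_wpM2l ?expR_ge0 // lerD2r.
  have /andP[m1 m2] := euler_time k tp.
  have q5 : expR (L * ((Num.truncn (t * 2 ^+ k))%:R * 2 ^- k)) *
      ((Num.truncn (t * 2 ^+ k))%:R * 2 ^- k * ((C + 2 * (4 * C)) * 2 ^- k)) <=
      expR (L * t) * (t * ((C + 2 * (4 * C)) * 2 ^- k)).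
    have c9 : 0 <= (C + 2 * (4 * C)) * 2 ^- k by rewrite mulr_ge0 // addr_ge0 // !mulr_ge0.
    apply: ler_pM; first exact: expR_ge0.
    - exact: mulr_ge0 (mulr_ge0 (ler0n _ _) ep) c9.
    - exact: (expR_mono_time L_ge0 k tp).
    - by rewrite ler_wpM2r //; lra.
  have := dist_tri (euler sg' k t (euler sg k t x)) (euler sg' k t (F t x)) x.
  rewrite [in X in _ -> X]mulrDl.
  have q6 : dist (euler sg' k t (euler sg k t x)) x <=
     expR (L * t) * (t * ((C + 2 * (4 * C)) * 2 ^- k)) by apply: le_trans q5.
  by lra.
have inv12 : forall (t : R) x, 0 <= t -> K x -> F2 t (F1 t x) = x.
  apply: (inv sig sigN F1 F2 B1 B2) => // e x ep ee Kx.
  have := @sigD (- e) e x; rewrite normrN nn // addNr sig0 //.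
  have -> : C * (e + e) ^+ 2 = 4 * C * e ^+ 2 by ring.
  by apply => //; lra.
have inv21 : forall (t : R) x, 0 <= t -> K x -> F1 t (F2 t x) = x.
  apply: (inv sigN sig F2 F1 B2 B1) => // e x ep ee Kx.
  have := @sigD e (- e) x; rewrite normrN nn // subrr sig0 //.
  have -> : C * (e + e) ^+ 2 = 4 * C * e ^+ 2 by ring.
  by apply => //; lra.
have conj (sg sg' : R -> T -> T) F F' (B B' : R -> R) (j : T -> T) (D : R) : 0 <= D ->
    (forall x, K x -> K (j x)) -> (forall x y, K x -> K y -> dist (j x) (j y) <= dist x y) ->
    (forall (e : R) x, 0 <= e -> e <= e0 -> K x -> K (sg e x)) ->
    (forall (e : R) x, 0 <= e -> e <= e0 -> K x -> K (sg' e x)) ->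
    (forall (e : R) x y, 0 <= e -> e <= e0 -> K x -> K y ->
       dist (sg' e x) (sg' e y) <= (1 + L * e) * dist x y + C * e ^+ 2) ->
    (forall (e : R) x, 0 <= e -> e <= e0 -> K x ->
       dist (j (sg e x)) (sg' e (j x)) <= D * e ^+ 2) ->
    (forall (t : R) x, 0 <= t -> K x -> K (F t x) /\
      forall k, (k0 <= k)%N -> dist (euler sg k t x) (F t x) <= B t * 2 ^- k) ->
    (forall (t : R) x, 0 <= t -> K x -> K (F' t x) /\
      forall k, (k0 <= k)%N -> dist (euler sg' k t x) (F' t x) <= B' t * 2 ^- k) ->
    forall (t : R) x, 0 <= t -> K x -> F' t (j x) = j (F t x).
  move=> D0 Kj isoj Ks Ks' Ls' hss hF hF' t x tp Kx; have [Kt ht] := hF t x tp Kx.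
  apply: (@semiflow_unique sg' k0 F' B' hF' _ _ _
    (B t + expR (L * t) * (t * (C + 2 * D)))) => // [|k kk]; first exact: Kj.
  have ep : (0 : R) <= 2 ^- k := ltW (pow2_gt0 k).
  have Ke : K (euler sg k t x) := eulerK Ks hk' t kk Kx.
  have q2 := polygon_conjugate (Num.truncn (t * 2 ^+ k)) ep (hk' k kk)
    D0 Ks Ks' Ls' Kj (fun x => hss _ x ep (hk' k kk)) Kx.
  have /andP[m1 m2] := euler_time k tp.
  have q5 : expR (L * ((Num.truncn (t * 2 ^+ k))%:R * 2 ^- k)) *
      ((Num.truncn (t * 2 ^+ k))%:R * 2 ^- k * ((C + 2 * D) * 2 ^- k)) <=
      expR (L * t) * (t * ((C + 2 * D) * 2 ^- k)).
    have c9 : 0 <= (C + 2 * D) * 2 ^- k by rewrite mulr_ge0 // addr_ge0 // !mulr_ge0.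
    apply: ler_pM; first exact: expR_ge0.
    - exact: mulr_ge0 (mulr_ge0 (ler0n _ _) ep) c9.
    - exact: (expR_mono_time L_ge0 k tp).
    - by rewrite ler_wpM2r //; lra.
  have q3 := ht k kk; have q4 := isoj _ _ Ke Kt.
  have := dist_tri (j (euler sg k t x)) (euler sg' k t (j x)) (j (F t x)).
  rewrite [in X in _ -> X]mulrDl.
  have q6 : dist (euler sg' k t (j x)) (j (euler sg k t x)) <=
     expR (L * t) * (t * ((C + 2 * D) * 2 ^- k)) by apply: le_trans q5.
  by lra.
pose F (t : R) x := if 0 <= t then F1 t x else F2 (- t) x.
have Np (t : R) : (0 <= t) = false -> 0 <= - t by move=> /negbT; rewrite -ltNge; lra.
have KF t x : K x -> K (F t x).
  move=> Kx; rewrite /F; case: ifPn => [tp|/negbTE/Np tp]; first by have [] := hF1 t x tp Kx.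
  by have [] := hF2 _ x tp Kx.
have F10 x : K x -> F1 0 x = x by exact: semiflow0 hF1 _.
have F20 x : K x -> F2 0 x = x by exact: semiflow0 hF2 _.
have add1 s t x : 0 <= s -> 0 <= t -> K x -> F1 (s + t) x = F1 s (F1 t x).
  exact: (semiflowD L_ge0 C_ge0 K1 L1 S1 hk' hF1).
have add2 s t x : 0 <= s -> 0 <= t -> K x -> F2 (s + t) x = F2 s (F2 t x).
  exact: (semiflowD L_ge0 C_ge0 K2 L2 S2 hk' hF2).
have KF1 t x : 0 <= t -> K x -> K (F1 t x) by move=> tp Kx; have [] := hF1 t x tp Kx.
have KF2 t x : 0 <= t -> K x -> K (F2 t x) by move=> tp Kx; have [] := hF2 t x tp Kx.
exists F; split => //.
- by move=> x Kx; rewrite /F lexx F10.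
- move=> s t x Kx; rewrite /F; case: ifPn => [stp|/negbTE/Np stp];
    case: ifPn => [sp|/negbTE/Np sp]; case: ifPn => [tp|/negbTE/Np tp].
  + exact: add1.
  + rewrite -{1}(addrK t s) -addrA.
    have -> : F1 s (F2 (- t) x) = F1 (s + t) (F1 (- t) (F2 (- t) x)).
      rewrite -add1 //; first by congr (F1 _ _); lra.
      exact: KF2.
    by rewrite inv21 // addNr addr0.
  + have -> : F1 t x = F1 (- s) (F1 (s + t) x) by rewrite -add1 //; congr (F1 _ _); lra.
    by rewrite inv12 //; exact: KF1.
  (* [Np] keeps only weak inequalities, so the sign patterns that cannot occur show up as
     [s = t = 0]. *)
  + have -> : s + t = 0 by lra.
    have s0 : s = 0 by lra.
    have t0 : t = 0 by lra.
    by rewrite s0 t0 oppr0 F10 // !F20.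
  + have s0 : s = 0 by lra.
    have t0 : t = 0 by lra.
    by rewrite s0 t0 addr0 oppr0 F20 // !F10.
  + have -> : F2 (- t) x = F2 s (F2 (- (s + t)) x) by rewrite -add2 //; congr (F2 _ _); lra.
    by rewrite inv21 //; exact: KF2.
  + have -> : F2 (- s) (F1 t x) = F2 (- (s + t)) (F2 t (F1 t x)).
      rewrite -add2 //; first by congr (F2 _ _); lra.
      exact: KF1.
    by rewrite inv12.
  + by rewrite -add2 //; congr (F2 _ _); lra.
- move=> t x y Kx Ky; rewrite /F; case: ifPn => [tp|/negbTE/Np tp].
    by rewrite nn //; exact: (semiflow_lipschitz L_ge0 C_ge0 K1 L1 hk' hF1).
  by rewrite -normrN nn //; exact: (semiflow_lipschitz L_ge0 C_ge0 K2 L2 hk' hF2).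
split.
- move=> t x Kx; rewrite /F; case: ifPn => [tp|/negbTE/Np tp].
    by rewrite nn //; exact: (semiflow_dist C_ge0 K1 S1 hk' hF1).
  by rewrite -normrN nn //; exact: (semiflow_dist C_ge0 K2 S2 hk' hF2).
- move=> d pos X LX CX LX0 CX0 hpos hX hs t x Kx; rewrite /F.
  case: ifPn => [tp|/negbTE/Np tp].
    apply: (semiflow_velocity C_ge0 K1 S1 hk' hF1 LX0 CX0 hpos hX) => // e z ep ee Kz.
    by apply: hs => //; rewrite nn.
  have := @semiflow_velocity sigN C e0 C_ge0 K2 S2 k0 hk' F2 B2 hF2 d pos (fun x => - X x)
    LX CX LX0 CX0 hpos _ _ (- t) x tp Kx.
  rewrite scalerN scaleNr opprK sqrrN; apply.
    by move=> z y Kz Ky; rewrite -opprD enormN; exact: hX.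
  move=> e z ep ee Kz; rewrite scalerN -scaleNr -[e ^+ 2]sqrrN; apply: hs => //.
  by rewrite nN.
- move=> j D D0 Kj isoj hj t x Kx; rewrite /F oppr_ge0 opprK.
  have E1 : forall (t : R) x, 0 <= t -> K x -> F2 t (j x) = j (F1 t x).
    apply: (conj sig sigN F1 F2 B1 B2 j D) => // e z ep ee Kz.
    by apply: hj => //; rewrite nn.
  have E2 : forall (t : R) x, 0 <= t -> K x -> F1 t (j x) = j (F2 t x).
    apply: (conj sigN sig F2 F1 B2 B1 j D) => // e z ep ee Kz.
    rewrite -[e in X in dist _ X]opprK -sqrrN; apply: hj => //.
    by rewrite nN.
  case: (ltgtP t 0) => [tn|tp|->].
  - by rewrite E2 //; lra.
  - by rewrite E1 // ltW.
  - rewrite oppr0 F10 ?F10 //; exact: Kj.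
Qed.

End Flow.
End ApproximateFlow.

Section CurveDerivative.
Context {R : realType}.

Lemma is_derive_of_quadratic d (f v : R -> 'rV[R]_d) (B t : R) :
  (forall s, enorm (f (t + s) - f t - s *: v t) <= B * s ^+ 2) ->
  is_derive t 1 f (v t).
Proof.
move=> h; have B0 : 0 <= B.
  have := h 1; rewrite expr1n mulr1; apply: le_trans; exact: enorm_ge0.
have H : (fun s : R => s^-1 *: (((f \o shift t) (s *: 1)) - f t)) @ 0^' --> v t.
  apply/cvgrPdist_lt => e e0; near=> s.
  have s0 : s != 0 by near: s; exact: nbhs_dnbhs_neq.
  have se : `|s| < e / (B + 1).
    near: s; apply: dnbhs0_lt; rewrite divr_gt0 //; lra.
  rewrite /= [s *: 1]mulr1 [s + t]addrC; apply: le_lt_trans (ler_mx_enorm _) _; rewrite enormB.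
  have -> : s^-1 *: (f (t + s) - f t) - v t = s^-1 *: (f (t + s) - f t - s *: v t).
    by rewrite [in RHS]scalerBr scalerA mulVf // scale1r.
  rewrite enormZ normfV -(ltr_pM2l (_ : 0 < `|s|)) ?normr_gt0 //.
  rewrite mulrA mulfV ?normr_eq0 // mul1r; apply: le_lt_trans (h s) _.
  rewrite ltr_pdivlMr in se; last lra.
  have sp : 0 < `|s| by rewrite normr_gt0.
  have -> : s ^+ 2 = `|s| * `|s| by rewrite -expr2 -normrX ger0_norm // sqr_ge0.
  by nra.
by split; [apply/cvg_ex; exists (v t)|exact: cvg_lim].
Unshelve. all: by end_near. Qed.

End CurveDerivative.

(** * Orthogonal decomposition along the tangent projection and its Lipschitz dependence on the
    point *)

Lemma dotpD_orth (R : realType) d (a b : 'rV[R]_d) : dotp a b = 0 ->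
  dotp (a + b) (a + b) = dotp a a + dotp b b.
Proof. by move=> h; rewrite dotpDl !dotpDr (dotpC b a) h addr0 add0r. Qed.

Section Projection.
Context {R : realType} {n d : nat}.
Variables (M : set 'rV[R]_d) (P : 'rV[R]_d -> 'M[R]_d) (kap del C : R).
Hypothesis td : tangent_data n M P kap del C.

Lemma dotp_proj x (u v : 'rV[R]_d) : M x -> dotp (u *m P x) v = dotp u (v *m P x).
Proof. by move=> Mx; rewrite dotp_mulmxl (td_sym td). Qed.

Lemma proj_proj x (v : 'rV[R]_d) : M x -> v *m P x *m P x = v *m P x.
Proof. by move=> Mx; rewrite -mulmxA (td_idem td). Qed.

Lemma proj_normal x (v : 'rV[R]_d) : M x -> (v - v *m P x) *m P x = 0.
Proof. by move=> Mx; rewrite mulmxBl proj_proj // subrr. Qed.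

Lemma dotp_tangent_normal x (u v : 'rV[R]_d) : M x -> u *m P x = u -> v *m P x = 0 ->
  dotp u v = 0.
Proof. by move=> Mx uP vP; rewrite -uP dotp_proj // vP dotp0. Qed.

Lemma pythagoras_proj x (v : 'rV[R]_d) : M x ->
  dotp v v = dotp (v *m P x) (v *m P x) + dotp (v - v *m P x) (v - v *m P x).
Proof.
move=> Mx; have h : dotp (v *m P x) (v - v *m P x) = 0.
  by apply: (@dotp_tangent_normal x) => //; [exact: proj_proj|exact: proj_normal].
by rewrite -(dotpD_orth h) addrC subrK.
Qed.

Lemma dotp_proj_self x (v : 'rV[R]_d) : M x -> dotp v (v *m P x) = dotp (v *m P x) (v *m P x).
Proof. by move=> Mx; rewrite dotp_proj // proj_proj. Qed.

Lemma enorm_le_sqr (u v : 'rV[R]_d) : dotp u u <= dotp v v -> enorm u <= enorm v.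
Proof. by rewrite -!enorm_sqr ler_pXn2r ?nnegrE. Qed.

Lemma enorm_proj x (v : 'rV[R]_d) : M x -> enorm (v *m P x) <= enorm v.
Proof.
by move=> Mx; apply: enorm_le_sqr; rewrite [leRHS](pythagoras_proj v Mx) lerDl dotp_ge0.
Qed.

Lemma enorm_normal x (v : 'rV[R]_d) : M x -> enorm (v - v *m P x) <= enorm v.
Proof.
by move=> Mx; apply: enorm_le_sqr; rewrite [leRHS](pythagoras_proj v Mx) lerDr dotp_ge0.
Qed.

Lemma normal_part_le x y : M x -> M y -> enorm (y - x) < del ->
  enorm ((y - x) - (y - x) *m P x) <= kap / 2 * enorm (y - x) ^+ 2.
Proof.
move=> Mx My yx; set v := y - x; set nu := v - v *m P x.
have k0 : 0 <= kap / 2 by rewrite divr_ge0 // ltW // (td_kap td).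
have [->|nu0] := eqVneq nu 0; first by rewrite enorm0 mulr_ge0 // sqr_ge0.
have := td_normal td Mx My yx (proj_normal v Mx); rewrite -/v -/nu.
have -> : dotp v nu = enorm nu ^+ 2.
  have h : dotp (v *m P x) nu = 0.
    by apply: (@dotp_tangent_normal x) => //; [exact: proj_proj|exact: proj_normal].
  have vE : v = nu + v *m P x by rewrite subrK.
  by rewrite {1}vE dotpDl h addr0 enorm_sqr.
by rewrite expr2 ler_pM2r // enorm_gt0.
Qed.

(** A tangent vector at [y] is nearly a chord of [M]: move from [y] in its direction by the distance
    [r] of [x] and [y], to a point [y']. Seen from [x], both [y] and [y'] have normal parts of order
    [r ^+ 2], so a unit tangent vector at [y] has a normal part of order [r] at [x]. Symmetry of the
    projections gives the dual statement for normal vectors. *)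
Lemma proj_lipschitz : exists2 L, 0 <= L & forall x y (v : 'rV[R]_d), M x -> M y ->
  enorm (v *m P x - v *m P y) <= L * enorm (x - y) * enorm v.
Proof.
have k0 : 0 <= kap / 2 by rewrite divr_ge0 // ltW // (td_kap td).
have C0 := ltW (td_C td); have d0 := td_del td.
(* Keeps [y'], whose distance from [x] is at most [(2 + C * del) * r], within [del] of [x]. *)
pose r0 := Num.min (del / (C * del + 3)) 1.
have Cd : 0 < C * del + 3 by rewrite ltr_wpDl // mulr_ge0 // ltW.
have r00 : 0 < r0 by rewrite lt_min ltr01 divr_gt0.
have r01 : r0 <= 1 by rewrite ge_min lexx orbT.
have r0d : r0 * (C * del + 3) <= del by rewrite -ler_pdivlMr // ge_min lexx.
pose L1 := kap / 2 * (2 + C) ^+ 2 + kap / 2 + C.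
have C2 : 0 <= kap / 2 * (2 + C) ^+ 2 by rewrite mulr_ge0 // sqr_ge0.
have L10 : 0 <= L1 by rewrite /L1; lra.
have tang x y (v : 'rV[R]_d) : M x -> M y -> enorm (x - y) < r0 -> v *m P y = v ->
    enorm (v - v *m P x) <= L1 * enorm (x - y) * enorm v.
  move=> Mx My xy vP; set r := enorm (x - y) in xy *.
  have rge0 : 0 <= r := enorm_ge0 _.
  have [v0|v0] := eqVneq v 0; first by rewrite v0 mul0mx subrr enorm0 mulr0.
  have [xy0|xy0] := eqVneq (x - y) 0.
    by move/eqP: xy0; rewrite subr_eq0 => /eqP ->; rewrite vP subrr enorm0 !mulr_ge0.
  have rp : 0 < r := enorm_gt0 xy0; have vp := enorm_gt0 v0.
  have r1 : r < 1 by lra.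
  pose u := (r / enorm v) *: v.
  have un : enorm u = r by rewrite enormZ ger0_norm ?divr_ge0 // divfK // gt_eqF.
  have rd : r <= del.
    apply: ltW; apply: lt_le_trans xy _; apply: le_trans r0d.
    by rewrite ler_peMr ?ltW //; have := mulr_ge0 C0 (ltW d0); lra.
  have uP : u *m P y = u by rewrite -scalemxAl vP.
  have ud : enorm u <= del by rewrite un.
  have [y' My' hy'] := td_exp td My uP ud.
  have yx : enorm (y - x) = r by rewrite enormB.
  rewrite un in hy'.
  have yy' : enorm (y' - y) <= r + C * r ^+ 2.
    by have := ler_enormD (y' - y - u) u; rewrite subrK un; lra.
  have y'x : enorm (y' - x) <= (2 + C) * r.
    have := ler_enorm_dist y y' x; rewrite yx.
    have : C * r ^+ 2 <= C * r by rewrite ler_wpM2l // expr2 ler_piMr // ltW.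
    by lra.
  have rdel : r < del.
    apply: lt_le_trans xy _; apply: le_trans r0d; rewrite ler_peMr ?ltW //.
    by have := mulr_ge0 C0 (ltW d0); lra.
  have y'xd : enorm (y' - x) < del.
    apply: le_lt_trans (ler_enorm_dist y _ _) _; rewrite yx.
    have : C * r ^+ 2 <= C * del * r by rewrite expr2 mulrA; apply: ler_wpM2r => //; apply: ler_wpM2l => //; exact: ltW.
    move=> h; apply: le_lt_trans (_ : r * (C * del + 3) < del); first lra.
    by apply: lt_le_trans r0d; rewrite ltr_pM2r.
  have n1 := normal_part_le Mx My' y'xd.
  have n2 := normal_part_le Mx My (_ : enorm (y - x) < del).
  rewrite yx in n2; have {}n2 := n2 rdel.
  have n3 := enorm_normal (y' - y - u) Mx.
  have uN : enorm (u - u *m P x) <= L1 * r ^+ 2.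
    have -> : u - u *m P x = ((y' - x) - (y' - x) *m P x) - ((y - x) - (y - x) *m P x) -
        ((y' - y - u) - (y' - y - u) *m P x).
      by rewrite !mulmxBl; apply/rowP => i; rewrite !mxE; ring.
    apply: le_trans (ler_enormB _ _) _; rewrite /L1 [leRHS]mulrDl; apply: lerD.
      apply: le_trans (ler_enormB _ _) _; rewrite [leRHS]mulrDl; apply: lerD => //.
      apply: le_trans n1 _; rewrite -[leRHS]mulrA -exprMn ler_wpM2l //.
      by rewrite lerXn2r ?nnegrE // mulr_ge0 // addr_ge0.
    exact: le_trans n3 hy'.
  have uE : u - u *m P x = (r / enorm v) *: (v - v *m P x).
    by rewrite /u -scalemxAl -scalerBr.
  move: uN; rewrite uE enormZ ger0_norm ?divr_ge0 // expr2 mulrA.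
  rewrite mulrAC ler_pdivrMr // => uN; rewrite -(ler_pM2r rp).
  by rewrite [leLHS]mulrC; apply: le_trans uN _; rewrite mulrAC lexx.
have near x y (v : 'rV[R]_d) : M x -> M y -> enorm (x - y) < r0 ->
    enorm (v *m P x - v *m P y) <= 2 * L1 * enorm (x - y) * enorm v.
  move=> Mx My xy.
  have yx : enorm (y - x) < r0 by rewrite enormB.
  have -> : v *m P x - v *m P y = (v - v *m P y) *m P x - (v *m P y - v *m P y *m P x).
    by rewrite mulmxBl; apply/rowP => i; rewrite !mxE; ring.
  apply: le_trans (ler_enormB _ _) _.
  have h1 : enorm (v *m P y - v *m P y *m P x) <= L1 * enorm (x - y) * enorm v.
    apply: le_trans (tang x y _ Mx My xy (proj_proj v My)) _.
    by rewrite ler_wpM2l ?mulr_ge0 // enorm_proj.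
  have h2 : enorm ((v - v *m P y) *m P x) <= L1 * enorm (x - y) * enorm v.
    apply: ler_enorm_dot; first by rewrite !mulr_ge0.
    move=> w w1; rewrite dotp_proj //.
    have -> : dotp (v - v *m P y) (w *m P x) = dotp v (w *m P x - w *m P x *m P y).
      by rewrite dotpBl dotpBr [dotp (v *m _) _]dotp_proj.
    apply: le_trans (ler_dotp _ _) _; rewrite mulrC ler_wpM2r //.
    apply: le_trans (tang y x _ My Mx yx (proj_proj w Mx)) _.
    by rewrite enormB ler_piMr ?mulr_ge0 // -w1 enorm_proj.
  by lra.
(* For distant points the difference is at most [2 * enorm v], which [2 / r0] times their distance
   covers. *)
have q0 : 0 <= 2 / r0 by rewrite divr_ge0 // ltW.
have L0 : 0 <= 2 * L1 + 2 / r0 by rewrite addr_ge0 // mulr_ge0.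
exists (2 * L1 + 2 / r0) => // x y v Mx My.
have [xy|xy] := ltrP (enorm (x - y)) r0.
  apply: le_trans (near x y v Mx My xy) _; rewrite ler_wpM2r // ler_wpM2r //.
  by rewrite lerDl divr_ge0 // ltW.
apply: le_trans (ler_enormB _ _) _.
have := enorm_proj v Mx; have := enorm_proj v My.
have : 2 * enorm v <= (2 * L1 + 2 / r0) * enorm (x - y) * enorm v.
  rewrite ler_wpM2r //; apply: le_trans (_ : 2 <= (2 / r0) * enorm (x - y)) _.
    by rewrite mulrAC ler_pdivlMr // ler_pM2l.
  by rewrite ler_wpM2r // lerDr mulr_ge0.
by lra.
Qed.

End Projection.

(** * Gradient flows of squared distances *)

Section GradientFlow.
Context {R : realType} {n d : nat}.
Variables (M : set 'rV[R]_d) (P : 'rV[R]_d -> 'M[R]_d) (kap del C : R).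
Hypothesis td : tangent_data n M P kap del C.

(* Half the gradient on [M] of the squared distance to [w]. *)
Definition radial_field (w x : 'rV[R]_d) : 'rV[R]_d := (x - w) *m P x.

Record gradient_flow (w : 'rV[R]_d) (F : R -> 'rV[R]_d -> 'rV[R]_d) (Lp B : R) : Prop :=
 GradientFlow {
  gf_Lp : 0 <= Lp;
  gf_in : forall t x, M x -> M (F t x);
  gf_0 : forall x, M x -> F 0 x = x;
  gf_D : forall s t x, M x -> F (s + t) x = F s (F t x);
  gf_lip : forall t x y, M x -> M y ->
    enorm (F t x - F t y) <= expR (Lp * `|t|) * enorm (x - y);
  gf_vel : forall t x, M x -> enorm (F t x - x - t *: radial_field w x) <= B * t ^+ 2 }.

Lemma compact_complete (K : set 'rV[R]_d) (u : nat -> 'rV[R]_d) : compact K ->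
  (forall k, K (u k)) ->
  (forall e : R, 0 < e -> exists N, forall i j, (N <= i)%N -> (N <= j)%N ->
     enorm (u i - u j) < e) ->
  exists2 l, K l & forall e : R, 0 < e -> exists N, forall i, (N <= i)%N -> enorm (u i - l) < e.
Proof.
move=> cK Ku cau; have [l Kl hl] := compact_seq_cluster cK Ku.
exists l => // e e0; have e20 : 0 < e / 2 by rewrite divr_gt0.
have [N hN] := cau _ e20; exists N => i Ni.
have [m Nm hm] := hl (e / 2) N e20.
by have := hN i m Ni Nm; have := ler_enorm_dist (u m) (u i) l; lra.
Qed.

Lemma radial_field_bound w : exists2 BY, 0 < BY & forall x, M x ->
  enorm (x - w) <= BY /\ enorm (radial_field w x) <= BY.
Proof.
have [BM BM0 hBM] := compact_enorm_bounded (td_compact td).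
exists (BM + enorm w); first by have := enorm_ge0 w; lra.
move=> x Mx; have h : enorm (x - w) <= BM + enorm w.
  by apply: le_trans (ler_enormB _ _) _; rewrite lerD2r; exact: hBM.
by split => //; apply: le_trans h; exact: (enorm_proj td).
Qed.

Lemma radial_field_lipschitz w : exists2 LY, 0 <= LY & forall x y, M x -> M y ->
  enorm (radial_field w x - radial_field w y) <= LY * enorm (x - y).
Proof.
have [L L0 hL] := proj_lipschitz td; have [BY BY0 hBY] := radial_field_bound w.
exists (L * BY + 1); first by rewrite addr_ge0 // mulr_ge0 // ltW.
move=> x y Mx My.
have -> : radial_field w x - radial_field w y =
    ((x - w) *m P x - (x - w) *m P y) + (x - y) *m P y.
  by rewrite /radial_field !mulmxBl; apply/rowP => i; rewrite !mxE; ring.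
apply: le_trans (ler_enormD _ _) _; rewrite mulrDl mul1r; apply: lerD.
  apply: le_trans (hL x y _ Mx My) _; rewrite mulrAC ler_wpM2r // ler_wpM2l //.
  by have [] := hBY x Mx.
exact: (enorm_proj td).
Qed.

Lemma exists_gradient_flow w : exists F Lp B, gradient_flow w F Lp B.
Proof.
have [BY BY0 hBY] := radial_field_bound w.
have [LY LY0 hLY] := radial_field_lipschitz w.
have d0 := td_del td; have C0 := ltW (td_C td).
pose e0 := del / BY; have e00 : 0 < e0 by rewrite divr_gt0.
pose c := C * BY ^+ 2; have c0 : 0 <= c by rewrite mulr_ge0 // sqr_ge0.
have Yt x : M x -> radial_field w x *m P x = radial_field w x.
  by move=> Mx; rewrite /radial_field (proj_proj td).
(* An Euler step corrected so as to end on [M]. The correction is known only up to a quadratic error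
   and is chosen separately at each point; this is why the Lipschitz hypothesis of [exists_flow]
   carries an additive quadratic term. *)
have /choice[sg hsg] : forall ex : R * 'rV[R]_d, exists y : 'rV[R]_d,
    `|ex.1| <= e0 -> M ex.2 -> M y /\
    enorm (y - ex.2 - ex.1 *: radial_field w ex.2) <= c * ex.1 ^+ 2.
  move=> [e x] /=; have [ee|] := pselect (`|e| <= e0); last by exists x.
  have [Mx|] := pselect (M x); last by exists x.
  have [_ yb] := hBY x Mx.
  have uP : (e *: radial_field w x) *m P x = e *: radial_field w x.
    by rewrite -scalemxAl Yt.
  have un : enorm (e *: radial_field w x) <= `|e| * BY by rewrite enormZ ler_wpM2l.
  have ud : enorm (e *: radial_field w x) <= del.
    by apply: le_trans un _; rewrite -ler_pdivlMr.
  have [y My hy] := td_exp td Mx uP ud.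
  exists y => _ _; split => //; apply: le_trans hy _.
  rewrite /c -mulrA ler_wpM2l // -[X in _ * X]real_normK ?num_real // -exprMn mulrC.
  by rewrite lerXn2r ?nnegrE // mulr_ge0 // ltW.
pose sig e x := sg (e, x).
have sK (e : R) x : `|e| <= e0 -> M x -> M (sig e x).
  by move=> ee Mx; have [] := hsg (e, x) ee Mx.
have sv (e : R) x : `|e| <= e0 -> M x ->
    enorm (sig e x - x - e *: radial_field w x) <= c * e ^+ 2.
  by move=> ee Mx; have [] := hsg (e, x) ee Mx.
pose c1 := BY + c * e0; have BY0' := ltW BY0; have e00' := ltW e00.
have c10 : 0 <= c1 by rewrite addr_ge0 // mulr_ge0.
pose Cc := 2 * c + LY * c1 + c1.
have Lc : 0 <= LY * c1 by rewrite mulr_ge0.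
have Cc0 : 0 <= Cc by rewrite /Cc; lra.
have sq (e : R) : e ^+ 2 = `|e| * `|e| by rewrite -expr2 real_normK ?num_real.
have s1 (e : R) x : `|e| <= e0 -> M x -> enorm (sig e x - x) <= c1 * `|e|.
  move=> ee Mx; have := ler_enormD (sig e x - x - e *: radial_field w x) (e *: radial_field w x).
  rewrite subrK enormZ => /le_trans -> //; rewrite /c1 addrC mulrDl; apply: lerD.
    by rewrite mulrC ler_wpM2r //; have [] := hBY x Mx.
  by apply: le_trans (sv e x ee Mx) _; rewrite sq mulrA ler_wpM2r // ler_wpM2l.
have sL (e : R) x y : `|e| <= e0 -> M x -> M y ->
    enorm (sig e x - sig e y) <= (1 + LY * `|e|) * enorm (x - y) + Cc * e ^+ 2.
  move=> ee Mx My.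
  have -> : sig e x - sig e y = ((x - y) + e *: (radial_field w x - radial_field w y)) +
    ((sig e x - x - e *: radial_field w x) - (sig e y - y - e *: radial_field w y)).
    by apply/rowP => i; rewrite !mxE; ring.
  apply: le_trans (ler_enormD _ _) _; apply: lerD.
    apply: le_trans (ler_enormD _ _) _; rewrite mulrDl mul1r lerD2l enormZ.
    by rewrite mulrAC [leRHS]mulrC ler_wpM2l //; exact: hLY.
  apply: le_trans (ler_enormB _ _) _.
  apply: le_trans (lerD (sv e x ee Mx) (sv e y ee My)) _.
  by rewrite -mulrDl ler_wpM2r ?sqr_ge0 // /Cc; lra.
have sD (e f : R) x : `|e| + `|f| <= e0 -> M x ->
    enorm (sig e (sig f x) - sig (e + f) x) <= Cc * (`|e| + `|f|) ^+ 2.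
  move=> ef Mx; have ep := normr_ge0 e; have fp := normr_ge0 f.
  have ee : `|e| <= e0 by lra.
  have fe : `|f| <= e0 by lra.
  have efe : `|e + f| <= e0 by apply: le_trans (ler_normD _ _) ef.
  set z := sig f x; have Mz : M z := sK f x fe Mx.
  have -> : sig e z - sig (e + f) x = (sig e z - z - e *: radial_field w z) +
     (z - x - f *: radial_field w x) + e *: (radial_field w z - radial_field w x) -
     (sig (e + f) x - x - (e + f) *: radial_field w x).
    by apply/rowP => i; rewrite !mxE; ring.
  have h1 := sv e z ee Mz; have h2 := sv f x fe Mx; have h3 := sv (e + f) x efe Mx.
  have h4 : enorm (e *: (radial_field w z - radial_field w x)) <= `|e| * (LY * (c1 * `|f|)).
    rewrite enormZ ler_wpM2l //; apply: le_trans (hLY z x Mz Mx) _.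
    by rewrite ler_wpM2l //; exact: s1.
  apply: le_trans (ler_enormB _ _) _; apply: le_trans (lerD (ler_enormD _ _) h3) _.
  apply: le_trans (lerD (lerD (ler_enormD _ _) h4) (lexx _)) _.
  apply: le_trans (lerD (lerD (lerD h1 h2) (lexx _)) (lexx _)) _.
  have h5 : c * (e + f) ^+ 2 <= c * (`|e| + `|f|) ^+ 2.
    rewrite ler_wpM2l // -[leLHS]real_normK ?num_real // lerXn2r ?nnegrE ?addr_ge0 //.
    exact: ler_normD.
  apply: le_trans (lerD (lexx _) h5) _; rewrite (sq e) (sq f) /Cc.
  set a := `|e| in ep *; set b := `|f| in fp *.
  rewrite -subr_ge0 [X in 0 <= X](_ : _ = 2 * (c * (a * b)) + LY * c1 * (a * a + b * b + a * b)
    + c1 * (a + b) ^+ 2); last by ring.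
  by rewrite !addr_ge0 ?mulr_ge0 ?sqr_ge0 // !addr_ge0 ?mulr_ge0.
have s1' (e : R) x : `|e| <= e0 -> M x -> enorm (sig e x - x) <= Cc * `|e|.
  move=> ee Mx; apply: le_trans (s1 e x ee Mx) _; rewrite ler_wpM2r // /Cc; lra.
have q0 (x y : 'rV[R]_d) : 0 <= enorm (x - y) := enorm_ge0 _.
have q1 (x : 'rV[R]_d) : enorm (x - x) = 0 by rewrite subrr enorm0.
have q2 (y x z : 'rV[R]_d) : enorm (x - z) <= enorm (x - y) + enorm (y - z).
  exact: ler_enorm_dist.
have q3 (x y : 'rV[R]_d) : enorm (x - y) <= 0 -> x = y.
  move=> h; apply/eqP; rewrite -subr_eq0; apply/eqP; apply: enorm_eq0.
  by apply/eqP; rewrite eq_le h enorm_ge0.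
have [F [F1 F2 F3 F4 [_ F6 _]]] := @exists_flow R 'rV[R]_d (fun x y => enorm (x - y)) M
  q0 q1 enormB q2 q3 (fun u Ku => compact_complete (td_compact td) Ku)
  sig LY Cc e0 LY0 Cc0 e00 sK sL sD s1'.
exists F, LY, (LY * Cc); split => //.
move=> t x Mx; apply: (F6 d id (radial_field w) LY c) => //.
Qed.

End GradientFlow.

Section GradientFlowTheory.
Context {R : realType} {n d : nat}.
Variables (M : set 'rV[R]_d) (P : 'rV[R]_d -> 'M[R]_d) (kap del C : R).
Hypothesis td : tangent_data n M P kap del C.
Variables (w : 'rV[R]_d) (F : R -> 'rV[R]_d -> 'rV[R]_d) (Lp B : R).
Hypothesis gf : gradient_flow M P w F Lp B.

Lemma flowN t x : M x -> F (- t) (F t x) = x.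
Proof. by move=> Mx; rewrite -(gf_D gf) // addNr (gf_0 gf). Qed.

Lemma flowNr t x : M x -> F t (F (- t) x) = x.
Proof. by move=> Mx; rewrite -(gf_D gf) // subrr (gf_0 gf). Qed.

Lemma flow_is_derive x (t : R) : M x ->
  is_derive t 1 (fun s : R => F s x) (radial_field P w (F t x)).
Proof.
move=> Mx; apply: (@is_derive_of_quadratic R d (fun s => F s x)
  (fun s => radial_field P w (F s x)) B) => s /=.
rewrite [t + s]addrC (gf_D gf) //; exact: (gf_vel gf s (gf_in gf t Mx)).
Qed.

Lemma dist2_is_derive x (a : 'rV[R]_d) (t : R) : M x ->
  is_derive t 1 (fun s : R => dotp (F s x - a) (F s x - a))
    (2 * dotp (F t x - a) (radial_field P w (F t x))).
Proof.
move=> Mx; have h := is_deriveB (flow_is_derive t Mx) (is_derive_cst a t 1).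
rewrite subr0 in h.
apply: (is_derive_eq (is_derive_dotp h h)).
by rewrite dotpC -mulr2n mulr_natl.
Qed.

Lemma flow_time_econt x (t e : R) : M x -> 0 < e ->
  exists2 dl, 0 < dl & forall s : R, `|s - t| < dl -> enorm (F s x - F t x) < e.
Proof.
move=> Mx e0; have [BY BY0 hBY] := radial_field_bound td w.
have B0 : 0 <= B.
  have := gf_vel gf 1 Mx; rewrite expr1n mulr1; apply: le_trans; exact: enorm_ge0.
exists (Num.min 1 (e / (B + BY))).
  by rewrite lt_min ltr01 divr_gt0 // ltr_wpDl.
move=> s; rewrite lt_min ltr_pdivlMr; last by rewrite ltr_wpDl.
move=> /andP[s1 s2].
have Mt := gf_in gf t Mx; have [_ yb] := hBY _ Mt.
have -> : F s x = F (s - t) (F t x) by rewrite -(gf_D gf) // subrK.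
set z := F t x in Mt yb *; set r := s - t in s1 s2 *.
have := ler_enormD (F r z - z - r *: radial_field P w z) (r *: radial_field P w z).
rewrite subrK enormZ; have := gf_vel gf r Mt.
have -> : r ^+ 2 = `|r| * `|r| by rewrite -expr2 real_normK ?num_real.
have r0 := normr_ge0 r.
have : B * (`|r| * `|r|) <= B * `|r| by rewrite ler_wpM2l // ler_piMr // ltW.
have : `|r| * enorm (radial_field P w z) <= `|r| * BY by rewrite ler_wpM2l.
lra.
Qed.

Lemma radial_dotE x : M x ->
  dotp (x - w) (radial_field P w x) = dotp (radial_field P w x) (radial_field P w x).
Proof. by move=> Mx; rewrite /radial_field (dotp_proj_self td). Qed.

Lemma dist2_nondecreasing x (s t : R) : M x -> s <= t ->
  dotp (F s x - w) (F s x - w) <= dotp (F t x - w) (F t x - w).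
Proof.
move=> Mx; rewrite le_eqVlt => /orP[/eqP -> //|st].
have [c _ E] := @mean_value R (fun s => dotp (F s x - w) (F s x - w)) _ s t st
  (fun u _ => dist2_is_derive w u Mx).
rewrite -subr_ge0 E mulr_ge0 ?subr_ge0 ?(ltW st) //.
by rewrite radial_dotE ?mulr_ge0 ?dotp_ge0 //; exact: (gf_in gf).
Qed.

(** In a time [tau] the point [x] moves by order [tau ^+ 2]. Composing [2 ^ k] such motions, each
    transported by a map with bounded Lipschitz constant, gives a displacement of order [2 ^- k]. *)
Lemma critical_fixed x (t : R) : M x -> radial_field P w x = 0 -> F t x = x.
Proof.
move=> Mx x0.
apply/eqP; rewrite -subr_eq0; apply/eqP; apply: enorm_eq0.
apply/eqP; rewrite eq_le enorm_ge0 andbT.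
pose E := expR (Lp * `|t|).
apply: (@le0_pow2 R _ (E * (B * t ^+ 2)) 0%N) => k _.
have p0 : (0 : R) < 2 ^- k by rewrite invr_gt0 exprn_gt0.
pose tau := t * 2 ^- k.
have h1 : enorm (F tau x - x) <= B * tau ^+ 2.
  by have := gf_vel gf tau Mx; rewrite x0 scaler0 subr0.
have h j : (j <= 2 ^ k)%N -> enorm (F (j%:R * tau) x - x) <= j%:R * (E * (B * tau ^+ 2)).
  elim: j => [_|j IH jN]; first by rewrite !mul0r (gf_0 gf) // subrr enorm0.
  rewrite -natr1 !mulrDl !mul1r (gf_D gf) //.
  apply: le_trans (ler_enorm_dist (F (j%:R * tau) x) _ _) _; rewrite addrC.
  apply: lerD; first by apply: IH; exact: ltnW.
  apply: le_trans (gf_lip gf _ (gf_in gf _ Mx) Mx) _.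
  apply: ler_pM; rewrite ?expR_ge0 // ler_expR ler_wpM2l ?(gf_Lp gf) //.
  rewrite /tau mulrCA normrM ler_piMr // (ger0_norm (mulr_ge0 (ler0n _ _) (ltW p0))).
  by rewrite ler_pdivrMr ?exprn_gt0 // mul1r -natrX ler_nat ltnW.
have := h (2 ^ k)%N (leqnn _); rewrite natrX.
have -> : 2 ^+ k * tau = t by rewrite /tau mulrCA mulfV ?mulr1 // expf_neq0.
move=> /le_trans -> //.
rewrite /tau exprMn le_eqVlt; apply/orP; left; apply/eqP.
have q : (2 : R) ^+ k != 0 by rewrite expf_neq0.
by field.
Qed.

End GradientFlowTheory.

(** Stands in for a nonnegative derivative when the function need not be differentiable: losses
    quadratic in the step disappear under subdivision. *)
Lemma subdivide_ge (R : realType) (g : R -> R) (K s0 t : R) : 0 < s0 -> 0 <= t ->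
  (forall u s : R, 0 <= u -> 0 <= s -> s <= s0 -> g u - K * s ^+ 2 <= g (u + s)) ->
  g 0 <= g t.
Proof.
move=> s00 t0 h; rewrite -subr_le0.
have [t00|tn0] := eqVneq t 0; first by rewrite t00 subrr.
have tp : 0 < t by rewrite lt_neqAle eq_sym tn0.
have [N hN] := pow2_eps (divr_gt0 s00 tp).
apply: (@le0_pow2 R _ (K * t ^+ 2) N) => k Nk.
have p0 : (0 : R) < 2 ^- k by rewrite invr_gt0 exprn_gt0.
pose tau := t * 2 ^- k.
have tau0 : 0 <= tau by rewrite mulr_ge0 // ltW.
have taus : tau <= s0 by rewrite /tau mulrC -ler_pdivlMr // ltW // hN.
have hj j : g 0 - j%:R * (K * tau ^+ 2) <= g (j%:R * tau).
  elim: j => [|j IH]; first by rewrite !mul0r subr0.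
  have := h (j%:R * tau) tau (mulr_ge0 (ler0n _ _) tau0) tau0 taus.
  by rewrite -natr1 !mulrDl !mul1r; lra.
have := hj (2 ^ k)%N; rewrite natrX.
have -> : 2 ^+ k * tau = t by rewrite /tau mulrCA mulfV ?mulr1 // expf_neq0.
have -> : 2 ^+ k * (K * tau ^+ 2) = K * t ^+ 2 * 2 ^- k.
  have q : (2 : R) ^+ k != 0 by rewrite expf_neq0.
  by rewrite /tau; field.
lra.
Qed.

(** * Monotone quantities along gradient flows and limits of orbits *)

Section GradientFlowTheory2.
Context {R : realType} {n d : nat}.
Variables (M : set 'rV[R]_d) (P : 'rV[R]_d -> 'M[R]_d) (kap del C : R).
Hypothesis td : tangent_data n M P kap del C.

Definition normal_dist (w x : 'rV[R]_d) : R := enorm ((x - w) - radial_field P w x).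

(* [bow w x >= 0] says that [w] lies outside of all open balls of radius [1 / kap]
   tangent to [M] at [x]. *)
Definition bow (w x : 'rV[R]_d) : R :=
  dotp (x - w) (x - w) - 2 / kap * normal_dist w x.

Lemma normal_dist_lipschitz w : exists2 L, 0 <= L & forall x y, M x -> M y ->
  `|normal_dist w x - normal_dist w y| <= L * enorm (x - y).
Proof.
have [LY LY0 hLY] := radial_field_lipschitz td w.
exists (1 + LY); first by rewrite addr_ge0.
move=> x y Mx My; apply: le_trans (ler_enorm_sub _ _) _.
have -> : x - w - radial_field P w x - (y - w - radial_field P w y) =
  (x - y) - (radial_field P w x - radial_field P w y).
  by apply/rowP => i; rewrite !mxE; ring.
by apply: le_trans (ler_enormB _ _) _; rewrite mulrDl mul1r lerD2l; exact: hLY.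
Qed.

Lemma dist2_lipschitz w : exists2 L, 0 <= L & forall x y, M x -> M y ->
  `|dotp (x - w) (x - w) - dotp (y - w) (y - w)| <= L * enorm (x - y).
Proof.
have [BY BY0 hBY] := radial_field_bound td w.
exists (2 * BY); first by rewrite mulr_ge0 // ltW.
move=> x y Mx My.
have -> : dotp (x - w) (x - w) - dotp (y - w) (y - w) = dotp ((x - w) + (y - w)) (x - y).
  by rewrite !dotpE (dotpC y x) (dotpC w x) (dotpC w y); ring.
apply: le_trans (ler_abs_dotp _ _) _; rewrite ler_wpM2r //.
have [xb _] := hBY x Mx; have [yb _] := hBY y My.
by apply: le_trans (ler_enormD _ _) _; lra.
Qed.

Lemma bow_lipschitz w : exists2 L, 0 <= L & forall x y, M x -> M y ->
  `|bow w x - bow w y| <= L * enorm (x - y).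
Proof.
have [L1 L10 h1] := normal_dist_lipschitz w; have [L2 L20 h2] := dist2_lipschitz w.
have k0 : 0 <= 2 / kap by rewrite divr_ge0 // ltW // (td_kap td).
exists (L2 + 2 / kap * L1); first by rewrite addr_ge0 // mulr_ge0.
move=> x y Mx My.
have -> : bow w x - bow w y = (dotp (x - w) (x - w) - dotp (y - w) (y - w)) -
   2 / kap * (normal_dist w x - normal_dist w y) by rewrite /bow; ring.
apply: le_trans (ler_normB _ _) _; rewrite [leRHS]mulrDl; apply: lerD; first exact: h2.
by rewrite normrM ger0_norm // -[leRHS]mulrA ler_wpM2l // h1.
Qed.

Lemma pythagoras_field w x : M x ->
  dotp (x - w) (x - w) = dotp (radial_field P w x) (radial_field P w x) + normal_dist w x ^+ 2.
Proof. by move=> Mx; rewrite /normal_dist enorm_sqr; exact: (pythagoras_proj td). Qed.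

Lemma critical_normal_dist w x : radial_field P w x = 0 -> normal_dist w x = enorm (x - w).
Proof. by move=> h; rewrite /normal_dist h subr0. Qed.

(** This is the bound of [td_normal] for the normal vector [w - q]: at a critical point nearer to
    [w] than the radius [1 / kap], the squared distance to [w] grows quadratically. *)
Lemma strict_local_min w q y : M q -> M y -> radial_field P w q = 0 -> enorm (y - q) < del ->
  dotp (q - w) (q - w) + (1 - kap * enorm (q - w)) * enorm (y - q) ^+ 2 <=
  dotp (y - w) (y - w).
Proof.
move=> Mq My q0 yq.
have nu0 : (- (q - w)) *m P q = 0 by rewrite mulNmx; move: q0; rewrite /radial_field => ->; rewrite oppr0.
have := td_normal td Mq My yq nu0; rewrite enormN dotpNr.
have -> : dotp (y - w) (y - w) = dotp (q - w) (q - w) + 2 * dotp (y - q) (q - w) +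
    enorm (y - q) ^+ 2.
  by rewrite enorm_sqr !dotpE (dotpC w q) (dotpC q y) (dotpC w y); ring.
lra.
Qed.

Variables (w : 'rV[R]_d) (F : R -> 'rV[R]_d -> 'rV[R]_d) (Lp B : R).
Hypothesis gf : gradient_flow M P w F Lp B.

Local Notation A := (radial_field P w).

Lemma vel_bound_ge0 x : M x -> 0 <= B.
Proof.
move=> Mx; have := gf_vel gf 1 Mx; rewrite expr1n mulr1; apply: le_trans; exact: enorm_ge0.
Qed.

(** The normal direction at [y = F s x] is compared with [x] without differentiating the projection.
    A unit normal [nu] at [y] is tested against the chord from [x] to [y], and the curvature bound
    is applied at both ends: to [nu] at [y], and to the normal part of the chord at [x]. Each end
    contributes [kap / 2 * |y - x|^2]; together and divided by [s] they give the term
    [kap * s * dotp (A x) (A x)]. *)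
Lemma normal_dist_step : exists K, exists2 s0, 0 < s0 & forall x s, M x -> 0 <= s -> s <= s0 ->
  normal_dist w (F s x) <= normal_dist w x + kap * s * dotp (A x) (A x) + K * s ^+ 2.
Proof.
have [BY BY0 hBY] := radial_field_bound td w.
have [L L0 hL] := proj_lipschitz td.
have kap0 := td_kap td; have d0 := td_del td.
have [[x0 Mx0]|M0] := pselect (M !=set0); last first.
  by exists 0, 1 => // x s Mx; case: M0; exists x.
have B0 := vel_bound_ge0 Mx0.
pose c1 := BY + B; have c10 : 0 < c1 by rewrite /c1; lra.
pose K := kap / 2 * c1 ^+ 2 + kap * (2 * B * BY + B ^+ 2) + L * c1 * B.
have K0 : 0 <= K.
  have k1 : 0 <= kap / 2 * c1 ^+ 2 by rewrite mulr_ge0 ?sqr_ge0 // divr_ge0 // ltW.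
  have k2 : 0 <= kap * (2 * B * BY + B ^+ 2).
    apply: mulr_ge0; first exact: ltW.
    by rewrite addr_ge0 ?sqr_ge0 // !mulr_ge0 // ltW.
  have k3 : 0 <= L * c1 * B by rewrite !mulr_ge0 // ltW.
  by rewrite /K; lra.
exists K, (Num.min 1 (del / (c1 + 1))).
  by rewrite lt_min ltr01 divr_gt0 //; lra.
move=> x s Mx s0; rewrite le_min ler_pdivlMr; last lra.
move=> /andP[s1 sd]; set y := F s x; have My : M y := gf_in gf s Mx.
have [_ Ab] := hBY x Mx.
set a := enorm (A x) in Ab; have a0 : 0 <= a := enorm_ge0 _.
have aE : dotp (A x) (A x) = a ^+ 2 by rewrite enorm_sqr.
rewrite aE.
have [sE|sn0] := eqVneq s 0.
  by rewrite /y sE (gf_0 gf) // expr0n !(mulr0, mul0r) !addr0.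
have sp : 0 < s by rewrite lt_neqAle eq_sym sn0.
have v := gf_vel gf s Mx; rewrite -/y in v.
set e := y - x - s *: A x in v.
have yx : enorm (y - x) <= s * a + B * s ^+ 2.
  have := ler_enormD e (s *: A x); rewrite subrK enormZ (ger0_norm s0) -/a; lra.
have yx2 : enorm (y - x) <= c1 * s.
  apply: le_trans yx _; rewrite /c1 mulrDl; apply: lerD; first by rewrite mulrC ler_wpM2r.
  by rewrite ler_wpM2l // expr2 ler_piMr.
have yxd : enorm (y - x) < del.
  apply: le_lt_trans yx2 _; apply: lt_le_trans sd; rewrite mulrC ltr_pM2l //; lra.
have xyd : enorm (x - y) < del by rewrite enormB.
have yxn := enorm_ge0 (y - x).
have R0 : 0 <= normal_dist w x + kap * s * a ^+ 2 + K * s ^+ 2.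
  by rewrite !addr_ge0 ?enorm_ge0 // mulr_ge0 ?sqr_ge0 // mulr_ge0 // ltW.
set u := (y - w) - A y; have uE : normal_dist w y = enorm u by [].
have [u0|u0] := eqVneq u 0; first by rewrite uE u0 enorm0.
have up := enorm_gt0 u0.
pose nu := (enorm u)^-1 *: u; have nu1 : enorm nu = 1 := unit_vector u0.
have nuP : nu *m P y = 0 by rewrite -scalemxAl (proj_normal td) // scaler0.
have nyE : normal_dist w y = dotp (y - w) nu.
  have h : dotp (A y) nu = 0.
    by apply: (dotp_tangent_normal td My) => //; rewrite /radial_field (proj_proj td).
  have -> : y - w = u + A y by rewrite subrK.
  rewrite dotpDl h addr0 dotpZr -enorm_sqr expr2 mulKf // gt_eqF //.
rewrite nyE; have -> : y - w = (y - x) + (x - w) by rewrite addrA subrK.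
rewrite dotpDl.
have t1 : dotp (y - x) nu <= kap / 2 * enorm (y - x) ^+ 2.
  have nuP' : (- nu) *m P y = 0 by rewrite mulNmx nuP oppr0.
  have := td_normal td My Mx xyd nuP'; rewrite enormN nu1 mulr1 dotpNr -dotpNl opprB.
  by rewrite enormB.
have t1' : kap / 2 * enorm (y - x) ^+ 2 <= kap / 2 * c1 ^+ 2 * s ^+ 2.
  rewrite -[leRHS]mulrA -exprMn ler_wpM2l //; first by rewrite divr_ge0 // ltW.
  by rewrite lerXn2r ?nnegrE // mulr_ge0 // ltW.
have t2 : dotp (x - w) nu <= normal_dist w x + dotp (A x) nu.
  have -> : x - w = ((x - w) - A x) + A x by rewrite subrK.
  rewrite dotpDl lerD2r; apply: le_trans (ler_dotp _ _) _.
  by rewrite nu1 mulr1.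
have AP : A x *m P x = A x by rewrite /radial_field (proj_proj td).
(* The chord is [s *: A x + e]. The normal part of [e] at [x] is that of the chord, and its
   tangential part pairs with [nu] only to order [s ^+ 3], since [nu] is normal at the nearby point
   [y]. *)
have t3 : s * dotp (A x) nu <= s * (kap * s * a ^+ 2 + (kap * (2 * B * BY + B ^+ 2) + L * c1 * B) * s ^+ 2).
  have -> : s * dotp (A x) nu = dotp (y - x) nu - dotp (e - e *m P x) nu - dotp (e *m P x) nu.
    by rewrite -!dotpBl /e -dotpZl; congr dotp; apply/rowP => i; rewrite !mxE; ring.
  have eN : e - e *m P x = (y - x) - (y - x) *m P x.
    rewrite /e mulmxBl -scalemxAl AP; apply/rowP => i; rewrite !mxE; ring.
  have b1 : - dotp (e - e *m P x) nu <= kap / 2 * enorm (y - x) ^+ 2.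
    rewrite eN -dotpNl; apply: le_trans (ler_dotp _ _) _.
    by rewrite nu1 mulr1 enormN; exact: (normal_part_le td).
  have b2 : - dotp (e *m P x) nu <= L * c1 * B * s ^+ 3.
    have -> : dotp (e *m P x) nu = dotp (e *m P x *m P x - e *m P x *m P y) nu.
      rewrite (proj_proj td) // [in RHS]dotpBl [dotp (e *m P x *m P y) nu](dotp_proj td) //.
      by rewrite nuP dotp0 subr0.
    rewrite -dotpNl; apply: le_trans (ler_dotp _ _) _; rewrite nu1 mulr1 enormN.
    apply: le_trans (hL x y _ Mx My) _; rewrite enormB.
    have -> : L * c1 * B * s ^+ 3 = (L * (c1 * s)) * (B * s ^+ 2) by ring.
    apply: ler_pM; rewrite ?mulr_ge0 //; first by rewrite ler_wpM2l.
    exact: le_trans (enorm_proj td _ Mx) v.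
  have b3 : enorm (y - x) ^+ 2 <= s ^+ 2 * a ^+ 2 + (2 * B * BY + B ^+ 2) * s ^+ 3.
    apply: le_trans (_ : (s * a + B * s ^+ 2) ^+ 2 <= _).
      by rewrite lerXn2r ?nnegrE //; apply: le_trans yx.
    rewrite -subr_ge0 [X in 0 <= X](_ : _ = 2 * B * s ^+ 3 * (BY - a) + B ^+ 2 * s ^+ 3 * (1 - s)); last by ring.
    have s3 : 0 <= s ^+ 3 by rewrite exprn_ge0.
    by rewrite addr_ge0 // mulr_ge0 ?subr_ge0 ?mulr_ge0 ?sqr_ge0.
  have b4 : kap * enorm (y - x) ^+ 2 <= kap * (s ^+ 2 * a ^+ 2 + (2 * B * BY + B ^+ 2) * s ^+ 3).
    by rewrite ler_wpM2l // ltW.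
  have -> : s * (kap * s * a ^+ 2 + (kap * (2 * B * BY + B ^+ 2) + L * c1 * B) * s ^+ 2) =
     kap * (s ^+ 2 * a ^+ 2 + (2 * B * BY + B ^+ 2) * s ^+ 3) + L * c1 * B * s ^+ 3 by ring.
  move: t1 b1 b2 b4; set T1 := dotp (y - x) nu; set T2 := dotp (e - _) nu.
  set T3 := dotp (e *m _) nu; set Y2 := enorm (y - x) ^+ 2.
  set Z1 := kap * (_ + _); set Z2 := L * c1 * B * s ^+ 3.
  clear -kap0 => t1 b1 b2 b4; lra.
rewrite ler_pM2l // in t3.
rewrite /K; move: t1 t1' t2 t3; set T1 := dotp (y - x) nu; set T2 := dotp (x - w) nu.
set T3 := dotp (A x) nu; set Y2 := enorm (y - x) ^+ 2.
set Z1 := kap / 2 * c1 ^+ 2 * s ^+ 2; set Z2 := kap * s * a ^+ 2.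
set Z3 := kap * (2 * B * BY + B ^+ 2) + L * c1 * B; set Z4 := kap / 2 * Y2.
have -> : (kap / 2 * c1 ^+ 2 + kap * (2 * B * BY + B ^+ 2) + L * c1 * B) * s ^+ 2 =
  Z1 + Z3 * s ^+ 2 by rewrite /Z1 /Z3; ring.
by clearbody Z1 Z2 Z3 Z4 T1 T2 T3; clear => t1 t1' t2 t3; lra.
Qed.

(** In a step [s] the squared distance gains [2 * s * dotp (A x) (A x)], and [2 / kap] times the
    normal length gains at most as much by [normal_dist_step]. The linear terms cancel;
    [subdivide_ge] disposes of the quadratic ones. *)
Lemma bow_nondecreasing x t : M x -> 0 <= t -> bow w x <= bow w (F t x).
Proof.
move=> Mx t0.
have [K [s0 s00 hK]] := normal_dist_step.
have [BY BY0 hBY] := radial_field_bound td w.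
have kap0 := td_kap td; have B0 := vel_bound_ge0 Mx.
have := @subdivide_ge R (fun u => bow w (F u x)) (2 * BY * B + 2 / kap * K) s0 t s00 t0.
rewrite (gf_0 gf) //; apply => u s u0 sp ss.
have Mu := gf_in gf u Mx; rewrite [u + s]addrC (gf_D gf) //.
set z := F u x in Mu *; have h1 := hK z s Mu sp ss.
set y := F s z in h1 *.
have v := gf_vel gf s Mu; rewrite -/y in v.
set e := y - z - s *: A z in v.
have [zb Ab] := hBY z Mu.
have h2 : dotp (z - w) (z - w) + 2 * (s * dotp (A z) (A z)) - 2 * BY * B * s ^+ 2 <=
    dotp (y - w) (y - w).
  have yE : y - w = (z - w) + (s *: A z + e).
    by rewrite /e; apply/rowP => i; rewrite !mxE; ring.
  have -> : dotp (y - w) (y - w) = dotp (z - w) (z - w) + 2 * (s * dotp (z - w) (A z)) +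
     2 * dotp (z - w) e + dotp (s *: A z + e) (s *: A z + e).
    rewrite yE; set p := z - w; set q := A z; clearbody p q e.
    by rewrite !dotpE (dotpC q p) (dotpC e p); ring.
  have h := dotp_ge0 (s *: A z + e).
  have := ler_abs_dotp (z - w) e; rewrite ler_norml => /andP[h3 _].
  have h4 : enorm (z - w) * enorm e <= BY * (B * s ^+ 2) by apply: ler_pM.
  rewrite (radial_dotE td) //; move: h h3 h4; set p := dotp (s *: A z + e) _; set q := dotp (z - w) e.
  by clear => *; lra.
have h5 : 2 / kap * normal_dist w y <= 2 / kap * normal_dist w z + 2 * (s * dotp (A z) (A z)) +
   2 / kap * K * s ^+ 2.
  have -> : 2 / kap * normal_dist w z + 2 * (s * dotp (A z) (A z)) + 2 / kap * K * s ^+ 2 =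
    2 / kap * (normal_dist w z + kap * s * dotp (A z) (A z) + K * s ^+ 2).
    by field; rewrite gt_eqF.
  by rewrite ler_wpM2l // divr_ge0 // ltW.
rewrite /bow; move: h2 h5; clear => *; lra.
Qed.

(** A bounded monotone quantity cannot gain a fixed amount at arbitrarily late times; this is what
    forces limit points of orbits to be critical. *)
Lemma orbit_escape (s0 a : R) (G : R -> R) : 0 < a ->
  (exists b, forall t, G t <= b) -> (forall s t, s <= t -> G s <= G t) ->
  (forall T, exists2 t, T <= t & G t + a <= G (t + s0)) -> False.
Proof.
move=> a0 [b hb] mono h.
have hs : has_sup (range G).
  by split; [exists (G 0), 0|exists b => _ [t _ <-]; exact: hb].
have [_ [T _ <-] hT] := sup_adherent a0 hs.
have [t Tt ht] := h T.
have := mono _ _ Tt; have : G (t + s0) <= sup (range G).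
  by apply: sup_upper_bound => //; exists (t + s0).
by lra.
Qed.

Lemma noncritical_gain y : M y -> A y != 0 -> exists2 s0, 0 < s0 & exists2 a, 0 < a &
  exists2 e, 0 < e & forall x, M x -> enorm (x - y) < e ->
   dotp (x - w) (x - w) + a <= dotp (F s0 x - w) (F s0 x - w).
Proof.
move=> My Ay; have B0 := vel_bound_ge0 My.
have [BY BY0 hBY] := radial_field_bound td w; have [yb _] := hBY y My.
set b := dotp (A y) (A y); have b0 : 0 < b by rewrite /b -enorm_sqr exprn_gt0 // enorm_gt0.
(* So small that the quadratic error takes away at most half of the linear gain [2 * s0 * b]. *)
pose s0 := b / (2 * BY * B + 1).
have q0 : 0 < 2 * BY * B + 1 by rewrite ltr_wpDl // !mulr_ge0 // ltW.
have s00 : 0 < s0 by rewrite divr_gt0.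
have gain : dotp (y - w) (y - w) + s0 * b <= dotp (F s0 y - w) (F s0 y - w).
  have v := gf_vel gf s0 My; set e := _ - _ - _ in v.
  have yE : F s0 y - w = (y - w) + (s0 *: A y + e).
    by rewrite /e; apply/rowP => i; rewrite !mxE; ring.
  have -> : dotp (F s0 y - w) (F s0 y - w) = dotp (y - w) (y - w) +
     2 * (s0 * dotp (y - w) (A y)) +
     2 * dotp (y - w) e + dotp (s0 *: A y + e) (s0 *: A y + e).
    rewrite yE; set p := y - w; set q := A y; clearbody p q e.
    by rewrite !dotpE (dotpC q p) (dotpC e p); ring.
  have h := dotp_ge0 (s0 *: A y + e).
  have := ler_abs_dotp (y - w) e; rewrite ler_norml => /andP[h3 _].
  have h4 : enorm (y - w) * enorm e <= BY * (B * s0 ^+ 2) by apply: ler_pM.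
  have h5 : 2 * BY * B * s0 ^+ 2 <= s0 * b.
    have e1 : 2 * BY * B * s0 <= b.
      by rewrite /s0 mulrA ler_pdivrMr // mulrC ler_wpM2l ?(ltW b0) //; lra.
    by rewrite expr2 mulrA mulrC ler_wpM2l // ltW.
  rewrite (radial_dotE td) // -/b; move: h h3 h4 h5; set p := dotp (s0 *: A y + e) _; set q := dotp (y - w) e.
  by clear => *; lra.
have [L L0 hL] := dist2_lipschitz w.
exists s0 => //; exists (s0 * b / 2); first by rewrite divr_gt0 // mulr_gt0.
pose E := expR (Lp * `|s0|).
have E0 : 0 < E := expR_gt0 _.
have Q0 : 0 < 2 * L * (1 + E) + 1 by rewrite ltr_wpDl // mulr_ge0 // ?mulr_ge0 // addr_ge0 // ltW.
exists (s0 * b / (2 * L * (1 + E) + 1)); first by rewrite !divr_gt0 // mulr_gt0.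
move=> x Mx; rewrite ltr_pdivlMr // => xy.
have := hL x y Mx My; rewrite ler_norml => /andP[_ h1].
have := hL _ _ (gf_in gf s0 Mx) (gf_in gf s0 My); rewrite ler_norml => /andP[h2 _].
have h3 : L * enorm (F s0 x - F s0 y) <= L * (E * enorm (x - y)).
  by rewrite ler_wpM2l //; exact: (gf_lip gf).
have xyn := enorm_ge0 (x - y).
move: gain h1 h2 h3 xy xyn; set X := dotp (x - w) _; set Y := dotp (y - w) _.
set X' := dotp (F s0 x - w) _; set Y' := dotp (F s0 y - w) _; set D := enorm (x - y).
by clear => *; lra.
Qed.

Lemma omega_limit_pos x : M x -> exists2 y, M y /\ A y = 0 &
  forall e T : R, 0 < e -> exists2 t, T <= t & enorm (F t x - y) < e.
Proof.
move=> Mx; have [y My hy] := compact_seq_cluster (td_compact td)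
  (fun m : nat => gf_in gf m%:R Mx).
have hy' e T : 0 < e -> exists2 t : R, T <= t & enorm (F t x - y) < e.
  move=> e0; have [m Nm hm] := hy e (Num.truncn T).+1 e0; exists m%:R => //.
  by apply: ltW; apply: lt_le_trans (truncnS_gt T) _; rewrite ler_nat.
exists y => //; split=> //; apply: contrapT => /eqP Ay.
have [s0 s00 [a a0 [e e0 he]]] := noncritical_gain My Ay.
have [BY BY0 hBY] := radial_field_bound td w.
apply: (@orbit_escape s0 a (fun t => dotp (F t x - w) (F t x - w)) a0).
- exists (BY * BY) => t; have [h _] := hBY _ (gf_in gf t Mx).
  by rewrite -enorm_sqr expr2; apply: ler_pM.
- by move=> s t st; exact: (dist2_nondecreasing td gf).
move=> T; have [t Tt ht] := hy' e T e0; exists t => //.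
by rewrite [t + s0]addrC (gf_D gf) //; apply: he => //; exact: (gf_in gf).
Qed.

Lemma omega_limit_neg x : M x -> exists2 y, M y /\ A y = 0 &
  forall e T : R, 0 < e -> exists2 t, T <= t & enorm (F (- t) x - y) < e.
Proof.
move=> Mx; have [y My hy] := compact_seq_cluster (td_compact td)
  (fun m : nat => gf_in gf (- m%:R) Mx).
have hy' e T : 0 < e -> exists2 t : R, T <= t & enorm (F (- t) x - y) < e.
  move=> e0; have [m Nm hm] := hy e (Num.truncn T).+1 e0; exists m%:R => //.
  by apply: ltW; apply: lt_le_trans (truncnS_gt T) _; rewrite ler_nat.
exists y => //; split=> //; apply: contrapT => /eqP Ay.
have [s0 s00 [a a0 [e e0 he]]] := noncritical_gain My Ay.
apply: (@orbit_escape s0 a (fun t => - dotp (F (- t) x - w) (F (- t) x - w)) a0).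
- by exists 0 => t; rewrite oppr_le0 dotp_ge0.
- by move=> s t st; rewrite lerN2; apply: (dist2_nondecreasing td gf) => //; rewrite lerN2.
move=> T; have [t Tt ht] := hy' e (T + s0) e0; exists (t - s0); first lra.
have -> : - (t - s0) = s0 + - t by rewrite opprB.
rewrite subrK (gf_D gf) //.
have := he (F (- t) x) (gf_in gf _ Mx) ht.
set X := dotp _ _; set Y := dotp _ _ ; lra.
Qed.

End GradientFlowTheory2.

Section FlowLimits.
Context {R : realType} {n d : nat}.
Variables (M : set 'rV[R]_d) (P : 'rV[R]_d -> 'M[R]_d) (kap del C : R).
Hypothesis td : tangent_data n M P kap del C.

Definition lipschitz_fun (g : 'rV[R]_d -> R) := exists2 L, 0 <= L & forall x y, M x -> M y ->
  `|g x - g y| <= L * enorm (x - y).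

Lemma lipschitz_limit_ge (g : 'rV[R]_d -> R) (y : 'rV[R]_d) (a : R) : lipschitz_fun g -> M y ->
  (forall e : R, 0 < e -> exists2 x, M x /\ a <= g x & enorm (x - y) < e) -> a <= g y.
Proof.
move=> [L L0 hL] My h.
rewrite leNgt; apply/negP => lt.
have e0 : 0 < (a - g y) / (L + 1) by rewrite divr_gt0 //; lra.
have [x [Mx ax]] := h _ e0; rewrite ltr_pdivlMr; last lra.
have := hL x y Mx My; rewrite ler_norml => /andP[_ h1].
have := enorm_ge0 (x - y); lra.
Qed.

Lemma lipschitz_limit_le (g : 'rV[R]_d -> R) (y : 'rV[R]_d) (a : R) : lipschitz_fun g -> M y ->
  (forall e : R, 0 < e -> exists2 x, M x /\ g x <= a & enorm (x - y) < e) -> g y <= a.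
Proof.
move=> [L L0 hL] My h; rewrite -lerN2.
apply: (@lipschitz_limit_ge (fun x => - g x)) => //.
  by exists L => // u v Mu Mv; rewrite -opprD normrN; exact: hL.
by move=> e e0; have [x [Mx xa] xy] := h e e0; exists x => //; rewrite lerN2.
Qed.

(** Adding the strict minimum inequalities at [q] and at [y] leaves no room for a positive
    distance. *)
Lemma critical_near_unique w q y : M q -> M y -> radial_field P w q = 0 ->
  radial_field P w y = 0 -> kap * enorm (q - w) < 1 -> kap * enorm (y - w) < 1 ->
  enorm (y - q) < del -> y = q.
Proof.
move=> Mq My q0 y0 kq ky yq.
have h1 := strict_local_min td Mq My q0 yq.
have qy : enorm (q - y) < del by rewrite enormB.
have h2 := strict_local_min td My Mq y0 qy; rewrite (enormB q y) in h2.
apply/eqP; rewrite -subr_eq0; apply/eqP; apply: enorm_eq0.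
apply/eqP; rewrite -sqrf_eq0 eq_le sqr_ge0 andbT.
have := sqr_ge0 (enorm (y - q)); nra.
Qed.

Lemma not_isolated x (e : R) : (0 < n)%N -> M x -> 0 < e ->
  exists2 y, M y & y != x /\ enorm (y - x) < e.
Proof.
move=> n0 Mx e0; have C0 := td_C td; have d0 := td_del td.
have Px : P x != 0.
  by apply/negP => /eqP h; have := td_rank td Mx; rewrite h mxrank0 => h'; move: n0; rewrite -h'.
have [v v0] : exists v : 'rV[R]_d, v *m P x != 0.
  apply: contrapT => h; case/negP: Px; apply/eqP/row_matrixP => i; rewrite row0 rowE.
  by apply: contrapT => /eqP h'; apply: h; exists (delta_mx 0 i).
set u0 := v *m P x in v0; have u00 := enorm_gt0 v0.
(* A step so short that the error [C * m ^+ 2] is at most [m / 2], so that its endpoint differs from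
   [x]. *)
pose m := Num.min del (Num.min (1 / (2 * C)) (e / 2)).
have m0 : 0 < m by rewrite !lt_min d0 /= !divr_gt0 // mulr_gt0.
pose u := (m / enorm u0) *: u0.
have un : enorm u = m by rewrite enormZ ger0_norm ?divr_ge0 ?(ltW m0) // divfK // gt_eqF.
have uP : u *m P x = u by rewrite -scalemxAl (proj_proj td).
have md : m <= del by rewrite ge_min lexx.
have mC : m * (2 * C) <= 1.
  by rewrite -ler_pdivlMr ?mulr_gt0 // !ge_min lexx orbT.
have me : m <= e / 2 by rewrite !ge_min lexx !orbT.
have [|y My hy] := td_exp td Mx uP; first by rewrite un.
rewrite un in hy.
have mm : C * m ^+ 2 <= m / 2.
  by rewrite expr2 mulrA ler_pdivlMr // -subr_ge0 [X in 0 <= X](_ : _ = m * (1 - m * (2 * C)));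
    [rewrite mulr_ge0 ?subr_ge0 // ltW|ring].
exists y => //; split.
  apply/negP => /eqP yx; move: hy; rewrite yx subrr sub0r enormN un; lra.
have := ler_enormD (y - x - u) u; rewrite subrK un; lra.
Qed.

Lemma dist2_limit_pos w F Lp B x y (t : R) : gradient_flow M P w F Lp B -> M x -> M y ->
  (forall e T : R, 0 < e -> exists2 t, T <= t & enorm (F t x - y) < e) ->
  dotp (F t x - w) (F t x - w) <= dotp (y - w) (y - w).
Proof.
move=> gf Mx My h.
apply: (@lipschitz_limit_ge (fun x => dotp (x - w) (x - w)) y _ (dist2_lipschitz td w)) => //.
move=> e e0; have [s ts hs] := h e t e0; exists (F s x) => //; split; first exact: (gf_in gf).
exact: (dist2_nondecreasing td gf).
Qed.

End FlowLimits.

(* [M] is normalised to lie in the closed unit ball and to touch the unit sphere at [p];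
   [rho] is a lower bound for the radii of curvature. *)
Section Normalized.
Context {R : realType} {n d : nat}.
Variables (M : set 'rV[R]_d) (P : 'rV[R]_d -> 'M[R]_d) (kap del C : R).
Hypothesis td : tangent_data n M P kap del C.
Variable p : 'rV[R]_d.
Hypotheses (n0 : (0 < n)%N) (Mp : M p) (p1 : dotp p p = 1)
  (Mball : forall x, M x -> dotp x x <= 1).

(** Otherwise the ascending flow of [|x|^2] would carry [p] out of the unit ball. *)
Lemma farthest_critical : p *m P p = 0.
Proof.
have [F [Lp [B gf]]] := exists_gradient_flow td 0.
apply: contrapT => /eqP h.
have h' : radial_field P 0 p != 0 by rewrite /radial_field subr0.
have [s s0 [a a0 [e e0 he]]] := noncritical_gain td gf Mp h'.
have := he p Mp; rewrite subrr enorm0 => /(_ e0).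
by have := Mball (gf_in gf s Mp); rewrite !subr0 p1; lra.
Qed.

Lemma enorm_p : enorm p = 1.
Proof.
by apply/eqP; rewrite -(@eqrXn2 _ 2) ?enorm_ge0 // enorm_sqr p1 expr1n.
Qed.

Lemma near_farthest x : M x -> enorm (x - p) < del ->
  (1 - kap) * enorm (x - p) ^+ 2 <= dotp x x - 1.
Proof.
move=> Mx xp; have pP : - p *m P p = 0 by rewrite mulNmx farthest_critical oppr0.
have := td_normal td Mp Mx xp pP; rewrite enormN enorm_p mulr1 dotpNr.
have -> : dotp x x = 1 + 2 * dotp (x - p) p + enorm (x - p) ^+ 2.
  by rewrite enorm_sqr !dotpE (dotpC p x) p1; ring.
lra.
Qed.

(** At its farthest point [M] bends at least as much as the enclosing sphere: for [kap < 1],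
    [near_farthest] would put points of [M] outside the unit ball. *)
Lemma farthest_curvature : 1 <= kap.
Proof.
have [x Mx [xp hx]] := not_isolated td n0 Mp (td_del td).
have h := near_farthest Mx hx; have hb := Mball Mx.
rewrite -subr_le0 -(@pmulr_lle0 _ (enorm (x - p) ^+ 2)); first lra.
by rewrite exprn_gt0 // enorm_gt0 // subr_eq0.
Qed.

Hypotheses (kap_gt1 : 1 < kap) (kap_lt : 3 * kap ^+ 2 < 4).

Let rho := kap^-1.

Lemma rho_gt0 : 0 < rho. Proof. by rewrite invr_gt0 (td_kap td). Qed.
Lemma rho_lt1 : rho < 1. Proof. by rewrite invf_lt1 // (td_kap td). Qed.
Lemma kap_rho : kap * rho = 1. Proof. by rewrite mulfV // gt_eqF // (td_kap td). Qed.

Lemma rho_gt : 3 < 4 * rho ^+ 2.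
Proof.
have h : kap ^+ 2 * rho ^+ 2 = 1 by rewrite -exprMn kap_rho expr1n.
have r2 : 0 < rho ^+ 2 by rewrite exprn_gt0 // rho_gt0.
have : 3 * kap ^+ 2 * rho ^+ 2 < 4 * rho ^+ 2 by rewrite ltr_pM2r.
by rewrite -mulrA h mulr1.
Qed.

Lemma rho_ge : 3 / 4 < rho.
Proof. have := rho_gt; have := rho_gt0; rewrite -/rho => h1 h2; nra. Qed.

Lemma enorm_le1 x : M x -> enorm x <= 1.
Proof.
by move=> Mx; rewrite -(@ler_pXn2r _ 2) ?nnegrE ?enorm_ge0 // enorm_sqr expr1n Mball.
Qed.

(** Let [y] be a limit of the orbit of [x] under the ascending flow of [|x|^2]. If
    [rho <= |y| <= 1], then [bow] at [y] is [|y|^2 - 2 * rho * |y|], which is at most its value for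
    [|y| = 1], and monotonicity carries the bound back to [x]. If [|y| < rho], then [y] is a strict
    local minimum, which an ascending orbit can approach only by resting there. *)
Lemma bow0_dichotomy x : M x -> bow P kap 0 x <= 1 - 2 * rho \/
  radial_field P 0 x = 0 /\ enorm x < rho.
Proof.
move=> Mx; have [F [Lp [B gf]]] := exists_gradient_flow td 0.
have [y [My Ay] hy] := omega_limit_pos td gf Mx.
have [le|lt] := lerP rho (enorm y).
  left; apply: le_trans (_ : bow P kap 0 y <= _).
    apply: (lipschitz_limit_ge (bow_lipschitz td 0)) => // e e0.
    have [t t0 ht] := hy e 0 e0; exists (F t x) => //; split; first exact: (gf_in gf).
    exact: (bow_nondecreasing td gf).
  rewrite /bow critical_normal_dist // subr0 -enorm_sqr -/rho.
  have := enorm_le1 My; have := rho_lt1; rewrite -/rho; nra.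
right; have [t _ ht] := hy del 0 (td_del td).
have Mt := gf_in gf t Mx.
have h1 := strict_local_min td My Mt Ay ht.
have h2 := dist2_limit_pos td t gf Mx My hy.
have k1 : 0 < 1 - kap * enorm (y - 0).
  by rewrite subr0 subr_gt0 -kap_rho ltr_pM2l // (td_kap td).
have : enorm (F t x - y) ^+ 2 <= 0 by rewrite -(pmulr_rle0 _ k1); lra.
move=> h3; have Fy : F t x = y.
  apply/eqP; rewrite -subr_eq0; apply/eqP; apply: enorm_eq0.
  by apply/eqP; rewrite -sqrf_eq0 eq_le h3 sqr_ge0.
have <- : y = x by rewrite -(flowN gf t Mx) Fy (critical_fixed gf).
by [].
Qed.

(** The ball of radius [rho] tangent to [M] at [x] on the side of [0] has its centre at squared
    distance [bow + rho ^+ 2] from [0], so the bound places this ball inside the unit ball. The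
    exceptional points of [bow0_dichotomy] are isolated from each other while [M] has no isolated
    point, so continuity covers them. *)
Lemma bow0_le x : M x -> bow P kap 0 x <= 1 - 2 * rho.
Proof.
move=> Mx; have [//|[Ax xr]] := bow0_dichotomy Mx.
apply: (lipschitz_limit_le (bow_lipschitz td 0)) => // e e0.
have m0 : 0 < Num.min e del by rewrite lt_min e0 (td_del td).
have [y My [yx]] := not_isolated td n0 Mx m0; rewrite lt_min => /andP[ye yd].
exists y => //; split => //; have [//|[Ay yr]] := bow0_dichotomy My.
case/negP: yx; apply/eqP.
apply: (critical_near_unique td Mx My Ax Ay) => //.
  by rewrite subr0 -kap_rho ltr_pM2l // (td_kap td).
by rewrite subr0 -kap_rho ltr_pM2l // (td_kap td).
Qed.

Lemma radial0_le x : M x -> 4 * rho ^+ 2 * dotp (x *m P x) (x *m P x) <=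
  (1 - dotp x x) * (4 * rho * (1 - rho) - (1 - dotp x x)).
Proof.
move=> Mx; have := bow0_le Mx; have := pythagoras_field td 0 Mx.
rewrite /bow -/rho /radial_field subr0.
set N := normal_dist _ _ _; set s := dotp x x; set a := dotp _ _.
have N0 : 0 <= N := enorm_ge0 _; have s0 : 0 <= s := dotp_ge0 _.
have r1 := rho_ge; rewrite -/rho in r1.
clearbody N s a => hs hb.
(* Squaring is allowed because [2 * rho > 1]. *)
have h : (s + 2 * rho - 1) ^+ 2 <= (2 * rho * N) ^+ 2.
  by rewrite lerXn2r ?nnegrE //; lra.
have -> : a = s - N ^+ 2 by rewrite hs addrK.
by move: h; rewrite exprMn; lra.
Qed.

End Normalized.

(** * The region swept out from the farthest point *)

Section RealInduction.
Context {R : realType}.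

(** Past the last time [s0] at which [g] is nonnegative, the function [expR (- s) * g s] would be
    nondecreasing, and so could not become negative. *)
Lemma nonneg_of_derive_ge (g dg : R -> R) (T : R) : 0 <= T ->
  (forall s : R, is_derive s 1 g (dg s)) ->
  (forall s : R, 0 <= s -> g s < 0 -> g s <= dg s) -> 0 <= g 0 -> 0 <= g T.
Proof.
move=> T0 dgP hdg g0.
pose S : set R := [set s : R | (0 <= s <= T) /\ 0 <= g s].
have S0 : S 0 by split; rewrite // lexx.
have hs : has_sup S by split; [exists 0|exists T => s [/andP[]]].
set s0 := sup S.
have s00 : 0 <= s0 by apply: sup_upper_bound.
have s0T : s0 <= T by apply: ge_sup; [exists 0|move=> s [/andP[]]].
have gs0 : 0 <= g s0.
  rewrite leNgt; apply/negP => lt.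
  have lt' : 0 < - g s0 by rewrite oppr_gt0.
  have /cvgrPdist_lt/(_ _ lt')/nbhs_ballP[dl /= dl0 hdl] :=
    (is_derive_continuous dgP : forall x, g @ x --> g x) s0.
  have [s [sT gs] hs'] := sup_adherent dl0 hs.
  have ss : s <= s0 by apply: sup_upper_bound.
  have := hdl s; rewrite /ball /= ger0_norm ?subr_ge0 // ltrBlDr -ltrBlDl => /(_ hs').
  by rewrite ltr_norml => /andP[]; lra.
have [->//|ne] := eqVneq T s0.
have lt : s0 < T by rewrite lt_neqAle eq_sym ne.
pose h s := expR (- s) * g s.
have dh (s : R) : is_derive s 1 h (expR (- s) * (dg s - g s)).
  have d1 : is_derive s 1 (fun s : R => expR (- s)) (- expR (- s)).
    have := @is_derive1_comp R expR (fun s : R => - s) s (expR (- s)) (- 1).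
    by rewrite mulrN1; apply; exact: is_deriveN.
  apply: (is_derive_eq (is_deriveM d1 (dgP s))).
  by rewrite /GRing.scale /=; ring.
have [c /andP[c1 c2] E] := mean_value lt (fun s _ => dh s).
have cg : g c < 0.
  rewrite ltNge; apply/negP => gc.
  suff : c <= s0 by rewrite leNgt c1.
  apply: sup_upper_bound => //; split => //; apply/andP; split; last exact: ltW.
  by apply: le_trans (ltW c1).
have : 0 <= h T - h s0.
  rewrite E mulr_ge0 ?subr_ge0 ?(ltW lt) // mulr_ge0 ?expR_ge0 // subr_ge0.
  by apply: hdg => //; apply: le_trans (ltW c1).
rewrite subr_ge0 => hh; have : 0 <= h T.
  by apply: le_trans hh; rewrite mulr_ge0 ?expR_ge0.
by rewrite pmulr_rge0 // expR_gt0.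
Qed.

Lemma real_induction (Q : R -> Prop) (T : R) : 0 <= T -> Q 0 ->
  (forall t : R, 0 <= t -> t <= T -> Q t ->
    exists2 e : R, 0 < e & forall s, t <= s -> s < t + e -> s <= T -> Q s) ->
  (forall t : R, 0 < t -> t <= T -> (forall s : R, 0 <= s -> s < t -> Q s) -> Q t) ->
  Q T.
Proof.
move=> T0 Q0 hop hcl.
pose S : set R := [set s : R | (0 <= s <= T) /\ forall u : R, 0 <= u -> u <= s -> Q u].
have S0 : S 0.
  by split; rewrite ?lexx // => u u0 u0'; have -> : u = 0 by apply/eqP; rewrite eq_le u0 u0'.
have hs : has_sup S by split; [exists 0|exists T => s [/andP[]]].
set s0 := sup S.
have s00 : 0 <= s0 by apply: sup_upper_bound.
have s0T : s0 <= T by apply: ge_sup; [exists 0|move=> s [/andP[]]].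
have below u : 0 <= u -> u < s0 -> Q u.
  move=> u0 us; have us' : 0 < s0 - u by rewrite subr_gt0.
  have [s [_ hQ]] := sup_adherent us' hs.
  by rewrite -/s0 subKr => us''; apply: hQ => //; exact: ltW.
have Qs0 : Q s0.
  have [->//|ne] := eqVneq s0 0.
  by apply: hcl => //; rewrite lt_neqAle eq_sym ne.
have [->//|ne] := eqVneq T s0.
have lt : s0 < T by rewrite lt_neqAle eq_sym ne.
have [e e0 he] := hop s0 s00 s0T Qs0.
pose s1 := Num.min (s0 + e / 2) T.
have s01 : s0 < s1 by rewrite lt_min lt ltrDl divr_gt0.
suff : s1 <= s0 by rewrite leNgt s01.
apply: sup_upper_bound => //; split.
  by rewrite ge_min lexx orbT andbT (le_trans s00) // ltW.
move=> u u0; rewrite le_min => /andP[u1 u2].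
have [us|us] := ltrP u s0; first exact: below.
by apply: he => //; lra.
Qed.

End RealInduction.

Record unit_position {R : realType} {n d : nat} (M : set 'rV[R]_d) (P : 'rV[R]_d -> 'M[R]_d)
    (kap del C : R) (p : 'rV[R]_d) : Prop := UnitPosition {
  up_td : tangent_data n M P kap del C;
  up_n0 : (0 < n)%N;
  up_p : M p;
  up_p1 : dotp p p = 1;
  up_ball : forall x, M x -> dotp x x <= 1;
  up_kap1 : 1 < kap;
  up_kap : 3 * kap ^+ 2 < 4 }.

(** Used with [m = 1 - |x|^2], [f = |x - p|^2], and [a], [b] the squared tangential parts of [x] and
    [x - p]. Since [f / 3] lies between [m] and [1 - m], concavity gives
    [m * (1 - m) <= f / 3 * (1 - f / 3)]; the strict inequality comes from replacing [3] by
    [4 * rho ^+ 2] in [f * (3 - f)]. *)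
Lemma curvature_comparison (R : realType) (rho m f a b : R) : 3 / 4 < rho -> rho < 1 ->
  3 < 4 * rho ^+ 2 -> 0 <= m -> 4 * rho ^+ 2 * a <= m * (4 * rho * (1 - rho) - m) ->
  f * (4 * rho ^+ 2 - f) <= 4 * rho ^+ 2 * b -> rho * m <= (1 - rho) * f ->
  f <= 3 * (1 - m) -> 0 < f -> 9 * a < b.
Proof.
move=> r1 r2 r3 m0 ha hb hm hf f0.
have r0 : 0 < 4 * rho ^+ 2 by lra.
rewrite -(ltr_pM2l r0).
have h1 : m * (4 * rho * (1 - rho) - m) <= m * (1 - m).
  by rewrite ler_wpM2l // lerD2r; have := sqr_ge0 (2 * rho - 1); lra.
have h2 : m <= f / 3.
  have h : rho * m <= rho * (f / 3) by apply: le_trans hm _; nra.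
  by move: h; rewrite ler_pM2l //; lra.
have h3 : m * (1 - m) <= f / 3 * (1 - f / 3).
  rewrite -subr_ge0 [X in 0 <= X](_ : _ = (f / 3 - m) * (1 - f / 3 - m)); last by field.
  by rewrite mulr_ge0 //; lra.
have h4 : f * (3 - f) < f * (4 * rho ^+ 2 - f) by rewrite ltr_pM2l // ltrD2r.
lra.
Qed.

(** The long hypothesis is [0 <= |rho *: u + (1 - rho) *: v|^2] for the tangential parts [u], [v] of
    [x] and [x - p]; it removes the mixed term [c]. In what remains, the terms linear in [f] and
    [1 - s] add up to a multiple of [ph], and the quadratic ones to [- ph * X], which is nonnegative
    since [ph < 0 <= X]. *)
Lemma bulge_comparison (R : realType) (rho s f a b c : R) : 0 < rho -> rho < 1 ->
  0 <= f -> 0 <= 1 - s -> 4 * rho ^+ 2 * a <= (1 - s) * (4 * rho * (1 - rho) - (1 - s)) ->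
  f * (4 * rho ^+ 2 - f) <= 4 * rho ^+ 2 * b ->
  0 <= rho * (rho * a) + (1 - rho) * (rho * c) + (rho * ((1 - rho) * c) + (1 - rho) * ((1 - rho) * b)) ->
  rho * (s - 1) + (1 - rho) * f < 0 ->
  rho * (s - 1) + (1 - rho) * f <= 2 * rho * c + 2 * (1 - rho) * b.
Proof.
move=> rho0 rho1 f0 s0 h2 h1 h3 hn.
have r1 : 0 < 1 - rho by rewrite subr_gt0.
have r2 : 0 < 4 * rho ^+ 2 by rewrite mulr_gt0 // exprn_gt0.
rewrite -(ler_pM2l r1) -(ler_pM2l r2).
pose ph := rho * (s - 1) + (1 - rho) * f; pose X := (1 - rho) * f + rho * (1 - s).
have X0 : 0 <= X by rewrite addr_ge0 // mulr_ge0 // ltW.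
have e1 : ph * X <= 0 by rewrite mulr_le0_ge0 // ltW.
have e2 : 0 <= 4 * rho ^+ 2 * (rho * (rho * a) + (1 - rho) * (rho * c) +
   (rho * ((1 - rho) * c) + (1 - rho) * ((1 - rho) * b))).
  by apply: mulr_ge0; [exact: ltW|lra].
have e3 : (1 - rho) ^+ 2 * (f * (4 * rho ^+ 2 - f)) <= (1 - rho) ^+ 2 * (4 * rho ^+ 2 * b).
  by rewrite ler_wpM2l // sqr_ge0.
have e4 : rho ^+ 2 * (4 * rho ^+ 2 * a) <=
   rho ^+ 2 * ((1 - s) * (4 * rho * (1 - rho) - (1 - s))).
  by rewrite ler_wpM2l // sqr_ge0.
move: e1 e2 e3 e4; rewrite /ph /X; lra.
Qed.

Section Reach.
Context {R : realType} {n d : nat}.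
Variables (M : set 'rV[R]_d) (P : 'rV[R]_d -> 'M[R]_d) (kap del C : R) (p : 'rV[R]_d).
Hypothesis up : @unit_position R n d M P kap del C p.

Let td := up_td up.
Let rho := kap^-1.
Let rho0 : 0 < rho := rho_gt0 td.
Let rho1 : rho < 1 := rho_lt1 td (up_kap1 up).
Let rho_ge' : 3 / 4 < rho := rho_ge td (up_kap up).
Let rho_gt' : 3 < 4 * rho ^+ 2 := rho_gt td (up_kap up).
Let kaprho : kap * rho = 1 := kap_rho td.

Lemma bow_near_ge0 x : M x -> enorm (x - p) < del -> 0 <= bow P kap p x.
Proof.
move=> Mx xp; have px : enorm (p - x) < del by rewrite enormB.
have := normal_part_le td Mx (up_p up) px.
have -> : p - x - (p - x) *m P x = - (x - p - radial_field P p x).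
  by rewrite /radial_field !mulmxBl; apply/rowP => i; rewrite !mxE; ring.
rewrite enormN (enormB p x) /bow -enorm_sqr -/(normal_dist P p x) subr_ge0 => h.
have k0 : 0 < 2 / kap by rewrite divr_gt0 // (td_kap td).
rewrite -(ler_pM2l k0) in h; apply: le_trans h _.
by rewrite mulrA (_ : 2 / kap * (kap / 2) = 1) ?mul1r //; field; rewrite gt_eqF // (td_kap td).
Qed.

Variables (Fp : R -> 'rV[R]_d -> 'rV[R]_d) (Lp Bp : R).
Hypothesis gp : gradient_flow M P p Fp Lp Bp.

(** Points that the descending flow of [|x - p|^2] brings into the [del]-ball around [p], where the
    local estimates apply. Once inside, an orbit stays, by [reach_later]. *)
Definition reach x := exists2 t, 0 <= t & enorm (Fp (- t) x - p) < del.

Lemma reach_later x s t : M x -> s <= t -> enorm (Fp (- t) x - p) <= enorm (Fp (- s) x - p).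
Proof.
by move=> Mx st; apply: enorm_le_sqr; apply: (dist2_nondecreasing td gp) => //; rewrite lerN2.
Qed.

Lemma reach_back x t : M x -> 0 <= t -> reach x -> reach (Fp (- t) x).
Proof.
move=> Mx t0 [s s0 hs]; exists s => //.
have -> : Fp (- s) (Fp (- t) x) = Fp (- (t + s)) x by rewrite -(gf_D gp) // opprD addrC.
by apply: le_lt_trans hs; apply: reach_later => //; lra.
Qed.

Lemma reach_near x : M x -> enorm (x - p) < del -> reach x.
Proof. by move=> Mx xp; exists 0 => //; rewrite oppr0 (gf_0 gp). Qed.

Lemma reach_bow x : M x -> reach x -> 0 <= bow P kap p x.
Proof.
move=> Mx [t t0 ht]; have Mt := gf_in gp (- t) Mx.
rewrite -(flowNr gp t Mx); apply: le_trans (bow_near_ge0 Mt ht) _.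
exact: (bow_nondecreasing td gp).
Qed.

Lemma reach_open x : M x -> reach x ->
  exists2 dl, 0 < dl & forall y, M y -> enorm (y - x) < dl -> reach y.
Proof.
move=> Mx [t t0 ht]; pose E := expR (Lp * `|- t|).
have E0 : 0 < E := expR_gt0 _.
exists ((del - enorm (Fp (- t) x - p)) / E); first by rewrite divr_gt0 // subr_gt0.
move=> y My; rewrite ltr_pdivlMr // => h; exists t => //.
have := ler_enorm_dist (Fp (- t) x) (Fp (- t) y) p.
have := gf_lip gp (- t) My Mx; rewrite -/E; lra.
Qed.

(** Closedness is obtained within distance [2 * rho] of [p]. The descending orbit of [x] satisfies
    [bow >= 0] as a limit of orbits that do. Its limit [y] is critical, so
    [2 * rho * |y - p| <= |y - p|^2], and [|y - p| < 2 * rho] leaves only [y = p]. *)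
Lemma reach_closed x : M x -> dotp (x - p) (x - p) < 4 * rho ^+ 2 ->
  (forall e : R, 0 < e -> exists2 y, M y /\ reach y & enorm (y - x) < e) -> reach x.
Proof.
move=> Mx hx hcl.
have hb t : 0 <= t -> 0 <= bow P kap p (Fp (- t) x).
  move=> t0; apply: (lipschitz_limit_ge (bow_lipschitz td p) (gf_in gp _ Mx)) => e e0.
  pose E := expR (Lp * `|- t|); have E0 : 0 < E := expR_gt0 _.
  have [y [My ry]] := hcl _ (divr_gt0 e0 E0); rewrite ltr_pdivlMr // => h.
  have Mt := gf_in gp (- t) My.
  exists (Fp (- t) y); first by split => //; apply: reach_bow => //; exact: reach_back.
  by have := gf_lip gp (- t) My Mx; rewrite -/E; lra.
have [y [My y0] hy] := omega_limit_neg td gp Mx.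
have by0 : 0 <= bow P kap p y.
  apply: (lipschitz_limit_ge (bow_lipschitz td p)) => // e e0.
  have [t t0 ht] := hy e 0 e0; exists (Fp (- t) x) => //; split; first exact: (gf_in gp).
  exact: hb.
have yx : dotp (y - p) (y - p) <= dotp (x - p) (x - p).
  apply: (lipschitz_limit_le (dist2_lipschitz td p)) => // e e0.
  have [t t0 ht] := hy e 0 e0; exists (Fp (- t) x) => //; split; first exact: (gf_in gp).
  rewrite -[in leRHS](gf_0 gp Mx); apply: (dist2_nondecreasing td gp) => //; lra.
rewrite /bow critical_normal_dist // -/rho -enorm_sqr in by0.
rewrite -enorm_sqr in yx.
have yp : enorm (y - p) = 0.
  apply/eqP; rewrite eq_le enorm_ge0 andbT leNgt; apply/negP => pos.
  have yr : 2 * rho <= enorm (y - p).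
    by rewrite -(ler_pM2r pos) -expr2; lra.
  have : (2 * rho) ^+ 2 <= enorm (y - p) ^+ 2.
    by rewrite lerXn2r ?nnegrE ?enorm_ge0 // mulr_ge0 // ltW.
  rewrite exprMn; lra.
have [t t0 ht] := hy del 0 (td_del td); exists t => //.
have := ler_enorm_dist y (Fp (- t) x) p; lra.
Qed.

(** Equal to [|x - (1 - rho) p|^2 - rho^2] because [|p| = 1]: it is nonnegative outside the open
    ball of radius [rho] that touches the unit sphere from inside at [p]. *)
Definition bulge x := rho * (dotp x x - 1) + (1 - rho) * dotp (x - p) (x - p).

Lemma radialp_ge x : M x -> 0 <= bow P kap p x ->
  dotp (x - p) (x - p) * (4 * rho ^+ 2 - dotp (x - p) (x - p)) <=
  4 * rho ^+ 2 * dotp ((x - p) *m P x) ((x - p) *m P x).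
Proof.
move=> Mx; have := pythagoras_field td p Mx.
rewrite /bow -/rho /radial_field.
set N := normal_dist _ _ _; set f := dotp _ _; set a := dotp _ _.
have N0 : 0 <= N := enorm_ge0 _; have f0 : 0 <= f := dotp_ge0 _.
clearbody N f a => hf hb.
have h : (2 * rho * N) ^+ 2 <= f ^+ 2.
  rewrite lerXn2r ?nnegrE //; last lra.
  by rewrite !mulr_ge0 // ltW.
have -> : a = f - N ^+ 2 by rewrite hf addrK.
by move: h; rewrite exprMn; lra.
Qed.

Lemma bulge_is_derive x (t : R) : M x ->
  is_derive t 1 (fun s => bulge (Fp s x))
   (2 * rho * dotp (Fp t x *m P (Fp t x)) ((Fp t x - p) *m P (Fp t x)) +
    2 * (1 - rho) * dotp ((Fp t x - p) *m P (Fp t x)) ((Fp t x - p) *m P (Fp t x))).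
Proof.
move=> Mx; have Mt := gf_in gp t Mx.
have d1 := dist2_is_derive gp 0 t Mx.
have d2 := dist2_is_derive gp p t Mx.
have d1' : is_derive t 1 (fun s => dotp (Fp s x) (Fp s x) - 1)
   (2 * dotp (Fp t x) (radial_field P p (Fp t x))).
  rewrite (_ : (fun s => _) = (fun s => dotp (Fp s x - 0) (Fp s x - 0)) - cst 1); last first.
    by apply/funext => s; rewrite -[in LHS](subr0 (Fp s x)).
  have d1c := is_deriveB d1 (is_derive_cst (1 : R) t 1).
  by apply: (is_derive_eq d1c); rewrite !subr0.
rewrite (_ : (fun s => _) = rho \*: (fun s => dotp (Fp s x) (Fp s x) - 1) +
  (1 - rho) \*: (fun s => dotp (Fp s x - p) (Fp s x - p))); last exact/funext.
apply: (is_derive_eq (is_deriveD (is_deriveZ rho d1') (is_deriveZ (1 - rho) d2))).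
rewrite /radial_field (dotp_proj_self td) // /GRing.scale /=.
set y := Fp t x in Mt *.
have -> : dotp y ((y - p) *m P y) = dotp (y *m P y) ((y - p) *m P y).
  by rewrite (dotp_proj td) // (proj_proj td).
ring.
Qed.

Lemma bulge_derive_ge y : M y -> 0 <= bow P kap p y -> bulge y < 0 ->
  bulge y <= 2 * rho * dotp (y *m P y) ((y - p) *m P y) +
    2 * (1 - rho) * dotp ((y - p) *m P y) ((y - p) *m P y).
Proof.
move=> My hb; have h1 := radialp_ge My hb.
have h2 := radial0_le td (up_n0 up) (up_ball up) (up_kap1 up) (up_kap up) My.
have hy := up_ball up My; rewrite -/rho in h2; rewrite /bulge.
have := dotp_ge0 (rho *: (y *m P y) + (1 - rho) *: ((y - p) *m P y)).
move: h1 h2 hy; have := dotp_ge0 (y - p).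
set u := y *m P y; set v := (y - p) *m P y; set f := dotp (y - p) _; set s := dotp y y.
rewrite dotpDl !dotpDr !dotpZl !dotpZr (dotpC v u).
set a := dotp u u; set b := dotp v v; set c := dotp u v; clearbody u v f s a b c.
move=> f0 h1 h2 hs h3 hn.
apply: (bulge_comparison rho0 rho1 f0 _ h2 h1) => //; first by rewrite subr_ge0.
by rewrite addrACA.
Qed.

(** Near [p] the curvature bound keeps [M] outside the ball. Further along the ascending flow of
    [|x - p|^2], the differential inequality [bulge_derive_ge], valid wherever [bulge] is negative,
    prevents it from becoming negative. *)
Lemma reach_bulge x : M x -> reach x -> 0 <= bulge x.
Proof.
move=> Mx [t t0 ht]; have Mt := gf_in gp (- t) Mx.
rewrite -(flowNr gp t Mx); set y := Fp (- t) x in ht Mt *.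
apply: (nonneg_of_derive_ge t0 (fun s => bulge_is_derive s Mt)).
  move=> s s0; apply: bulge_derive_ge; first exact: (gf_in gp).
  apply: le_trans (bow_near_ge0 Mt ht) _; exact: (bow_nondecreasing td gp).
rewrite (gf_0 gp) //.
have := near_farthest td (up_p up) (up_p1 up) (up_ball up) Mt ht.
rewrite -(ler_pM2l rho0) /bulge -(enorm_sqr (y - p)).
set e2 := _ ^+ 2; set s := dotp y y.
have -> : rho * ((1 - kap) * e2) = (rho - 1) * e2 by rewrite mulrA mulrBr mulr1 [rho * kap]mulrC kaprho.
by rewrite -subr_ge0 => /le_trans; apply; rewrite le_eqVlt; apply/orP; left; apply/eqP; ring.
Qed.

(** The midpoint of [0] and [- p]. Lying beyond [0] as seen from [p], it makes [|x - midpt|^2] a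
    combination of [|x|^2] and [|x - p|^2] in which the latter has a negative coefficient. *)
Definition midpt : 'rV[R]_d := - (2^-1 *: p).

Lemma dist2_midptE x : dotp (x - midpt) (x - midpt) =
  3 / 2 * dotp x x - dotp (x - p) (x - p) / 2 + 3 / 4.
Proof. by rewrite /midpt !dotpE (dotpC p x) (up_p1 up); field. Qed.

Lemma radial_midptE x : radial_field P midpt x =
  2^-1 *: (3 *: (x *m P x) - (x - p) *m P x).
Proof.
rewrite /radial_field /midpt opprK mulmxDl mulmxBl -scalemxAl.
by apply/rowP => i; rewrite !mxE; field.
Qed.

Lemma reach_descent x : M x -> reach x -> x != p -> 3 / 4 <= dotp (x - midpt) (x - midpt) ->
  dotp (x - p) (radial_field P midpt x) < 0.
Proof.
move=> Mx rx xp; rewrite dist2_midptE => hx.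
have h1 := radialp_ge Mx (reach_bow Mx rx).
have h2 := radial0_le td (up_n0 up) (up_ball up) (up_kap1 up) (up_kap up) Mx.
have h3 := reach_bulge Mx rx; have hy := up_ball up Mx; rewrite -/rho in h2.
have f0 : 0 < dotp (x - p) (x - p).
  by rewrite -enorm_sqr exprn_gt0 // enorm_gt0 // subr_eq0.
rewrite /bulge in h3.
have h4 : 9 * dotp (x *m P x) (x *m P x) < dotp ((x - p) *m P x) ((x - p) *m P x).
  apply: (curvature_comparison rho_ge' rho1 rho_gt' _ h2 h1) => //; lra.
have -> : dotp (x - p) (radial_field P midpt x) = dotp ((x - p) *m P x) (radial_field P midpt x).
  by rewrite (dotp_proj td) // /radial_field (proj_proj td).
rewrite radial_midptE; move: h4; set u := x *m P x; set v := _ *m P x.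
(* This gives [6 * c <= 9 * a + b < 2 * b], and the product in question is [(3 * c - b) / 2]. *)
have := dotp_ge0 (3 *: u - v); rewrite !dotpE (dotpC v u).
set a := dotp u u; set b := dotp v v; set c := dotp u v; lra.
Qed.

Variables (Fz : R -> 'rV[R]_d -> 'rV[R]_d) (Lz Bz : R).
Hypothesis gz : gradient_flow M P midpt Fz Lz Bz.

Local Notation h x := (dotp (x - midpt) (x - midpt)).
Local Notation f x := (dotp (x - p) (x - p)).

Lemma upper_region_le x : M x -> 3 / 4 <= h x -> f x < 4 * rho ^+ 2.
Proof. by move=> Mx; rewrite dist2_midptE; have := up_ball up Mx; have := rho_gt'; lra. Qed.

(** The factor [c] lets one induction serve both time directions. Membership persists because
    [reach] is open, and closed as long as the orbit stays where [upper_region_le] applies. *)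
Lemma reach_orbit_signed (c T : R) (x : 'rV[R]_d) : M x -> reach x -> 0 <= T ->
  (forall t, 0 <= t -> t <= T -> 3 / 4 <= h (Fz (c * t) x)) -> reach (Fz (c * T) x).
Proof.
move=> Mx rx T0 hh.
apply: (@real_induction R (fun t => reach (Fz (c * t) x)) T) => //.
- by rewrite mulr0 (gf_0 gz).
- move=> t t0 tT rt; have Mt := gf_in gz (c * t) Mx.
  have [dl dl0 hdl] := reach_open Mt rt.
  have [e e0 he] := flow_time_econt td gz (c * t) Mx dl0.
  have c0 : 0 < `|c| + 1 by rewrite ltr_wpDl.
  exists (e / (`|c| + 1)); first by rewrite divr_gt0.
  move=> s ts; rewrite addrC -ltrBlDr ltr_pdivlMr // => se _.
  apply: hdl; first exact: (gf_in gz).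
  apply: he; rewrite -mulrBr normrM (ger0_norm (_ : 0 <= s - t)) ?subr_ge0 //.
  apply: le_lt_trans se; rewrite mulrC ler_wpM2l ?subr_ge0 //; lra.
move=> t t0 tT ih; have Mt := gf_in gz (c * t) Mx.
apply: reach_closed => //.
  by apply: upper_region_le => //; apply: hh => //; exact: ltW.
move=> e e0; have [dl dl0 hdl] := flow_time_econt td gz (c * t) Mx e0.
have c0 : 0 < `|c| + 1 by rewrite ltr_wpDl.
pose s := Num.max 0 (t - dl / (`|c| + 1)).
have s0 : 0 <= s by rewrite le_max lexx.
have dc : 0 < dl / (`|c| + 1) by rewrite divr_gt0.
have st : s < t by rewrite gt_max t0 /=; lra.
exists (Fz (c * s) x); first by split; [exact: (gf_in gz)|exact: ih].
apply: hdl; rewrite -mulrBr normrM distrC (ger0_norm (_ : 0 <= t - s)) ?subr_ge0 ?(ltW st) //.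
have ts : t - s <= dl / (`|c| + 1) by have : t - dl / (`|c| + 1) <= s by [rewrite le_max lexx orbT]; lra.
rewrite ler_pdivlMr // in ts; apply: lt_le_trans ts.
by rewrite mulrC ltr_pM2l ?subr_gt0 // ltrDl.
Qed.

Lemma midpt_nondecreasing x (s t : R) : M x -> s <= t -> h (Fz s x) <= h (Fz t x).
Proof. exact: (dist2_nondecreasing td gz). Qed.

Lemma reach_orbit x t : M x -> reach x -> 3 / 4 <= h x -> 3 / 4 <= h (Fz t x) ->
  reach (Fz t x).
Proof.
move=> Mx rx hx ht; have [t0|t0] := lerP 0 t.
  rewrite -[t]mul1r; apply: reach_orbit_signed => // s s0 st; rewrite mul1r.
  apply: le_trans hx _; rewrite -{1 2}(gf_0 gz Mx); exact: midpt_nondecreasing.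
have -> : t = -1 * (- t) by rewrite mulN1r opprK.
apply: reach_orbit_signed => //; first by rewrite oppr_ge0 ltW.
move=> s s0 st; rewrite mulN1r; apply: le_trans ht _.
by apply: midpt_nondecreasing => //; lra.
Qed.

Lemma farthest_fixed t : Fz t p = p.
Proof.
apply: (critical_fixed gz) => //; first exact: (up_p up).
have pP := farthest_critical td (up_p up) (up_p1 up) (up_ball up).
by rewrite radial_midptE pP subrr mul0mx scaler0 subrr scaler0.
Qed.

Lemma orbit_neq x t : M x -> x != p -> Fz t x != p.
Proof.
move=> Mx; apply: contra_neq => E; by rewrite -(flowN gz t Mx) E farthest_fixed.
Qed.

Lemma farthest_dist_decreasing x (s t : R) : M x -> reach x -> 3 / 4 <= h x -> x != p ->
  3 / 4 <= h (Fz s x) -> s < t -> f (Fz t x) < f (Fz s x).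
Proof.
move=> Mx rx hx xp hs st.
have [c /andP[c1 c2] E] := @mean_value R (fun s => f (Fz s x)) _ s t st
  (fun u _ => dist2_is_derive gz p u Mx).
rewrite -subr_lt0 E pmulr_llt0 ?subr_gt0 // pmulr_rlt0 //.
have hc : 3 / 4 <= h (Fz c x).
  by apply: le_trans hs _; apply: midpt_nondecreasing => //; exact: ltW.
apply: reach_descent => //; [exact: (gf_in gz)|exact: reach_orbit|exact: orbit_neq].
Qed.

Lemma farthest_dist_nonincreasing x (s t : R) : M x -> reach x -> 3 / 4 <= h x ->
  3 / 4 <= h (Fz s x) -> s <= t -> f (Fz t x) <= f (Fz s x).
Proof.
move=> Mx rx hx hs; rewrite le_eqVlt => /orP[/eqP -> //|st].
have [->|xp] := eqVneq x p; first by rewrite !farthest_fixed.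
by apply: ltW; apply: farthest_dist_decreasing.
Qed.

Lemma critical_upper_eq y : M y -> reach y -> 3 / 4 <= h y -> radial_field P midpt y = 0 -> y = p.
Proof.
move=> My ry hy y0; apply/eqP; apply: contraT => yp.
by have := reach_descent My ry yp hy; rewrite y0 dotp0 ltxx.
Qed.

(** Otherwise the descending orbit has a critical limit in the region [3 / 4 <= h], which can only
    be [p]; but along this orbit the distance to [p] does not fall below that of [x]. *)
Lemma orbit_leaves_upper x : M x -> reach x -> 3 / 4 <= h x -> x != p ->
  exists2 t, 0 <= t & h (Fz (- t) x) < 3 / 4.
Proof.
move=> Mx rx hx xp; apply: contrapT => no.
have hh t : 0 <= t -> 3 / 4 <= h (Fz (- t) x).
  by move=> t0; rewrite leNgt; apply/negP => lt; apply: no; exists t.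
have [y [My y0] hy] := omega_limit_neg td gz Mx.
have hy34 : 3 / 4 <= h y.
  apply: (lipschitz_limit_ge (dist2_lipschitz td midpt)) => // e e0.
  by have [t t0 ht] := hy e 0 e0; exists (Fz (- t) x) => //; split; [exact: (gf_in gz)|exact: hh].
have fy : f x <= f y.
  apply: (lipschitz_limit_ge (dist2_lipschitz td p)) => // e e0.
  have [t t0 ht] := hy e 0 e0; exists (Fz (- t) x) => //; split; first exact: (gf_in gz).
  rewrite -{1 2}(gf_0 gz Mx); apply: farthest_dist_nonincreasing => //; first exact: hh.
  by rewrite oppr_le0.
have ry : reach y.
  apply: reach_closed => //; first exact: upper_region_le.
  move=> e e0; have [t t0 ht] := hy e 0 e0; exists (Fz (- t) x) => //.
  by split; [exact: (gf_in gz)|apply: reach_orbit => //; exact: hh].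
move: fy; rewrite (critical_upper_eq My ry hy34 y0) subrr dotp0.
by rewrite -enorm_sqr leNgt exprn_gt0 // enorm_gt0 // subr_eq0.
Qed.

Lemma orbit_ascends x (e : R) : M x -> reach x -> 3 / 4 <= h x -> 0 < e ->
  exists2 t, 0 <= t & enorm (Fz t x - p) < e.
Proof.
move=> Mx rx hx e0; have [y [My y0] hy] := omega_limit_pos td gz Mx.
have hh t : 0 <= t -> 3 / 4 <= h (Fz t x).
  by move=> t0; apply: le_trans hx _; rewrite -{1 2}(gf_0 gz Mx); exact: midpt_nondecreasing.
have hy34 : 3 / 4 <= h y.
  apply: (lipschitz_limit_ge (dist2_lipschitz td midpt)) => // e1 e10.
  by have [t t0 ht] := hy e1 0 e10; exists (Fz t x) => //; split; [exact: (gf_in gz)|exact: hh].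
have ry : reach y.
  apply: reach_closed => //; first exact: upper_region_le.
  move=> e1 e10; have [t t0 ht] := hy e1 0 e10; exists (Fz t x) => //.
  by split; [exact: (gf_in gz)|apply: reach_orbit => //; exact: hh].
by move: hy; rewrite (critical_upper_eq My ry hy34 y0) => hy; exact: hy.
Qed.

End Reach.

(** * Sinks and their basins *)

Section Sinks.
Context {R : realType} {n d : nat}.
Variables (M : set 'rV[R]_d) (P : 'rV[R]_d -> 'M[R]_d) (kap del C : R).
Hypothesis td : tangent_data n M P kap del C.
Variables (w : 'rV[R]_d) (F : R -> 'rV[R]_d -> 'rV[R]_d) (Lp B : R).
Hypothesis gf : gradient_flow M P w F Lp B.

Definition sink q := [/\ M q, radial_field P w q = 0 & kap * enorm (q - w) < 1].

(* Attraction is meant for the descending flow [F (- t)]. *)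
Definition attracted x q := forall e : R, 0 < e ->
  exists T : R, forall t, T <= t -> enorm (F (- t) x - q) < e.

(** Lyapunov stability: [strict_local_min] gives the squared distance to [w] a barrier of height
    [a * e1 ^+ 2] on the sphere of radius [e1] around [q], and the descending flow cannot climb
    it. *)
Lemma sink_trap q (e : R) : sink q -> 0 < e ->
  exists2 dl, 0 < dl & forall y, M y -> enorm (y - q) < dl ->
    forall t, 0 <= t -> enorm (F (- t) y - q) < e.
Proof.
move=> [Mq q0 kq] e0; have [L L0 hL] := dist2_lipschitz td w.
have d0 := td_del td.
pose e1 := Num.min (e / 2) (del / 2).
have e10 : 0 < e1 by rewrite lt_min !divr_gt0.
pose a := 1 - kap * enorm (q - w); have a0 : 0 < a by rewrite subr_gt0.
have ae : 0 < a * e1 ^+ 2 by rewrite mulr_gt0 // exprn_gt0.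
have L1 : 0 < L + 1 by lra.
exists (Num.min e1 (a * e1 ^+ 2 / (L + 1))); first by rewrite lt_min e10 divr_gt0.
move=> y My; rewrite lt_min ltr_pdivlMr // => /andP[y1 y2] t t0.
have hy : dotp (y - w) (y - w) < dotp (q - w) (q - w) + a * e1 ^+ 2.
  have := hL y q My Mq; rewrite ler_norml => /andP[_].
  have := enorm_ge0 (y - q); move: y2; set X := dotp (y - w) _; set Y := dotp (q - w) _; lra.
have e1e : e1 < e by have : e1 <= e / 2 by [rewrite ge_min lexx]; lra.
have e1d : e1 < del by have : e1 <= del / 2 by [rewrite ge_min lexx orbT]; lra.
apply: lt_trans e1e.
apply: (@real_induction R (fun t => enorm (F (- t) y - q) < e1) t) => //.
- by rewrite oppr0 (gf_0 gf).
- move=> s s0 st hs; have gap : 0 < e1 - enorm (F (- s) y - q) by rewrite subr_gt0.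
  have [dl dl0 hdl] := flow_time_econt td gf (- s) My gap.
  exists dl => // u su us _.
  have : enorm (F (- u) y - F (- s) y) < e1 - enorm (F (- s) y - q).
    by apply: hdl; rewrite opprK addrC -normrN opprB ger0_norm; lra.
  have := ler_enorm_dist (F (- s) y) (F (- u) y) q; lra.
move=> s s0 st ih; have Ms := gf_in gf (- s) My.
have le : enorm (F (- s) y - q) <= e1.
  rewrite leNgt; apply/negP => lt.
  have gap : 0 < enorm (F (- s) y - q) - e1 by rewrite subr_gt0.
  have [dl dl0 hdl] := flow_time_econt td gf (- s) My gap.
  pose u := Num.max 0 (s - dl / 2).
  have u0 : 0 <= u by rewrite le_max lexx.
  have us : u < s by rewrite gt_max s0 /=; lra.
  have : enorm (F (- u) y - F (- s) y) < enorm (F (- s) y - q) - e1.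
    apply: hdl; have : s - dl / 2 <= u by rewrite le_max lexx orbT.
    by move=> h; rewrite opprK addrC ger0_norm; lra.
  have := ih u u0 us; have := ler_enorm_dist (F (- u) y) (F (- s) y) q.
  rewrite (enormB (F (- s) y) (F (- u) y)); lra.
have h1 := strict_local_min td Mq Ms q0 (le_lt_trans le e1d).
have h2 : dotp (F (- s) y - w) (F (- s) y - w) <= dotp (y - w) (y - w).
  rewrite -{3 4}(gf_0 gf My); apply: (dist2_nondecreasing td gf) => //.
  by rewrite oppr_le0 ltW.
have : a * enorm (F (- s) y - q) ^+ 2 < a * e1 ^+ 2 by rewrite -/a in h1; lra.
by rewrite ltr_pM2l // ltr_pXn2r // ?nnegrE ?(ltW e10).
Qed.

Lemma attracted_shift x q (T : R) : M x -> attracted (F (- T) x) q -> attracted x q.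
Proof.
move=> Mx h e e0; have [T1 hT] := h e e0; exists (T1 + T) => t tT.
have := hT (t - T); rewrite -(gf_D gf) // opprB addrAC subrr add0r.
by apply; rewrite lerBrDr.
Qed.

Lemma attracted_unique x q q' : attracted x q -> attracted x q' -> q = q'.
Proof.
move=> h h'; apply/eqP; rewrite -subr_eq0; apply/eqP/enorm_eq0.
apply/eqP; rewrite eq_le enorm_ge0 andbT leNgt; apply/negP => e0.
have e2 : 0 < enorm (q - q') / 2 by rewrite divr_gt0.
have [T hT] := h _ e2; have [T' hT'] := h' _ e2.
have h1 : enorm (F (- Num.max T T') x - q) < enorm (q - q') / 2.
  by apply: hT; rewrite le_max lexx.
have h2 : enorm (F (- Num.max T T') x - q') < enorm (q - q') / 2.
  by apply: hT'; rewrite le_max lexx orbT.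
have := ler_enorm_dist (F (- Num.max T T') x) q q'; rewrite (enormB q (F _ _)); lra.
Qed.

Lemma attracted_uniform x q (e : R) : M x -> sink q -> attracted x q -> 0 < e ->
  exists T : R, exists2 dl, 0 < dl & forall y, M y -> enorm (y - x) < dl ->
    forall t, T <= t -> enorm (F (- t) y - q) < e.
Proof.
move=> Mx sq ax e0; have [d1 d10 h1] := sink_trap sq e0.
have d2 : 0 < d1 / 2 by rewrite divr_gt0.
have [T hT] := ax _ d2; pose E := expR (Lp * `|- T|).
have E0 : 0 < E := expR_gt0 _.
exists T, (d1 / 2 / E); first by rewrite divr_gt0.
move=> y My; rewrite ltr_pdivlMr // => yx t Tt.
have -> : - t = - (t - T) + - T by rewrite opprB addrAC subrr add0r.
rewrite (gf_D gf) //; apply: h1; [exact: (gf_in gf)| |by rewrite subr_ge0].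
have := hT T (lexx _); have := gf_lip gf (- T) My Mx; rewrite -/E.
have := ler_enorm_dist (F (- T) x) (F (- T) y) q; lra.
Qed.

Lemma attracted_of_cluster x q : M x -> sink q ->
  (forall e T : R, 0 < e -> exists2 t, T <= t & enorm (F (- t) x - q) < e) -> attracted x q.
Proof.
move=> Mx sq h e e0; have [dl dl0 hdl] := sink_trap sq e0.
have [T _ hT] := h dl 0 dl0; exists T => t Tt.
have -> : - t = - (t - T) + - T by rewrite opprB addrAC subrr add0r.
by rewrite (gf_D gf) //; apply: hdl; [exact: (gf_in gf)| |rewrite subr_ge0].
Qed.

Lemma sink_attracts q : sink q -> exists2 dl, 0 < dl &
  forall y, M y -> enorm (y - q) < dl -> attracted y q.
Proof.
move=> sq; have [Mq q0 kq] := sq; have k0 := td_kap td; have d0 := td_del td.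
(* The second term keeps every limit [y'] within the radius [1 / kap] from [w], so that
   [critical_near_unique] identifies it with [q]. *)
pose e1 := Num.min (del / 2) ((1 - kap * enorm (q - w)) / (2 * kap)).
have e10 : 0 < e1 by rewrite lt_min !divr_gt0 // ?mulr_gt0 // subr_gt0.
have [dl dl0 hdl] := sink_trap sq e10; exists dl => // y My yq.
have [y' [My' y0'] hy'] := omega_limit_neg td gf My.
have y'q : enorm (y' - q) <= e1.
  apply/ler_addgt0Pr => e e0; have [t t0 ht] := hy' e 0 e0.
  have := hdl y My yq t t0; have := ler_enorm_dist (F (- t) y) y' q.
  rewrite (enormB y' (F _ _)); lra.
have e1d : e1 <= del / 2 by rewrite ge_min lexx.
have e1k : kap * e1 <= (1 - kap * enorm (q - w)) / 2.
  have : e1 <= (1 - kap * enorm (q - w)) / (2 * kap) by rewrite ge_min lexx orbT.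
  rewrite -(ler_pM2l k0) => /le_trans; apply; rewrite le_eqVlt; apply/orP; left; apply/eqP.
  by field; rewrite gt_eqF.
have ky' : kap * enorm (y' - w) < 1.
  have h1 : kap * enorm (y' - w) <= kap * enorm (y' - q) + kap * enorm (q - w).
    by rewrite -mulrDr ler_pM2l //; exact: ler_enorm_dist.
  have h2 : kap * enorm (y' - q) <= kap * e1 by rewrite ler_pM2l.
  lra.
have y'E : y' = q.
  by apply: (critical_near_unique td Mq My' q0 y0' kq ky'); lra.
by apply: attracted_of_cluster => //; rewrite y'E in hy'.
Qed.

Lemma attracted_open x q : M x -> sink q -> attracted x q ->
  exists2 dl, 0 < dl & forall y, M y -> enorm (y - x) < dl -> attracted y q.
Proof.
move=> Mx sq ax; have [dl dl0 hdl] := sink_attracts sq.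
have [T [d1 d10 h1]] := attracted_uniform Mx sq ax dl0.
exists d1 => // y My yx; apply: (attracted_shift (T := T)) => //.
by apply: hdl; [exact: (gf_in gf)|exact: h1].
Qed.

Lemma attracted_exists x : M x -> kap * enorm (x - w) < 1 -> exists2 q,
  sink q /\ enorm (q - w) <= enorm (x - w) & attracted x q.
Proof.
move=> Mx kx; have k0 := td_kap td.
have [q [Mq q0] hq] := omega_limit_neg td gf Mx.
have qx : enorm (q - w) <= enorm (x - w).
  apply: enorm_le_sqr; apply: (lipschitz_limit_le (dist2_lipschitz td w)) => // e e0.
  have [t t0 ht] := hq e 0 e0; exists (F (- t) x) => //; split; first exact: (gf_in gf).
  rewrite -{3 4}(gf_0 gf Mx); apply: (dist2_nondecreasing td gf) => //.
  by rewrite oppr_le0.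
have sq : sink q by split => //; apply: le_lt_trans kx; rewrite ler_pM2l.
by exists q => //; exact: attracted_of_cluster.
Qed.

Lemma dist2_ivt x (a : 'rV[R]_d) (s t v : R) : M x -> s <= t ->
  dotp (F s x - a) (F s x - a) <= v <= dotp (F t x - a) (F t x - a) \/
  dotp (F t x - a) (F t x - a) <= v <= dotp (F s x - a) (F s x - a) ->
  exists2 u, s <= u <= t & dotp (F u x - a) (F u x - a) = v.
Proof.
move=> Mx st hv; pose g u := dotp (F u x - a) (F u x - a).
have [||u uin gu] := @IVT R g s t v st.
- apply: derivable_within_continuous => u _.
  by have [] := dist2_is_derive gf a u Mx.
- by rewrite /g ge_min le_max; case: hv => /andP[-> ->]; rewrite ?orbT.
by exists u => //; rewrite in_itv /= in uin.
Qed.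

End Sinks.

(** Shaped after images of punctured balls under charts: [A] lies between two punctured
    neighbourhoods of [x]. *)
Definition punctured_connected {R : realType} {d : nat} (M : set 'rV[R]_d) x :=
  forall e : R, 0 < e -> exists A : set 'rV[R]_d, [/\ connected A,
    forall y, A y -> [/\ M y, y != x & enorm (y - x) < e] &
    exists2 e', 0 < e' & forall y, M y -> y != x -> enorm (y - x) < e' -> A y].

(** Distance spheres of [M] around [x] of arbitrarily small radius, parametrised by the unit sphere
    of the parameter space. They serve as cross sections to the orbits leaving [p]. *)
Definition sphere_sections {R : realType} (n : nat) {d : nat} (M : set 'rV[R]_d) x :=
  forall e : R, 0 < e -> exists2 eps, 0 < eps < e &
    exists s : 'rV[R]_n -> 'rV[R]_d, [/\
      forall th, enorm th = 1 -> M (s th) /\ enorm (s th - x) = eps,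
      econt (@usphere R n) s,
      forall th th', enorm th = 1 -> enorm th' = 1 -> s th = s th' -> th = th' &
      forall y, M y -> enorm (y - x) = eps -> exists2 th, enorm th = 1 & s th = y].

(** If [g] jumped at [y], its values along a sequence tending to [y] would cluster at some [a] with
    [f a = y], and injectivity makes [a] equal to [g y]. *)
Lemma compact_inverse_econt (R : realType) m d (A : set 'rV[R]_m) (B : set 'rV[R]_d)
    (f : 'rV[R]_m -> 'rV[R]_d) (g : 'rV[R]_d -> 'rV[R]_m) :
  compact A -> econt A f -> (forall x x', A x -> A x' -> f x = f x' -> x = x') ->
  (forall y, B y -> A (g y) /\ f (g y) = y) -> econt B g.
Proof.
move=> cA fc inj hg y By e e0; apply: contrapT => no.
have p0 (m' : nat) : (0 : R) < 2 ^- m' by rewrite invr_gt0 exprn_gt0.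
have /choice[u hu] : forall m' : nat, exists y', B y' /\ enorm (y' - y) < 2 ^- m' /\
   e <= enorm (g y' - g y).
  move=> m'; apply: contrapT => no'; apply: no; exists (2 ^- m') => // y' By' yy'.
  by rewrite ltNge; apply/negP => le; apply: no'; exists y'.
have Bu m' : B (u m') by have [] := hu m'.
have [a Aa ha] := compact_seq_cluster cA (fun m' => (hg _ (Bu m')).1).
have fa : f a = y.
  apply/eqP; rewrite -subr_eq0; apply/eqP/enorm_eq0.
  apply/eqP; rewrite eq_le enorm_ge0 andbT leNgt; apply/negP => gap.
  have gap2 : 0 < enorm (f a - y) / 2 by rewrite divr_gt0.
  have [dl dl0 hdl] := fc a Aa _ gap2; have [N hN] := pow2_eps gap2.
  have [k Nk hk] := ha dl N dl0.
  have h1 := hdl _ (hg _ (Bu k)).1 hk; rewrite (hg _ (Bu k)).2 in h1.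
  have [_ [h2 _]] := hu k; have := hN k Nk.
  have := ler_enorm_dist (u k) (f a) y; rewrite (enormB (f a) (u k)); lra.
have [Ag fg] := hg y By.
have ga : g y = a by apply: inj => //; rewrite fg fa.
have [k _ hk] := ha e 0%N e0; have [_ [_]] := hu k; rewrite ga; lra.
Qed.

Lemma ler_normalize (R : realType) d (u v : 'rV[R]_d) : u != 0 -> v != 0 ->
  enorm ((enorm u)^-1 *: u - (enorm v)^-1 *: v) <= 2 * enorm (u - v) / enorm v.
Proof.
move=> u0 v0; have up := enorm_gt0 u0; have vp := enorm_gt0 v0.
have -> : (enorm u)^-1 *: u - (enorm v)^-1 *: v = (enorm v)^-1 *: (u - v) +
    ((enorm u)^-1 - (enorm v)^-1) *: u.
  by apply/rowP => i; rewrite !mxE; ring.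
apply: le_trans (ler_enormD _ _) _; rewrite !enormZ.
have -> : `|(enorm u)^-1 - (enorm v)^-1| * enorm u = (enorm v)^-1 * `|enorm v - enorm u|.
  have -> : (enorm u)^-1 - (enorm v)^-1 = (enorm v)^-1 * (enorm v - enorm u) * (enorm u)^-1.
    by field; rewrite !gt_eqF.
  by rewrite !normrM !normfV !(ger0_norm (enorm_ge0 _)) divfK // gt_eqF.
rewrite normfV (ger0_norm (enorm_ge0 _)) -mulrDr mulrC ler_pM2r ?invr_gt0 //.
have := ler_enorm_sub v u; rewrite (enormB v u); lra.
Qed.

(** * Suspensions of spheres *)

Section Suspension.
Context {R : realType} {n d : nat}.

Definition height (x : 'rV[R]_n.+1) : R := x 0 ord0.
Definition equatorial (x : 'rV[R]_n.+1) : 'rV[R]_n := \row_j x 0 (lift ord0 j).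
Definition suspend (a : R) (v : 'rV[R]_n) : 'rV[R]_n.+1 :=
  \row_i (if unlift ord0 i is Some j then v 0 j else a).

Lemma height_suspend a v : height (suspend a v) = a.
Proof. by rewrite /height mxE unlift_none. Qed.

Lemma equatorial_suspend a v : equatorial (suspend a v) = v.
Proof. by apply/rowP => j; rewrite !mxE liftK. Qed.

Lemma suspend_eta x : suspend (height x) (equatorial x) = x.
Proof.
apply/rowP => i; rewrite mxE; case: unliftP => [j ->|->] //.
by rewrite mxE.
Qed.

Local Transparent dotp.
Lemma dotp_suspend x : dotp x x = height x ^+ 2 + dotp (equatorial x) (equatorial x).
Proof.
rewrite /dotp big_ord_recl expr2; congr (_ + _).
by apply: eq_bigr => j _; rewrite !mxE.
Qed.
Local Opaque dotp.

Lemma heightB x y : height (x - y) = height x - height y.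
Proof. by rewrite /height !mxE. Qed.

Lemma equatorialB x y : equatorial (x - y) = equatorial x - equatorial y.
Proof. by apply/rowP => j; rewrite !mxE. Qed.

Lemma height_le x : `|height x| <= enorm x.
Proof.
rewrite -(@ler_pXn2r _ 2) ?nnegrE ?enorm_ge0 // real_normK ?num_real //.
by rewrite enorm_sqr dotp_suspend lerDl dotp_ge0.
Qed.

Lemma equatorial_le x : enorm (equatorial x) <= enorm x.
Proof.
rewrite -(@ler_pXn2r _ 2) ?nnegrE ?enorm_ge0 // !enorm_sqr.
by rewrite [leRHS]dotp_suspend lerDr sqr_ge0.
Qed.

Variables (p q : 'rV[R]_d) (G : R -> 'rV[R]_n -> 'rV[R]_d).
Hypothesis G_cont : forall (t : R) th (e : R), enorm th = 1 -> 0 < e ->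
  exists2 dl, 0 < dl & forall (t' : R) th', enorm th' = 1 -> `|t' - t| < dl ->
    enorm (th' - th) < dl -> enorm (G t' th' - G t th) < e.
Hypothesis G_pos : forall e : R, 0 < e -> exists T : R, forall t th, enorm th = 1 ->
  T <= t -> enorm (G t th - q) < e.
Hypothesis G_neg : forall e : R, 0 < e -> exists T : R, forall t th, enorm th = 1 ->
  T <= t -> enorm (G (- t) th - p) < e.
Hypothesis G_inj : forall (t t' : R) th th', enorm th = 1 -> enorm th' = 1 ->
  G t th = G t' th' -> t = t' /\ th = th'.
Hypothesis G_p : forall (t : R) th, enorm th = 1 -> G t th != p.
Hypothesis G_q : forall (t : R) th, enorm th = 1 -> G t th != q.
Hypothesis pq : p != q.

(** On the unit sphere this is [a / (1 - a ^+ 2)] for the height [a]: an increasing bijection from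
    the open interval between [-1] and [1] onto the line, inverted by solving a quadratic
    equation. *)
Definition suspension_time (x : 'rV[R]_n.+1) : R := height x / enorm (equatorial x) ^+ 2.
Definition suspension_dir (x : 'rV[R]_n.+1) : 'rV[R]_n :=
  (enorm (equatorial x))^-1 *: equatorial x.

Definition suspension_map (x : 'rV[R]_n.+1) : 'rV[R]_d :=
  if equatorial x == 0 then (if height x < 0 then p else q)
  else G (suspension_time x) (suspension_dir x).

Local Notation S := (@esphere R n).

Lemma sphere_suspendE x : S x -> height x ^+ 2 + enorm (equatorial x) ^+ 2 = 1.
Proof. by rewrite /esphere /= => x1; rewrite enorm_sqr -dotp_suspend -enorm_sqr x1 expr1n. Qed.

Lemma pole_height x : S x -> equatorial x = 0 -> height x = 1 \/ height x = -1.
Proof.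
move=> /sphere_suspendE + e0; rewrite e0 enorm0 expr0n addr0 => h.
have /eqP : height x ^+ 2 = 1 ^+ 2 by rewrite expr1n.
by rewrite eqf_sqr => /orP[] /eqP ->; [left|right].
Qed.

Lemma suspension_time_inj x y : S x -> S y -> equatorial x != 0 -> equatorial y != 0 ->
  suspension_time x = suspension_time y -> suspension_dir x = suspension_dir y -> x = y.
Proof.
move=> /sphere_suspendE Sx /sphere_suspendE Sy x0 y0.
have xp := enorm_gt0 x0; have yp := enorm_gt0 y0.
rewrite /suspension_time /suspension_dir => ht hd.
set a := height x in Sx ht; set b := height y in Sy ht.
set u := enorm (equatorial x) in Sx ht xp hd; set v := enorm (equatorial y) in Sy ht yp hd.
have u0 : u != 0 by rewrite gt_eqF.
have v0 : v != 0 by rewrite gt_eqF.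
have h : a * v ^+ 2 = b * u ^+ 2.
  have := congr1 (fun z => z * u ^+ 2 * v ^+ 2) ht.
  by rewrite divfK ?expf_neq0 // mulrAC divfK ?expf_neq0.
(* Equal times say [a * (1 - b ^+ 2) = b * (1 - a ^+ 2)], which factors; the second factor is
   nonzero because both heights are less than [1] in absolute value. *)
have h2 : (a - b) * (1 + a * b) = 0.
  have -> : (a - b) * (1 + a * b) = a * (1 - b ^+ 2) - b * (1 - a ^+ 2) by ring.
  have -> : 1 - b ^+ 2 = v ^+ 2 by rewrite -Sy addrAC subrr add0r.
  have -> : 1 - a ^+ 2 = u ^+ 2 by rewrite -Sx addrAC subrr add0r.
  by rewrite h subrr.
have u2 : 0 < u ^+ 2 by rewrite exprn_gt0.
have v2 : 0 < v ^+ 2 by rewrite exprn_gt0.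
have ab : a = b.
  move/eqP: h2; rewrite mulf_eq0 => /orP[|/eqP h2]; first by rewrite subr_eq0 => /eqP.
  have := sqr_ge0 (a + b); have -> : (a + b) ^+ 2 = a ^+ 2 + 2 * (a * b) + b ^+ 2 by ring.
  lra.
have uv : u = v.
  by apply/eqP; rewrite -(@eqrXn2 _ 2) ?ltW //; apply/eqP; move: Sx Sy; rewrite ab; lra.
rewrite -[x]suspend_eta -[y]suspend_eta -/a -/b ab; congr suspend.
have := congr1 (fun z => u *: z) hd.
by rewrite [in RHS]uv !scalerA !mulfV ?scale1r.
Qed.

Lemma suspension_map_inj x y : S x -> S y -> suspension_map x = suspension_map y -> x = y.
Proof.
move=> Sx Sy; rewrite /suspension_map.
have dir1 z : equatorial z != 0 -> enorm (suspension_dir z) = 1 := fun h => unit_vector h.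
have [x0|x0] := eqVneq (equatorial x) 0; have [y0|y0] := eqVneq (equatorial y) 0.
- rewrite -[x]suspend_eta -[y]suspend_eta x0 y0.
  rewrite !height_suspend.
  have [->|->] := pole_height Sx x0; have [->|->] := pole_height Sy y0; rewrite ?ltrN10 ?ltr10 //.
    by move/eqP; rewrite eq_sym (negbTE pq).
  by move/eqP; rewrite (negbTE pq).
- by case: ifP => _ /eqP; rewrite eq_sym ?(negbTE (G_p _ (dir1 _ y0))) ?(negbTE (G_q _ (dir1 _ y0))).
- by case: ifP => _ /eqP; rewrite ?(negbTE (G_p _ (dir1 _ x0))) ?(negbTE (G_q _ (dir1 _ x0))).
move=> h; have [ht hd] := G_inj (dir1 _ x0) (dir1 _ y0) h.
exact: suspension_time_inj.
Qed.

Lemma suspension_map_cont : econt S suspension_map.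
Proof.
move=> x Sx e e0.
have dir1 z : equatorial z != 0 -> enorm (suspension_dir z) = 1 := fun h => unit_vector h.
have [x0|x0] := eqVneq (equatorial x) 0.
  (* Near a pole the time tends to infinity with the sign of [height x], which is [1] or [-1],
     whatever the direction; multiplying by [height x] treats both poles at once. *)
  have near_time (T : R) : exists2 dl, 0 < dl & forall y, S y -> enorm (y - x) < dl ->
     0 < height x * height y /\
     (equatorial y != 0 -> T <= height x * suspension_time y).
    have T1 : 0 < `|T| + 1 by rewrite ltr_wpDl.
    pose d1 := Num.min (1 / 2) (1 / (2 * (`|T| + 1))).
    have d10 : 0 < d1 by rewrite lt_min !divr_gt0 // mulr_gt0.
    exists d1 => // y Sy yx.
    have d11 : d1 <= 1 / 2 by rewrite ge_min lexx.
    have d12 : d1 * (2 * (`|T| + 1)) <= 1.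
      by rewrite -ler_pdivlMr ?mulr_gt0 // ge_min lexx orbT.
    have hxy : `|height y - height x| < d1.
      by rewrite -heightB; apply: le_lt_trans yx; exact: height_le.
    have exy : enorm (equatorial y) < d1.
      apply: le_lt_trans yx; rewrite -[equatorial y]subr0 -x0 -equatorialB.
      exact: equatorial_le.
    have hh : 1 / 2 < height x * height y.
      move: hxy; rewrite ltr_norml => /andP[l1 l2].
      by have [E|E] := pole_height Sx x0; rewrite E in l1 l2 *; lra.
    split; first lra.
    move=> y0; have yp := enorm_gt0 y0.
    rewrite /suspension_time mulrA ler_pdivlMr ?exprn_gt0 //.
    set u := enorm _ in exy yp *.
    have u2 : u ^+ 2 <= d1.
      by rewrite expr2; apply: le_trans (_ : u * 1 <= _); [rewrite ler_pM2l //; lra|rewrite mulr1 ltW].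
    have h3 : T * u ^+ 2 <= (`|T| + 1) * u ^+ 2.
      by rewrite ler_wpM2r ?sqr_ge0 //; have := ler_norm T; lra.
    have h4 : (`|T| + 1) * u ^+ 2 <= (`|T| + 1) * d1 by rewrite ler_pM2l.
    by apply: le_trans (ltW hh); apply: le_trans h3 (le_trans h4 _); lra.
  have [h1|h1] := pole_height Sx x0.
    have [T hT] := G_pos e0; have [dl dl0 hdl] := near_time T.
    exists dl => // y Sy yx; have [hy ty] := hdl y Sy yx.
    rewrite h1 !mul1r in hy ty; rewrite /suspension_map x0 eqxx h1 ltr10.
    have [y0|y0] := eqVneq (equatorial y) 0; first by rewrite (lt_gtF hy) subrr enorm0.
    by apply: hT; [exact: dir1|exact: ty].
  have [T hT] := G_neg e0; have [dl dl0 hdl] := near_time T.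
  exists dl => // y Sy yx; have [hy ty] := hdl y Sy yx.
  rewrite h1 !mulN1r in hy ty; rewrite /suspension_map x0 eqxx h1 ltrN10.
  have [y0|y0] := eqVneq (equatorial y) 0; first by rewrite -oppr_gt0 hy subrr enorm0.
  by rewrite -[suspension_time y]opprK; apply: hT; [exact: dir1|exact: ty].
have [d1 d10 hd1] := G_cont (suspension_time x) (dir1 _ x0) e0.
have ux := enorm_gt0 x0.
have FF : Filter (nbhs x) by exact: nbhs_filter.
have ch : height y @[y --> x] --> height x.
  apply/(@cvgrPdist_lt _ _ _ _ FF) => r r0; apply/nbhs_enormP; exists r => // y yx.
  by rewrite -heightB; apply: le_lt_trans (height_le _) _; rewrite enormB.
have ce : enorm (equatorial y) @[y --> x] --> enorm (equatorial x).
  apply/(@cvgrPdist_lt _ _ _ _ FF) => r r0; apply/nbhs_enormP; exists r => // y yx.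
  apply: le_lt_trans (ler_enorm_sub _ _) _; rewrite -equatorialB.
  by apply: le_lt_trans (equatorial_le _) _; rewrite enormB.
have ct : suspension_time y @[y --> x] --> suspension_time x.
  apply: (@cvgM _ _ _ FF) => //; apply: (@cvgV _ _ _ FF); first by rewrite expf_neq0 // gt_eqF.
  exact: (@cvgM _ _ _ FF).
have /(@cvgrPdist_lt _ _ _ _ FF)/(_ _ d10)/nbhs_enormP[d2 d20 hd2] := ct.
exists (Num.min d2 (enorm (equatorial x) * Num.min 1 (d1 / 2))).
  by rewrite lt_min d20 mulr_gt0 // lt_min ltr01 divr_gt0.
move=> y Sy; rewrite lt_min => /andP[y1 y2].
set ex := equatorial x in x0 ux y2 *; set ey := equatorial y.
have exy : enorm (ey - ex) < enorm ex * Num.min 1 (d1 / 2).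
  by apply: le_lt_trans y2; rewrite -equatorialB; exact: equatorial_le.
have exy1 : enorm (ey - ex) < enorm ex.
  by apply: lt_le_trans exy _; rewrite ler_piMr // ge_min lexx.
have exy2 : enorm (ey - ex) < enorm ex * (d1 / 2).
  by apply: lt_le_trans exy _; rewrite ler_pM2l // ge_min lexx orbT.
have y0 : ey != 0.
  by apply: contraTneq exy1 => ->; rewrite sub0r enormN ltxx.
have uy := enorm_gt0 y0.
rewrite /suspension_map (negbTE y0) (negbTE x0); apply: hd1; first exact: dir1.
  by rewrite distrC; exact: hd2.
apply: le_lt_trans (ler_normalize y0 x0) _.
by rewrite ltr_pdivrMr // mulrC -ltr_pdivlMr // [d1 * _]mulrC -mulrA.
Qed.

Lemma suspension_map_range x : S x -> [\/ suspension_map x = p, suspension_map x = q |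
  exists t, exists2 th, enorm th = 1 & suspension_map x = G t th].
Proof.
move=> Sx; rewrite /suspension_map; have [x0|x0] := eqVneq (equatorial x) 0.
  by case: ifP; [constructor 1|constructor 2].
constructor 3; exists (suspension_time x), (suspension_dir x) => //; exact: unit_vector.
Qed.

Lemma suspension_map_p : exists2 x, S x & suspension_map x = p.
Proof.
exists (suspend (-1) 0).
  apply/eqP; rewrite -(@eqrXn2 _ 2) ?enorm_ge0 // enorm_sqr dotp_suspend height_suspend.
  by rewrite equatorial_suspend dotp0 sqrrN expr1n addr0.
by rewrite /suspension_map equatorial_suspend eqxx height_suspend ltrN10.
Qed.

Lemma suspension_map_q : exists2 x, S x & suspension_map x = q.
Proof.
exists (suspend 1 0).
  apply/eqP; rewrite -(@eqrXn2 _ 2) ?enorm_ge0 // enorm_sqr dotp_suspend height_suspend.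
  by rewrite equatorial_suspend dotp0 expr1n addr0.
by rewrite /suspension_map equatorial_suspend eqxx height_suspend ltr10.
Qed.

(* The height [a] solves [a / (1 - a ^+ 2) = t]. *)
Lemma suspension_map_G (t : R) th : enorm th = 1 -> exists2 x, S x & suspension_map x = G t th.
Proof.
move=> th1; pose D := Num.sqrt (1 + 4 * t ^+ 2).
have t2 := sqr_ge0 t.
have D2 : D ^+ 2 = 1 + 4 * t ^+ 2 by rewrite sqr_sqrtr //; lra.
have D0 : 0 <= D := sqrtr_ge0 _.
have D1 : 0 < 1 + D by lra.
pose m := Num.sqrt (2 / (1 + D)).
have m0 : 0 < m by rewrite sqrtr_gt0 divr_gt0.
have m2 : m ^+ 2 = 2 / (1 + D) by rewrite sqr_sqrtr // divr_ge0 // ltW.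
have ev : equatorial (suspend (2 * t / (1 + D)) (m *: th)) = m *: th by rewrite equatorial_suspend.
have em : enorm (m *: th) = m by rewrite enormZ th1 mulr1 ger0_norm // ltW.
exists (suspend (2 * t / (1 + D)) (m *: th)).
  apply/eqP; rewrite -(@eqrXn2 _ 2) ?enorm_ge0 // enorm_sqr dotp_suspend height_suspend.
  rewrite ev -enorm_sqr em m2 expr1n; apply/eqP.
  have -> : (2 * t / (1 + D)) ^+ 2 = (D ^+ 2 - 1) / (1 + D) ^+ 2.
    by rewrite D2; field; rewrite gt_eqF.
  by field; rewrite gt_eqF.
have n0 : m *: th != 0.
  by apply/eqP => h; move: em; rewrite h enorm0 => h'; move: m0; rewrite -h' ltxx.
rewrite /suspension_map ev (negbTE n0) /suspension_time /suspension_dir ev height_suspend em.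
rewrite scalerA mulVf ?gt_eqF // scale1r m2; congr (G _ th).
by field; rewrite gt_eqF.
Qed.

End Suspension.

(** * The orbits from the farthest point to the common sink as a suspension *)

Section NormalizedSphere.
Context {R : realType} {n d : nat}.
Variables (M : set 'rV[R]_d) (P : 'rV[R]_d -> 'M[R]_d) (kap del C : R) (p : 'rV[R]_d).
Hypothesis up : @unit_position R n d M P kap del C p.

Let td := up_td up.

Variables (Fp : R -> 'rV[R]_d -> 'rV[R]_d) (Lp Bp : R).
Hypothesis gp : gradient_flow M P p Fp Lp Bp.
Variables (Fz : R -> 'rV[R]_d -> 'rV[R]_d) (Lz Bz : R).
Hypothesis gz : gradient_flow M P (midpt p) Fz Lz Bz.

Local Notation hz x := (dotp (x - midpt p) (x - midpt p)).
Local Notation reachp := (reach del p Fp).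
Local Notation sinkz := (sink M P kap (midpt p)).
Local Notation attr := (attracted Fz).

Lemma upper_near : exists2 r0, 0 < r0 & forall x, M x -> enorm (x - p) < r0 ->
  reachp x /\ 3 / 4 <= hz x.
Proof.
exists (Num.min (1 / 2) del); first by rewrite lt_min divr_gt0 // (td_del td).
move=> x Mx; rewrite lt_min => /andP[x1 x2]; split; first exact: (reach_near gp).
have e1 : enorm (p - midpt p) = 3 / 2.
  have -> : p - midpt p = (3 / 2) *: p.
    by apply/rowP => i; rewrite !mxE; field.
  by rewrite enormZ (enorm_p (up_p1 up)) mulr1 ger0_norm.
have : 1 <= enorm (x - midpt p).
  have := ler_enorm_dist x p (midpt p); rewrite (enormB p x) e1; lra.
rewrite -enorm_sqr => h; have : 1 ^+ 2 <= enorm (x - midpt p) ^+ 2.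
  by rewrite lerXn2r ?nnegrE ?enorm_ge0.
rewrite expr1n; lra.
Qed.

Lemma lower_sink x : M x -> reachp x -> 3 / 4 <= hz x -> x != p ->
  exists2 q, sinkz q /\ hz q < 3 / 4 & attr x q.
Proof.
move=> Mx rx hx xp; have [t t0 ht] := orbit_leaves_upper up gp gz Mx rx hx xp.
have Mt := gf_in gz (- t) Mx.
have k0 := td_kap td.
have kt : kap * enorm (Fz (- t) x - midpt p) < 1.
  rewrite -(@ltr_pXn2r _ 2) ?nnegrE ?mulr_ge0 ?enorm_ge0 ?(ltW k0) // expr1n exprMn enorm_sqr.
  have := up_kap up; have k2 : 0 < kap ^+ 2 by rewrite exprn_gt0.
  rewrite -(ltr_pM2l k2) in ht; lra.
have [q [sq qt] aq] := attracted_exists td gz Mt kt.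
exists q; last exact: (attracted_shift gz (T := t)).
split=> //; apply: le_lt_trans ht.
by rewrite -!enorm_sqr lerXn2r ?nnegrE ?enorm_ge0.
Qed.

Hypothesis pc : forall x, M x -> punctured_connected M x.

(** Basins are open, so the sink reached is a locally constant function on a connected punctured
    neighbourhood of [p]. *)
Lemma common_sink : exists2 q, sinkz q /\ hz q < 3 / 4 & exists2 r1, 0 < r1 &
  forall x, M x -> enorm (x - p) < r1 -> [/\ reachp x, 3 / 4 <= hz x & x != p -> attr x q].
Proof.
have [r0 r00 hr0] := upper_near.
have [A [cA hA [e' e'0 he']]] := pc (up_p up) r00.
have m0 : 0 < Num.min r0 e' by rewrite lt_min r00.
have [x1 Mx1 [x1p]] := not_isolated td (up_n0 up) (up_p up) m0.
rewrite lt_min => /andP[x1r x1e].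
have [rx1 hx1] := hr0 x1 Mx1 x1r.
have [q [sq hq] aq] := lower_sink Mx1 rx1 hx1 x1p.
have Asub : A `<=` [set x | A x /\ attr x q].
  apply: connected_clopen => //; first by move=> x [].
  - by exists x1; split => //; exact: he'.
  - move=> x [Ax axq]; have [Mx _ _] := hA x Ax.
    have [dl dl0 hdl] := attracted_open td gz Mx sq axq.
    exists dl => // y Ay yx; split => //; apply: hdl => //; by have [] := hA y Ay.
  move=> x Ax nB; have [Mx xp xr] := hA x Ax; have [rx hx] := hr0 x Mx xr.
  have [q' [sq' _] aq'] := lower_sink Mx rx hx xp.
  have [dl dl0 hdl] := attracted_open td gz Mx sq' aq'.
  exists dl => // y Ay yx [_ ayq]; apply: nB; split => //.
  have [My _ _] := hA y Ay.
  by rewrite (attracted_unique ayq (hdl y My yx)).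
exists q => //; exists (Num.min r0 e') => //.
move=> x Mx; rewrite lt_min => /andP[xr xe]; have [rx hx] := hr0 x Mx xr.
split => // xp; have [] := Asub x _ => //; exact: he'.
Qed.

Variables (q : 'rV[R]_d) (r1 eps : R) (s : 'rV[R]_n -> 'rV[R]_d).
Hypotheses (sq : sinkz q) (hq : hz q < 3 / 4).
Hypothesis hr1 : forall x, M x -> enorm (x - p) < r1 ->
  [/\ reachp x, 3 / 4 <= hz x & x != p -> attr x q].
Hypotheses (eps0 : 0 < eps) (epsr : eps < r1).
Hypothesis sM : forall th, enorm th = 1 -> M (s th) /\ enorm (s th - p) = eps.
Hypothesis sC : econt (@usphere R n) s.
Hypothesis sI : forall th th', enorm th = 1 -> enorm th' = 1 -> s th = s th' -> th = th'.
Hypothesis sS : forall y, M y -> enorm (y - p) = eps -> exists2 th, enorm th = 1 & s th = y.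

(** Time runs along the descending flow: large [t] leads to [q], large [- t] back to [p]. *)
Definition orbit_of (t : R) th := Fz (- t) (s th).

Local Notation G := orbit_of.

Lemma section_props th : enorm th = 1 ->
  [/\ M (s th), reachp (s th), 3 / 4 <= hz (s th), s th != p & attr (s th) q].
Proof.
move=> th1; have [Ms hs] := sM th1.
have lt : enorm (s th - p) < r1 by rewrite hs.
have [h1 h2 h3] := hr1 Ms lt.
have sp : s th != p by rewrite -subr_eq0; apply/eqP => h; move: eps0; rewrite -hs h enorm0 ltxx.
by split => //; exact: h3.
Qed.

Lemma orbit_of_cont (t : R) th (e : R) : enorm th = 1 -> 0 < e ->
  exists2 dl, 0 < dl & forall (t' : R) th', enorm th' = 1 -> `|t' - t| < dl ->
    enorm (th' - th) < dl -> enorm (G t' th' - G t th) < e.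
Proof.
move=> th1 e0; have [Ms _] := sM th1.
have e20 : 0 < e / 2 by rewrite divr_gt0.
have [d1 d10 h1] := flow_time_econt td gz (- t) Ms e20.
pose E := expR (Lz * (`|t| + 1)); have E0 : 0 < E := expR_gt0 _.
have [d2 d20 h2] := sC th1 (divr_gt0 e20 E0).
exists (Num.min 1 (Num.min d1 d2)); first by rewrite !lt_min ltr01 d10.
move=> t' th' th'1; rewrite !lt_min => /andP[t1 /andP[t2 _]] /andP[_ /andP[_ t3]].
have [Ms' _] := sM th'1.
have b1 : enorm (Fz (- t') (s th') - Fz (- t') (s th)) < e / 2.
  apply: le_lt_trans (gf_lip gz (- t') Ms' Ms) _.
  have : enorm (s th' - s th) < e / 2 / E by apply: h2.
  rewrite ltr_pdivlMr // => h; apply: le_lt_trans h; rewrite mulrC ler_wpM2l //.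
  rewrite ler_expR ler_wpM2l ?(gf_Lp gz) // normrN.
  have := ler_normD (t' - t) t; rewrite subrK; lra.
have b2 : enorm (Fz (- t') (s th) - Fz (- t) (s th)) < e / 2.
  by apply: h1; rewrite opprK addrC distrC.
rewrite /G; have := ler_enorm_dist (Fz (- t') (s th)) (Fz (- t') (s th')) (Fz (- t) (s th)); lra.
Qed.

Lemma orbit_of_pos (e : R) : 0 < e -> exists T : R, forall t th, enorm th = 1 ->
  T <= t -> enorm (G t th - q) < e.
Proof.
move=> e0.
have [||e1 e10 h] := @compact_uniform R n (@usphere R n)
   (fun th e1 => forall t : R, e1^-1 <= t -> enorm (G t th - q) < e) (@compact_usphere R n).
- move=> th a b b0 ba h t ht; apply: h; apply: le_trans ht; rewrite lef_pV2 ?posrE //.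
  exact: lt_le_trans ba.
- move=> th th1; have [Ms _ _ _ asq] := section_props th1.
  have [T [dl dl0 hdl]] := attracted_uniform td gz Ms sq asq e0.
  have [d2 d20 h2] := sC th1 dl0.
  have T1 : 0 < `|T| + 1 by rewrite ltr_wpDl.
  exists (Num.min d2 (`|T| + 1)^-1); first by rewrite lt_min d20 invr_gt0.
  move=> th' th'1; rewrite lt_min => /andP[t1 _] t ht.
  apply: hdl; [by have [] := sM th'1|exact: h2|].
  apply: le_trans ht; apply: (@le_trans _ _ (`|T| + 1)).
    by have := ler_norm T; lra.
  rewrite -[leLHS]invrK lef_pV2 ?posrE ?invr_gt0 ?lt_min ?d20 ?invr_gt0 //.
  by rewrite ge_min lexx orbT.
by exists e1^-1 => t th th1 ht; exact: (h th).
Qed.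

(** Pointwise convergence becomes uniform because the distance to [p] does not grow again: at a time
    [T] where one orbit is within [e / 2], those of nearby directions are within [e], and they
    remain so. *)
Lemma orbit_of_neg (e : R) : 0 < e -> exists T : R, forall t th, enorm th = 1 ->
  T <= t -> enorm (G (- t) th - p) < e.
Proof.
move=> e0.
have [||e1 e10 h] := @compact_uniform R n (@usphere R n)
   (fun th e1 => forall t : R, e1^-1 <= t -> enorm (G (- t) th - p) < e) (@compact_usphere R n).
- move=> th a b b0 ba h t ht; apply: h; apply: le_trans ht; rewrite lef_pV2 ?posrE //.
  exact: lt_le_trans ba.
- move=> th th1; have [Ms rs hs _ _] := section_props th1.
  have e20 : 0 < e / 2 by rewrite divr_gt0.
  have [T T0 hT] := orbit_ascends up gp gz Ms rs hs e20.
  pose E := expR (Lz * `|T|); have E0 : 0 < E := expR_gt0 _.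
  have [d2 d20 h2] := sC th1 (divr_gt0 e20 E0).
  have T1 : 0 < T + 1 by lra.
  exists (Num.min d2 (T + 1)^-1); first by rewrite lt_min d20 invr_gt0.
  move=> th' th'1; rewrite lt_min => /andP[t1 _] t ht.
  have [Ms' rs' hs' _ _] := section_props th'1.
  have hT' : enorm (Fz T (s th') - p) < e.
    have := gf_lip gz T Ms' Ms; rewrite -/E.
    have : enorm (s th' - s th) < e / 2 / E by apply: h2.
    rewrite ltr_pdivlMr //; have := ler_enorm_dist (Fz T (s th)) (Fz T (s th')) p; lra.
  rewrite /G opprK; apply: le_lt_trans hT'; apply: enorm_le_sqr.
  apply: (farthest_dist_nonincreasing up gp gz) => //.
    apply: le_trans hs' _; rewrite -{1 2}(gf_0 gz Ms'); exact: (midpt_nondecreasing up gz).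
  apply: le_trans ht; apply: (@le_trans _ _ (T + 1)); first lra.
  rewrite -[leLHS]invrK lef_pV2 ?posrE ?invr_gt0 ?lt_min ?d20 ?invr_gt0 //.
  by rewrite ge_min lexx orbT.
by exists e1^-1 => t th th1 ht; exact: (h th).
Qed.

(** By [farthest_dist_decreasing], an orbit passes through points of the [r1]-ball around [p] with a
    different distance to [p] each time. *)
Lemma section_no_return (tau : R) y : M y -> enorm (y - p) = eps ->
  enorm (Fz tau y - p) = eps -> tau = 0.
Proof.
move=> My y1 y2; have My2 := gf_in gz tau My.
have l1 : enorm (y - p) < r1 by rewrite y1.
have l2 : enorm (Fz tau y - p) < r1 by rewrite y2.
have [ry hy _] := hr1 My l1; have [ry2 hy2 _] := hr1 My2 l2.
have yp : y != p by rewrite -subr_eq0; apply/eqP => h; move: eps0; rewrite -y1 h enorm0 ltxx.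
apply/eqP; apply: contraT; rewrite neq_lt => /orP[lt|lt].
  have := farthest_dist_decreasing up gp gz My ry hy yp hy2 lt.
  by rewrite (gf_0 gz) // -!enorm_sqr y1 y2 ltxx.
have hy0 : 3 / 4 <= hz (Fz 0 y) by rewrite (gf_0 gz).
have := farthest_dist_decreasing up gp gz My ry hy yp hy0 lt.
by rewrite (gf_0 gz) // -!enorm_sqr y1 y2 ltxx.
Qed.

Lemma orbit_of_inj (t t' : R) th th' : enorm th = 1 -> enorm th' = 1 ->
  G t th = G t' th' -> t = t' /\ th = th'.
Proof.
move=> th1 th'1 h; have [Ms es] := sM th1; have [Ms' es'] := sM th'1.
have E : s th = Fz (t - t') (s th').
  by rewrite (gf_D gz) // -/(G t' th') -h /G (flowNr gz).
have t0 : t - t' = 0 by apply: (section_no_return Ms' es'); rewrite -E.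
split; first by apply/eqP; rewrite -subr_eq0 t0.
by apply: sI => //; rewrite E t0 (gf_0 gz).
Qed.

Lemma sink_neq_near x : M x -> enorm (x - p) < r1 -> x != q.
Proof.
move=> Mx xr; have [_ hx _] := hr1 Mx xr.
by apply/eqP => xq; move: hx; rewrite xq leNgt hq.
Qed.

Lemma orbit_of_p (t : R) th : enorm th = 1 -> G t th != p.
Proof.
by move=> th1; have [Ms _ _ sp _] := section_props th1; exact: (orbit_neq up gz).
Qed.

Lemma orbit_of_q (t : R) th : enorm th = 1 -> G t th != q.
Proof.
move=> th1; have [Ms es] := sM th1; have [Mq q0 _] := sq.
apply/eqP => h; have lt : enorm (s th - p) < r1 by rewrite es.
have /eqP := sink_neq_near Ms lt; apply.
by rewrite -(flowNr gz t Ms) -/(G t th) h (critical_fixed gz).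
Qed.

Lemma farthest_neq_sink : p != q.
Proof.
apply: sink_neq_near; first exact: (up_p up).
by rewrite subrr enorm0 (lt_trans eps0).
Qed.

Definition swept x := x = p \/ exists t, exists2 th, enorm th = 1 & x = G t th.

Lemma swept_in x : swept x -> M x.
Proof.
case=> [->|[t [th th1 ->]]]; first exact: (up_p up).
by apply: (gf_in gz); have [] := sM th1.
Qed.

Lemma swept_flow (t : R) x : swept x -> swept (Fz t x).
Proof.
case=> [->|[u [th th1 ->]]]; first by left; exact: (farthest_fixed up gz).
right; exists (u - t), th => //; have [Ms _] := sM th1.
by rewrite /G -(gf_D gz) // opprB.
Qed.

(** The orbit of [x] has to cross the section: from outside because it ascends to [p], from inside
    because it descends to [q], whose distance from [p] is at least [r1]. The intermediate value
    theorem gives the crossing. *)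
Lemma swept_near x : M x -> enorm (x - p) < r1 -> swept x.
Proof.
move=> Mx xr; have [->|xp] := eqVneq x p; first by left.
have [rx hx ax] := hr1 Mx xr; have {}ax := ax xp.
right; suff [u hu] : exists u, dotp (Fz u x - p) (Fz u x - p) = eps ^+ 2.
  have Mu := gf_in gz u Mx.
  have [|th th1 hth] := sS Mu.
    by apply/eqP; rewrite -(@eqrXn2 _ 2) ?enorm_ge0 ?(ltW eps0) // enorm_sqr hu.
  by exists u, th => //; rewrite /G hth (flowN gz).
have [le|lt] := lerP eps (enorm (x - p)).
  have [T T0 hT] := orbit_ascends up gp gz Mx rx hx eps0.
  have [|u _ hu] := dist2_ivt gz (a := p) (v := eps ^+ 2) Mx T0; last by exists u.
  right; rewrite (gf_0 gz) // -!enorm_sqr !lerXn2r ?nnegrE ?enorm_ge0 ?(ltW eps0) //.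
  exact: ltW.
have qr : r1 <= enorm (q - p).
  rewrite leNgt; apply/negP => h; have [Mq _ _] := sq.
  by have := sink_neq_near Mq h; rewrite eqxx.
have gap : 0 < r1 - eps by rewrite subr_gt0.
have [T hT] := ax _ gap; pose t := Num.max 0 T.
have ht : enorm (Fz (- t) x - q) < r1 - eps by apply: hT; rewrite le_max lexx orbT.
have t0 : - t <= 0 by rewrite oppr_le0 le_max lexx.
have [|u _ hu] := dist2_ivt gz (a := p) (v := eps ^+ 2) Mx t0; last by exists u.
have ge : eps <= enorm (Fz (- t) x - p).
  have := ler_enorm_dist (Fz (- t) x) q p; rewrite (enormB q (Fz _ _)); lra.
right; rewrite (gf_0 gz) // -!enorm_sqr; apply/andP.
by split; rewrite lerXn2r ?nnegrE ?enorm_ge0 ?(ltW eps0) // ltW.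
Qed.

Lemma swept_open x : swept x -> exists2 dl, 0 < dl &
  forall y, M y -> enorm (y - x) < dl -> swept y.
Proof.
case=> [->|[t [th th1 ->]]].
  by exists r1; [exact: lt_trans epsr|move=> y; exact: swept_near].
have [Ms es] := sM th1; pose E := expR (Lz * `|t|); have E0 : 0 < E := expR_gt0 _.
have gap : 0 < r1 - eps by rewrite subr_gt0.
exists ((r1 - eps) / E); first by rewrite divr_gt0.
move=> y My; rewrite ltr_pdivlMr // => yx.
rewrite -(flowN gz t My); apply: swept_flow; apply: swept_near; first exact: (gf_in gz).
have := gf_lip gz t My (gf_in gz (- t) Ms); rewrite (flowNr gz) // -/E.
have := ler_enorm_dist (s th) (Fz t y) p; rewrite es; move: yx; rewrite /G; lra.
Qed.

Hypothesis cM : connected M.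

Local Notation T := (suspension_map p q G).

(** The image is compact, hence closed. It is open away from [q] by [swept_open]. At [q], the swept
    set is open and closed in a connected punctured neighbourhood, and it is not empty there since
    an orbit converging to [q] enters. *)
Lemma suspension_image : T @` (@esphere R n) = M.
Proof.
have c1 := suspension_map_cont orbit_of_cont orbit_of_pos orbit_of_neg.
set I := T @` _.
have cI : compact I.
  apply: continuous_compact; first exact/within_econtP.
  exact: compact_usphere.
have IP x : I x <-> x = q \/ swept x.
  split=> [[z Sz <-]|].
    have [h|h|[t [th th1 h]]] := suspension_map_range p q G Sz.
    - by right; left.
    - by left.
    by right; right; exists t, th.
  case=> [->|[->|[t [th th1 ->]]]].
  - by have [z Sz hz'] := suspension_map_q p q G; exists z.
  - by have [z Sz hz'] := suspension_map_p p q G; exists z.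
  by have [z Sz hz'] := suspension_map_G p q G t th1; exists z.
have [Mq q0 _] := sq.
have IM : I `<=` M by move=> x /IP[->//|]; exact: swept_in.
have nI x : ~ I x -> exists2 e, 0 < e & forall y, enorm (y - x) < e -> ~ I y.
  move=> nIx; apply: contrapT => no; apply: nIx; apply: (compact_closed_seq cI) => e e0.
  by apply: contrapT => no'; apply: no; exists e => // y yx Iy; apply: no'; exists y.
apply/seteqP; split=> //.
apply: connected_clopen => //.
- by exists q; apply/IP; left.
- move=> x /IP[->|sx]; last first.
    by have [dl dl0 h] := swept_open sx; exists dl => // y My yx; apply/IP; right; exact: h.
  have [A [cA hA [e' e'0 he']]] := pc Mq ltr01.
  have [x1 Mx1 [x1p x1r]] := not_isolated td (up_n0 up) (up_p up) (lt_trans eps0 epsr).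
  have [rx1 hx1 ax1] := hr1 Mx1 x1r; have {}ax1 := ax1 x1p.
  have Asub : A `<=` [set x | A x /\ swept x].
    apply: connected_clopen => //; first by move=> z [].
    - have [t ht] := ax1 e' e'0; exists (Fz (- t) x1).
      have sx1 : swept (Fz (- t) x1) by apply: swept_flow; exact: swept_near.
      split=> //; apply: he'; [exact: swept_in| |exact: ht].
      case: sx1 => [->|[u [th th1 ->]]]; [exact: farthest_neq_sink|exact: orbit_of_q].
    - move=> z [Az sz]; have [dl dl0 h] := swept_open sz.
      by exists dl => // y Ay yz; split=> //; apply: h => //; have [] := hA y Ay.
    move=> z Az nz; have [_ zq _] := hA z Az.
    have [|e e0 he] := nI z.
      by move=> /IP[zq'|sz]; [move: zq; rewrite zq' eqxx|apply: nz].
    by exists e => // y Ay yz [_ sy]; apply: (he y yz); apply/IP; right.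
  exists e' => // y My yq; apply/IP; have [->|yq'] := eqVneq y q; first by left.
  by right; have [] := Asub y _ => //; exact: he'.
by move=> x Mx /nI[e e0 he]; exists e => // y My yx; exact: he.
Qed.

Lemma suspension_homeomorphic : homeomorphic M (@esphere R n).
Proof.
have c1 := suspension_map_cont orbit_of_cont orbit_of_pos orbit_of_neg.
have inj := suspension_map_inj orbit_of_inj orbit_of_p orbit_of_q farthest_neq_sink.
have /choice[g hg] : forall y, exists x, M y -> esphere x /\ T x = y.
  move=> y; have [My|] := pselect (M y); last by exists 0.
  by have : (T @` (@esphere R n)) y by [rewrite suspension_image]; case=> x Sx xy; exists x.
exists g, T; split.
- by move=> y My; exact: hg.
- move=> x Sx; have MT : M (T x) by rewrite -suspension_image; exists x.
  by split=> //; have [S' e] := hg _ MT; apply: inj.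
- apply/within_econtP; apply: (compact_inverse_econt (A := @esphere R n) _ c1) => //.
  exact: compact_usphere.
exact/within_econtP.
Qed.

End NormalizedSphere.

Lemma unit_position_homeomorphic (R : realType) (n d : nat) (M : set 'rV[R]_d) P
    (kap del C : R) (p : 'rV[R]_d) : @unit_position R n d M P kap del C p -> connected M ->
  (forall x, M x -> punctured_connected M x) -> sphere_sections n M p ->
  homeomorphic M (@esphere R n).
Proof.
move=> up cM pc ss; have td := up_td up.
have [Fp [Lp [Bp gp]]] := exists_gradient_flow td p.
have [Fz [Lz [Bz gz]]] := exists_gradient_flow td (midpt p).
have [q [sq hq] [r1 r10 hr1]] := common_sink up gp gz pc.
have [eps /andP[eps0 epsr] [s [s1 s2 s3 s4]]] := ss r1 r10.
exact: (suspension_homeomorphic up gp gz pc sq hq hr1 eps0 epsr s1 s2 s3 s4 cM).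
Qed.

(** * Punctured neighbourhoods and small spheres *)

Section PuncturedBall.
Context {R : realType} {n : nat}.
Implicit Types (u v y : 'rV[R]_n) (e : R).

Lemma star_connected (A : set 'rV[R]_n) u : A u ->
  (forall y (t : R), A y -> 0 <= t <= 1 -> A (u + t *: (y - u))) -> connected A.
Proof.
move=> Au star.
have -> : A = \bigcup_(y in A) ((fun t : R => u + t *: (y - u)) @` `[0, 1]%classic).
  apply/seteqP; split=> [y Ay|z [y Ay [t]]].
    by exists y => //; exists 1; [rewrite /= in_itv /= lexx ler01|rewrite scale1r addrC subrK].
  by rewrite /= in_itv /= => t01 <-; exact: star.
apply: bigcup_connected.
  exists u => y Ay; exists 0; first by rewrite /= in_itv /= lexx ler01.
  by rewrite scale0r addr0.
move=> y Ay; apply: connected_continuous_connected; first exact: segment_connected.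
apply: continuous_subspaceT => t; apply: cvgD; first exact: cvg_cst.
by apply: cvgZr_tmp; exact: cvg_id.
Qed.

Definition punctured_ball e : set 'rV[R]_n := [set y | y != 0 /\ enorm y < e].

(** The points that the origin does not hide from [u] form a set star-shaped about [u]. *)
Lemma visible_connected e u : u != 0 -> enorm u < e ->
  connected [set y | enorm y < e /\ forall t : R, 0 <= t <= 1 -> u + t *: (y - u) != 0].
Proof.
move=> u0 ue; apply: (@star_connected _ u).
  by split=> // t _; rewrite subrr scaler0 addr0.
move=> y t [ye hy] /andP[t0 t1]; split.
  have -> : u + t *: (y - u) = (1 - t) *: u + t *: y.
    by apply/rowP => i; rewrite !mxE; ring.
  apply: le_lt_trans (ler_enormD _ _) _.
  rewrite !enormZ (ger0_norm t0) ger0_norm ?subr_ge0 //.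
  have [->|tn0] := eqVneq t 0; first by rewrite mul0r subr0 mul1r addr0.
  have tp : 0 < t by rewrite lt_neqAle eq_sym tn0.
  have h1 : (1 - t) * enorm u <= (1 - t) * e by rewrite ler_wpM2l ?subr_ge0 // ltW.
  have h2 : t * enorm y < t * e by rewrite ltr_pM2l.
  lra.
move=> t' /andP[t'0 t'1]; have -> : u + t' *: (u + t *: (y - u) - u) = u + (t' * t) *: (y - u).
  by apply/rowP => i; rewrite !mxE; ring.
by apply: hy; rewrite mulr_ge0 //= mulr_ile1.
Qed.

(** A nonzero point cannot be hidden by the origin from both [u] and [- u], so two star-shaped sets
    cover the punctured ball. A vector along a second axis, available since [n > 1], lies in
    both. *)
Lemma punctured_ball_connected e : (1 < n)%N -> 0 < e -> connected (punctured_ball e).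
Proof.
move=> n1 e0; pose i0 := Ordinal (ltnW n1); pose i1 := Ordinal n1.
have i01 : i1 != i0 by [].
pose dl i : 'rV[R]_n := (e / 2) *: delta_mx 0 i.
have e2 : 0 < e / 2 by rewrite divr_gt0.
have dln i : enorm (dl i) = e / 2.
  rewrite enormZ ger0_norm ?(ltW e2) //.
  have -> : enorm (delta_mx 0 i : 'rV[R]_n) = 1; last by rewrite mulr1.
  apply/eqP; rewrite -(@eqrXn2 _ 2) ?enorm_ge0 // enorm_sqr expr1n.
  Local Transparent dotp.
  rewrite /dotp (bigD1 i) //= !mxE !eqxx mulr1 big1 ?addr0 // => j ji.
  by rewrite !mxE (negbTE ji) /= mulr0.
  Local Opaque dotp.
set u := dl i0; have ue : enorm u < e by rewrite dln; lra.
have u0 : u != 0 by apply/eqP => h; move: e2; rewrite -(dln i0) -/u h enorm0 ltxx.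
pose V (w : 'rV[R]_n) := [set y | enorm y < e /\ forall t : R, 0 <= t <= 1 -> w + t *: (y - w) != 0].
have -> : punctured_ball e = V u `|` V (- u).
  apply/seteqP; split=> [y [y0 ye]|y]; last first.
    by move=> [[ye h]|[ye h]]; split=> //; have := h 1; rewrite scale1r addrC subrK; apply;
      rewrite ler01 lexx.
  apply: contrapT => /not_orP[nu nv].
  have neg w : ~ V w y -> exists2 t : R, 0 <= t <= 1 & w + t *: (y - w) = 0.
    move=> nw; apply: contrapT => no; apply: nw; split=> // t t01.
    by apply/eqP => h; apply: no; exists t.
  have [t /andP[t0 t1] ht] := neg _ nu; have [t' /andP[t'0 t'1] ht'] := neg _ nv.
  (* Eliminating [y] from the two segments through the origin leaves a multiple of [u] with a
     nonnegative coefficient. *)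
  have h0 : (t' * (1 - t) + t * (1 - t')) *: u = 0.
    have -> : (t' * (1 - t) + t * (1 - t')) *: u =
       t' *: (u + t *: (y - u)) - t *: (- u + t' *: (y - - u)).
      by apply/rowP => i; rewrite !mxE; ring.
    by rewrite ht ht' !scaler0 subrr.
  move/eqP: h0; rewrite scaler_eq0 (negbTE u0) orbF.
  rewrite paddr_eq0 ?mulr_ge0 ?subr_ge0 // !mulf_eq0 !subr_eq0.
  have tn0 : t != 0 by apply: contra_eq_neq ht => ->; rewrite scale0r addr0.
  have t'n0 : t' != 0 by apply: contra_eq_neq ht' => ->; rewrite scale0r addr0 oppr_eq0.
  rewrite (negbTE tn0) (negbTE t'n0) /= => /andP[/eqP t1' _].
  by move: ht; rewrite -t1' scale1r addrC subrK => /eqP; rewrite (negbTE y0).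
apply: connectedU.
- exists (dl i1).
  have vis (w : 'rV[R]_n) : w 0 i1 = 0 -> w 0 i0 != 0 -> V w (dl i1).
    move=> w1 w0; split; first by rewrite dln; lra.
    move=> t _; apply/eqP => /rowP h.
    have := h i1; rewrite !mxE w1 !eqxx mulr1 subr0 add0r => /eqP.
    rewrite mulf_eq0 (gt_eqF e2) orbF => /eqP t0.
    by have /eqP := h i0; rewrite !mxE t0 mul0r addr0 (negbTE w0).
  have u1 : u 0 i1 = 0 by rewrite !mxE (negbTE i01) mulr0.
  have u00 : u 0 i0 != 0 by rewrite !mxE !eqxx mulr1 gt_eqF.
  by split; apply: vis; rewrite // mxE ?u1 ?oppr0 ?oppr_eq0.
- exact: visible_connected.
by apply: visible_connected; rewrite ?oppr_eq0 ?enormN.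
Qed.

End PuncturedBall.

Section ChartTopology.
Context {R : realType} {n d : nat}.
Variables (M : set 'rV[R]_d).

Lemma chart_econt p U (phi : 'rV[R]_n -> 'rV[R]_d) y : chart_at M p U phi y -> econt U phi.
Proof. by move=> [[_ _ _ [V _ [g [_ _ fc _]]]] _ _]; exact/within_econtP. Qed.

Lemma submanifold_punctured x : submanifold n M -> (1 < n)%N -> M x -> punctured_connected M x.
Proof.
move=> sM n1 Mx e e0; have [U [phi [lp [y Uy pyx]]]] := sM x Mx.
have ch : chart_at M x U phi y by split.
have [oU sm inj _] := lp.
have [e1 e10 [c c0 [C C0 [hU hb]]]] := derivative_bounds oU sm Uy (inj _ Uy).
have [MU inv] := chart_at_inverse ch.
have [e2 e20 he2] := chart_econt ch Uy e0.
pose e3 := Num.min e1 e2; have e30 : 0 < e3 by rewrite lt_min e10.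
have shift a : enorm (y + a - y) = enorm a by rewrite addrC addKr.
have Ua a : enorm a < e3 -> U (y + a).
  by rewrite lt_min => /andP[a1 _]; apply: hU; rewrite shift.
exists ((fun a => phi (y + a)) @` (@punctured_ball R n e3)); split.
- apply: connected_continuous_connected; first exact: punctured_ball_connected.
  apply/within_econtP => a [a0 ae] r r0.
  have [dl dl0 hdl] := chart_econt ch (Ua a ae) r0.
  exists dl => // b [_ be] ba; apply: hdl; first exact: Ua.
  by rewrite opprD addrACA subrr add0r.
- move=> _ [a [a0 ae] <-]; have Uya := Ua a ae.
  move: ae; rewrite lt_min => /andP[a1 a2]; split; first exact: MU.
    apply/eqP => h; have yy : enorm (y - y) < e1 by rewrite subrr enorm0.
    have [_ + _ _ _] := hb y yy.
    move=> /(_ (y + a)); rewrite shift => /(_ a1); rewrite h pyx subrr enorm0.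
    by rewrite leNgt mulr_gt0 // enorm_gt0.
  by rewrite -pyx; apply: he2; rewrite ?shift.
have [dl dl0 hdl] := inv e3 e30.
exists dl => // q Mq qx qd; have [z [Uz zy pz]] := hdl q Mq qd.
exists (z - y); last by rewrite addrC subrK.
split=> //; rewrite subr_eq0; apply/eqP => zy'.
by move: qx; rewrite -pz zy' pyx eqxx.
Qed.

(** Along each ray of the chart the distance to [x] is strictly increasing, and at parameter radius
    [e2] it exceeds [eps]. So each ray meets the sphere of radius [eps] exactly once in the chart
    ball, at radius [rad a]; continuity follows from compactness. *)
Lemma submanifold_sphere_sections x : submanifold n M -> M x -> sphere_sections n M x.
Proof.
move=> sM Mx e e0; have [U [phi [lp [y Uy pyx]]]] := sM x Mx.
have ch : chart_at M x U phi y by split.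
have [oU sm inj _] := lp.
have [e1 e10 [c c0 [C C0 [hU hb]]]] := derivative_bounds oU sm Uy (inj _ Uy).
have [MU inv] := chart_at_inverse ch.
pose e2 := e1 / 2; have e20 : 0 < e2 by rewrite divr_gt0.
have e21 : e2 < e1 by rewrite /e2; lra.
have [dl dl0 hdl] := inv e2 e20.
have yy : enorm (y - y) < e1 by rewrite subrr enorm0.
have shift a : enorm (y + a - y) = enorm a by rewrite addrC addKr.
have lower a : enorm a < e1 -> c * enorm a <= enorm (phi (y + a) - x).
  move=> ae; have [_ + _ _ _] := hb y yy.
  by move=> /(_ (y + a)); rewrite shift pyx; exact.
have Ua a : enorm a < e1 -> U (y + a) by move=> ae; apply: hU; rewrite shift.
pose g (a : 'rV[R]_n) (r : R) := dotp (phi (y + r *: a) - x) (phi (y + r *: a) - x).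
have gE a r : g a r = enorm (phi (y + r *: a) - x) ^+ 2 by rewrite enorm_sqr.
have ra (a : 'rV[R]_n) (r : R) : enorm a = 1 -> 0 <= r -> enorm (r *: a) = r.
  by move=> a1 r0; rewrite enormZ a1 mulr1 ger0_norm.
have dg a (r : R) : enorm a = 1 -> `|r| < e1 ->
   is_derive r 1 (g a) (2 * dotp (phi (y + r *: a) - x) ('D_a phi (y + r *: a))).
  move=> a1 re; have Ur : U (y + r *: a) by apply: Ua; rewrite enormZ a1 mulr1.
  have h0 : is_derive r 1 (fun t : R => phi (y + t *: a)) ('D_a phi (y + r *: a)).
    by apply: is_derive_line; apply: diff_derivable; exact: (chart_diff sm).
  have h := is_deriveB h0 (is_derive_cst x r 1); rewrite subr0 in h.
  apply: (is_derive_eq (is_derive_dotp h h)).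
  by rewrite dotpC -mulr2n mulr_natl.
have mono a (r r' : R) : enorm a = 1 -> 0 <= r -> r < r' -> r' < e1 -> g a r < g a r'.
  move=> a1 r0 rr' r'e.
  have dall (s : R) : r <= s <= r' ->
      is_derive s 1 (g a) (2 * dotp (phi (y + s *: a) - x) ('D_a phi (y + s *: a))).
    move=> /andP[h1 h2]; apply: dg => //.
    by rewrite ger0_norm ?(le_trans r0) //; apply: le_lt_trans r'e.
  have [s /andP[s1 s2] E] := mean_value rr' dall.
  rewrite -subr_gt0 E mulr_gt0 ?subr_gt0 // mulr_gt0 //.
  have s0 : 0 < s by apply: le_lt_trans s1.
  have sa : enorm (y + s *: a - y) < e1.
    by rewrite shift ra // ?ltW //; exact: lt_trans r'e.
  (* The chart estimate based at [y + s *: a] and applied to the point [y] says that the radial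
     derivative is positive. *)
  have [+ _ _ _ _] := hb _ sa; move=> /(_ y yy).
  have -> : y - (y + s *: a) = - s *: a by rewrite opprD addrA subrr add0r scaleNr.
  rewrite (chart_deriveZ sm) ?pyx; last by apply: Ua; move: sa; rewrite shift.
  rewrite dotpZr -[x - _]opprB dotpNl mulrNN enormZ a1 mulr1 normrN.
  have h1 : 0 < c * `|s| ^+ 2 by rewrite mulr_gt0 // exprn_gt0 // normr_gt0 gt_eqF.
  by move=> /(lt_le_trans h1); rewrite pmulr_rgt0.
(* Below [e] as required, below [c * e2] so that every ray reaches the sphere before radius [e2],
   and below [dl] so that the chart covers the whole sphere. *)
pose eps := Num.min e (Num.min (c * e2) dl) / 2.
have m0 : 0 < Num.min e (Num.min (c * e2) dl) by rewrite !lt_min e0 dl0 mulr_gt0.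
have eps0 : 0 < eps by rewrite divr_gt0.
have epsm : eps < Num.min e (Num.min (c * e2) dl) by rewrite /eps; lra.
move: (epsm); rewrite !lt_min => /andP[epse /andP[epsc epsd]].
have /choice[rad hrad] : forall a : 'rV[R]_n, exists r : R, enorm a = 1 ->
   [/\ 0 < r, r <= e2 & enorm (phi (y + r *: a) - x) = eps].
  move=> a; have [a1|] := pselect (enorm a = 1); last by exists 0.
  have [||r rin gr] := @IVT R (g a) 0 e2 (eps ^+ 2) (ltW e20).
  - apply: derivable_within_continuous => r; rewrite in_itv /= => /andP[r0 r1].
    have re : `|r| < e1 by rewrite ger0_norm //; apply: le_lt_trans e21.
    by have [] := dg a r a1 re.
  - have g0 : g a 0 = 0 by rewrite /g scale0r addr0 pyx subrr dotp0.
    rewrite g0 ge_min le_max sqr_ge0 /= gE.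
    have -> : eps ^+ 2 <= enorm (phi (y + e2 *: a) - x) ^+ 2; last by rewrite orbT.
    rewrite lerXn2r ?nnegrE ?enorm_ge0 ?(ltW eps0) //.
    have := lower (e2 *: a); rewrite ra ?(ltW e20) // => /(_ e21) h.
    by apply: le_trans h; exact: ltW.
  have hr : enorm (phi (y + r *: a) - x) = eps.
    by apply/eqP; rewrite -(@eqrXn2 _ 2) ?enorm_ge0 ?(ltW eps0) // -gE gr.
  rewrite in_itv /= in rin; case/andP: rin => r0 r1.
  exists r => _; split=> //; rewrite lt_neqAle r0 andbT eq_sym; apply/eqP => r00.
  by move: eps0; rewrite -hr r00 scale0r addr0 pyx subrr enorm0 ltxx.
have rad_unique a (r : R) : enorm a = 1 -> 0 <= r -> r < e1 ->
   enorm (phi (y + r *: a) - x) = eps -> r = rad a.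
  move=> a1 r0 r1 hr; have [h1 h2 h3] := hrad a a1.
  apply/eqP; apply: contraT; rewrite neq_lt => /orP[lt|lt].
    have := mono a _ _ a1 r0 lt (le_lt_trans h2 e21); by rewrite !gE hr h3 ltxx.
  by have := mono a _ _ a1 (ltW h1) lt r1; rewrite !gE hr h3 ltxx.
exists eps; first by rewrite eps0 epse.
have rade a : enorm a = 1 -> enorm (rad a *: a) < e1.
  by move=> a1; have [h1 h2 _] := hrad a a1; rewrite ra ?(ltW h1) // (le_lt_trans h2).
(* The sphere as seen in the chart. It is compact, and [rad a *: a] inverts the radial projection on
   it, hence is continuous by [compact_inverse_econt]. *)
pose K : set 'rV[R]_n := [set b | enorm b <= e2 /\ enorm (phi (y + b) - x) = eps].
have Ke b : K b -> enorm b < e1 by move=> [h _]; exact: le_lt_trans e21.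
have phic b (r : R) : enorm b < e1 -> 0 < r -> exists2 dl, 0 < dl & forall b', enorm b' < e1 ->
   enorm (b' - b) < dl -> enorm (phi (y + b') - phi (y + b)) < r.
  move=> be r0; have [d1 d10 h1] := chart_econt ch (Ua b be) r0.
  exists d1 => // b' be' bb; apply: h1; first exact: Ua.
  by rewrite opprD addrACA subrr add0r.
have cK : compact K.
  apply: (@compact_closed_bounded _ _ _ e2) => [b [] //|b hcl].
  have b2 : enorm b <= e2.
    apply/ler_addgt0Pr => r r0; have [b' [h1 _] h2] := hcl r r0.
    have := ler_enormD (b - b') b'; rewrite subrK (enormB b b'); lra.
  split=> //; apply/eqP; rewrite -subr_eq0 -normr_le0; apply/ler_addgt0Pr => r r0.
  rewrite add0r; have [d1 d10 h1] := phic b r (le_lt_trans b2 e21) r0.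
  have [b' Kb' bb] := hcl d1 d10; have h := h1 b' (Ke _ Kb') bb; have [_ <-] := Kb'.
  apply: le_trans (ler_enorm_sub _ _) _; apply: ltW; apply: le_lt_trans h.
  by rewrite [leRHS]enormB opprB addrA subrK.
have K0 b : K b -> b != 0.
  move=> [_ h]; apply/eqP => b0; move: eps0.
  by rewrite -h b0 addr0 pyx subrr enorm0 ltxx.
have Kdir b : K b -> b = rad ((enorm b)^-1 *: b) *: ((enorm b)^-1 *: b).
  move=> Kb; have b0 := enorm_gt0 (K0 b Kb).
  have bE : b = enorm b *: ((enorm b)^-1 *: b) by rewrite scalerA mulfV ?scale1r // gt_eqF.
  rewrite -(@rad_unique _ (enorm b)) //; first exact: unit_vector (K0 b Kb).
  - exact: Ke.
  - by rewrite -bE; have [] := Kb.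
have Krad a : enorm a = 1 -> K (rad a *: a).
  by move=> a1; have [h1 h2 h3] := hrad a a1; split; rewrite ?ra // ltW.
have sec_cont : econt (@usphere R n) (fun a => rad a *: a).
  apply: (@compact_inverse_econt R _ _ K _ (fun b => (enorm b)^-1 *: b)) => //.
  - move=> b Kb r r0; have b0 := K0 b Kb; have bp := enorm_gt0 b0.
    exists (r * enorm b / 2); first by rewrite divr_gt0 // mulr_gt0.
    move=> b' Kb' bb; apply: le_lt_trans (ler_normalize (K0 b' Kb') b0) _.
    by rewrite ltr_pdivrMr //; lra.
  - by move=> b b' Kb Kb' h; rewrite (Kdir b Kb) (Kdir b' Kb') h.
  move=> a a1; split; first exact: Krad.
  have [h1 _ _] := hrad a a1.
  by rewrite ra ?(ltW h1) // scalerA mulVf ?scale1r // gt_eqF.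
exists (fun a => phi (y + rad a *: a)); split.
- by move=> a a1; split; [apply: MU; apply: Ua; exact: rade|have [] := hrad a a1].
- move=> a a1 r r0; have [d1 d10 h1] := phic _ r (rade a a1) r0.
  have [d2 d20 h2] := sec_cont a a1 d1 d10.
  by exists d2 => // a' a'1 aa; apply: h1; [exact: rade|exact: h2].
- move=> a a' a1 a'1 h.
  have ay : enorm (y + rad a *: a - y) < e1 by rewrite shift; exact: rade.
  have ay' : enorm (y + rad a' *: a' - y) < e1 by rewrite shift; exact: rade.
  have [_ + _ _ _] := hb _ ay; move=> /(_ _ ay'); rewrite h subrr enorm0.
  rewrite pmulr_rle0 // => le.
  have /enorm_eq0/eqP : enorm (y + rad a' *: a' - (y + rad a *: a)) = 0.
    by apply/eqP; rewrite eq_le le enorm_ge0.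
  rewrite subr_eq0 => /eqP /addrI E; have [r1 _ _] := hrad a a1; have [r1' _ _] := hrad a' a'1.
  have rr : rad a' = rad a by rewrite -(ra a' (rad a')) ?(ltW r1') // E ra // ltW.
  by move: E; rewrite rr => /(scalerI (lt0r_neq0 r1)).
move=> q Mq qx; have [|z [Uz zy pz]] := hdl q Mq; first by rewrite qx.
have yz : y + (z - y) = z by rewrite addrC subrK.
have Kz : K (z - y) by split; [exact: ltW|rewrite yz pz].
exists ((enorm (z - y))^-1 *: (z - y)); first exact: unit_vector (K0 _ Kz).
by rewrite -(Kdir _ Kz) yz.
Qed.

End ChartTopology.

Lemma econt_comp (R : realType) m d k (A : set 'rV[R]_m) (B : set 'rV[R]_d)
    (f : 'rV[R]_m -> 'rV[R]_d) (g : 'rV[R]_d -> 'rV[R]_k) :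
  (forall x, A x -> B (f x)) -> econt A f -> econt B g -> econt A (g \o f).
Proof.
move=> AB fc gc x Ax e e0; have [d1 d10 h1] := gc _ (AB _ Ax) e e0.
have [d2 d20 h2] := fc x Ax d1 d10; exists d2 => // y Ay yx.
by apply: h1; [exact: AB|exact: h2].
Qed.

(** * Normalisation to the unit ball by a similarity *)

Section Similarity.
Context {R : realType} {n d : nat}.
Variables (M : set 'rV[R]_d) (c : 'rV[R]_d) (k : R).
Hypothesis k0 : 0 < k.

Definition dilate (x : 'rV[R]_d) := k *: x + c.
Definition contract (y : 'rV[R]_d) := k^-1 *: (y - c).

Lemma contractK y : dilate (contract y) = y.
Proof. by rewrite /dilate /contract scalerA mulfV ?gt_eqF // scale1r subrK. Qed.

Lemma dilateK x : contract (dilate x) = x.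
Proof. by rewrite /dilate /contract addrK scalerA mulVf ?gt_eqF // scale1r. Qed.

Lemma dilateB x y : dilate x - dilate y = k *: (x - y).
Proof. by rewrite /dilate opprD addrACA subrr addr0 scalerBr. Qed.

Lemma enorm_dilateB x y : enorm (dilate x - dilate y) = k * enorm (x - y).
Proof. by rewrite dilateB enormZ gtr0_norm. Qed.

Lemma enorm_contractB x y : enorm (contract x - contract y) = enorm (x - y) / k.
Proof. by rewrite -[in RHS](contractK x) -[in RHS](contractK y) enorm_dilateB mulrC mulKf ?gt_eqF. Qed.

Lemma dilate_econt A : econt A dilate.
Proof.
move=> x _ e e0; exists (e / k); first by rewrite divr_gt0.
by move=> y _; rewrite ltr_pdivlMr // enorm_dilateB mulrC.
Qed.

Lemma contract_econt A : econt A contract.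
Proof.
move=> x _ e e0; exists (e * k); first by rewrite mulr_gt0.
by move=> y _; rewrite enorm_contractB ltr_pdivrMr.
Qed.

Definition contracted : set 'rV[R]_d := [set x | M (dilate x)].

Lemma contractedE : contracted = contract @` M.
Proof.
apply/seteqP; split=> [x Mx|_ [y My <-]]; last by rewrite /contracted /= contractK.
by exists (dilate x) => //; exact: dilateK.
Qed.

Lemma contracted_connected : connected M -> connected contracted.
Proof.
move=> cM; rewrite contractedE; apply: connected_continuous_connected => //.
apply/within_econtP; exact: contract_econt.
Qed.

Lemma contracted_homeomorphic (S : set 'rV[R]_n.+1) :
  homeomorphic contracted S -> homeomorphic M S.
Proof.
move=> [f [g [h1 h2 /within_econtP fc /within_econtP gc]]].
exists (f \o contract), (dilate \o g); split.
- move=> x Mx; have Mx' : contracted (contract x) by rewrite /contracted /= contractK.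
  by have [Sx gx] := h1 _ Mx'; split=> //=; rewrite gx contractK.
- by move=> y Sy; have [Mg fg] := h2 y Sy; split=> //=; rewrite dilateK.
- apply/within_econtP; apply: (econt_comp _ (@contract_econt M) fc) => x Mx.
  by rewrite /contracted /= contractK.
by apply/within_econtP; apply: (econt_comp _ gc (@dilate_econt contracted)) => y /h2[].
Qed.

Lemma contracted_punctured x : punctured_connected M (dilate x) ->
  punctured_connected contracted x.
Proof.
move=> pc e e0; have [A [cA hA [e' e'0 he']]] := pc (k * e) (mulr_gt0 k0 e0).
exists (contract @` A); split.
- apply: connected_continuous_connected => //; apply/within_econtP; exact: contract_econt.
- move=> _ [y Ay <-]; have [My yx ye] := hA y Ay; rewrite /contracted /= contractK; split=> //.
    by apply: contra_neq yx => <-; rewrite contractK.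
  by rewrite -(ltr_pM2l k0) -enorm_dilateB contractK.
exists (e' / k); first by rewrite divr_gt0.
move=> y My yx; rewrite ltr_pdivlMr // mulrC -enorm_dilateB => ye.
exists (dilate y); last exact: dilateK.
apply: he' => //; apply: contra_neq yx => h.
by rewrite -(dilateK y) h dilateK.
Qed.

Lemma contracted_sphere_sections x : sphere_sections n M (dilate x) ->
  sphere_sections n contracted x.
Proof.
move=> ss e e0; have [eps /andP[p0 pe] [s [s1 s2 s3 s4]]] := ss (k * e) (mulr_gt0 k0 e0).
have hs y : enorm (contract y - x) = enorm (y - dilate x) / k.
  by rewrite -[in LHS](dilateK x) enorm_contractB.
exists (eps / k); first by rewrite divr_gt0 //= ltr_pdivrMr // mulrC.
exists (contract \o s); split.
- move=> th /s1[Ms es]; rewrite /contracted /= contractK hs es; split=> //.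
- by apply: (econt_comp (B := setT)) => //; exact: contract_econt.
- by move=> th th' t1 t'1 /= h; apply: s3 => //; rewrite -(contractK (s th)) h contractK.
move=> y My yx; have [|th th1 hth] := s4 _ My.
  by rewrite enorm_dilateB yx mulrC divfK // gt_eqF.
by exists th => //=; rewrite hth dilateK.
Qed.

(** Lengths are divided by [k], so curvatures, and with them the quadratic constants, are multiplied
    by [k]. *)
Lemma contracted_tangent_data P (kap del C : R) : tangent_data n M P kap del C ->
  tangent_data n contracted (P \o dilate) (kap * k) (del / k) (C * k).
Proof.
move=> td; have [t1 t2 t3 t4 t5 t6 t7 t8 t9] := td; have kn : k != 0 by rewrite gt_eqF.
split; rewrite ?mulr_gt0 ?invr_gt0 //.
- rewrite contractedE; apply: continuous_compact => //; apply/within_econtP; exact: contract_econt.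
- by move=> x; exact: t5.
- by move=> x; exact: t6.
- by move=> x; exact: t7.
- move=> x y nu Mx My; rewrite ltr_pdivlMr // mulrC -enorm_dilateB => yx nuP.
  have := t8 _ _ nu Mx My yx nuP.
  rewrite enorm_dilateB dilateB dotpZl.
  have -> : kap / 2 * (k * enorm (y - x)) ^+ 2 * enorm nu =
    k * (kap * k / 2 * enorm (y - x) ^+ 2 * enorm nu) by field.
  by rewrite ler_pM2l.
move=> x u Mx uP ud; have [||y My hy] := t9 (dilate x) (k *: u) Mx.
- by rewrite -scalemxAl uP.
- by rewrite enormZ gtr0_norm // mulrC -ler_pdivlMr.
exists (contract y); first by rewrite /contracted /= contractK.
rewrite -(ler_pM2l k0) -[X in X * enorm _](gtr0_norm k0) -enormZ.
have -> : k *: (contract y - x - u) = y - dilate x - k *: u.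
  by rewrite scalerBr -dilateB contractK.
apply: le_trans hy _; rewrite enormZ gtr0_norm // le_eqVlt; apply/orP; left; apply/eqP; ring.
Qed.

End Similarity.

Lemma farthest_point (R : realType) d (M : set 'rV[R]_d) (c : 'rV[R]_d) : M !=set0 -> compact M ->
  exists2 p, M p & forall x, M x -> enorm (x - c) <= enorm (p - c).
Proof.
move=> M0 cM; have [|p /set_mem Mp h] := @EVT_max_rV R d (fun x => enorm (x - c)) M M0 cM.
  apply: continuous_subspaceT => x; have FF : Filter (nbhs x) by exact: nbhs_filter.
  apply/(@cvgrPdist_lt _ _ _ _ FF) => e e0; apply/nbhs_enormP; exists e => // y yx.
  apply: le_lt_trans (ler_enorm_sub _ _) _.
  by rewrite opprB addrA subrK enormB.
by exists p => // x Mx; apply: h; exact: mem_set.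
Qed.

Lemma submanifold_homeomorphic_sphere (R : realType) (n d : nat) (r : R) (M : set 'rV[R]_d) :
  (1 < n)%N -> 0 < r -> closed_submanifold n M -> M !=set0 -> connected M ->
  (exists c : 'rV[R]_d, M `<=` eball c r) ->
  (forall k : R, normal_curvatures n M k -> k < 2 / Num.sqrt 3 * (1 / r)) ->
  homeomorphic M (@esphere R n).
Proof.
move=> n1 r0 [sM cM] M0 ctM [c hc] hcurv.
have s3 : 0 < Num.sqrt 3 :> R by rewrite sqrtr_gt0.
have s32 : Num.sqrt 3 ^+ 2 = 3 :> R by rewrite sqr_sqrtr.
pose m := 2 / Num.sqrt 3 : R; have m0 : 0 < m by rewrite divr_gt0.
have m2 : 3 * m ^+ 2 = 4 by rewrite exprMn exprVn s32; field.
have k00 : 0 < m * (1 / r) by rewrite mulr_gt0 // divr_gt0.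
have [P [del [C [kap hkap td]]]] := exists_tangent_data k00 hcurv (conj sM cM).
have [p Mp pmax] := farthest_point c M0 cM.
have n0 := ltnW n1.
have k0 : 0 < enorm (p - c).
  have [x Mx [xp _]] := not_isolated td n0 Mp ltr01.
  rewrite lt_neqAle enorm_ge0 andbT eq_sym; apply/eqP => h.
  have /enorm_eq0/eqP : enorm (x - c) = 0.
    by apply/eqP; rewrite eq_le enorm_ge0 andbT -h pmax.
  rewrite subr_eq0 => /eqP xc; move/enorm_eq0/eqP: h; rewrite subr_eq0 => /eqP pc.
  by move: xp; rewrite xc pc eqxx.
set k := enorm (p - c) in k0.
have kr : k <= r := hc p Mp.
apply: (contracted_homeomorphic (c := c) k0).
set M' := contracted M c k; pose p' := contract c k p.
have dp : dilate c k p' = p := contractK c k0 p.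
have td' := contracted_tangent_data c k0 td.
have Mp' : M' p' by rewrite /M' /contracted /= dp.
have nrm x : enorm x = enorm (dilate c k x - c) / k.
  by rewrite /dilate addrK enormZ gtr0_norm // mulrC mulKf // gt_eqF.
have p1 : dotp p' p' = 1.
  by rewrite -enorm_sqr nrm dp -/k divff ?expr1n // gt_eqF.
have ball x : M' x -> dotp x x <= 1.
  move=> Mx; rewrite -enorm_sqr -(expr1n R 2) lerXn2r ?nnegrE ?enorm_ge0 //.
  by rewrite nrm ler_pdivrMr // mul1r; exact: pmax.
have k1 := farthest_curvature td' n0 Mp' p1 ball.
have km : kap * k < m.
  apply: lt_le_trans (_ : m * (1 / r) * k <= m); first by rewrite ltr_pM2r.
  by rewrite div1r -mulrA ler_piMr ?(ltW m0) // mulrC ler_pdivrMr // mul1r.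
(* [kap * k] is only known to be at least [1]; its mean with [m] lies strictly between [1] and
   [m]. *)
pose kap' := (kap * k + m) / 2.
have kk : kap * k <= kap' by rewrite /kap'; lra.
have up : @unit_position R n d M' (P \o dilate c k) kap' (del / k) (C * k) p'.
  split => //; first exact: tangent_data_le td'.
    by rewrite /kap'; lra.
  rewrite -m2 ltr_pM2l // ltr_pXn2r ?nnegrE ?(ltW m0) //; first by rewrite /kap'; lra.
  by rewrite /kap'; lra.
apply: (unit_position_homeomorphic up).
- exact: contracted_connected.
- by move=> x Mx; apply: (contracted_punctured k0); apply: (@submanifold_punctured R n).
by apply: (contracted_sphere_sections k0); rewrite dp; exact: submanifold_sphere_sections.
Qed.

(** * Closed curves *)

Section StepErrors.
Context {R : realType}.

Lemma sum_squares_le (a b : R) : 0 <= b * b -> 0 <= a * a -> 0 <= a * b ->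
  a * a + b * b <= 2 * (a + b) ^+ 2.
Proof. lra. Qed.

Lemma product_le_square (a b : R) : 0 <= a -> 0 <= b -> a * b <= (a + b) ^+ 2.
Proof.
move=> a0 b0; have := mulr_ge0 a0 b0; have := mulr_ge0 a0 a0; have := mulr_ge0 b0 b0; lra.
Qed.

Lemma four_errors_le (C L X1 X2 X3 X4 Q Q1 Q2 Q3 Z : R) : X2 <= C * Q2 -> X1 <= C * Q1 ->
  X3 <= C * Q3 -> X4 <= Z -> C * Q3 <= C * Q -> C * Q1 + C * Q2 <= 2 * (C * Q) ->
  Z <= 4 * L * Q -> X1 + X2 + X4 + X3 <= (3 * C + 4 * L) * Q.
Proof. lra. Qed.

End StepErrors.

Section ArclengthFlow.
Context {R : realType} {d : nat}.
Variables (M : set 'rV[R]_d) (P : 'rV[R]_d -> 'M[R]_d) (kap del C : R).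
Hypothesis td : tangent_data 1 M P kap del C.

Local Notation V := 'rV[R]_d.

Definition unit_tangent (z : V * V) := [/\ M z.1, z.2 *m P z.1 = z.2 & enorm z.2 = 1].

Definition reverse (z : V * V) : V * V := (z.1, - z.2).

Lemma reverse_unit_tangent z : unit_tangent z -> unit_tangent (reverse z).
Proof. by move=> [h1 h2 h3]; split => //=; [rewrite mulNmx h2|rewrite enormN]. Qed.

Lemma tangent_line z (v : V) : unit_tangent z -> v *m P z.1 = v -> v = dotp v z.2 *: z.2.
Proof.
case: z => x u [/= Mx uP u1] vP.
have u0 : u != 0 by apply/eqP => h; move: u1; rewrite h enorm0 => /eqP; rewrite eq_sym oner_eq0.
have uu : dotp u u = 1 by rewrite -enorm_sqr u1 expr1n.
have su : (u <= P x)%MS by rewrite -uP submxMl.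
have sP : (P x <= u)%MS.
  by rewrite -(mxrank_leqif_sup su) rank_rV u0 (td_rank td Mx).
have : (v <= u)%MS by rewrite -vP; exact: submx_trans (submxMl _ _) sP.
by case/sub_rVP => a ->; rewrite dotpZl uu mulr1.
Qed.

Lemma opposite_tangent z v : unit_tangent z -> unit_tangent (z.1, v) -> v = z.2 \/ v = - z.2.
Proof.
move=> Kz [/= _ vP v1]; have E := tangent_line Kz vP; have [_ _ z1] := Kz.
have : `|dotp v z.2| = 1 by rewrite -v1 [in RHS]E enormZ z1 mulr1.
move/eqP; rewrite eqr_norml ler01 andbT => /orP[]/eqP h; rewrite E h ?scale1r; first by left.
by right; rewrite scaleN1r.
Qed.

(** Tangent spaces being lines, unit tangent vectors at nearby points are almost equal or almost
    opposite. The bound [1] on their difference excludes the second case, and the Lipschitz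
    projection controls the difference by the positions. *)
Lemma tangent_dist (L : R) z z' : 0 <= L ->
  (forall x y (v : V), M x -> M y -> enorm (v *m P x - v *m P y) <= L * enorm (x - y) * enorm v) ->
  unit_tangent z -> unit_tangent z' -> enorm (z.2 - z'.2) <= 1 ->
  enorm (z.2 - z'.2) <= 2 * L * enorm (z.1 - z'.1).
Proof.
move=> L0 hL Kz Kz' le1; have [Mx uP u1] := Kz; have [Mx' uP' u1'] := Kz'.
move: Mx uP u1 Mx' uP' u1' le1 => Mx uP u1 Mx' uP' u1' le1.
set a := dotp z.2 z'.2.
have aE : z.2 *m P z'.1 = a *: z'.2.
  rewrite [LHS](tangent_line Kz') ?(proj_proj td) //; congr (_ *: _).
  by rewrite (dotp_proj td) // uP'.
have h := hL _ _ z.2 Mx Mx'; rewrite uP aE u1 mulr1 in h.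
have a12 : 1 / 2 <= a <= 1.
  have n0 := enorm_ge0 (z.2 - z'.2).
  have : enorm (z.2 - z'.2) ^+ 2 <= 1 by rewrite expr_le1.
  rewrite enorm_sqr !dotpE (dotpC z'.2 z.2) -!enorm_sqr u1 u1' expr1n -/a => h1.
  have := ler_dotp z.2 z'.2; rewrite u1 u1' mulr1 -/a; lra.
have [a1 a2] := andP a12.
have h1 : 1 - a <= enorm (z.2 - a *: z'.2).
  have := ler_enorm_sub z.2 (a *: z'.2); rewrite enormZ u1 u1' mulr1 (ger0_norm (le_trans _ a1)) //.
  by rewrite ger0_norm; lra.
have -> : z.2 - z'.2 = (z.2 - a *: z'.2) + (a - 1) *: z'.2.
  by apply/rowP => i; rewrite !mxE; ring.
apply: le_trans (ler_enormD _ _) _; rewrite [X in _ + X]enormZ u1' mulr1.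
by rewrite ler0_norm; lra.
Qed.

Record arclength_flow (F : R -> V * V -> V * V) (B : R) : Prop := ArclengthFlow {
  af_in : forall t z, unit_tangent z -> unit_tangent (F t z);
  af_0 : forall z, unit_tangent z -> F 0 z = z;
  af_D : forall s t z, unit_tangent z -> F (s + t) z = F s (F t z);
  af_lip : forall t z, unit_tangent z -> enorm ((F t z).1 - z.1) <= B * `|t|;
  af_vel : forall t z, unit_tangent z -> enorm ((F t z).1 - z.1 - t *: z.2) <= B * t ^+ 2;
  af_rev : forall t z, unit_tangent z -> F (- t) (reverse z) = reverse (F t z) }.

Lemma unit_tangent_complete (u : nat -> V * V) : (forall k, unit_tangent (u k)) ->
  (forall e : R, 0 < e -> exists N, forall i j, (N <= i)%N -> (N <= j)%N ->
     enorm ((u i).1 - (u j).1) < e /\ enorm ((u i).2 - (u j).2) < e) ->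
  exists2 l, unit_tangent l & forall e : R, 0 < e -> exists N, forall i, (N <= i)%N ->
    enorm ((u i).1 - l.1) < e /\ enorm ((u i).2 - l.2) < e.
Proof.
move=> Ku cau.
have [||x Mx hx] := @compact_complete R d M (fun k => (u k).1) (td_compact td).
- by move=> k; have [] := Ku k.
- move=> e e0; have [N hN] := cau e e0; exists N => i j Ni Nj; exact: (hN i j Ni Nj).1.
have [||v v1 hv] := @compact_complete R d (@usphere R d) (fun k => (u k).2) (@compact_usphere R d).
- by move=> k; have [] := Ku k.
- move=> e e0; have [N hN] := cau e e0; exists N => i j Ni Nj; exact: (hN i j Ni Nj).2.
have lim e : 0 < e -> exists N, forall i, (N <= i)%N ->
    enorm ((u i).1 - x) < e /\ enorm ((u i).2 - v) < e.
  move=> e0; have [N1 h1] := hx e e0; have [N2 h2] := hv e e0.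
  exists (maxn N1 N2) => i; rewrite geq_max => /andP[i1 i2].
  by split; [exact: h1|exact: h2].
exists (x, v) => //; split => //=.
have [L L0 hL] := proj_lipschitz td.
apply/eqP; rewrite -subr_eq0; apply/eqP/enorm_eq0.
apply/eqP; rewrite eq_le enorm_ge0 andbT; apply/ler_addgt0Pr => e e0; rewrite add0r.
have L1 : 0 < L + 2 by lra.
have [N hN] := lim _ (divr_gt0 e0 L1); have [h1 h2] := hN N (leqnn _).
have [Mu uP u1] := Ku N.
have -> : v *m P x - v = (v - (u N).2) *m P x + ((u N).2 *m P x - (u N).2 *m P (u N).1) +
   ((u N).2 - v).
  by rewrite uP mulmxBl; apply/rowP => i; rewrite !mxE; ring.
apply: le_trans (ler_enormD _ _) _; apply: le_trans (lerD (ler_enormD _ _) (lexx _)) _.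
have h3 := enorm_proj td (v - (u N).2) Mx.
have h4 := hL x (u N).1 (u N).2 Mx Mu; rewrite u1 mulr1 in h4.
rewrite (enormB v) in h3; rewrite (enormB x) in h4.
have h5 : L * enorm ((u N).1 - x) <= L * (e / (L + 2)) by rewrite ler_wpM2l // ltW.
have : (L + 2) * (e / (L + 2)) = e by rewrite mulrC divfK // gt_eqF.
rewrite mulrDl; move: h2 h3 h4 h5; clear; lra.
Qed.

Lemma exists_arclength_flow : exists F B, arclength_flow F B.
Proof.
have [L L0 hL] := proj_lipschitz td; have C0 := td_C td; have d0 := td_del td.
have /choice[Y hY] : forall xw : V * V, exists y, M xw.1 -> xw.2 *m P xw.1 = xw.2 ->
    enorm xw.2 <= del -> M y /\ enorm (y - xw.1 - xw.2) <= C * enorm xw.2 ^+ 2.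
  move=> [x w] /=; have [Mx|] := pselect (M x); last by exists x.
  have [wP|] := pselect (w *m P x = w); last by exists x.
  have [wd|] := pselect (enorm w <= del); last by exists x.
  by have [y My hy] := td_exp td Mx wP wd; exists y.
pose y (e : R) (z : V * V) := Y (z.1, e *: z.2).
pose v (e : R) (z : V * V) := z.2 *m P (y e z).
(* After a move along the tangent vector, the vector is carried over by projecting it to the new
   tangent line and normalising. *)
pose sig (e : R) (z : V * V) : V * V := (y e z, (enorm (v e z))^-1 *: v e z).
(* So that [td_exp] applies, a step moves by at most [2 * |e|], and the vector turns so little that
   its projection is nonzero and composed steps never come close to reversing it. *)
pose e0 := Num.min del (Num.min C^-1 (1 / (16 * (L + 1)))).
have L1 : 0 < 16 * (L + 1) by lra.
have e00 : 0 < e0 by rewrite !lt_min d0 invr_gt0 C0 divr_gt0.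
have e0d : e0 <= del by rewrite ge_min lexx.
have e0C : C * e0 <= 1.
  by rewrite mulrC -ler_pdivlMr // div1r !ge_min lexx orbT.
have e0L : 16 * L * e0 <= 1.
  have : e0 * (16 * (L + 1)) <= 1 by rewrite -ler_pdivlMr // !ge_min lexx !orbT.
  lra.
have sq (e : R) : e ^+ 2 = `|e| * `|e| by rewrite -expr2 real_normK ?num_real.
have yP (e : R) z : `|e| <= e0 -> unit_tangent z ->
    M (y e z) /\ enorm (y e z - z.1 - e *: z.2) <= C * e ^+ 2.
  move=> ee [Mx uP u1]; have [||My hy] := hY (z.1, e *: z.2) Mx.
  - by rewrite -scalemxAl uP.
  - by rewrite enormZ u1 mulr1; exact: le_trans e0d.
  by split=> //; move: hy; rewrite /= enormZ u1 mulr1 real_normK ?num_real.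
have y1 (e : R) z : `|e| <= e0 -> unit_tangent z -> enorm (y e z - z.1) <= 2 * `|e|.
  move=> ee Kz; have [_ h] := yP e z ee Kz; have [_ _ u1] := Kz.
  have := ler_enormD (y e z - z.1 - e *: z.2) (e *: z.2); rewrite subrK enormZ u1 mulr1.
  have : C * e ^+ 2 <= `|e|.
    rewrite sq mulrA ler_piMl //; apply: le_trans e0C; by rewrite ler_pM2l.
  lra.
have v1 (e : R) z : `|e| <= e0 -> unit_tangent z -> enorm (v e z - z.2) <= 2 * L * `|e|.
  move=> ee Kz; have [My _] := yP e z ee Kz; have [Mx uP u1] := Kz.
  rewrite -[X in _ - X]uP; apply: le_trans (hL _ _ _ My Mx) _; rewrite u1 mulr1.
  by rewrite -mulrA mulrCA ler_wpM2l // y1.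
have v0 (e : R) z : `|e| <= e0 -> unit_tangent z -> v e z != 0.
  move=> ee Kz; apply/eqP => h; have := v1 e z ee Kz; have [_ _ u1] := Kz.
  rewrite h sub0r enormN u1; have : L * `|e| <= L * e0 by rewrite ler_wpM2l.
  lra.
have sigK (e : R) z : `|e| <= e0 -> unit_tangent z -> unit_tangent (sig e z).
  move=> ee Kz; have [My _] := yP e z ee Kz; split=> //=; last exact: unit_vector (v0 e z ee Kz).
  by rewrite -scalemxAl /v (proj_proj td).
have s1 (e : R) z : `|e| <= e0 -> unit_tangent z -> enorm ((sig e z).2 - z.2) <= 4 * L * `|e|.
  move=> ee Kz; have [_ _ u1] := Kz.
  have u0 : z.2 != 0.
    by apply/eqP => h; move: u1; rewrite h enorm0 => /eqP; rewrite eq_sym oner_eq0.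
  have := ler_normalize (v0 e z ee Kz) u0; rewrite u1 invr1 scale1r mulr1.
  by have := v1 e z ee Kz; rewrite /sig /=; lra.
(* With this weight, [tangent_dist] makes the position term dominate the distance of two states
   whose vectors differ by at most [1]; such states need to be compared in position only. *)
pose w := 2 * L + 1; have w1 : 1 <= w by rewrite /w; lra.
have w0 : 0 < w by lra.
pose dist (z z' : V * V) := Num.max (w * enorm (z.1 - z'.1)) (enorm (z.2 - z'.2)).
have dist1 z z' : w * enorm (z.1 - z'.1) <= dist z z' by rewrite le_max lexx.
have dist2 z z' : enorm (z.2 - z'.2) <= dist z z' by rewrite le_max lexx orbT.
have dist0 z z' : 0 <= dist z z' by apply: le_trans (dist2 z z').
have dist1' z z' : enorm (z.1 - z'.1) <= dist z z'.
  by apply: le_trans (dist1 z z'); rewrite ler_peMl.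
have close z z' : unit_tangent z -> unit_tangent z' -> enorm (z.2 - z'.2) <= 1 ->
    dist z z' <= w * enorm (z.1 - z'.1).
  move=> Kz Kz' le1; rewrite ge_max lexx /=.
  apply: le_trans (tangent_dist L0 hL Kz Kz' le1) _.
  by rewrite ler_wpM2r // /w; lra.
have distR z : dist z z = 0 by rewrite /dist !subrr !enorm0 mulr0 maxxx.
have distS z z' : dist z z' = dist z' z by rewrite /dist (enormB z.1) (enormB z.2).
have distT z' z z'' : dist z z'' <= dist z z' + dist z' z''.
  rewrite ge_max; apply/andP; split.
    apply: le_trans (lerD (dist1 z z') (dist1 z' z'')).
    by rewrite -mulrDr ler_pM2l //; exact: ler_enorm_dist.
  apply: le_trans (lerD (dist2 z z') (dist2 z' z'')); exact: ler_enorm_dist.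
have distE z z' : dist z z' <= 0 -> z = z'.
  move=> h; have h1 := le_trans (dist1' z z') h; have h2 := le_trans (dist2 z z') h.
  case: z z' {h} h1 h2 => [x u] [x' u'] /= h1 h2; congr (_, _).
    by apply/eqP; rewrite -subr_eq0; apply/eqP/enorm_eq0/eqP; rewrite eq_le h1 enorm_ge0.
  by apply/eqP; rewrite -subr_eq0; apply/eqP/enorm_eq0/eqP; rewrite eq_le h2 enorm_ge0.
have compl (u : nat -> V * V) : (forall k, unit_tangent (u k)) ->
    (forall e : R, 0 < e -> exists N, forall i j, (N <= i)%N -> (N <= j)%N -> dist (u i) (u j) < e) ->
    exists2 l, unit_tangent l & forall e : R, 0 < e -> exists N, forall i, (N <= i)%N -> dist (u i) l < e.
  move=> Ku cau; have [|l Kl hl] := unit_tangent_complete Ku.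
    move=> e ep; have [N hN] := cau e ep; exists N => i j Ni Nj; have h := hN i j Ni Nj.
    by split; [exact: le_lt_trans (dist1' _ _) h|exact: le_lt_trans (dist2 _ _) h].
  exists l => // e ep; have [N hN] := hl (e / w) (divr_gt0 ep w0).
  exists N => i Ni; have [h1 h2] := hN i Ni.
  rewrite gt_max mulrC -ltr_pdivlMr // h1 /=; apply: lt_le_trans h2 _.
  by rewrite ler_pdivrMr // ler_peMr // ltW.
pose Lc := w + 16 * L; pose Cc := w * (3 * C + 4 * L) + 2 * w.
have Lc0 : 0 <= Lc by rewrite /Lc; lra.
have wC : 0 <= w * C by rewrite mulr_ge0 // ltW.
have wL : 0 <= w * L by rewrite mulr_ge0 // ltW.
have Cc0 : 0 <= Cc by rewrite /Cc; lra.
have sigL (e : R) z z' : `|e| <= e0 -> unit_tangent z -> unit_tangent z' ->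
    dist (sig e z) (sig e z') <= (1 + Lc * `|e|) * dist z z' + Cc * e ^+ 2.
  move=> ee Kz Kz'; have [_ h] := yP e z ee Kz; have [_ h'] := yP e z' ee Kz'.
  have e2 := sqr_ge0 e; have en := normr_ge0 e.
  have b1 : w * enorm (y e z - y e z') <= (1 + Lc * `|e|) * dist z z' + Cc * e ^+ 2.
    have b : enorm (y e z - y e z') <= enorm (z.1 - z'.1) + `|e| * enorm (z.2 - z'.2) + 2 * C * e ^+ 2.
      have -> : y e z - y e z' = (z.1 - z'.1) + e *: (z.2 - z'.2) +
         ((y e z - z.1 - e *: z.2) - (y e z' - z'.1 - e *: z'.2)).
        by apply/rowP => i; rewrite !mxE; ring.
      apply: le_trans (ler_enormD _ _) _; apply: le_trans (lerD (ler_enormD _ _) (ler_enormB _ _)) _.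
      by rewrite enormZ; move: h h'; clear; lra.
    rewrite -(ler_pM2l w0) in b; apply: le_trans b _.
    have c1 := dist1 z z'; have c2 : w * (`|e| * enorm (z.2 - z'.2)) <= w * (`|e| * dist z z').
      by rewrite ler_pM2l // ler_wpM2l.
    have c3 : 0 <= L * (`|e| * dist z z') by rewrite !mulr_ge0.
    have c4 : w * (2 * C * e ^+ 2) <= Cc * e ^+ 2.
      by rewrite mulrA ler_wpM2r // /Cc; lra.
    rewrite /Lc; move: c1 c2 c3 c4; set D := dist z z'.
    by set X := enorm (z.1 - _); set U := enorm (z.2 - _); clear; lra.
  rewrite ge_max; apply/andP; split; first exact: b1.
  (* If the new vectors are more than [1] apart, the old ones were already at least [1 / 2] apart,
     and the turning of order [|e|] is absorbed by the factor [1 + Lc * |e|]. *)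
  have [le1|gt1] := lerP (enorm ((sig e z).2 - (sig e z').2)) 1.
    apply: le_trans (dist2 (sig e z) (sig e z')) _.
    exact: le_trans (close _ _ (sigK e z ee Kz) (sigK e z' ee Kz') le1) b1.
  have c1 := s1 e z ee Kz; have c2 := s1 e z' ee Kz'.
  have b : enorm ((sig e z).2 - (sig e z').2) <= enorm (z.2 - z'.2) + 8 * L * `|e|.
    have := ler_enorm_dist z.2 (sig e z).2 (sig e z').2.
    have := ler_enorm_dist z'.2 z.2 (sig e z').2; rewrite (enormB z'.2 (sig e z').2).
    by move: c1 c2; clear; lra.
  have Le : L * `|e| <= L * e0 by rewrite ler_wpM2l.
  have d12 : 1 / 2 <= dist z z'.
    by apply: le_trans (dist2 z z'); move: b gt1 Le e0L; clear; lra.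
  have c3 : L * `|e| * (1 / 2) <= L * `|e| * dist z z' by rewrite ler_wpM2l // mulr_ge0.
  have c4 : 0 <= Cc * e ^+ 2 by rewrite mulr_ge0.
  have c5 : 0 <= w * (`|e| * dist z z') by rewrite !mulr_ge0 // ltW.
  have := dist2 z z'; rewrite /Lc; move: b c3 c4 c5; set D := dist z z'.
  by set X := enorm (_ - (sig e z').2); set U := enorm (z.2 - _); clear; lra.
have sigD (e f : R) z : `|e| + `|f| <= e0 -> unit_tangent z ->
    dist (sig e (sig f z)) (sig (e + f) z) <= Cc * (`|e| + `|f|) ^+ 2.
  move=> ef Kz; have en := normr_ge0 e; have fn := normr_ge0 f.
  have ee : `|e| <= e0 by lra.
  have fe : `|f| <= e0 by lra.
  have efn : `|e + f| <= `|e| + `|f| := ler_normD _ _.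
  have efe : `|e + f| <= e0 by apply: le_trans efn ef.
  have K1 := sigK f z fe Kz; have K2 := sigK e _ ee K1; have K3 := sigK _ z efe Kz.
  have [_ h1] := yP f z fe Kz; have [_ h2] := yP e _ ee K1; have [_ h3] := yP _ z efe Kz.
  have t1 := s1 f z fe Kz; have t2 := s1 e _ ee K1; have t3 := s1 _ z efe Kz.
  have le1 : enorm ((sig e (sig f z)).2 - (sig (e + f) z).2) <= 1.
    have := ler_enorm_dist (sig f z).2 (sig e (sig f z)).2 (sig (e + f) z).2.
    have := ler_enorm_dist z.2 (sig f z).2 (sig (e + f) z).2; rewrite (enormB z.2 (sig (e + f) z).2).
    have l1 : L * `|e + f| <= L * (`|e| + `|f|) by rewrite ler_wpM2l.
    have l2 : L * (`|e| + `|f|) <= L * e0 by rewrite ler_wpM2l.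
    by move: t1 t2 t3 l1 l2 e0L; clear; lra.
  apply: le_trans (close _ _ K2 K3 le1) _.
  have b : enorm (y e (sig f z) - y (e + f) z) <= (3 * C + 4 * L) * (`|e| + `|f|) ^+ 2.
    have -> : y e (sig f z) - y (e + f) z =
       (y e (sig f z) - (sig f z).1 - e *: (sig f z).2) + (y f z - z.1 - f *: z.2) +
       e *: ((sig f z).2 - z.2) - (y (e + f) z - z.1 - (e + f) *: z.2).
      by apply/rowP => i; rewrite !mxE; ring.
    apply: le_trans (ler_enormB _ _) _.
    apply: le_trans (lerD (le_trans (ler_enormD _ _) (lerD (ler_enormD _ _) (lexx _))) (lexx _)) _.
    rewrite enormZ.
    have l1 : `|e| * enorm ((sig f z).2 - z.2) <= `|e| * (4 * L * `|f|) by rewrite ler_wpM2l.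
    have l2 : C * (e + f) ^+ 2 <= C * (`|e| + `|f|) ^+ 2.
      rewrite ler_wpM2l ?(ltW C0) // -[leLHS]real_normK ?num_real // lerXn2r ?nnegrE ?addr_ge0 //.
    have l3 : C * e ^+ 2 + C * f ^+ 2 <= 2 * (C * (`|e| + `|f|) ^+ 2).
      rewrite (sq e) (sq f) -mulrDr mulrCA ler_pM2l //.
      by have := mulr_ge0 en fn; have := mulr_ge0 en en; have := mulr_ge0 fn fn; exact: sum_squares_le.
    have l4 : `|e| * (4 * L * `|f|) <= 4 * L * (`|e| + `|f|) ^+ 2.
      have -> : `|e| * (4 * L * `|f|) = 4 * L * (`|e| * `|f|) by ring.
      by rewrite ler_wpM2l ?mulr_ge0 //; exact: product_le_square.
    move: h1 h2 h3 l1 l2 l3 l4.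
    set X1 := enorm (y e (sig f z) - _ - _); set X2 := enorm (y f z - _ - _).
    set X3 := enorm (y (e + f) z - _ - _); set X4 := `|e| * enorm _.
    set Q := (`|e| + `|f|) ^+ 2; set Q1 := e ^+ 2; set Q2 := f ^+ 2; set Q3 := (e + f) ^+ 2.
    exact: four_errors_le.
  rewrite -(ler_pM2l w0) in b; apply: le_trans b _.
  by rewrite mulrA ler_wpM2r ?sqr_ge0 // /Cc lerDl mulr_ge0 // ltW.
have sig1 (e : R) z : `|e| <= e0 -> unit_tangent z -> dist (sig e z) z <= Cc * `|e|.
  move=> ee Kz; rewrite ge_max; apply/andP; split.
    have := y1 e z ee Kz; rewrite -(ler_pM2l w0) => /le_trans; apply.
    by rewrite mulrA ler_wpM2r // /Cc; lra.
  apply: le_trans (s1 e z ee Kz) _; rewrite ler_wpM2r //.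
  by have : L <= w * L by [rewrite ler_peMl]; rewrite /Cc; lra.
have [F [F1 F2 F3 F4 [F5 F6 F7]]] := @exists_flow R (V * V)%type dist unit_tangent
  dist0 distR distS distT distE compl sig Lc Cc e0 Lc0 Cc0 e00 sigK sigL sigD sig1.
exists F, Cc; split => //.
- by move=> t z Kz; apply: le_trans (dist1' _ _) (F5 t z Kz).
- move=> t z Kz; rewrite -[X in X * _]mul1r.
  apply: (F6 d fst snd 1 C) => //; first exact: ltW.
  + by move=> z1 z2 _ _; rewrite mul1r.
  by move=> e z1 ee Kz1; have [] := yP e z1 ee Kz1.
move=> t z Kz; apply: (F7 reverse 0) => //.
- exact: reverse_unit_tangent.
- move=> z1 z2 _ _; rewrite /dist /= -opprD enormN; exact: lexx.
move=> e z1 ee Kz1; rewrite mul0r.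
(* The chosen point depends on the vector only through [e *: z.2], so reversal turns a step exactly
   into a backward step. *)
suff -> : sig (- e) (reverse z1) = reverse (sig e z1) by rewrite distR.
have yE : y (- e) (reverse z1) = y e z1 by rewrite /y /= scalerN scaleNr opprK.
by rewrite /sig /reverse /= yE /v /= yE mulNmx enormN scalerN.
Qed.

End ArclengthFlow.

(** * The periodic arc length parametrisation of a closed curve *)

Section ClosedCurve.
Context {R : realType} {d : nat}.
Variables (M : set 'rV[R]_d) (P : 'rV[R]_d -> 'M[R]_d) (kap del C : R).
Hypothesis td : tangent_data 1 M P kap del C.

Local Notation V := 'rV[R]_d.
Local Notation K := (unit_tangent M P).

Lemma exists_unit_tangent x : M x -> exists u, K (x, u).
Proof.
move=> Mx; have Px : P x != 0.
  by apply/negP => /eqP h; have := td_rank td Mx; rewrite h mxrank0.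
have [v v0] : exists v : V, v *m P x != 0.
  apply: contrapT => h; case/negP: Px; apply/eqP/row_matrixP => i; rewrite row0 rowE.
  by apply: contrapT => /eqP h'; apply: h; exists (delta_mx 0 i).
exists ((enorm (v *m P x))^-1 *: (v *m P x)); split => //=; last exact: unit_vector.
by rewrite -scalemxAl (proj_proj td).
Qed.

(** The difference [e] of two such points is normal at [z.1], hence nearly normal at [y]; but as a
    chord of [M] it is nearly tangent at [y]. Both errors are a small multiple of [|e|], so
    [e = 0]. *)
Lemma tangent_coordinate_injective : exists2 dl, 0 < dl & forall z y y', K z -> M y -> M y' ->
  enorm (y - z.1) < dl -> enorm (y' - z.1) < dl ->
  dotp (y - z.1) z.2 = dotp (y' - z.1) z.2 -> y = y'.
Proof.
have [L L0 hL] := proj_lipschitz td; have k0 := td_kap td; have d0 := td_del td.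
have D0 : 0 < kap + L + 1 by lra.
pose dl := Num.min (del / 2) (kap + L + 1)^-1.
have dl0 : 0 < dl by rewrite lt_min divr_gt0 //= invr_gt0.
have dld : dl <= del / 2 by rewrite ge_min lexx.
have dlk : dl * (kap + L + 1) <= 1.
  by rewrite -ler_pdivlMr // div1r ge_min lexx orbT.
exists dl => // z y y' Kz My My' yz y'z E; have [Mx uP u1] := Kz.
pose e := y' - y.
have eu : dotp e z.2 = 0.
  by move: E; rewrite /e !dotpBl => E; lra.
have ex : e *m P z.1 = 0.
  rewrite (tangent_line td Kz (v := e *m P z.1)) ?(proj_proj td) //.
  by rewrite (dotp_proj td) // uP eu scale0r.
have e2 : enorm e < 2 * dl.
  by have := ler_enorm_dist z.1 y' y; rewrite -/e (enormB z.1 y); lra.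
have ed : enorm (y' - y) < del by rewrite -/e; lra.
have h1 := normal_part_le td My My' ed; rewrite -/e in h1.
have h2 : enorm (e *m P y) <= L * dl * enorm e.
  rewrite -[e *m P y]subr0 -ex; apply: le_trans (hL _ _ _ My Mx) _.
  by rewrite ler_wpM2r ?enorm_ge0 // ler_wpM2l // ltW.
have h3 : enorm e <= enorm (e - e *m P y) + enorm (e *m P y).
  by rewrite -{1}[e](subrK (e *m P y)); exact: ler_enormD.
have en := enorm_ge0 e.
have h4 : kap / 2 * enorm e ^+ 2 <= kap * dl * enorm e.
  rewrite expr2 mulrA ler_wpM2r //.
  have : kap * enorm e <= kap * (2 * dl) by rewrite ler_pM2l // ltW.
  lra.
apply/esym/eqP; rewrite -subr_eq0; apply/eqP/enorm_eq0; rewrite -/e.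
apply/eqP; rewrite eq_le en andbT.
rewrite -(@pmulr_rle0 _ (1 - (kap * dl + L * dl))); first lra.
by rewrite subr_gt0; lra.
Qed.

Variables (F : R -> V * V -> V * V) (B : R).
Hypothesis af : arclength_flow M P F B.

Lemma arclength_bound_ge0 z : K z -> 0 <= B.
Proof.
move=> Kz; have := af_lip af 1 Kz; rewrite normr1 mulr1; apply: le_trans; exact: enorm_ge0.
Qed.

Lemma arclength_lip s t z : K z -> enorm ((F s z).1 - (F t z).1) <= B * `|s - t|.
Proof.
move=> Kz; have -> : F s z = F (s - t) (F t z) by rewrite -(af_D af) // subrK.
exact: (af_lip af _ (af_in af t Kz)).
Qed.

Lemma arclength_is_derive z (t : R) : K z -> is_derive t 1 (fun s : R => (F s z).1) (F t z).2.
Proof.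
move=> Kz; apply: (@is_derive_of_quadratic R d (fun s => (F s z).1) (fun s => (F s z).2) B) => s /=.
rewrite [t + s]addrC (af_D af) //; exact: (af_vel af s (af_in af t Kz)).
Qed.

(** The tangential coordinate of the curve through [z.1] differs from the time [t] by at most
    [|t| / 2], so it takes the value of the coordinate of [y], and [tangent_coordinate_injective]
    identifies the points. The bound on [t] later serves to separate integer times. *)
Lemma arclength_local_onto : exists2 dl, 0 < dl & forall z y, K z -> M y ->
  enorm (y - z.1) < dl -> exists2 t, `|t| <= 1 / 2 & y = (F t z).1.
Proof.
have [d1 d10 h1] := tangent_coordinate_injective.
have B1 : 0 < `|B| + 1 by rewrite ltr_wpDl.
pose tau := Num.min (1 / 2) (Num.min (1 / (2 * (`|B| + 1))) (d1 / 2)).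
have tau0 : 0 < tau by rewrite !lt_min !divr_gt0 // mulr_gt0.
have tau1 : tau <= 1 / 2 by rewrite ge_min lexx.
have taud : tau <= d1 / 2 by rewrite !ge_min lexx !orbT.
have tauB : `|B| * tau <= 1 / 2.
  have : tau * (2 * (`|B| + 1)) <= 1 by rewrite -ler_pdivlMr ?mulr_gt0 // !ge_min lexx !orbT.
  lra.
exists (tau / 2); first by rewrite divr_gt0.
move=> z y Kz My yz; have [Mx uP u1] := Kz; have B0 := arclength_bound_ge0 Kz.
rewrite (ger0_norm B0) in tauB.
pose g (t : R) := dotp ((F t z).1 - z.1) z.2.
have small (t : R) : `|t| <= tau -> B * t ^+ 2 <= `|t| / 2.
  move=> tt; rewrite -[t ^+ 2]real_normK ?num_real // expr2 mulrA.
  have : B * `|t| <= B * tau by rewrite ler_wpM2l.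
  by move=> h; rewrite mulrC ler_wpM2l //; lra.
have gt (t : R) : `|t| <= tau -> `|g t - t| <= `|t| / 2.
  move=> tt; apply: le_trans (small t tt); apply: le_trans (af_vel af t Kz).
  have -> : g t - t = dotp ((F t z).1 - z.1 - t *: z.2) z.2.
    by rewrite [RHS]dotpBl dotpZl -enorm_sqr u1 expr1n mulr1.
  by apply: le_trans (ler_abs_dotp _ _) _; rewrite u1 mulr1.
have nt : `|tau| = tau by rewrite ger0_norm // ltW.
have gp := gt tau; rewrite nt lexx in gp; have {}gp := gp isT.
have gn := gt (- tau); rewrite normrN nt lexx in gn; have {}gn := gn isT.
move: gp gn; rewrite !ler_norml => /andP[gp _] /andP[_ gn].
have : `|dotp (y - z.1) z.2| <= tau / 2.
  by apply: le_trans (ler_abs_dotp _ _) _; rewrite u1 mulr1 ltW.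
rewrite ler_norml => /andP[y1 y2].
have tt : - tau <= tau by lra.
have [||t tin ht] := @IVT R g (- tau) tau (dotp (y - z.1) z.2) tt.
- apply: derivable_within_continuous => t _.
  have h := is_deriveB (arclength_is_derive t Kz) (is_derive_cst z.1 t 1).
  by have [] := is_derive_dotpl z.2 h.
- by rewrite ge_min le_max; apply/andP; split; apply/orP; [left|right]; lra.
rewrite in_itv /= in tin; have tl : `|t| <= tau by rewrite ler_norml.
exists t; first lra.
apply: (h1 z) => //; first by have [] := af_in af t Kz.
- by lra.
have := af_vel af t Kz; have := small t tl.
have := ler_enormD ((F t z).1 - z.1 - t *: z.2) (t *: z.2); rewrite subrK enormZ u1 mulr1.
lra.
Qed.

Variable z0 : V * V.
Hypothesis Kz0 : K z0.

Let gam (t : R) := (F t z0).1.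

Lemma same_position z z' : K z -> K z' -> z.1 = z'.1 -> z = z' \/ z = reverse z'.
Proof.
move=> Kz Kz' e; have Kz'' : K (z'.1, z.2) by rewrite -e; case: (z) Kz.
by case: (opposite_tangent td Kz' Kz'') => h; [left|right]; case: z e h {Kz Kz''} => x u /= -> ->;
  case: z' {Kz'}.
Qed.

Lemma curve_onto : connected M -> forall y, M y -> exists t, y = gam t.
Proof.
move=> cM; have [dl dl0 hdl] := arclength_local_onto.
have Mg t : M (gam t) by have [] := af_in af t Kz0.
suff : M `<=` [set y | exists t, y = gam t] by [].
apply: connected_clopen => //.
- by move=> y [t ->].
- by exists (gam 0), 0.
- move=> _ [t ->]; exists dl => // y My yg.
  have [s _ ->] := hdl (F t z0) y (af_in af t Kz0) My yg.
  by exists (s + t); rewrite /gam (af_D af).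
move=> x Mx nx; have [u Kx] := exists_unit_tangent Mx.
exists dl => // y My yx [t yt]; apply: nx.
have [s _ ys] := hdl (x, u) y Kx My yx.
have Ks := af_in af s Kx; have Kt := af_in af t Kz0.
have xs : F (- s) (F s (x, u)) = (x, u) by rewrite -(af_D af) // addNr (af_0 af).
(* The two curves through [y] run in the same or in opposite directions; [af_rev] treats the
   latter. *)
have [h|h] := same_position Ks Kt (etrans (esym ys) yt).
  by exists (- s + t); rewrite /gam (af_D af) // -h xs.
exists (s + t); rewrite /gam (af_D af) //.
have := xs; rewrite h (af_rev af) // => E.
by have := congr1 fst E.
Qed.

(** If the curve came back with reversed velocity, then by time reversal its state halfway between
    [a] and [b] would equal its own reverse, impossible for a unit vector. *)
Lemma same_point_same_state a b : gam a = gam b -> F a z0 = F b z0.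
Proof.
move=> ab; have Ka := af_in af a Kz0; have Kb := af_in af b Kz0.
have [h|h] := same_position Kb Ka (esym ab); first by rewrite h.
have e1 : F ((a + b) / 2) z0 = F (- ((b - a) / 2)) (F b z0).
  by rewrite -(af_D af) //; congr (F _ _); field.
have e2 : F ((a + b) / 2) z0 = F ((b - a) / 2) (F a z0).
  by rewrite -(af_D af) //; congr (F _ _); field.
have : F ((a + b) / 2) z0 = reverse (F ((a + b) / 2) z0).
  by rewrite {1}e1 h (af_rev af) // -e2.
have [_ _ u1] := af_in af ((a + b) / 2) Kz0.
move=> /(congr1 snd) /= /eqP; rewrite -subr_eq0 opprK -mulr2n -scaler_nat scaler_eq0 pnatr_eq0 /=.
by move=> /eqP h0; move: u1; rewrite h0 enorm0 => /eqP; rewrite eq_sym oner_eq0.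
Qed.

Lemma period_ge T : 0 < T -> F T z0 = z0 -> (B + 1)^-1 <= T.
Proof.
move=> T0 h; have B0 := arclength_bound_ge0 Kz0; have [_ _ u1] := Kz0.
have := af_vel af T Kz0; rewrite h subrr sub0r enormN enormZ u1 mulr1 gtr0_norm //.
rewrite expr2 mulrA ler_pMl // => BT.
by rewrite -div1r ler_pdivrMr; lra.
Qed.

(** The points at integer times cluster, so two of them, at times [m < m'], are joined by an arc of
    duration at most [1 / 2]; since [m' - m >= 1], the difference is a positive period. *)
Lemma exists_period : exists2 T, 0 < T & F T z0 = z0.
Proof.
have [dl dl0 hdl] := arclength_local_onto.
have Mg t : M (gam t) by have [] := af_in af t Kz0.
have [x Mx hx] := compact_seq_cluster (td_compact td) (fun m : nat => Mg m%:R).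
have d2 : 0 < dl / 2 by rewrite divr_gt0.
have [m _ hm] := hx _ 0%N d2; have [m' mm' hm'] := hx _ m.+1 d2.
have near : enorm (gam m'%:R - (F m%:R z0).1) < dl.
  have := ler_enorm_dist x (gam m'%:R) (gam m%:R); rewrite (enormB x (gam m%:R)) /gam; lra.
have [t t1 ht] := hdl _ _ (af_in af _ Kz0) (Mg _) near.
have E : F m'%:R z0 = F (t + m%:R) z0.
  by apply: same_point_same_state; rewrite ht /gam (af_D af).
exists (m'%:R - (t + m%:R)).
  have : (m%:R + 1 : R) <= m'%:R by rewrite natr1 ler_nat.
  move: t1; rewrite ler_norml => /andP[_]; lra.
by rewrite addrC (af_D af) // E -(af_D af) // addNr (af_0 af).
Qed.

Lemma exists_min_period : exists2 c, 0 < c & F c z0 = z0 /\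
  forall T, 0 < T -> F T z0 = z0 -> c <= T.
Proof.
pose S : set R := [set T : R | 0 < T /\ F T z0 = z0].
have B0 := arclength_bound_ge0 Kz0; have B1 : 0 < (B + 1)^-1 by rewrite invr_gt0; lra.
have hS : has_inf S.
  have [T T0 hT] := exists_period; split; first by exists T.
  by exists 0 => T' [T'0 _]; exact: ltW.
have [c [c0 hc] ci] := inf_adherent B1 hS.
exists c => //; split=> // T T0 hT; rewrite leNgt; apply/negP => lt.
have ST : S T by split.
have iT : inf S <= T by apply: ge_inf => //; have [_] := hS.
(* The difference of two periods is a period, and positive periods are at least [(B + 1)^-1]; a
   period that close to the infimum is therefore the least one. *)
have := @period_ge (c - T); rewrite subr_gt0 => /(_ lt).
rewrite addrC (af_D af) // hc -{1}hT -(af_D af) // addNr (af_0 af) // => /(_ erefl); lra.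
Qed.

Variable c : R.
Hypotheses (c0 : 0 < c) (pc : F c z0 = z0) (cmin : forall T, 0 < T -> F T z0 = z0 -> c <= T).

Lemma curve_periodic (t : R) (m : nat) : gam (t + m%:R * c) = gam t.
Proof.
elim: m => [|m IH]; first by rewrite mul0r addr0.
have -> : t + m.+1%:R * c = t + m%:R * c + c by rewrite -natr1 mulrDl mul1r addrA.
by rewrite -[RHS]IH /gam [in LHS](af_D af) // pc.
Qed.

Lemma curve_inj (a b : R) : gam a = gam b -> `|a - b| < c -> a = b.
Proof.
wlog le : a b / a <= b => [W E1 E2|].
  have [ab|/ltW ba] := lerP a b; first exact: (W a b ab E1 E2).
  by apply/esym/(W b a ba (esym E1)); rewrite distrC.
move=> /same_point_same_state E; rewrite distrC ger0_norm ?subr_ge0 // => lt.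
apply/eqP; rewrite eq_le le andTb leNgt; apply/negP => ab.
have := cmin (T := b - a); rewrite subr_gt0 => /(_ ab).
rewrite addrC (af_D af) // -E -(af_D af) // addNr (af_0 af) // => /(_ erefl); lra.
Qed.

Lemma curve_reduce (t : R) : exists2 t', `|t'| <= c / 2 & gam t = gam t'.
Proof.
(* A preliminary shift by whole periods makes the time nonnegative before it is rounded. *)
have c' := c0; pose m := (Num.truncn (`|t| / c)).+1.
have tm : 0 <= t + m%:R * c.
  have : `|t| / c < m%:R by exact: truncnS_gt.
  rewrite ltr_pdivrMr //; have := ler_norm (- t); rewrite normrN; lra.
pose x := (t + m%:R * c + c / 2) / c; have x0 : 0 <= x by rewrite divr_ge0; lra.
pose N := Num.truncn x.
have /andP[x1 x2] := truncn_itv x0; rewrite -/N in x1 x2.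
have xc : x * c = t + m%:R * c + c / 2 by rewrite divfK // gt_eqF.
have y1 : N%:R * c <= x * c by rewrite ler_pM2r.
have y2 : x * c < N%:R * c + c.
  by move: x2; rewrite -natr1 -(ltr_pM2r c0) mulrDl mul1r.
exists (t + m%:R * c - N%:R * c).
  by rewrite ler_norml; apply/andP; split; lra.
by rewrite -(curve_periodic t m) -{1}[t + m%:R * c](subrK (N%:R * c)) curve_periodic.
Qed.

Local Notation S := (@esphere R 1).

Definition width (y : 'rV[R]_2) : R := equatorial y 0 0.

(* Each of the two half circles [0 <= width] and [width < 0] runs through half a period. *)
Definition circle_time (y : 'rV[R]_2) : R :=
  (if width y < 0 then -1 else 1) * (c * (1 - height y) / 4).

Definition circle_map (y : 'rV[R]_2) : V := gam (circle_time y).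

Local Transparent dotp.
Lemma circleE y : S y -> height y ^+ 2 + width y ^+ 2 = 1.
Proof.
rewrite /esphere /= => y1; have := dotp_suspend y; rewrite -enorm_sqr y1 expr1n => ->.
by congr (_ + _); rewrite /dotp big_ord1 expr2.
Qed.
Local Opaque dotp.

Lemma circle_height y : S y -> -1 <= height y <= 1.
Proof.
move=> /circleE h; have := sqr_ge0 (width y) => w.
by rewrite -ler_norml -(@expr_le1 _ 2) // real_normK ?num_real; lra.
Qed.

(** The formulas of both half circles agree at the poles: the time is [0] at height [1], and at
    height [-1] the times [c / 2] and [- (c / 2)] differ by a period. *)
Lemma circle_map_pole y (b : R) : S y -> width y = 0 -> b = 1 \/ b = -1 ->
  circle_map y = gam (b * (c * (1 - height y) / 4)).
Proof.
move=> Sy w0; rewrite /circle_map /circle_time w0 ltxx => -[->//|->].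
have := circleE Sy; rewrite w0 expr0n addr0 => h.
have /eqP : height y ^+ 2 = 1 ^+ 2 by rewrite expr1n.
rewrite eqf_sqr => /orP[]/eqP ->; first by rewrite subrr !(mulr0, mul0r).
by rewrite -(curve_periodic (-1 * _) 1); congr gam; field.
Qed.

Lemma circle_map_cont : econt S circle_map.
Proof.
move=> y Sy e e0; have B0 := arclength_bound_ge0 Kz0.
pose L := B * (c / 4) + 1; have L0 : 0 < L.
  by rewrite /L ltr_wpDl // mulr_ge0 // divr_ge0 // ltW.
have key (b : R) y' : b = 1 \/ b = -1 -> enorm (y' - y) < e / L ->
   enorm (gam (b * (c * (1 - height y') / 4)) - gam (b * (c * (1 - height y) / 4))) < e.
  move=> b1; rewrite ltr_pdivlMr // => yy.
  apply: le_lt_trans (arclength_lip _ _ Kz0) _; apply: le_lt_trans yy.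
  have -> : b * (c * (1 - height y') / 4) - b * (c * (1 - height y) / 4) =
    - (b * (c / 4) * (height y' - height y)) by field.
  rewrite normrN !normrM (_ : `|b| = 1); last by case: b1 => ->; rewrite ?normrN normr1.
  rewrite mul1r -heightB (ger0_norm (_ : 0 <= c)) ?(ltW c0) // ger0_norm ?invr_ge0 //.
  have := height_le (y' - y) => h.
  have c4 : 0 <= B * (c / 4) by rewrite mulr_ge0 // divr_ge0 // ltW.
  rewrite mulrA; apply: le_trans (_ : B * (c / 4) * enorm (y' - y) <= _).
    by rewrite ler_wpM2l.
  by rewrite mulrC ler_wpM2l ?enorm_ge0 // /L; lra.
have [w0|w0] := eqVneq (width y) 0.
  exists (e / L); first by rewrite divr_gt0.
  move=> y' Sy' yy; rewrite {1}/circle_map /circle_time; case: ifP => _.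
    by rewrite (circle_map_pole Sy w0 (or_intror erefl)); apply: key => //; right.
  by rewrite (circle_map_pole Sy w0 (or_introl erefl)); apply: key => //; left.
exists (Num.min (e / L) `|width y|); first by rewrite lt_min divr_gt0 //= normr_gt0.
move=> y' Sy'; rewrite lt_min => /andP[h1 h2].
have ww : `|width y' - width y| < `|width y|.
  apply: le_lt_trans h2; apply: le_trans (equatorial_le _).
  have -> : width y' - width y = equatorial (y' - y) 0 0 by rewrite equatorialB /width !mxE.
  by apply: le_trans (ler_mx_enorm _); exact: ler_coord.
have same : (width y' < 0) = (width y < 0).
  move: ww; rewrite ltr_norml.
  have [wn|wp] := ltrP (width y) 0.
    by rewrite (ltr0_norm wn) => /andP[_ h]; apply/idP; lra.
  by rewrite ger0_norm // => /andP[h _]; apply/negbTE; rewrite -leNgt; lra.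
rewrite /circle_map /circle_time same; case: ifP => _; apply: key => //; [right|left] => //.
Qed.

Lemma circle_map_inj y y' : S y -> S y' -> circle_map y = circle_map y' -> y = y'.
Proof.
move=> Sy Sy'; have E := circleE Sy; have E' := circleE Sy'.
have /andP[h1 h2] := circle_height Sy; have /andP[h1' h2'] := circle_height Sy'.
(* All times lie in a half-open interval of length [c], on which the curve is injective, and the
   sign of the time tells the half circle. *)
have bound x : S x -> - (c / 2) < circle_time x <= c / 2 /\ (width x < 0 -> circle_time x < 0) /\
    (0 <= width x -> 0 <= circle_time x).
  move=> Sx; have Ex := circleE Sx; have /andP[x1 x2] := circle_height Sx.
  rewrite /circle_time; have [wn|wp] := ltrP (width x) 0.
    have w2 : 0 < width x ^+ 2 by rewrite exprn_even_gt0 //= lt_eqF.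
    have xm : height x != -1.
      by apply/eqP => h; move: Ex; rewrite h sqrrN expr1n; lra.
    have xp : height x != 1.
      by apply/eqP => h; move: Ex; rewrite h expr1n; lra.
    have x1' : -1 < height x by rewrite lt_neqAle eq_sym xm.
    have x2' : height x < 1 by rewrite lt_neqAle xp.
    have q1 : 0 < c * (1 - height x) by rewrite mulr_gt0 // subr_gt0.
    have q2 : 0 < c * (1 + height x) by rewrite mulr_gt0 //; lra.
    split; first by apply/andP; split; lra.
    by split; lra.
  have q1 : 0 <= c * (1 - height x) by rewrite mulr_ge0 ?subr_ge0 // ltW.
  have q2 : 0 <= c * (1 + height x) by rewrite mulr_ge0 ?(ltW c0) //; lra.
  have c' := c0; split; first by apply/andP; split; lra.
  by split; lra.
have [/andP[t1 t2] [tn tp]] := bound y Sy; have [/andP[t1' t2'] [tn' tp']] := bound y' Sy'.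
move=> /curve_inj; have tt : `|circle_time y - circle_time y'| < c.
  by rewrite ltr_norml; apply/andP; split; lra.
move=> /(_ tt) T.
have same : (width y < 0) = (width y' < 0).
  have [wn|wp] := ltrP (width y) 0; have [wn'|wp'] := ltrP (width y') 0 => //.
    by have := tn wn; have := tp' wp'; lra.
  by have := tn' wn'; have := tp wp; lra.
have hh : height y = height y'.
  have c' : c != 0 by rewrite gt_eqF.
  move: T; rewrite /circle_time same; case: ifP => _ T; apply: (mulfI c'); lra.
have w2 : width y ^+ 2 = width y' ^+ 2 by move: E E'; rewrite hh; lra.
have ww : width y = width y'.
  move/eqP: w2; rewrite eqf_sqr => /orP[]/eqP // wN.
  by move: same; rewrite wN oppr_lt0; case: ltgtP => // <- _; rewrite oppr0.
rewrite -[y]suspend_eta -[y']suspend_eta hh; congr suspend.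
by apply/rowP => i; rewrite (ord1 i).
Qed.

Lemma circle_map_onto t : exists2 y, S y & circle_map y = gam t.
Proof.
have [t' tc ->] := curve_reduce t; have c' : c != 0 by rewrite gt_eqF.
(* Solves [c * (1 - a) / 4 = |t'|], the formula of [circle_time]. *)
pose a := 1 - 4 * `|t'| / c; have t'0 := normr_ge0 t'.
have a1 : a <= 1 by rewrite gerBl divr_ge0 ?(ltW c0) // mulr_ge0.
have a2 : -1 <= a.
  have : 4 * `|t'| / c <= 2 by rewrite ler_pdivrMr //; lra.
  by rewrite /a; lra.
have aa : a ^+ 2 <= 1 by rewrite -real_normK ?num_real // expr_le1 // ler_norml a2.
have tE : c * (1 - a) / 4 = `|t'| by rewrite /a; field.
pose s := Num.sqrt (1 - a ^+ 2); have s0 : 0 <= s := sqrtr_ge0 _.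
have s2 : s ^+ 2 = 1 - a ^+ 2 by rewrite sqr_sqrtr // subr_ge0.
pose pt (b : R) : 'rV[R]_2 := suspend a (const_mx (b * s)).
have wpt b : width (pt b) = b * s by rewrite /width equatorial_suspend mxE.
have Spt b : b = 1 \/ b = -1 -> S (pt b).
  move=> b1; have b2 : b ^+ 2 = 1 by case: b1 => ->; rewrite ?sqrrN expr1n.
  apply/eqP; rewrite -(@eqrXn2 _ 2) ?enorm_ge0 // enorm_sqr dotp_suspend height_suspend.
  rewrite equatorial_suspend expr1n.
  Local Transparent dotp.
  rewrite /dotp big_ord1 !mxE -expr2 exprMn b2 mul1r s2; apply/eqP; ring.
  Local Opaque dotp.
have [tp|tn] := lerP 0 t'.
  exists (pt 1); first by apply: Spt; left.
  rewrite /circle_map /circle_time wpt mul1r ltNge s0 /= height_suspend tE mul1r.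
  by rewrite ger0_norm.
exists (pt (-1)); first by apply: Spt; right.
(* At a pole [pt (-1)] has width [0] and is counted with the other half circle, whence
   [circle_map_pole]. *)
have [s00|s00] := eqVneq s 0.
  rewrite (circle_map_pole (b := -1)) ?wpt ?s00 ?mulr0 //; [|exact: Spt (or_intror _)|by right].
  by rewrite height_suspend tE ltr0_norm // mulN1r opprK.
rewrite /circle_map /circle_time wpt mulN1r oppr_lt0 lt_neqAle eq_sym s00 s0 /=.
by rewrite height_suspend tE ltr0_norm // mulN1r opprK.
Qed.

Lemma circle_homeomorphic : connected M -> homeomorphic M S.
Proof.
move=> cM; have onto := curve_onto cM.
have Mg t : M (gam t) by have [] := af_in af t Kz0.
have /choice[g hg] : forall y, exists x, M y -> S x /\ circle_map x = y.
  move=> y; have [My|] := pselect (M y); last by exists 0.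
  by have [t ->] := onto y My; have [x Sx xt] := circle_map_onto t; exists x.
exists g, circle_map; split.
- by move=> y My; exact: hg.
- move=> x Sx; have MT : M (circle_map x) by exact: Mg.
  by split=> //; have [S' e] := hg _ MT; apply: circle_map_inj.
- apply/within_econtP; apply: (compact_inverse_econt (A := S) _ circle_map_cont) => //.
    exact: compact_usphere.
  exact: circle_map_inj.
exact/within_econtP/circle_map_cont.
Qed.

End ClosedCurve.

Lemma closed_curve_homeomorphic_circle (R : realType) (d : nat) (M : set 'rV[R]_d) P
    (kap del C : R) : tangent_data 1 M P kap del C -> M !=set0 -> connected M ->
  homeomorphic M (@esphere R 1).
Proof.
move=> td [x Mx] cM; have [F [B af]] := exists_arclength_flow td.
have [u Kz] := exists_unit_tangent td Mx.
have [c c0 [pc cmin]] := exists_min_period td af Kz.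
exact: (circle_homeomorphic td af Kz c0 pc cmin cM).
Qed.

Theorem mainTheorem1 (R : realType) (n d : nat) (r : R) (M : set 'rV[R]_d)
    (hn : (1 <= n)%N) (hd : (1 <= d)%N) (hr : 0 < r)
    (hM : closed_submanifold n M) (hM0 : M !=set0) (hMc : connected M)
    (hball : exists c : 'rV[R]_d, M `<=` eball c r)
    (hcurv : forall k : R, normal_curvatures n M k ->
       k < 2 / Num.sqrt 3 * (1 / r)) :
  homeomorphic M (@esphere R n).
Proof.
have [n1|n1] := ltnP 1 n; first exact: (submanifold_homeomorphic_sphere n1 hr).
have nE : n = 1%N by apply/eqP; rewrite eqn_leq n1 hn.
subst n; have k0 : 0 < 2 / Num.sqrt 3 * (1 / r) :> R.
  by rewrite mulr_gt0 // divr_gt0 // sqrtr_gt0.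
have [P [del [C [kap _ td]]]] := exists_tangent_data k0 hcurv hM.
exact: closed_curve_homeomorphic_circle td hM0 hMc.
Qed.
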